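(* Let $k\in\{1,2\}$ and let $\Delta_k(n)$ be defined by \[\sum_{n=0}^{\infty}\Delta_k(n)q^n=\prod_{n=1}^{\infty}\frac{(1-q^{2n})(1-q^{(2k+1)n})}{(1-q^n)^3(1-q^{(4k+2)n})}.\] Put $x_k(n)=\frac{\pi\sqrt{24n-(2k+2)}}{6}$, and for $j\ge1$ let \[\alpha_k(j)=\begin{cases}1+\dfrac{\gcd^2(2k+1,j)}{2k+1}, & j \text{ even},\\[2mm] \dfrac52-\dfrac{\gcd^2(2k+1,j)}{4k+2}, & j\text{ odd}.\end{cases}\] Let $(m_1,m_2,m_3,m_4)=(1,2,2k+1,4k+2)$ and $(\delta_1,\delta_2,\delta_3,\delta_4)=(-3,1,1,-1)$, and for $j\ge1$, $n\ge1$ let \[\hat A_j(n)=\sum_{\substack{0\le h<j\\ \gcd(h,j)=1}}\exp\!\left(-\frac{2\pi i h n}{j}-\pi i\sum_{r=1}^{4}\delta_r\, s\!\left(\frac{m_r h}{\gcd(m_r,j)},\frac{j}{\gcd(m_r,j)}\right)\right),\] where $s(h,j)=\sum_{r=1}^{j-1}\left(\frac rj-\left\lfloor\frac rj\right\rfloor-\frac12\right)\left(\frac{hr}{j}-\left\lfloor\frac{hr}{j}\right\rfloor-\frac12\right)$ is the Dedekind sum. Then for all $n\ge1$, \[\Delta_k(n)=\frac{\pi^3}{18x_k^2(n)}\sum_{j\ge1}\alpha_k(j)\,j^{-1}\,\hat A_j(n)\,I_2\!\left(\frac{\sqrt{\alpha_k(j)}\,x_k(n)}{j}\right),\] where $I_2$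 is the modified Bessel function of the first kind of order $2$.
   Context: $\Delta_k(n)$ is the number of broken $k$-diamond partitions of $n$ (in the sense of Andrews and Paule), whose generating function is the product displayed. The modified Bessel function of the first kind is $I_\nu(s)=\sum_{r\ge0}\frac{1}{r!\,\Gamma(r+\nu+1)}(s/2)^{2r+\nu}$. *)

(* Defs.v *)
From Stdlib Require Import Reals Lra Lia Arith Factorial.
From Coquelicot Require Import Coquelicot.
Open Scope R_scope.

(** ** Formal power series, as coefficient sequences [nat -> R] *)

Definition PS_one : nat -> R := fun i => if Nat.eqb i 0 then 1 else 0.

(** [1 - q^m] and [1 / (1 - q^m) = 1 + q^m + q^(2m) + ...], for [1 <= m]. *)
Definition PS_one_minus_pow (m : nat) : nat -> R :=
  fun i => if Nat.eqb i 0 then 1 else if Nat.eqb i m then -1 else 0.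

Definition PS_geom (m : nat) : nat -> R :=
  fun i => if Nat.eqb (i mod m) 0 then 1 else 0.

Fixpoint PS_prod (F : nat -> nat -> R) (N : nat) : nat -> R :=
  match N with
  | O => PS_one
  | S N' => PS_mult (PS_prod F N') (F (S N'))
  end.

Definition diamond_factor (k n : nat) : nat -> R :=
  PS_mult
    (PS_mult (PS_one_minus_pow (2 * n)) (PS_one_minus_pow ((2 * k + 1) * n)))
    (PS_mult
       (PS_mult (PS_geom n) (PS_mult (PS_geom n) (PS_geom n)))
       (PS_geom ((4 * k + 2) * n))).

(** Coefficient of [q^n] in the infinite product: the factors of index greater
    than [n] are [1 + O(q^(n+1))] and do not contribute to it
    (see [DiamondDelta_stable]). *)
Definition DiamondDelta (k n : nat) : R := PS_prod (diamond_factor k) n n.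

Lemma PS_geom_correct (m : nat) : (1 <= m)%nat ->
  forall i, PS_mult (PS_one_minus_pow m) (PS_geom m) i = PS_one i.
Proof.
intros Hm i; unfold PS_mult.
assert (H : forall M, (M <= i)%nat ->
  sum_f_R0 (fun l => PS_one_minus_pow m l * PS_geom m (i - l)) M
  = PS_geom m i - (if Nat.leb m M then PS_geom m (i - m) else 0)).
{ induction M as [|M IH]; intros HM; simpl sum_f_R0.
  - rewrite Nat.sub_0_r; unfold PS_one_minus_pow at 1; simpl.
    destruct (Nat.leb_spec m 0); [lia | ring].
  - rewrite IH by lia; unfold PS_one_minus_pow.
    replace (Nat.eqb (S M) 0) with false by reflexivity.
    destruct (Nat.eqb_spec (S M) m) as [E|E];
      destruct (Nat.leb_spec m M); destruct (Nat.leb_spec m (S M));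
      try lia; try ring.
    rewrite <- E; ring. }
rewrite H by lia; unfold PS_geom, PS_one.
destruct (Nat.leb_spec m i) as [L|L].
- replace (i mod m)%nat with ((i - m) mod m)%nat.
  + destruct (Nat.eqb_spec i 0); [lia|]; ring.
  + replace i with (i - m + 1 * m)%nat at 2 by lia.
    rewrite Nat.Div0.mod_add; reflexivity.
- rewrite Nat.mod_small by lia; ring.
Qed.

Definition one_upto (n : nat) (a : nat -> R) : Prop :=
  forall i, (i < n)%nat -> a i = PS_one i.

Lemma PS_mult_one_upto (n : nat) (a b : nat -> R) : one_upto n b ->
  forall i, (i < n)%nat -> PS_mult a b i = a i.
Proof.
intros Hb i Hi; unfold PS_mult.
assert (H0 : b 0%nat = 1) by (apply Hb; lia).
destruct i as [|i].
- simpl; rewrite H0; ring.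
- rewrite tech5, Nat.sub_diag, H0.
  rewrite (sum_eq _ (fun _ => 0)).
  + rewrite sum_cte; ring.
  + intros l Hl; rewrite Hb by lia; unfold PS_one.
    destruct (Nat.eqb_spec (S i - l) 0); [lia | ring].
Qed.

Lemma DiamondDelta_stable (k n N : nat) : (n <= N)%nat ->
  PS_prod (diamond_factor k) N n = DiamondDelta k n.
Proof.
assert (Hmul : forall m a b, one_upto m a -> one_upto m b ->
  one_upto m (PS_mult a b)).
{ intros m a b Ha Hb i Hi; rewrite (PS_mult_one_upto m) by assumption.
  now apply Ha. }
assert (Hm : forall m M, (m <= M)%nat -> one_upto m (PS_one_minus_pow M)).
{ intros m M HM i Hi; unfold PS_one_minus_pow, PS_one.
  destruct (Nat.eqb_spec i 0); auto.
  destruct (Nat.eqb_spec i M); [lia | auto]. }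
assert (Hg : forall m M, (m <= M)%nat -> one_upto m (PS_geom M)).
{ intros m M HM i Hi; unfold PS_geom, PS_one.
  rewrite Nat.mod_small by lia; auto. }
induction 1 as [|N HN IH]; [reflexivity|].
simpl; rewrite (PS_mult_one_upto (S N)); [exact IH | | lia].
unfold diamond_factor; repeat apply Hmul;
  first [apply Hm | apply Hg]; nia.
Qed.

(** ** Analytic ingredients *)

Definition Gamma (x : R) : R :=
  RInt_gen (fun t => Rpower t (x - 1) * exp (- t))
    (at_right 0) (Rbar_locally p_infty).

(** [I_nu] for natural order, so that [(s/2)^(2r+nu)] is an ordinary power,
    also meaningful at [s = 0]. *)
Definition BesselI (nu : nat) (s : R) : R :=
  Series (fun r => / (INR (fact r) * Gamma (INR (r + nu + 1)))
                   * (s / 2) ^ (2 * r + nu)).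

Definition Cexp (z : C) : C :=
  (exp (Re z) * cos (Im z), exp (Re z) * sin (Im z)).

(** [Int_part] is the floor function. *)
Definition dedekind_sum (h j : nat) : R :=
  sum_n_m (fun r =>
      (INR r / INR j - IZR (Int_part (INR r / INR j)) - 1 / 2)
    * (INR h * INR r / INR j - IZR (Int_part (INR h * INR r / INR j)) - 1 / 2))
    1 (j - 1).

Definition x_ (k n : nat) : R :=
  PI * sqrt (24 * INR n - (2 * INR k + 2)) / 6.

Definition alpha_ (k j : nat) : R :=
  if Nat.even j
  then 1 + INR (Nat.gcd (2 * k + 1) j) ^ 2 / (2 * INR k + 1)
  else 5 / 2 - INR (Nat.gcd (2 * k + 1) j) ^ 2 / (4 * INR k + 2).

(** Indices range over [1..4]. *)
Definition m_ (k r : nat) : nat :=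
  match r with
  | 1 => 1
  | 2 => 2
  | 3 => 2 * k + 1
  | 4 => 4 * k + 2
  | _ => 0
  end.

Definition delta_ (r : nat) : R :=
  match r with
  | 1%nat => -3
  | 2%nat => 1
  | 3%nat => 1
  | 4%nat => -1
  | _ => 0
  end.

(** The divisions by the gcd are exact. *)
Definition A_phase (k h j : nat) : R :=
  sum_n_m (fun r =>
    delta_ r * dedekind_sum (m_ k r * h / Nat.gcd (m_ k r) j)
                            (j / Nat.gcd (m_ k r) j)) 1 4.

Definition A_hat (k j n : nat) : C :=
  sum_n_m (G := C_AbelianMonoid) (fun h =>
    if Nat.eqb (Nat.gcd h j) 1
    then Cexp (- (2 * PI * Ci * INR h * INR n / INR j)
               - PI * Ci * A_phase k h j)%C
    else RtoC 0) 0 (j - 1).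

(* Main.v *)
Require Import Defs.
From Stdlib Require Import Reals Lra Lia ZArith List Permutation.
From Coquelicot Require Import Coquelicot.
Open Scope R_scope.

(** The generating function is an eta quotient of weight [-1], and the proof is
    Rademacher's circle method.  With [P(q) = prod (1 - q^n)] and
    [q = exp (- 2 pi w)], the behaviour of [P] under [w -> 1/w] follows from the
    exchange of summation in the Eisenstein series [sum 1/(m w + i n)^2], whose
    rows are given by the partial fractions of [coth] and [1/sinh^2].  Combining
    it with [w -> w - i] by Euclid's algorithm gives the behaviour of [P] near
    every [exp (2 pi i h/j)]; the phase is a Dedekind sum, by its reciprocity
    law.  For [k = 1, 2] every other term of the eta quotient is bounded against
    the leading one, [j z exp (b/z - c z)] with [b = pi alpha_k(j)/(12 j^2)].

    The coefficient is an integral over [Re w = 1/N^2], [0 <= Im w <= 1], cut at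
    the mediants of the Farey fractions of order [N].  On each arc the function
    may be replaced by its leading term, and the arc completed to a rectangle
    around [0], with an error proportional to the length of the arc and to
    [1/N].  The residue of [z exp (a z + b/z)] at [0] is
    [(b/a) I_2(2 sqrt (a b))].  The error vanishes as [N] tends to infinity
    along the integers, which yields convergence of the partial sums over
    [j <= N] and the value of the series. *)

(** * Complex sequences, sums and derivatives *)

(** The number of arcs grows with [N], so each error must be small in proportion to the length of
    its arc. Weight [-1] provides this: inversion puts the factor [j z] into the leading term, and
    [Re z = 1/N^2], [|Im z| <= 1/(j N)] give [j |z| <= 2/N], while [Re (1/(j^2 z)) >= 1/2] keeps the
    transformed nomes in a fixed disc. The correction to the leading term cancels the growth of its
    exponential as soon as [alpha_k(j) <= 24 gcd(m_r, j)^2 / m_r] for all [r]; this check, finite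
    because only [j] modulo [4 k + 2] matters, is where [k] is restricted. A Farey arc is not
    symmetric about its centre, so each half is completed separately to half a rectangle. The half
    integral does not depend on the height of the rectangle, and the two halves are conjugate, so
    only a real part, the residue, survives. Cauchy's theorem is replaced by explicit primitives of
    Laurent monomials and truncated exponentials. What is integrated is always a finite product,
    exact in the coefficients of index up to its length; that length is chosen after [N]. *)

Lemma Ceq (z w : C) : Re z = Re w -> Im z = Im w -> z = w.
Proof. destruct z, w; simpl; intros -> ->; reflexivity. Qed.

Lemma re_minus (a b : C) : Re (a - b)%C = Re a - Re b.
Proof. reflexivity. Qed.

Lemma im_minus (a b : C) : Im (a - b)%C = Im a - Im b.
Proof. reflexivity. Qed.

Lemma im_le_Cmod (c : C) : Rabs (Im c) <= Cmod c.
Proof. apply Rle_trans with (2 := Rmax_Cmod c); apply Rmax_r. Qed.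

Lemma Re_le (z : C) : Re z <= Cmod z.
Proof. apply Rle_trans with (2 := re_le_Cmod z), Rle_abs. Qed.

Lemma Cmod_le_abs (z : C) : Cmod z <= Rabs (Re z) + Rabs (Im z).
Proof.
replace z with (RtoC (Re z) + Ci * RtoC (Im z))%C at 1
  by (apply Ceq; simpl; ring).
eapply Rle_trans; [apply Cmod_triangle|].
rewrite Cmod_mult, Cmod_Ci, !Cmod_R; lra.
Qed.

Lemma Cmod_sub_comm (a b : C) : Cmod (a - b)%C = Cmod (b - a)%C.
Proof. rewrite <- Cmod_opp; f_equal; ring. Qed.

Lemma Cmod_triangle_sub (a b : C) : Cmod a <= Cmod b + Cmod (a - b)%C.
Proof.
replace a with (b + (a - b))%C at 1 by ring; apply Cmod_triangle.
Qed.

Lemma Cmod_minus_le (a b : C) : Cmod (a - b)%C <= Cmod a + Cmod b.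
Proof. unfold Cminus; rewrite <- (Cmod_opp b); apply Cmod_triangle. Qed.

Lemma Re_pos_nz (w : C) : 0 < Re w -> w <> RtoC 0.
Proof. intros H E; rewrite E in H; simpl in H; lra. Qed.

Lemma Re_inv_pos (w : C) : 0 < Re w -> 0 < Re (/ w)%C.
Proof.
intros H; destruct w as [x y]; simpl in *.
apply Rdiv_lt_0_compat; nra.
Qed.

Definition Clim (u : nat -> C) (l : C) : Prop :=
  forall eps, 0 < eps ->
    exists N, forall n, (N <= n)%nat -> Cmod (u n - l)%C < eps.

Definition Rlim (u : nat -> R) (l : R) : Prop :=
  forall eps, 0 < eps ->
    exists N, forall n, (N <= n)%nat -> Rabs (u n - l) < eps.

Lemma Rlim_is_lim_seq (u : nat -> R) (l : R) : is_lim_seq u l <-> Rlim u l.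
Proof.
rewrite <- is_lim_seq_spec; split; intros H eps.
- intros He; destruct (H (mkposreal _ He)) as [N HN]; exists N; exact HN.
- destruct (H eps (cond_pos eps)) as [N HN]; exists N; exact HN.
Qed.

Lemma Clim_squeeze (u : nat -> C) (l : C) (e : nat -> R) :
  (forall n, Cmod (u n - l)%C <= e n) -> is_lim_seq e 0 -> Clim u l.
Proof.
intros H He eps Heps; apply Rlim_is_lim_seq in He.
destruct (He eps Heps) as [N HN]; exists N; intros n Hn.
eapply Rle_lt_trans; [apply H|].
generalize (HN n Hn); rewrite Rminus_0_r; intros A.
generalize (Rle_abs (e n)); lra.
Qed.

Lemma Clim_const (c : C) : Clim (fun _ => c) c.
Proof.
intros eps He; exists O; intros n _.
replace (c - c)%C with (RtoC 0) by ring; rewrite Cmod_0; lra.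
Qed.

Lemma Clim_ext (u v : nat -> C) (l : C) :
  (forall n, u n = v n) -> Clim u l -> Clim v l.
Proof.
intros E H eps He; destruct (H eps He) as [N HN]; exists N; intros n Hn.
rewrite <- E; auto.
Qed.

Lemma Clim_eventually (u v : nat -> C) (l : C) (N0 : nat) :
  (forall n, (N0 <= n)%nat -> u n = v n) -> Clim u l -> Clim v l.
Proof.
intros E H eps He; destruct (H eps He) as [N HN]; exists (N + N0)%nat.
intros n Hn; rewrite <- E by lia; apply HN; lia.
Qed.

Lemma Clim_plus (u v : nat -> C) (a b : C) :
  Clim u a -> Clim v b -> Clim (fun n => u n + v n)%C (a + b)%C.
Proof.
intros Hu Hv eps He.
destruct (Hu (eps / 2)) as [N HN]; [lra|].
destruct (Hv (eps / 2)) as [M HM]; [lra|].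
exists (N + M)%nat; intros n Hn.
replace (u n + v n - (a + b))%C with ((u n - a) + (v n - b))%C by ring.
eapply Rle_lt_trans; [apply Cmod_triangle|].
specialize (HN n ltac:(lia)); specialize (HM n ltac:(lia)); lra.
Qed.

Lemma Clim_scal (u : nat -> C) (a c : C) :
  Clim u a -> Clim (fun n => c * u n)%C (c * a)%C.
Proof.
intros Hu eps He.
assert (Hc := Cmod_ge_0 c).
destruct (Hu (eps / (Cmod c + 1))) as [N HN]; [apply Rdiv_lt_0_compat; lra|].
exists N; intros n Hn.
replace (c * u n - c * a)%C with (c * (u n - a))%C by ring.
rewrite Cmod_mult; specialize (HN n Hn).
assert (Hm := Cmod_ge_0 (u n - a)%C).
apply Rle_lt_trans with ((Cmod c) * (eps / (Cmod c + 1))).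
- apply Rmult_le_compat_l; lra.
- apply Rmult_lt_reg_r with (Cmod c + 1); [lra|].
  field_simplify; [|lra]; nra.
Qed.

Lemma Clim_opp (u : nat -> C) (a : C) :
  Clim u a -> Clim (fun n => - u n)%C (- a)%C.
Proof.
intros H; apply Clim_ext with (fun n => (-1)%R * u n)%C.
- intros n; apply Ceq; simpl; ring.
- replace (- a)%C with ((-1)%R * a)%C by (apply Ceq; simpl; ring).
  now apply Clim_scal.
Qed.

Lemma Clim_minus (u v : nat -> C) (a b : C) :
  Clim u a -> Clim v b -> Clim (fun n => u n - v n)%C (a - b)%C.
Proof. intros Hu Hv; apply Clim_plus; auto; now apply Clim_opp. Qed.

Lemma Clim_bounded_le (u : nat -> C) (l : C) (M : R) (N0 : nat) :
  Clim u l -> (forall n, (N0 <= n)%nat -> Cmod (u n) <= M) -> Cmod l <= M.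
Proof.
intros H HM; apply Rnot_lt_le; intros Hlt.
destruct (H (Cmod l - M)) as [N HN]; [lra|].
specialize (HN (N + N0)%nat ltac:(lia)); specialize (HM (N + N0)%nat ltac:(lia)).
generalize (Cmod_triangle_sub l (u (N + N0)%nat)).
rewrite Cmod_sub_comm; lra.
Qed.

Lemma Clim_unique (u : nat -> C) (a b : C) : Clim u a -> Clim u b -> a = b.
Proof.
intros Ha Hb.
assert (H : Clim (fun _ => RtoC 0) (a - b)%C).
{ apply Clim_ext with (fun n => u n - u n)%C; [intros; ring|].
  now apply Clim_minus. }
assert (E : Cmod (a - b)%C <= 0).
{ apply (Clim_bounded_le _ _ 0 0 H); intros; rewrite Cmod_0; lra. }
assert (E' : (a - b = 0)%C).
{ apply Cmod_eq_0; generalize (Cmod_ge_0 (a - b)%C); lra. }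
replace a with ((a - b) + b)%C by ring; rewrite E'; ring.
Qed.

Lemma Clim_mult (u v : nat -> C) (a b : C) :
  Clim u a -> Clim v b -> Clim (fun n => u n * v n)%C (a * b)%C.
Proof.
intros Hu Hv.
assert (H0 : Clim (fun n => (u n - a) * (v n - b))%C (RtoC 0)).
{ intros eps He.
  destruct (Hu 1) as [N HN]; [lra|]; destruct (Hv eps He) as [M HM].
  exists (N + M)%nat; intros n Hn.
  replace ((u n - a) * (v n - b) - 0)%C with ((u n - a) * (v n - b))%C by ring.
  rewrite Cmod_mult.
  specialize (HN n ltac:(lia)); specialize (HM n ltac:(lia)).
  assert (A := Cmod_ge_0 (u n - a)%C); assert (B := Cmod_ge_0 (v n - b)%C).
  nra. }
replace (a * b)%C with (0 + (a * b + b * a - a * b))%C by ring.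
apply Clim_ext with
  (fun n => (u n - a) * (v n - b) + (a * v n + b * u n - a * b))%C.
- intros n; ring.
- apply Clim_plus; auto; apply Clim_minus; [|apply Clim_const].
  apply Clim_plus; now apply Clim_scal.
Qed.

Lemma Clim_inv (u : nat -> C) (a : C) : (a <> 0)%C ->
  Clim u a -> Clim (fun n => / u n)%C (/ a)%C.
Proof.
intros Ha Hu eps He.
assert (Hm : 0 < Cmod a) by (now apply Cmod_gt_0).
destruct (Hu (Cmod a / 2)) as [N HN]; [lra|].
destruct (Hu (eps * (Cmod a * Cmod a / 2))) as [M HM]; [apply Rmult_lt_0_compat; nra|].
exists (N + M)%nat; intros n Hn.
specialize (HN n ltac:(lia)); specialize (HM n ltac:(lia)).
assert (Hn2 : Cmod a / 2 <= Cmod (u n)).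
{ generalize (Cmod_triangle_sub a (u n)); rewrite Cmod_sub_comm; lra. }
assert (Hnz : (u n <> 0)%C) by (apply Cmod_gt_0; lra).
replace (/ u n - / a)%C with (- (u n - a) * (/ (u n * a)))%C by (field; auto).
rewrite Cmod_mult, Cmod_opp, Cmod_inv, Cmod_mult
  by (try apply Cmult_neq_0; auto).
apply Rmult_lt_reg_r with (Cmod (u n) * Cmod a); [nra|].
rewrite Rmult_assoc, Rinv_l, Rmult_1_r by nra.
eapply Rlt_le_trans; [apply HM|].
apply Rmult_le_compat_l; nra.
Qed.

Lemma Clim_Re (u : nat -> C) (l : C) :
  Clim u l -> is_lim_seq (fun n => Re (u n)) (Re l).
Proof.
intros H; apply Rlim_is_lim_seq; intros eps He.
destruct (H eps He) as [N HN]; exists N; intros n Hn.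
eapply Rle_lt_trans; [|apply (HN n Hn)].
rewrite <- re_minus; apply re_le_Cmod.
Qed.

Lemma Clim_Im (u : nat -> C) (l : C) :
  Clim u l -> is_lim_seq (fun n => Im (u n)) (Im l).
Proof.
intros H; apply Rlim_is_lim_seq; intros eps He.
destruct (H eps He) as [N HN]; exists N; intros n Hn.
eapply Rle_lt_trans; [|apply (HN n Hn)].
rewrite <- im_minus; apply im_le_Cmod.
Qed.

(** A junk value when [u] does not converge. *)
Definition Clim_val (u : nat -> C) : C :=
  (real (Lim_seq (fun n => Re (u n))), real (Lim_seq (fun n => Im (u n)))).

Lemma Clim_val_eq (u : nat -> C) (l : C) : Clim u l -> Clim_val u = l.
Proof.
intros H; apply Ceq; simpl.
- now rewrite (is_lim_seq_unique _ _ (Clim_Re _ _ H)).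
- now rewrite (is_lim_seq_unique _ _ (Clim_Im _ _ H)).
Qed.

Lemma Clim_shift (u : nat -> C) (l : C) :
  Clim (fun n => u (S n)) l <-> Clim u l.
Proof.
split; intros H eps He; destruct (H eps He) as [N HN].
- exists (S N); intros [|n] Hn; [lia|]; apply HN; lia.
- exists N; intros n Hn; apply HN; lia.
Qed.

Lemma Clim_subseq (u : nat -> C) (l : C) (s : nat -> nat) :
  (forall n, (n <= s n)%nat) -> Clim u l -> Clim (fun n => u (s n)) l.
Proof.
intros Hs H eps He; destruct (H eps He) as [N HN]; exists N; intros n Hn.
apply HN; specialize (Hs n); lia.
Qed.

(** * Finite sums, dominated series and exchange of summations *)

Fixpoint csum (f : nat -> C) (n : nat) : C :=
  match n with O => RtoC 0 | S n => (csum f n + f n)%C end.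

Fixpoint rsum (f : nat -> R) (n : nat) : R :=
  match n with O => 0 | S n => rsum f n + f n end.

Lemma csum_ext (f g : nat -> C) (n : nat) :
  (forall i, (i < n)%nat -> f i = g i) -> csum f n = csum g n.
Proof.
induction n as [|n IH]; intros H; simpl; auto.
rewrite IH, H by (intros; try apply H; lia); auto.
Qed.

Lemma csum_plus (f g : nat -> C) (n : nat) :
  csum (fun i => f i + g i)%C n = (csum f n + csum g n)%C.
Proof. induction n as [|n IH]; simpl; [ring|rewrite IH; ring]. Qed.

Lemma csum_minus (f g : nat -> C) (n : nat) :
  csum (fun i => f i - g i)%C n = (csum f n - csum g n)%C.
Proof. induction n as [|n IH]; simpl; [ring|rewrite IH; ring]. Qed.

Lemma csum_scal (c : C) (f : nat -> C) (n : nat) :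
  csum (fun i => c * f i)%C n = (c * csum f n)%C.
Proof. induction n as [|n IH]; simpl; [ring|rewrite IH; ring]. Qed.

Lemma csum_zero (n : nat) : csum (fun _ => RtoC 0) n = RtoC 0.
Proof. induction n as [|n IH]; simpl; [|rewrite IH]; ring. Qed.

Lemma csum_split (f : nat -> C) (n m : nat) :
  csum f (n + m) = (csum f n + csum (fun i => f (n + i)%nat) m)%C.
Proof.
induction m as [|m IH]; simpl; [rewrite Nat.add_0_r; ring|].
rewrite Nat.add_succ_r; simpl; rewrite IH; ring.
Qed.

Lemma csum_swap (f : nat -> nat -> C) (n m : nat) :
  csum (fun i => csum (f i) m) n = csum (fun j => csum (fun i => f i j) n) m.
Proof.
induction n as [|n IH]; simpl; [now rewrite csum_zero|].
rewrite IH, <- csum_plus; reflexivity.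
Qed.

Lemma csum_S_l (f : nat -> C) (n : nat) :
  csum f (S n) = (f O + csum (fun i => f (S i)) n)%C.
Proof.
replace (S n) with (1 + n)%nat by lia; rewrite csum_split; simpl; ring.
Qed.

Lemma csum_RtoC (f : nat -> R) (n : nat) :
  csum (fun i => RtoC (f i)) n = RtoC (rsum f n).
Proof.
induction n as [|n IH]; simpl; [reflexivity|]; rewrite IH, RtoC_plus; auto.
Qed.

Lemma rsum_ext (f g : nat -> R) (n : nat) :
  (forall i, (i < n)%nat -> f i = g i) -> rsum f n = rsum g n.
Proof.
induction n as [|n IH]; intros H; simpl; auto.
rewrite IH, H by (intros; try apply H; lia); auto.
Qed.

Lemma rsum_le (f g : nat -> R) (n : nat) :
  (forall i, (i < n)%nat -> f i <= g i) -> rsum f n <= rsum g n.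
Proof.
induction n as [|n IH]; intros H; simpl; [lra|].
apply Rplus_le_compat; [apply IH; intros|]; apply H; lia.
Qed.

Lemma rsum_scal (c : R) (f : nat -> R) (n : nat) :
  rsum (fun i => c * f i) n = c * rsum f n.
Proof. induction n as [|n IH]; simpl; [ring|rewrite IH; ring]. Qed.

Lemma rsum_plus (f g : nat -> R) (n : nat) :
  rsum (fun i => f i + g i) n = rsum f n + rsum g n.
Proof. induction n as [|n IH]; simpl; [ring|rewrite IH; ring]. Qed.

Lemma rsum_split (f : nat -> R) (n m : nat) :
  rsum f (n + m) = rsum f n + rsum (fun i => f (n + i)%nat) m.
Proof.
induction m as [|m IH]; simpl; [rewrite Nat.add_0_r; ring|].
rewrite Nat.add_succ_r; simpl; rewrite IH; ring.
Qed.

Lemma rsum_nonneg (f : nat -> R) (n : nat) :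
  (forall i, 0 <= f i) -> 0 <= rsum f n.
Proof.
intros H; induction n as [|n IH]; simpl; [lra|]; specialize (H n); lra.
Qed.

Lemma rsum_sum_n (f : nat -> R) (n : nat) : rsum f (S n) = sum_n f n.
Proof.
induction n as [|n IH]; [simpl; rewrite sum_O; ring|].
rewrite sum_Sn, <- IH; reflexivity.
Qed.

Lemma Cmod_csum_le (f : nat -> C) (b : nat -> R) (n : nat) :
  (forall i, (i < n)%nat -> Cmod (f i) <= b i) -> Cmod (csum f n) <= rsum b n.
Proof.
induction n as [|n IH]; intros H; simpl; [rewrite Cmod_0; lra|].
eapply Rle_trans; [apply Cmod_triangle|].
apply Rplus_le_compat; [apply IH; intros|]; apply H; lia.
Qed.

Definition Csums (f : nat -> C) (l : C) : Prop := Clim (csum f) l.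

Lemma Csums_unique (f : nat -> C) (a b : C) : Csums f a -> Csums f b -> a = b.
Proof. apply Clim_unique. Qed.

Lemma Csums_ext (f g : nat -> C) (l : C) :
  (forall n, f n = g n) -> Csums f l -> Csums g l.
Proof.
intros E; apply Clim_ext; intros n; apply csum_ext; auto.
Qed.

Lemma Csums_plus (f g : nat -> C) (a b : C) :
  Csums f a -> Csums g b -> Csums (fun n => f n + g n)%C (a + b)%C.
Proof.
intros Hf Hg; eapply Clim_ext; [intros n; symmetry; apply csum_plus|].
now apply Clim_plus.
Qed.

Lemma Csums_minus (f g : nat -> C) (a b : C) :
  Csums f a -> Csums g b -> Csums (fun n => f n - g n)%C (a - b)%C.
Proof.
intros Hf Hg; eapply Clim_ext; [intros n; symmetry; apply csum_minus|].
now apply Clim_minus.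
Qed.

Lemma Csums_scal (c : C) (f : nat -> C) (a : C) :
  Csums f a -> Csums (fun n => c * f n)%C (c * a)%C.
Proof.
intros Hf; eapply Clim_ext; [intros n; symmetry; apply csum_scal|].
now apply Clim_scal.
Qed.

Lemma Csums_csum (f : nat -> nat -> C) (l : nat -> C) (n : nat) :
  (forall i, (i < n)%nat -> Csums (f i) (l i)) ->
  Csums (fun m => csum (fun i => f i m) n) (csum l n).
Proof.
induction n as [|n IH]; intros H.
- intros eps He; exists O; intros m _; simpl; rewrite csum_zero.
  replace (0 - 0)%C with (RtoC 0) by ring; rewrite Cmod_0; lra.
- simpl; apply Csums_plus; [apply IH; intros|]; apply H; lia.
Qed.

Definition summable (b : nat -> R) : Prop :=
  (forall n, 0 <= b n) /\ ex_series b.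

Definition rtail (b : nat -> R) (n : nat) : R := Series (fun i => b (n + i)%nat).

Lemma summable_shift (b : nat -> R) (n : nat) :
  summable b -> summable (fun i => b (n + i)%nat).
Proof.
intros [H0 H]; split; [auto|]; now apply (ex_series_incr_n b n).
Qed.

Lemma rsum_le_Series (b : nat -> R) (n : nat) :
  summable b -> rsum b n <= Series b.
Proof.
intros [H0 H]; apply Rle_trans with (rsum b (S n)); [simpl; specialize (H0 n); lra|].
rewrite rsum_sum_n.
apply (is_lim_seq_incr_compare (sum_n b)).
- now apply Series_correct.
- intros m; rewrite sum_Sn; unfold plus; simpl; specialize (H0 (S m)); lra.
Qed.

Lemma summable_bound (b : nat -> R) (M : R) :
  (forall n, 0 <= b n) -> (forall n, rsum b n <= M) -> summable b.
Proof.
intros H0 HM; split; auto.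
assert (H : ex_finite_lim_seq (sum_n b)).
{ apply ex_finite_lim_seq_incr with M.
  - intros n; rewrite sum_Sn; unfold plus; simpl; specialize (H0 (S n)); lra.
  - intros n; rewrite <- rsum_sum_n; auto. }
destruct H as [l Hl]; exists l; exact Hl.
Qed.

Lemma summable_le (a b : nat -> R) :
  (forall n, 0 <= a n <= b n) -> summable b -> summable a.
Proof.
intros H Hb; apply summable_bound with (Series b); [intros; apply H|].
intros n; eapply Rle_trans; [|now apply rsum_le_Series].
apply rsum_le; intros; apply H.
Qed.

Lemma summable_scal (c : R) (b : nat -> R) :
  0 <= c -> summable b -> summable (fun n => c * b n).
Proof.
intros Hc [H0 H]; split.
- intros n; specialize (H0 n); nra.
- now apply (ex_series_scal c b).
Qed.

Lemma rtail_pos (b : nat -> R) (n : nat) : summable b -> 0 <= rtail b n.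
Proof.
intros H; unfold rtail.
apply (rsum_le_Series (fun i => b (n + i)%nat) 0).
now apply summable_shift.
Qed.

Lemma rtail_Series (b : nat -> R) (n : nat) :
  summable b -> rtail b n = Series b - rsum b n.
Proof.
intros [H0 H]; unfold rtail; destruct n as [|n].
- simpl; rewrite Rminus_0_r; apply Series_ext; intros; f_equal.
- rewrite (Series_incr_n b (S n)) by (auto; lia); simpl pred.
  rewrite <- sum_n_Reals, <- rsum_sum_n; lra.
Qed.

Lemma rtail_lim (b : nat -> R) : summable b -> is_lim_seq (rtail b) 0.
Proof.
intros Hb; destruct (Hb) as [H0 H].
apply is_lim_seq_ext with (fun n => Series b - rsum b n).
- intros n; symmetry; now apply rtail_Series.
- replace (Finite 0) with (Rbar_minus (Series b) (Series b))
    by (simpl; f_equal; ring).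
  apply is_lim_seq_minus'; [apply is_lim_seq_const|].
  apply is_lim_seq_incr_1.
  apply is_lim_seq_ext with (sum_n b); [intros; now rewrite rsum_sum_n|].
  now apply Series_correct.
Qed.

(** Comparison test on real and imaginary parts. The explicit tail, found by passing to the limit in
    the partial sums, is what later makes convergence uniform along paths and circles. *)
Lemma Csums_dom (f : nat -> C) (b : nat -> R) :
  (forall n, Cmod (f n) <= b n) -> ex_series b ->
  exists l, Csums f l /\ forall N, Cmod (l - csum f N)%C <= rtail b N.
Proof.
intros Hf Hb.
assert (Hs : summable b).
{ split; auto; intros n; eapply Rle_trans; [apply Cmod_ge_0|apply Hf]. }
assert (HR : ex_series (fun n => Re (f n))).
{ apply (ex_series_le (K := R_AbsRing) (V := R_CompleteNormedModule) _ b); auto.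
  intros n; eapply Rle_trans; [apply re_le_Cmod|apply Hf]. }
assert (HI : ex_series (fun n => Im (f n))).
{ apply (ex_series_le (K := R_AbsRing) (V := R_CompleteNormedModule) _ b); auto.
  intros n; eapply Rle_trans; [apply im_le_Cmod|apply Hf]. }
destruct HR as [x Hx]; destruct HI as [y Hy].
assert (HL : Csums f (x, y)).
{ apply Clim_shift; intros eps He.
  destruct (proj1 (Rlim_is_lim_seq _ _) Hx (eps / 2) ltac:(lra)) as [N HN].
  destruct (proj1 (Rlim_is_lim_seq _ _) Hy (eps / 2) ltac:(lra)) as [M HM].
  exists (N + M)%nat; intros n Hn.
  eapply Rle_lt_trans; [apply Cmod_le_abs|].
  assert (ER : forall n, Re (csum f (S n)) = sum_n (fun n => Re (f n)) n).
  { clear; induction n as [|n IH]; [rewrite sum_O; simpl csum; rewrite re_plus, re_RtoC; ring|].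
    rewrite sum_Sn, <- IH; reflexivity. }
  assert (EI : forall n, Im (csum f (S n)) = sum_n (fun n => Im (f n)) n).
  { clear; induction n as [|n IH]; [rewrite sum_O; simpl csum; rewrite im_plus, im_RtoC; ring|].
    rewrite sum_Sn, <- IH; reflexivity. }
  rewrite re_minus, im_minus, ER, EI; change (Re (x, y)) with x; change (Im (x, y)) with y.
  assert (HN' : Rabs (sum_n (fun n => Re (f n)) n - x) < eps / 2)
    by (apply HN; lia).
  assert (HM' : Rabs (sum_n (fun n => Im (f n)) n - y) < eps / 2)
    by (apply HM; lia).
  lra. }
exists (x, y); split; auto.
intros N.
apply (Clim_bounded_le (fun n => csum f n - csum f N)%C _ _ N).
- apply Clim_minus; [exact HL|apply Clim_const].
- intros n Hn; replace n with (N + (n - N))%nat by lia.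
  rewrite csum_split.
  replace (csum f N + csum (fun i => f (N + i)%nat) (n - N) - csum f N)%C
    with (csum (fun i => f (N + i)%nat) (n - N)) by ring.
  eapply Rle_trans; [apply Cmod_csum_le; intros; apply Hf|].
  now apply (rsum_le_Series (fun i => b (N + i)%nat)), summable_shift.
Qed.

Lemma Csums_dom_le (f : nat -> C) (b : nat -> R) (l : C) :
  (forall n, Cmod (f n) <= b n) -> ex_series b -> Csums f l ->
  forall N, Cmod (l - csum f N)%C <= rtail b N.
Proof.
intros Hf Hb Hl; destruct (Csums_dom f b Hf Hb) as [l' [H1 H2]].
now rewrite (Csums_unique _ _ _ Hl H1).
Qed.

(** Dominated convergence for sums whose length [K r] varies too. By [r <= K r] every fixed index
    eventually enters the sum; the majorant controls all terms beyond a fixed [N], and the finitely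
    many others converge one by one. *)
Lemma tannery (u : nat -> nat -> C) (v : nat -> C) (b : nat -> R)
    (K : nat -> nat) (l : C) :
  (forall r k, (k < K r)%nat -> Cmod (u r k) <= b k) -> ex_series b ->
  (forall k, Clim (fun r => u r k) (v k)) -> (forall r, (r <= K r)%nat) ->
  Csums v l -> Clim (fun r => csum (u r) (K r)) l.
Proof.
intros Hu Hb Hk HK Hl.
assert (Hv : forall k, Cmod (v k) <= b k).
{ intros k; apply (Clim_bounded_le _ _ _ (S k) (Hk k)); intros r Hr.
  apply Hu; specialize (HK r); lia. }
assert (Hs : summable b).
{ split; auto; intros n; eapply Rle_trans; [apply Cmod_ge_0|apply Hv]. }
intros eps He.
destruct (proj1 (Rlim_is_lim_seq _ _) (rtail_lim b Hs) (eps / 3) ltac:(lra))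
  as [N HN].
assert (HF : Clim (fun r => csum (u r) N) (csum v N)).
{ clear - Hk; induction N as [|N IH]; simpl; [apply Clim_const|].
  now apply Clim_plus. }
destruct (HF (eps / 3) ltac:(lra)) as [M HM].
exists (N + M)%nat; intros r Hr.
specialize (HM r ltac:(lia)); specialize (HN N ltac:(lia)).
assert (Hl' := Csums_dom_le v b l Hv Hb Hl N).
rewrite Rminus_0_r in HN; assert (HN' := Rle_abs (rtail b N)).
replace (K r) with (N + (K r - N))%nat by (specialize (HK r); lia).
rewrite csum_split.
set (T := csum _ (K r - N)).
assert (HT : Cmod T <= rtail b N).
{ eapply Rle_trans.
  - apply Cmod_csum_le; intros i Hi; apply Hu; specialize (HK r); lia.
  - apply (rsum_le_Series (fun i => b (N + i)%nat)), summable_shift, Hs. }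
replace (csum (u r) N + T - l)%C
  with ((csum (u r) N - csum v N) + (T - (l - csum v N)))%C by ring.
eapply Rle_lt_trans; [apply Cmod_triangle|].
assert (H2 := Cmod_minus_le T (l - csum v N)%C); lra.
Qed.

(** A majorant in product form makes the tails of rows and of columns explicit, so that both
    iterated sums can be compared with the square partial sums. *)
Lemma fubini (a : nat -> nat -> C) (c d : nat -> R) (rowsum : nat -> C) (l : C) :
  (forall m n, Cmod (a m n) <= c m * d n) -> summable c -> summable d ->
  (forall m, Csums (a m) (rowsum m)) -> Csums rowsum l ->
  exists colsum, (forall n, Csums (fun m => a m n) (colsum n)) /\
    Csums colsum l.
Proof.
intros Ha Hc Hd Hr Hl.
assert (Hcol : forall n, exists s, Csums (fun m => a m n) s).
{ intros n; destruct (Csums_dom (fun m => a m n) (fun m => d n * c m)) as [s [Hs _]].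
  - intros m; rewrite Rmult_comm; auto.
  - apply summable_scal; auto; apply Hd.
  - now exists s. }
assert (Hch : exists colsum, forall n, Csums (fun m => a m n) (colsum n)).
{ exists (fun n => Clim_val (csum (fun m => a m n))); intros n.
  destruct (Hcol n) as [s Hs]; unfold Csums; now rewrite (Clim_val_eq _ _ Hs). }
destruct Hch as [col Hcs]; exists col; split; auto.
set (Sc := Series c); set (Sd := Series d).
assert (HSc : 0 <= Sc) by (apply (rsum_le_Series c 0 Hc)).
assert (HSd : 0 <= Sd) by (apply (rsum_le_Series d 0 Hd)).
(* Both iterated sums differ from the [N x N] square sum by
   [Sc * rtail d N + Sd * rtail c N]. *)
apply Clim_squeeze with (fun N => 2 * (Sc * rtail d N + Sd * rtail c N)).
2:{ replace (Finite 0) with (Finite (2 * (Sc * 0 + Sd * 0))) by (f_equal; ring).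
    apply is_lim_seq_mult'; [apply is_lim_seq_const|].
    apply is_lim_seq_plus'; (apply is_lim_seq_mult';
      [apply is_lim_seq_const|now apply rtail_lim]). }
intros N.
assert (HcN := rsum_le_Series c N Hc); assert (HdN := rsum_le_Series d N Hd).
assert (Hc0 : 0 <= rsum c N) by (apply rsum_nonneg; apply Hc).
assert (Hd0 : 0 <= rsum d N) by (apply rsum_nonneg; apply Hd).
assert (Htd := rtail_pos d N Hd); assert (Htc := rtail_pos c N Hc).
assert (Hrow : forall m N, Cmod (rowsum m - csum (a m) N)%C <= c m * rtail d N).
{ intros m M.
  unfold rtail; rewrite <- Series_scal_l.
  apply (Csums_dom_le (a m) (fun n => c m * d n)); auto.
  apply summable_scal; auto; apply Hc. }
assert (Hcolb : forall n, Cmod (col n - csum (fun m => a m n) N)%C <= rtail c N * d n).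
{ intros n; rewrite Rmult_comm.
  unfold rtail; rewrite <- Series_scal_l.
  apply (Csums_dom_le (fun m => a m n) (fun m => d n * c m)); auto.
  - intros m; rewrite Rmult_comm; auto.
  - apply summable_scal; auto; apply Hd. }
assert (B1 : Cmod (l - csum rowsum N)%C <= Sd * rtail c N).
{ unfold rtail; rewrite <- Series_scal_l.
  apply (Csums_dom_le rowsum (fun m => Sd * c m)); auto.
  - intros m; specialize (Hrow m O).
    replace (rowsum m - csum (a m) 0)%C with (rowsum m) in Hrow by (simpl; ring).
    replace (rtail d 0) with Sd in Hrow
      by (rewrite rtail_Series by auto; unfold Sd; simpl; ring).
    lra.
  - apply summable_scal; auto. }
assert (B2 : Cmod (csum rowsum N - csum (fun m => csum (a m) N) N)%C
             <= Sc * rtail d N).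
{ rewrite <- csum_minus; eapply Rle_trans.
  - apply Cmod_csum_le; intros i _; apply Hrow.
  - rewrite (rsum_ext _ (fun i => rtail d N * c i)) by (intros; ring).
    rewrite rsum_scal, (Rmult_comm Sc); now apply Rmult_le_compat_l. }
assert (B3 : Cmod (csum col N - csum (fun m => csum (a m) N) N)%C
             <= Sd * rtail c N).
{ rewrite csum_swap, <- csum_minus; eapply Rle_trans.
  - apply Cmod_csum_le; intros i _; apply Hcolb.
  - rewrite rsum_scal, (Rmult_comm Sd); now apply Rmult_le_compat_l. }
set (Q := csum (fun m => csum (a m) N) N) in *.
replace (csum col N - l)%C
  with ((csum col N - Q) - ((csum rowsum N - Q) + (l - csum rowsum N)))%C by ring.
eapply Rle_trans; [apply Cmod_minus_le|].
assert (H3 := Cmod_triangle (csum rowsum N - Q)%C (l - csum rowsum N)%C).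
assert (0 <= Sc * rtail d N) by now apply Rmult_le_pos.
assert (0 <= Sd * rtail c N) by now apply Rmult_le_pos.
lra.
Qed.

(** * Derivatives of complex functions of a real variable *)

Definition cderiv (f : R -> C) (t : R) (l : C) : Prop :=
  is_derive (fun s => Re (f s)) t (Re l) /\ is_derive (fun s => Im (f s)) t (Im l).

Lemma is_derive_eq (f : R -> R) (t l l' : R) :
  is_derive f t l -> l = l' -> is_derive f t l'.
Proof. now intros H <-. Qed.

Lemma is_derive_Rplus (f g : R -> R) (t a b : R) :
  is_derive f t a -> is_derive g t b -> is_derive (fun s => f s + g s) t (a + b).
Proof. intros; now apply (is_derive_plus f g). Qed.

Lemma is_derive_Rminus (f g : R -> R) (t a b : R) :
  is_derive f t a -> is_derive g t b -> is_derive (fun s => f s - g s) t (a - b).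
Proof. intros; now apply (is_derive_minus f g). Qed.

Lemma is_derive_Rmult (f g : R -> R) (t a b : R) :
  is_derive f t a -> is_derive g t b ->
  is_derive (fun s => f s * g s) t (a * g t + f t * b).
Proof. intros Hf Hg; apply (is_derive_mult f g); auto; intros; apply Rmult_comm. Qed.

Lemma cderiv_eq (f : R -> C) (t : R) (l l' : C) :
  cderiv f t l -> l = l' -> cderiv f t l'.
Proof. now intros H <-. Qed.

Lemma cderiv_ext (f g : R -> C) (t : R) (l : C) :
  (forall s, f s = g s) -> cderiv f t l -> cderiv g t l.
Proof.
intros E [H1 H2]; split; [refine (is_derive_ext _ _ _ _ _ H1)|
  refine (is_derive_ext _ _ _ _ _ H2)]; intros; simpl; now rewrite E.
Qed.

Lemma cderiv_const (c : C) (t : R) : cderiv (fun _ => c) t (RtoC 0).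
Proof. split; simpl; apply @is_derive_const. Qed.

Lemma cderiv_RtoC (f : R -> R) (t l : R) :
  is_derive f t l -> cderiv (fun s => RtoC (f s)) t (RtoC l).
Proof. intros H; split; simpl; [exact H|apply @is_derive_const]. Qed.

Lemma cderiv_id (t : R) : cderiv RtoC t (RtoC 1).
Proof. apply (cderiv_RtoC (fun s => s)); apply @is_derive_id. Qed.

Lemma cderiv_plus (f g : R -> C) (t : R) (a b : C) :
  cderiv f t a -> cderiv g t b -> cderiv (fun s => f s + g s)%C t (a + b)%C.
Proof. intros [F1 F2] [G1 G2]; split; simpl; now apply is_derive_Rplus. Qed.

Lemma cderiv_minus (f g : R -> C) (t : R) (a b : C) :
  cderiv f t a -> cderiv g t b -> cderiv (fun s => f s - g s)%C t (a - b)%C.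
Proof. intros [F1 F2] [G1 G2]; split; simpl; now apply is_derive_Rminus. Qed.

Lemma cderiv_mult (f g : R -> C) (t : R) (a b : C) :
  cderiv f t a -> cderiv g t b ->
  cderiv (fun s => f s * g s)%C t (a * g t + f t * b)%C.
Proof.
intros [F1 F2] [G1 G2]; split.
- eapply is_derive_eq; [apply (is_derive_Rminus (fun s => Re (f s) * Re (g s)));
    apply is_derive_Rmult; eassumption|].
  unfold Re, Im; simpl; ring.
- eapply is_derive_eq; [apply (is_derive_Rplus (fun s => Re (f s) * Im (g s)));
    apply is_derive_Rmult; eassumption|].
  unfold Re, Im; simpl; ring.
Qed.

Lemma cderiv_scal (c : C) (f : R -> C) (t : R) (a : C) :
  cderiv f t a -> cderiv (fun s => c * f s)%C t (c * a)%C.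
Proof.
intros H; eapply cderiv_eq; [apply cderiv_mult; [apply cderiv_const|exact H]|].
simpl; ring.
Qed.

Lemma cderiv_inv (f : R -> C) (t : R) (a : C) : (f t <> 0)%C ->
  cderiv f t a -> cderiv (fun s => / f s)%C t (- a / (f t * f t))%C.
Proof.
intros Hf [F1 F2].
assert (Hn : Re (f t) ^ 2 + Im (f t) ^ 2 <> 0).
{ rewrite <- Cmod2_alt; apply pow_nonzero.
  apply Rgt_not_eq; now apply Cmod_gt_0. }
assert (HN : is_derive (fun s => Re (f s) ^ 2 + Im (f s) ^ 2) t
   (2 * Re a * Re (f t) + 2 * Im a * Im (f t))).
{ apply is_derive_ext with
    (fun s => Re (f s) * Re (f s) + Im (f s) * Im (f s)); [intros; simpl; ring|].
  eapply is_derive_eq; [apply is_derive_Rplus; apply is_derive_Rmult; eassumption|].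
  simpl; ring. }
assert (Hn' : Re (f t) * (Re (f t) * 1) + Im (f t) * (Im (f t) * 1) <> 0)
  by exact Hn.
assert (Hn2 : (Re (f t) * Re (f t) - Im (f t) * Im (f t)) ^ 2
   + (Re (f t) * Im (f t) + Im (f t) * Re (f t)) ^ 2 <> 0).
{ replace (_ + _) with ((Re (f t) ^ 2 + Im (f t) ^ 2) ^ 2) by ring.
  now apply pow_nonzero. }
split.
- eapply is_derive_eq.
  + apply (is_derive_Rmult (fun s => Re (f s))); [exact F1|].
    apply is_derive_inv; [exact HN|exact Hn].
  + unfold Cdiv; rewrite re_mult; destruct (f t) as [x y], a as [p q].
    unfold Re, Im in *; simpl in *; field; split; [intros E; apply Hn2; rewrite <- E; ring|intros E; apply Hn; rewrite <- E; ring].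
- eapply is_derive_eq.
  + apply (is_derive_Rmult (fun s => - Im (f s))); [apply @is_derive_opp; exact F2|].
    apply is_derive_inv; [exact HN|exact Hn].
  + unfold Cdiv; rewrite im_mult; destruct (f t) as [x y], a as [p q].
    unfold Re, Im, opp in *; simpl in *; field; split; [intros E; apply Hn2; rewrite <- E; ring|intros E; apply Hn; rewrite <- E; ring].
Qed.

Lemma cderiv_pow (f : R -> C) (t : R) (a : C) (n : nat) :
  cderiv f t a ->
  cderiv (fun s => f s ^ (S n))%C t (INR (S n) * f t ^ n * a)%C.
Proof.
intros H; induction n as [|n IH].
- apply cderiv_ext with f; [intros; simpl; ring|].
  eapply cderiv_eq; [exact H|]; simpl; ring.
- apply cderiv_ext with (fun s => f s * f s ^ (S n))%C; [intros; simpl; ring|].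
  eapply cderiv_eq; [apply cderiv_mult; eassumption|].
  rewrite (S_INR (S n)), RtoC_plus; simpl Cpow; ring.
Qed.

Lemma cderiv_csum (f : nat -> R -> C) (t : R) (a : nat -> C) (n : nat) :
  (forall i, (i < n)%nat -> cderiv (f i) t (a i)) ->
  cderiv (fun s => csum (fun i => f i s) n) t (csum a n).
Proof.
induction n as [|n IH]; intros H; simpl; [apply cderiv_const|].
apply cderiv_plus; [apply IH; intros|]; apply H; lia.
Qed.

(** From the real inequality applied to the component of [f] along [f b - f a]. *)
Lemma cderiv_dominated (f f' : R -> C) (psi psi' : R -> R) (a b : R) : a <= b ->
  (forall t, a <= t <= b -> cderiv f t (f' t)) ->
  (forall t, a <= t <= b -> is_derive psi t (psi' t)) ->
  (forall t, a <= t <= b -> Cmod (f' t) <= psi' t) ->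
  Cmod (f b - f a)%C <= psi b - psi a.
Proof.
intros Hab Hf Hpsi Hle.
set (c := (f b - f a)%C).
assert (Hk : exists k, Cmod k <= 1 /\ Re (k * c)%C = Cmod c).
{ destruct (Req_dec (Cmod c) 0) as [E|E].
  - exists (RtoC 0); rewrite Cmod_0, E; split; [lra|]; simpl; ring.
  - exists (Cconj c * / Cmod c)%C.
    assert (Hi : Cmod (Cconj c * / Cmod c)%C = 1).
    { rewrite Cmod_mult, Cmod_conj, Cmod_inv, Cmod_R, Rabs_pos_eq
        by (try apply Cmod_ge_0; intros X; apply RtoC_inj in X; auto).
      now field. }
    split; [lra|].
    replace (Cconj c * / Cmod c * c)%C with (c * Cconj c * / Cmod c)%C by ring.
    rewrite <- Cmod2_conj, <- RtoC_inv, <- RtoC_mult by auto.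
    rewrite re_RtoC; now field. }
destruct Hk as [k [Hk1 Hk2]].
set (h := fun t => Re (k * f t)%C - psi t).
destruct (MVT_gen h a b (fun t => Re (k * f' t)%C - psi' t)) as [x [Hx E]].
- intros t Ht; rewrite Rmin_left, Rmax_right in Ht by auto.
  apply is_derive_Rminus; [|apply Hpsi; lra].
  now apply (cderiv_scal k), Hf; lra.
- intros t Ht; rewrite Rmin_left, Rmax_right in Ht by auto.
  apply derivable_continuous_pt, ex_derive_Reals_0.
  exists (Re (k * f' t)%C - psi' t).
  apply is_derive_Rminus; [|apply Hpsi; lra].
  now apply (cderiv_scal k), Hf; lra.
- rewrite Rmin_left, Rmax_right in Hx by auto.
  assert (B : Re (k * f' x)%C <= psi' x).
  { apply Rle_trans with (1 := Re_le _); rewrite Cmod_mult.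
    specialize (Hle x Hx); assert (A := Cmod_ge_0 (f' x)).
    assert (A' := Cmod_ge_0 k); nra. }
  assert (Hb : h b - h a <= 0) by (rewrite E; nra).
  unfold h in Hb; rewrite <- Hk2; unfold c.
  replace (k * (f b - f a))%C with (k * f b - k * f a)%C by ring.
  rewrite re_minus; lra.
Qed.

Lemma cderiv_bounded (f f' : R -> C) (M a b : R) : a <= b ->
  (forall t, a <= t <= b -> cderiv f t (f' t)) ->
  (forall t, a <= t <= b -> Cmod (f' t) <= M) ->
  Cmod (f b - f a)%C <= M * (b - a).
Proof.
intros Hab Hf HM.
replace (M * (b - a)) with (M * b - M * a) by ring.
apply (cderiv_dominated f f' (fun t => M * t) (fun _ => M)); auto.
intros t _; auto_derive; auto; ring.
Qed.

(** * The complex exponential *)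

Lemma exp_mono (x y : R) : x <= y -> exp x <= exp y.
Proof. intros [H | ->]; [left; now apply exp_increasing|right; auto]. Qed.

Lemma Cexp_plus (z w : C) : Cexp (z + w)%C = (Cexp z * Cexp w)%C.
Proof.
destruct z as [a b], w as [c d]; unfold Cexp, Re, Im; simpl.
rewrite exp_plus, cos_plus, sin_plus; apply Ceq; simpl; ring.
Qed.

Lemma Cexp_RtoC (x : R) : Cexp (RtoC x) = RtoC (exp x).
Proof. unfold Cexp; simpl; rewrite cos_0, sin_0; apply Ceq; simpl; ring. Qed.

Lemma Cexp_0 : Cexp (RtoC 0) = RtoC 1.
Proof. now rewrite Cexp_RtoC, exp_0. Qed.

Lemma Cmod_Cexp (z : C) : Cmod (Cexp z) = exp (Re z).
Proof.
assert (H : Cmod (Cexp z) ^ 2 = exp (Re z) ^ 2).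
{ rewrite Cmod2_alt; simpl.
  assert (T := sin2_cos2 (Im z)); unfold Rsqr in T.
  transitivity (exp (Re z) ^ 2
    * (sin (Im z) * sin (Im z) + cos (Im z) * cos (Im z))); [|rewrite T]; ring. }
assert (A := Cmod_ge_0 (Cexp z)); assert (B := exp_pos (Re z)); nra.
Qed.

Lemma Cexp_nz (z : C) : (Cexp z <> RtoC 0)%C.
Proof. apply Cmod_gt_0; rewrite Cmod_Cexp; apply exp_pos. Qed.

Lemma Cexp_opp (z : C) : Cexp (- z)%C = (/ Cexp z)%C.
Proof.
assert (E : (Cexp (- z) * Cexp z)%C = RtoC 1).
{ rewrite <- Cexp_plus, <- Cexp_0; f_equal; ring. }
assert (H := Cexp_nz z).
replace (Cexp (- z)) with ((Cexp (- z) * Cexp z) * / Cexp z)%C by now field.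
rewrite E; ring.
Qed.

Lemma Cexp_pow (z : C) (n : nat) : (Cexp z ^ n)%C = Cexp (INR n * z)%C.
Proof.
induction n as [|n IH].
- simpl; replace (0 * z)%C with (RtoC 0) by ring; now rewrite Cexp_0.
- rewrite Cpow_S, IH, <- Cexp_plus, S_INR, RtoC_plus; f_equal; ring.
Qed.

Lemma Cexp_eq (z w : C) : z = w -> Cexp z = Cexp w.
Proof. now intros ->. Qed.

Lemma Cexp_2PI_nat (n : nat) : Cexp (2 * PI * Ci * INR n)%C = RtoC 1.
Proof.
replace (2 * PI * Ci * INR n)%C with ((0, 2 * PI * INR n) : C)
  by (apply Ceq; simpl; ring).
unfold Cexp; simpl.
replace (2 * PI * INR n) with (0 + 2 * INR n * PI) by ring.
rewrite exp_0, cos_period, sin_period, cos_0, sin_0; apply Ceq; simpl; ring.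
Qed.

Lemma Cexp_2PI_Z (k : Z) : Cexp (2 * PI * Ci * IZR k)%C = RtoC 1.
Proof.
destruct (Z_le_gt_dec 0 k) as [H|H].
- rewrite <- (Z2Nat.id k) by auto; rewrite <- INR_IZR_INZ; apply Cexp_2PI_nat.
- replace (2 * PI * Ci * IZR k)%C with (- (2 * PI * Ci * INR (Z.to_nat (- k))))%C.
  + rewrite Cexp_opp, Cexp_2PI_nat; field.
  + rewrite INR_IZR_INZ, Z2Nat.id by lia; rewrite opp_IZR, RtoC_opp; ring.
Qed.

Lemma cderiv_Cexp (f : R -> C) (t : R) (a : C) :
  cderiv f t a -> cderiv (fun s => Cexp (f s)) t (a * Cexp (f t))%C.
Proof.
intros [F1 F2].
assert (He : is_derive (fun s => exp (Re (f s))) t (Re a * exp (Re (f t)))).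
{ apply (is_derive_comp exp (fun s => Re (f s))); auto; apply is_derive_exp. }
assert (Hc : is_derive (fun s => cos (Im (f s))) t (Im a * - sin (Im (f t)))).
{ apply (is_derive_comp cos (fun s => Im (f s))); auto; apply is_derive_cos. }
assert (Hs : is_derive (fun s => sin (Im (f s))) t (Im a * cos (Im (f t)))).
{ apply (is_derive_comp sin (fun s => Im (f s))); auto; apply is_derive_sin. }
split.
- eapply is_derive_eq; [apply (is_derive_Rmult _ _ _ _ _ He Hc)|].
  rewrite re_mult; simpl; ring.
- eapply is_derive_eq; [apply (is_derive_Rmult _ _ _ _ _ He Hs)|].
  rewrite im_mult; simpl; ring.
Qed.

Definition ctaylor (M : nat) (u : C) : C :=
  csum (fun m => u ^ m / INR (fact m))%C M.

Lemma INR_fact_C_nz (m : nat) : (RtoC (INR (fact m)) <> RtoC 0)%C.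
Proof. intros E; apply RtoC_inj in E; now apply (INR_fact_neq_0 m). Qed.

Lemma cderiv_ctaylor (M : nat) (u : C) (t : R) :
  cderiv (fun s => ctaylor (S M) (s * u)%C) t (u * ctaylor M (t * u)%C)%C.
Proof.
unfold ctaylor.
apply cderiv_ext with (fun s => 1 + csum (fun m => (s * u) ^ (S m) / INR (fact (S m))) M)%C.
{ intros s; rewrite csum_S_l; f_equal; simpl; field. }
eapply cderiv_eq.
- apply cderiv_plus; [apply cderiv_const|].
  apply (cderiv_csum (fun m s => ((s * u) ^ S m / INR (fact (S m)))%C)).
  intros i _; apply cderiv_ext with (fun s => / INR (fact (S i)) * (s * u) ^ S i)%C.
  { intros; unfold Cdiv; ring. }
  apply cderiv_scal, cderiv_pow, cderiv_mult; [apply cderiv_id|apply cderiv_const].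
- rewrite Cplus_0_l, <- csum_scal; apply csum_ext; intros i _.
  assert (H1 := INR_fact_C_nz i).
  assert (H2 : (RtoC (INR (S i)) <> RtoC 0)%C).
  { intros E; apply RtoC_inj in E; generalize (S_INR i) (pos_INR i); lra. }
  rewrite fact_simpl, mult_INR, RtoC_mult; field; auto.
Qed.

(** Induction on [M]: the derivative in [t] of the remainder of order [M + 1] is [u] times the
    remainder of order [M], and [cderiv_dominated] integrates the bound. The factor [t ^ M] is
    carried along because integrating it produces the next factorial. *)
Lemma Cexp_taylor_aux (M : nat) (u : C) (t : R) : 0 <= t <= 1 ->
  Cmod (Cexp (t * u) - ctaylor M (t * u))%C
    <= exp (Cmod u) * Cmod u ^ M / INR (fact M) * t ^ M.
Proof.
revert t; induction M as [|M IH]; intros t Ht.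
- simpl ctaylor; unfold ctaylor; simpl csum.
  replace (Cexp (t * u) - 0)%C with (Cexp (t * u)%C) by ring.
  rewrite Cmod_Cexp, re_scal_l; simpl.
  replace (exp (Cmod u) * 1 / 1 * 1) with (exp (Cmod u)) by field.
  apply exp_mono; assert (A := Re_le u); assert (B := Cmod_ge_0 u); nra.
- assert (E0 : (Cexp (0 * u) - ctaylor (S M) (0 * u))%C = RtoC 0).
  { replace (0 * u)%C with (RtoC 0) by ring; rewrite Cexp_0.
    unfold ctaylor; rewrite csum_S_l; simpl.
    rewrite (csum_ext _ (fun _ => RtoC 0)), csum_zero; [field|].
    - intros i _; unfold Cdiv; ring. }
  assert (Hfs := INR_fact_lt_0 (S M)); assert (Hf := INR_fact_lt_0 M).
  set (K := exp (Cmod u) * Cmod u ^ S M / INR (fact (S M))).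
  replace (Cexp (t * u) - ctaylor (S M) (t * u))%C with
    ((Cexp (t * u) - ctaylor (S M) (t * u)) - (Cexp (0 * u) - ctaylor (S M) (0 * u)))%C
    by (rewrite E0; ring).
  replace (K * t ^ S M) with (K * t ^ S M - K * 0 ^ S M) by (simpl; ring).
  apply (cderiv_dominated (fun s => (Cexp (s * u) - ctaylor (S M) (s * u))%C)
    (fun s => u * (Cexp (s * u) - ctaylor M (s * u)))%C
    (fun s => K * s ^ S M) (fun s => K * (INR (S M) * s ^ M))); [lra| | |].
  + intros s Hs; eapply cderiv_eq.
    * apply cderiv_minus; [apply cderiv_Cexp, cderiv_mult;
        [apply cderiv_id|apply cderiv_const]|apply cderiv_ctaylor].
    * cbv beta; ring.
  + intros s Hs; apply is_derive_scal.
    apply is_derive_Reals, (derivable_pt_lim_pow s (S M)).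
  + intros s Hs; rewrite Cmod_mult.
    apply Rle_trans with (Cmod u * (exp (Cmod u) * Cmod u ^ M / INR (fact M) * s ^ M)).
    * apply Rmult_le_compat_l; [apply Cmod_ge_0|apply IH; lra].
    * apply Req_le; unfold K; rewrite fact_simpl, mult_INR; simpl pow.
      field; split; [|apply not_0_INR; lia]; lra.
Qed.

Lemma Cexp_taylor (M : nat) (u : C) :
  Cmod (Cexp u - ctaylor M u)%C <= exp (Cmod u) * Cmod u ^ M / INR (fact M).
Proof.
generalize (Cexp_taylor_aux M u 1 ltac:(lra)).
replace (RtoC 1 * u)%C with u by ring; rewrite pow1; lra.
Qed.

Lemma Cexp_sub_1_id (u : C) :
  Cmod (Cexp u - 1 - u)%C <= exp (Cmod u) * Cmod u ^ 2.
Proof.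
apply Rle_trans with (exp (Cmod u) * Cmod u ^ 2 / INR (fact 2)).
- replace (Cexp u - 1 - u)%C with (Cexp u - ctaylor 2 u)%C; [apply Cexp_taylor|].
  unfold ctaylor; simpl; field.
- assert (A := exp_pos (Cmod u)); assert (B := Cmod_ge_0 u).
  assert (0 <= exp (Cmod u) * Cmod u ^ 2) by (apply Rmult_le_pos; [lra|nra]).
  simpl INR; lra.
Qed.

(** * Integrals of complex-valued functions *)

Definition CInt (f : R -> C) (a b : R) : C :=
  (RInt (fun t => Re (f t)) a b, RInt (fun t => Im (f t)) a b).

Definition cdiff (f : R -> C) (t : R) : Prop := exists l, cderiv f t l.

Definition ex_CInt (f : R -> C) (a b : R) : Prop :=
  ex_RInt (fun t => Re (f t)) a b /\ ex_RInt (fun t => Im (f t)) a b.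

Lemma ex_CInt_diff (f : R -> C) (a b : R) :
  (forall t, Rmin a b <= t <= Rmax a b -> cdiff f t) -> ex_CInt f a b.
Proof.
intros H; split; apply (ex_RInt_continuous (V := R_CompleteNormedModule));
  intros t Ht; destruct (H t Ht) as [l [H1 H2]];
  [apply (ex_derive_continuous (fun t => Re (f t)))|
   apply (ex_derive_continuous (fun t => Im (f t)))]; eexists; eassumption.
Qed.

Lemma ex_CInt_plus (f g : R -> C) (a b : R) :
  ex_CInt f a b -> ex_CInt g a b -> ex_CInt (fun t => f t + g t)%C a b.
Proof.
intros [F1 F2] [G1 G2]; split; simpl;
  now apply (ex_RInt_plus (V := R_NormedModule)).
Qed.

Lemma ex_CInt_minus (f g : R -> C) (a b : R) :
  ex_CInt f a b -> ex_CInt g a b -> ex_CInt (fun t => f t - g t)%C a b.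
Proof.
intros [F1 F2] [G1 G2]; split; simpl;
  now apply (ex_RInt_minus (V := R_NormedModule)).
Qed.

Lemma CInt_plus (f g : R -> C) (a b : R) :
  ex_CInt f a b -> ex_CInt g a b ->
  CInt (fun t => f t + g t)%C a b = (CInt f a b + CInt g a b)%C.
Proof.
intros [F1 F2] [G1 G2]; apply Ceq; simpl.
- now apply (RInt_plus (V := R_CompleteNormedModule) (fun t => Re (f t))).
- now apply (RInt_plus (V := R_CompleteNormedModule) (fun t => Im (f t))).
Qed.

Lemma CInt_minus (f g : R -> C) (a b : R) :
  ex_CInt f a b -> ex_CInt g a b ->
  CInt (fun t => f t - g t)%C a b = (CInt f a b - CInt g a b)%C.
Proof.
intros [F1 F2] [G1 G2]; apply Ceq; simpl.
- now apply (RInt_minus (V := R_CompleteNormedModule) (fun t => Re (f t))).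
- now apply (RInt_minus (V := R_CompleteNormedModule) (fun t => Im (f t))).
Qed.

Lemma ex_RInt_scal_R (c : R) (f : R -> R) (a b : R) :
  ex_RInt f a b -> ex_RInt (fun t => c * f t) a b.
Proof. apply (ex_RInt_scal (V := R_NormedModule)). Qed.

Lemma RInt_scal_R (c : R) (f : R -> R) (a b : R) :
  ex_RInt f a b -> RInt (fun t => c * f t) a b = c * RInt f a b.
Proof. intros; now apply (RInt_scal (V := R_CompleteNormedModule)). Qed.

Lemma ex_CInt_scal (c : C) (f : R -> C) (a b : R) :
  ex_CInt f a b -> ex_CInt (fun t => c * f t)%C a b.
Proof.
intros [F1 F2]; split; simpl.
- apply (ex_RInt_minus (V := R_NormedModule) (fun t => Re c * Re (f t)));
    now apply ex_RInt_scal_R.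
- apply (ex_RInt_plus (V := R_NormedModule) (fun t => Re c * Im (f t)));
    now apply ex_RInt_scal_R.
Qed.

Lemma CInt_scal (c : C) (f : R -> C) (a b : R) :
  ex_CInt f a b -> CInt (fun t => c * f t)%C a b = (c * CInt f a b)%C.
Proof.
intros [F1 F2]; apply Ceq; simpl.
- rewrite (RInt_minus (V := R_CompleteNormedModule) (fun t => Re c * Re (f t))
    (fun t => Im c * Im (f t))) by now apply ex_RInt_scal_R.
  now rewrite !RInt_scal_R.
- rewrite (RInt_plus (V := R_CompleteNormedModule) (fun t => Re c * Im (f t))
    (fun t => Im c * Re (f t))) by now apply ex_RInt_scal_R.
  now rewrite !RInt_scal_R.
Qed.

Lemma CInt_ext (f g : R -> C) (a b : R) :
  (forall t, Rmin a b <= t <= Rmax a b -> f t = g t) -> CInt f a b = CInt g a b.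
Proof.
intros H; unfold CInt; f_equal; apply RInt_ext; intros; rewrite H; auto; lra.
Qed.

Lemma CInt_Chasles (f : R -> C) (a b c : R) :
  ex_CInt f a b -> ex_CInt f b c ->
  (CInt f a b + CInt f b c)%C = CInt f a c.
Proof.
intros [F1 F2] [G1 G2]; apply Ceq; simpl;
  now apply (RInt_Chasles (V := R_CompleteNormedModule)).
Qed.

(** The factor [2] comes from bounding real and imaginary parts separately; a sharp constant is of
    no use below. *)
Lemma CInt_bound (f : R -> C) (a b M : R) : a <= b -> ex_CInt f a b ->
  (forall t, a <= t <= b -> Cmod (f t) <= M) ->
  Cmod (CInt f a b) <= 2 * M * (b - a).
Proof.
intros Hab [F1 F2] HM.
eapply Rle_trans; [apply Cmod_le_abs|].
assert (A : Rabs (Re (CInt f a b)) <= M * (b - a)).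
{ rewrite Rmult_comm; apply (abs_RInt_le_const (fun t => Re (f t))); auto.
  intros t Ht; eapply Rle_trans; [apply re_le_Cmod|auto]. }
assert (B : Rabs (Im (CInt f a b)) <= M * (b - a)).
{ rewrite Rmult_comm; apply (abs_RInt_le_const (fun t => Im (f t))); auto.
  intros t Ht; eapply Rle_trans; [apply im_le_Cmod|auto]. }
lra.
Qed.

Lemma CInt_derive (F f : R -> C) (a b : R) :
  (forall t, Rmin a b <= t <= Rmax a b -> cderiv F t (f t)) ->
  (forall t, Rmin a b <= t <= Rmax a b -> cdiff f t) ->
  CInt f a b = (F b - F a)%C.
Proof.
intros HF Hf; apply Ceq; simpl; apply is_RInt_unique.
- apply (is_RInt_derive (V := R_CompleteNormedModule) (fun t => Re (F t)));
    intros t Ht; [now apply HF|].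
  destruct (Hf t Ht) as [l [H _]]; apply (ex_derive_continuous (fun t => Re (f t))).
  now exists (Re l).
- apply (is_RInt_derive (V := R_CompleteNormedModule) (fun t => Im (F t)));
    intros t Ht; [now apply HF|].
  destruct (Hf t Ht) as [l [_ H]]; apply (ex_derive_continuous (fun t => Im (f t))).
  now exists (Im l).
Qed.

Lemma CInt_comp_shift (f : R -> C) (c a b : R) :
  ex_CInt f (a + c) (b + c) ->
  CInt (fun t => f (t + c)) a b = CInt f (a + c) (b + c).
Proof.
intros [F1 F2]; unfold CInt; f_equal.
- replace (a + c) with (1 * a + c) in * by ring.
  replace (b + c) with (1 * b + c) in * by ring.
  rewrite <- (RInt_comp_lin (V := R_CompleteNormedModule) _ _ _ _ _ F1).
  apply RInt_ext; intros; unfold scal; simpl; unfold mult; simpl.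
  now rewrite !Rmult_1_l.
- replace (a + c) with (1 * a + c) in * by ring.
  replace (b + c) with (1 * b + c) in * by ring.
  rewrite <- (RInt_comp_lin (V := R_CompleteNormedModule) _ _ _ _ _ F2).
  apply RInt_ext; intros; unfold scal; simpl; unfold mult; simpl.
  now rewrite !Rmult_1_l.
Qed.

Lemma CInt_comp_reflect (f : R -> C) (c a b : R) :
  ex_CInt f (c - b) (c - a) ->
  CInt (fun t => f (c - t)) a b = CInt f (c - b) (c - a).
Proof.
intros [F1 F2].
assert (G : forall g : R -> R, ex_RInt g (c - b) (c - a) ->
  RInt (fun t => g (c - t)) a b = RInt g (c - b) (c - a)).
{ intros g Hg.
  apply (ex_RInt_swap (V := R_NormedModule)) in Hg.
  replace (c - a) with (-1 * a + c) in * by ring.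
  replace (c - b) with (-1 * b + c) in * by ring.
  assert (Hg' : ex_RInt g (-1 * b + c) (-1 * a + c))
    by now apply (ex_RInt_swap (V := R_NormedModule)).
  assert (E := RInt_comp_lin (V := R_CompleteNormedModule) _ _ _ _ _ Hg).
  assert (E2 := opp_RInt_swap (V := R_CompleteNormedModule) _ _ _ Hg').
  rewrite <- E2 in E.
  unfold scal, opp in E; simpl in E; unfold mult in E; simpl in E.
  assert (X : ex_RInt (fun y => g (-1 * y + c)) a b).
  { assert (X := ex_RInt_comp_lin (V := R_NormedModule) _ _ _ _ _ Hg).
    apply (ex_RInt_scal (V := R_NormedModule) _ _ _ (-1)) in X.
    refine (ex_RInt_ext (V := R_NormedModule) _ _ _ _ _ X).
    intros; unfold scal; simpl; unfold mult; simpl; ring. }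
  rewrite (RInt_scal_R (-1) (fun y => g (-1 * y + c))) in E by exact X.
  rewrite (RInt_ext _ (fun y => g (-1 * y + c))); [lra|].
  intros; f_equal; ring. }
unfold CInt; f_equal; [now apply (G (fun t => Re (f t)))|
  now apply (G (fun t => Im (f t)))].
Qed.

(** * Dedekind sums *)

Lemma rsum_const (c : R) (n : nat) : rsum (fun _ => c) n = INR n * c.
Proof.
induction n as [|n IH]; [simpl; ring|].
rewrite S_INR; simpl; rewrite IH; ring.
Qed.

Lemma rsum_swap (f : nat -> nat -> R) (n m : nat) :
  rsum (fun i => rsum (f i) m) n = rsum (fun j => rsum (fun i => f i j) n) m.
Proof.
induction n as [|n IH]; simpl; [rewrite rsum_const; ring|].
rewrite IH, <- rsum_plus; reflexivity.
Qed.

Lemma rsum_id (n : nat) : rsum (fun i => INR (S i)) n = INR n * (INR n + 1) / 2.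
Proof.
induction n as [|n IH]; [simpl; field|].
cbn [rsum]; rewrite IH, !S_INR; field.
Qed.

Lemma rsum_sq (n : nat) :
  rsum (fun i => INR (S i) ^ 2) n = INR n * (INR n + 1) * (2 * INR n + 1) / 6.
Proof.
induction n as [|n IH]; [simpl; field|].
cbn [rsum]; rewrite IH, !S_INR; field.
Qed.

Lemma rsum_fold (f : nat -> R) (n : nat) :
  rsum f n = fold_right Rplus 0 (map f (seq 0 n)).
Proof.
induction n as [|n IH]; [reflexivity|].
rewrite seq_S, map_app, fold_right_app; simpl; rewrite IH, Rplus_0_r.
generalize (map f (seq 0 n)); intros l.
induction l as [|x l IHl]; simpl; [ring|rewrite <- IHl; ring].
Qed.

Lemma fold_Rplus_perm (l l' : list R) :
  Permutation l l' -> fold_right Rplus 0 l = fold_right Rplus 0 l'.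
Proof. induction 1; simpl; lra. Qed.

Lemma mul_mod_inj (h k a b : nat) : Nat.gcd h k = 1%nat ->
  (a < b < k)%nat -> ((h * a) mod k <> (h * b) mod k)%nat.
Proof.
intros Hg Hab E.
assert (D : Nat.divide k (h * (b - a))).
{ exists ((h * b) / k - (h * a) / k)%nat.
  generalize (Nat.div_mod_eq (h * a) k) (Nat.div_mod_eq (h * b) k).
  rewrite <- E; intros; nia. }
apply Nat.gauss in D; [|now rewrite Nat.gcd_comm].
apply Nat.divide_pos_le in D; lia.
Qed.

Lemma mul_mod_pos (h k r : nat) : Nat.gcd h k = 1%nat -> (0 < r < k)%nat ->
  (0 < (h * r) mod k < k)%nat.
Proof.
intros Hg Hr.
generalize (mul_mod_inj h k 0 r Hg ltac:(lia)).
rewrite Nat.mul_0_r, Nat.Div0.mod_0_l.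
generalize (Nat.mod_upper_bound (h * r) k ltac:(lia)); lia.
Qed.

(** Multiplication by the unit [h] permutes the nonzero residues modulo [k]. *)
Lemma rsum_mul_mod (g : nat -> R) (h k : nat) : Nat.gcd h k = 1%nat ->
  rsum (fun i => g ((h * S i) mod k)%nat) (k - 1) = rsum (fun i => g (S i)) (k - 1).
Proof.
intros Hg; rewrite !rsum_fold.
apply fold_Rplus_perm.
rewrite <- (map_map (fun i => (h * S i) mod k)%nat g), <- (map_map S g).
apply Permutation_map, NoDup_Permutation_bis.
- apply NoDup_map_NoDup_ForallPairs; [|apply seq_NoDup].
  intros a b Ha Hb E; apply in_seq in Ha; apply in_seq in Hb.
  destruct (Nat.lt_trichotomy a b) as [L|[L|L]]; auto; exfalso.
  + apply (mul_mod_inj h k (S a) (S b)); auto; lia.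
  + apply (mul_mod_inj h k (S b) (S a)); auto; lia.
- rewrite !length_map; lia.
- intros x Hx; apply in_map_iff in Hx; destruct Hx as [i [<- Hi]].
  apply in_seq in Hi; generalize (mul_mod_pos h k (S i) Hg ltac:(lia)); intros B.
  apply in_map_iff; exists ((h * S i) mod k - 1)%nat; split; [lia|].
  apply in_seq; lia.
Qed.

Lemma rsum_indicator_ge (a n : nat) : (a <= n)%nat ->
  rsum (fun i => if (a <=? i)%nat then 1 else 0) n = INR n - INR a.
Proof.
induction 1 as [|n Hn IH].
- rewrite (rsum_ext _ (fun _ => 0)), rsum_const; [ring|].
  intros i Hi; destruct (Nat.leb_spec a i); [lia|auto].
- cbn [rsum]; rewrite IH, S_INR; destruct (Nat.leb_spec a n); [ring|lia].
Qed.

Lemma rsum_indicator_le (f n : nat) : (f <= n)%nat ->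
  rsum (fun i => if (S i <=? f)%nat then INR (S i) else 0) n
  = INR f * (INR f + 1) / 2.
Proof.
intros Hf; replace n with (f + (n - f))%nat by lia.
rewrite rsum_split.
rewrite (rsum_ext (fun i => if (S (f + i) <=? f)%nat then _ else _) (fun _ => 0)).
2:{ intros i _; destruct (Nat.leb_spec (S (f + i)) f); [lia|auto]. }
rewrite (rsum_ext _ (fun i => INR (S i))).
2:{ intros i Hi; destruct (Nat.leb_spec (S i) f); [auto|lia]. }
rewrite rsum_const, rsum_id; ring.
Qed.

(** The only part of a Dedekind sum without a closed form; reciprocity amounts to a relation between
    [floor_sum h k] and [floor_sum k h]. *)
Definition floor_sum (h k : nat) : R :=
  rsum (fun i => INR (S i) * INR (h * S i / k)) (k - 1).

(** Counting lattice points under the diagonal of the [k x h] rectangle. *)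
Lemma floor_square_sum (h k : nat) : (0 < h)%nat -> (0 < k)%nat ->
  Nat.gcd h k = 1%nat ->
  rsum (fun i => INR (h * S i / k) * (INR (h * S i / k) + 1) / 2) (k - 1)
  = INR (h - 1) * INR h / 2 * INR (k - 1) - floor_sum k h.
Proof.
intros Hh Hk Hg.
assert (Hq : forall v, (0 < v < h)%nat ->
  (h * (k * v / h) < k * v < h * S (k * v / h))%nat /\ (k * v / h <= k - 1)%nat).
{ intros v Hv.
  generalize (mul_mod_pos k h v ltac:(now rewrite Nat.gcd_comm) Hv); intros B.
  generalize (Nat.div_mod_eq (k * v) h); intros E.
  split; [nia|]. assert (k * v < k * h)%nat by nia. nia. }
(* With [f] the floor, [f (f + 1) / 2] is the sum of the [v <= f]. Exchanging the sums counts, for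
   each [v], the columns lying beyond the diagonal; coprimality keeps lattice points off the
   diagonal itself. *)
transitivity (rsum (fun i => rsum (fun v =>
   if (k * S v <=? h * S i)%nat then INR (S v) else 0) (h - 1)) (k - 1)).
- apply rsum_ext; intros i Hi.
  rewrite <- (rsum_indicator_le _ (h - 1)).
  2:{ assert (h * S i / k < h)%nat by (apply Nat.Div0.div_lt_upper_bound; nia). lia. }
  apply rsum_ext; intros v Hv.
  generalize (Nat.div_mod_eq (h * S i) k) (Nat.mod_upper_bound (h * S i) k).
  intros E1 E2.
  destruct (Nat.leb_spec (S v) (h * S i / k)), (Nat.leb_spec (k * S v) (h * S i));
    auto; exfalso; nia.
- rewrite rsum_swap.
  rewrite (rsum_ext _ (fun v => INR (k - 1) * INR (S v)
     + (-1) * (INR (S v) * INR (k * S v / h)))).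
  + rewrite rsum_plus, !rsum_scal, rsum_id; unfold floor_sum.
    rewrite !minus_INR by lia; change (INR 1) with 1; field.
  + intros v Hv; destruct (Hq (S v) ltac:(lia)) as [Hq1 Hq2].
    transitivity (rsum (fun i => INR (S v) *
       (if (k * S v / h <=? i)%nat then 1 else 0)) (k - 1)).
    * apply rsum_ext; intros i Hi.
      destruct (Nat.leb_spec (k * S v) (h * S i)),
        (Nat.leb_spec (k * S v / h) i); try ring; exfalso; nia.
    * rewrite rsum_scal, rsum_indicator_ge by auto; ring.
Qed.

Definition frac (x : R) : R := x - IZR (Int_part x).

Lemma frac_div (a : Z) (k : nat) : (0 < k)%nat ->
  frac (IZR a / INR k) = IZR (a mod Z.of_nat k) / INR k.
Proof.
intros Hk; assert (Hk' : 0 < INR k) by (apply lt_0_INR; lia).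
assert (E : (a / Z.of_nat k)%Z = Int_part (IZR a / INR k)).
{ apply Int_part_spec.
  assert (H1 := Z.mod_pos_bound a (Z.of_nat k) ltac:(lia)).
  assert (H2 := Z.div_mod a (Z.of_nat k) ltac:(lia)).
  apply (f_equal IZR) in H2; rewrite plus_IZR, mult_IZR, <- INR_IZR_INZ in H2.
  rewrite H2.
  destruct H1 as [H1 H3]; apply IZR_le in H1; apply IZR_lt in H3.
  rewrite <- INR_IZR_INZ in H3.
  replace ((INR k * IZR (a / Z.of_nat k) + IZR (a mod Z.of_nat k)) / INR k)
    with (IZR (a / Z.of_nat k) + IZR (a mod Z.of_nat k) / INR k) by (field; lra).
  assert (IZR (a mod Z.of_nat k) / INR k < 1)
    by (apply Rmult_lt_reg_r with (INR k); auto; field_simplify; lra).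
  assert (0 <= IZR (a mod Z.of_nat k) / INR k) by (now apply Rdiv_le_0_compat).
  lra. }
unfold frac; rewrite <- E.
rewrite Z.mod_eq, minus_IZR, mult_IZR, <- INR_IZR_INZ by lia; field; lra.
Qed.

(** The first argument is an integer because Euclid's algorithm passes from [(h, j)] to [(- j, h)].
    The first factor needs no floor, as [S i < k]. *)
Definition dsZ (h : Z) (k : nat) : R :=
  rsum (fun i => (INR (S i) / INR k - 1 / 2)
     * (frac (IZR h * INR (S i) / INR k) - 1 / 2)) (k - 1).

Lemma frac_mul_div (h : Z) (k r : nat) : (0 < k)%nat ->
  frac (IZR h * INR r / INR k) = IZR ((h * Z.of_nat r) mod Z.of_nat k) / INR k.
Proof. intros; rewrite INR_IZR_INZ, <- mult_IZR; now apply frac_div. Qed.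

Lemma dedekind_sum_dsZ (h k : nat) : dedekind_sum h k = dsZ (Z.of_nat h) k.
Proof.
unfold dedekind_sum, dsZ.
destruct (k - 1)%nat as [|m] eqn:Ek.
{ rewrite sum_n_m_zero by lia; reflexivity. }
assert (E : forall (f : nat -> R) n, sum_n_m f 1 (S n) = rsum (fun i => f (S i)) (S n)).
{ intros f n; induction n as [|n IH].
  - rewrite sum_n_n; simpl; ring.
  - rewrite sum_n_Sm by lia; rewrite IH; reflexivity. }
rewrite E; apply rsum_ext; intros i Hi.
assert (HI : IZR (Int_part (INR (S i) / INR k)) = 0).
{ assert (H : frac (IZR (Z.of_nat (S i)) / INR k) = IZR (Z.of_nat (S i)) / INR k).
  { rewrite frac_div by lia; rewrite Z.mod_small by lia; auto. }
  unfold frac in H; rewrite <- INR_IZR_INZ in H; lra. }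
rewrite HI, <- INR_IZR_INZ; unfold frac; ring.
Qed.

Lemma dsZ_mod (h h' : Z) (k : nat) : (0 < k)%nat ->
  (h mod Z.of_nat k = h' mod Z.of_nat k)%Z -> dsZ h k = dsZ h' k.
Proof.
intros Hk E; apply rsum_ext; intros i _; rewrite !frac_mul_div by auto.
now rewrite <- Z.mul_mod_idemp_l, E, Z.mul_mod_idemp_l by lia.
Qed.

Lemma Zgcd_mul_mod_nz (h : Z) (k r : nat) : Z.gcd h (Z.of_nat k) = 1%Z ->
  (0 < r < k)%nat -> ((h * Z.of_nat r) mod Z.of_nat k <> 0)%Z.
Proof.
intros Hg Hr E.
apply Z.mod_divide in E; [|lia].
apply Z.gauss in E; [|now rewrite Z.gcd_comm].
apply Z.divide_pos_le in E; lia.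
Qed.

(** Away from the integers [frac (- x) = 1 - frac x], so the second factor of each term changes
    sign; coprimality excludes integer values. *)
Lemma dsZ_opp (h : Z) (k : nat) : (0 < k)%nat -> Z.gcd h (Z.of_nat k) = 1%Z ->
  dsZ (- h) k = - dsZ h k.
Proof.
intros Hk Hg; unfold dsZ; replace (- _) with ((-1) * dsZ h k) by (unfold dsZ; ring).
unfold dsZ; rewrite <- rsum_scal; apply rsum_ext; intros i Hi.
rewrite !frac_mul_div by auto.
assert (Hn := Zgcd_mul_mod_nz h k (S i) Hg ltac:(lia)).
rewrite Z.mul_opp_l, Z.mod_opp_l_nz by lia.
rewrite minus_IZR, <- INR_IZR_INZ; field.
apply not_0_INR; lia.
Qed.

Lemma frac_nat (h k r : nat) : (0 < k)%nat ->
  frac (IZR (Z.of_nat h) * INR r / INR k) = INR ((h * r) mod k) / INR k.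
Proof.
intros Hk; rewrite frac_mul_div by auto.
now rewrite <- Nat2Z.inj_mul, <- Nat2Z.inj_mod, <- INR_IZR_INZ.
Qed.

(** All three come from [h r = k floor(h r / k) + (h r mod k)]. Since the residues are permuted, the
    sums of their first and second powers are known; this gives the last two, and expanding the
    Dedekind sum gives the first. *)
Lemma floor_sum_eqs (h k : nat) : (0 < k)%nat -> Nat.gcd h k = 1%nat ->
  INR k ^ 2 * dsZ (Z.of_nat h) k =
    INR h * rsum (fun i => INR (S i) ^ 2) (k - 1) - INR k * floor_sum h k
    - INR k ^ 2 * INR (k - 1) / 4 /\
  INR k * rsum (fun i => INR (h * S i / k)) (k - 1)
    = (INR h - 1) * rsum (fun i => INR (S i)) (k - 1) /\
  INR k ^ 2 * rsum (fun i => INR (h * S i / k) ^ 2) (k - 1)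
    = (1 - INR h ^ 2) * rsum (fun i => INR (S i) ^ 2) (k - 1)
      + 2 * INR h * INR k * floor_sum h k.
Proof.
intros Hk Hg.
assert (Hk' : INR k <> 0) by (apply not_0_INR; lia).
assert (Em : forall i, INR ((h * S i) mod k)
   = INR h * INR (S i) + (- INR k) * INR (h * S i / k)).
{ intros i; generalize (Nat.div_mod_eq (h * S i) k); intros E.
  apply (f_equal INR) in E; rewrite plus_INR, !mult_INR in E; lra. }
assert (P1 := rsum_mul_mod INR h k Hg).
assert (P2 := rsum_mul_mod (fun x => INR x ^ 2) h k Hg); cbv beta in P2.
rewrite (rsum_ext _ (fun i => INR h * INR (S i) + (- INR k) * INR (h * S i / k)))
  in P1 by (intros; apply Em).
rewrite rsum_plus, !rsum_scal in P1.
rewrite (rsum_ext _ (fun i => INR h ^ 2 * INR (S i) ^ 2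
  + ((- 2 * INR h * INR k) * (INR (S i) * INR (h * S i / k))
     + INR k ^ 2 * INR (h * S i / k) ^ 2))) in P2
  by (intros; rewrite Em; ring).
rewrite !rsum_plus, !rsum_scal in P2; fold (floor_sum h k) in P2.
repeat split; [|lra|lra].
unfold dsZ; rewrite <- rsum_scal.
rewrite (rsum_ext _ (fun i => INR h * INR (S i) ^ 2
  + ((- INR k) * (INR (S i) * INR (h * S i / k))
  + ((- (INR k * (INR h + 1) / 2)) * INR (S i)
  + (INR k ^ 2 / 2 * INR (h * S i / k) + INR k ^ 2 / 4))))).
2:{ intros i _; rewrite frac_nat, Em by auto; field; auto. }
rewrite !rsum_plus, !rsum_scal, rsum_const; fold (floor_sum h k).
assert (P1' : INR k ^ 2 / 2 * rsum (fun i => INR (h * S i / k)) (k - 1)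
  = INR k / 2 * ((INR h - 1) * rsum (fun i => INR (S i)) (k - 1))) by nra.
rewrite P1', rsum_id, minus_INR by lia; simpl (INR 1); field.
Qed.

(** The sum of the squared floors is computed twice: from the squares of the residues, which
    involves [floor_sum h k], and from the lattice point count, which involves [floor_sum k h].
    Equating the two and replacing both floor sums by Dedekind sums leaves a rational identity. *)
Lemma dsZ_reciprocity (h k : nat) : (0 < h)%nat -> (0 < k)%nat ->
  Nat.gcd h k = 1%nat ->
  dsZ (Z.of_nat h) k + dsZ (Z.of_nat k) h =
  - 1 / 4 + (INR h / INR k + INR k / INR h + 1 / (INR h * INR k)) / 12.
Proof.
intros Hh Hk Hg.
assert (Hk' : 0 < INR k) by (apply lt_0_INR; lia).
assert (Hh' : 0 < INR h) by (apply lt_0_INR; lia).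
destruct (floor_sum_eqs h k Hk Hg) as [A1 [A2 A3]].
destruct (floor_sum_eqs k h Hh ltac:(now rewrite Nat.gcd_comm)) as [B1 _].
assert (L := floor_square_sum h k Hh Hk Hg).
rewrite (rsum_ext _ (fun i => / 2 * INR (h * S i / k) ^ 2
  + / 2 * INR (h * S i / k))) in L by (intros; field).
rewrite rsum_plus, !rsum_scal in L.
rewrite rsum_sq in A1, A3, B1; rewrite rsum_id in A2.
rewrite minus_INR in A1 by lia; rewrite minus_INR in A2 by lia.
rewrite minus_INR in A3 by lia; rewrite minus_INR in B1 by lia.
rewrite !minus_INR in L by lia.
change (INR 1) with 1 in *.
set (H := INR h) in *; set (K := INR k) in *.
set (F := floor_sum h k) in *; set (F' := floor_sum k h) in *.
set (S1 := rsum (fun i => INR (h * S i / k)) (k - 1)) in *.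
set (S2 := rsum (fun i => INR (h * S i / k) ^ 2) (k - 1)) in *.
set (s := dsZ (Z.of_nat h) k) in *; set (s' := dsZ (Z.of_nat k) h) in *.
assert (E1 : S1 = (H - 1) * (K - 1) / 2).
{ apply Rmult_eq_reg_l with K; [|lra]; rewrite A2; field. }
assert (E2 : S2 = 2 * ((H - 1) * H / 2 * (K - 1) - F' - / 2 * S1)) by lra.
rewrite E1 in E2; clear A2 L E1.
assert (E3 : H * F' = K * ((H - 1) * (H - 1 + 1) * (2 * (H - 1) + 1) / 6)
   - H ^ 2 * s' - H ^ 2 * (H - 1) / 4) by lra.
assert (E4 : K * F = H * ((K - 1) * (K - 1 + 1) * (2 * (K - 1) + 1) / 6)
   - K ^ 2 * s - K ^ 2 * (K - 1) / 4) by lra.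
rewrite E2 in A3; clear E2 A1 B1; clearbody S1 S2 F F' s s' H K.
assert (A4 : K ^ 2 * (2 * ((H - 1) * H / 2 * (K - 1) * H - H * F'
      - / 2 * ((H - 1) * (K - 1) / 2) * H))
   = H * ((1 - H ^ 2) * ((K - 1) * (K - 1 + 1) * (2 * (K - 1) + 1) / 6))
     + 2 * H ^ 2 * (K * F)).
{ apply (Rmult_eq_compat_l H) in A3; rewrite Rmult_plus_distr_l in A3.
  replace (2 * H ^ 2 * (K * F)) with (H * (2 * H * K * F)) by ring.
  rewrite <- A3; ring. }
rewrite E3, E4 in A4; clear A3 E3 E4.
assert (A5 : (H * K ^ 2) * (12 * H * K * (s + s'))
  = (H * K ^ 2) * (- (3 * H * K) + H ^ 2 + K ^ 2 + 1)) by nra.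
apply Rmult_eq_reg_l in A5; [|apply Rgt_not_eq, Rmult_lt_0_compat; nra].
apply Rmult_eq_reg_l with (12 * H * K); [|apply Rgt_not_eq; nra].
rewrite A5; field; lra.
Qed.

(** * Partial fractions of the hyperbolic functions *)

Definition csinh (z : C) : C := ((Cexp z - Cexp (- z)) / 2)%C.
Definition ccosh (z : C) : C := ((Cexp z + Cexp (- z)) / 2)%C.

(** The value [1] at [0] lets [coth_diff] make sense at [x = y], the case that yields the expansion
    of [1/sinh^2]. *)
Definition csinhc (z : C) : C :=
  if Ceq_dec z (RtoC 0) then RtoC 1 else (csinh z / z)%C.

Lemma csinhc_mul (z : C) : (z * csinhc z)%C = csinh z.
Proof.
unfold csinhc; destruct (Ceq_dec z 0) as [->|H]; [|now field].
unfold csinh; replace (- RtoC 0)%C with (RtoC 0) by ring; rewrite Cexp_0; field.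
Qed.

Lemma csinh_double (z : C) : csinh (2 * z)%C = (2 * csinh z * ccosh z)%C.
Proof.
unfold csinh, ccosh.
replace (2 * z)%C with (z + z)%C by ring.
replace (- (z + z))%C with (- z + - z)%C by ring.
rewrite !Cexp_plus; field.
Qed.

Lemma csinhc_double (z : C) : csinhc (2 * z)%C = (csinhc z * ccosh z)%C.
Proof.
destruct (Ceq_dec z 0) as [->|H].
- unfold ccosh, csinhc; replace (2 * RtoC 0)%C with (RtoC 0) by ring.
  destruct (Ceq_dec (RtoC 0) 0) as [_|E]; [|tauto].
  replace (- RtoC 0)%C with (RtoC 0) by ring; rewrite Cexp_0; field.
- assert (H2 : (RtoC 2 <> RtoC 0)%C) by (intros E; apply RtoC_inj in E; lra).
  assert (E := csinhc_mul (2 * z)); rewrite csinh_double, <- (csinhc_mul z) in E.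
  replace (csinhc (2 * z)) with ((2 * z * csinhc (2 * z)) * / (2 * z))%C
    by (field; auto).
  rewrite E; field; auto.
Qed.

Lemma Cexp_half_PI : Cexp (PI / 2 * Ci)%C = Ci.
Proof.
replace (PI / 2 * Ci)%C with ((0, PI / 2) : C) by (apply Ceq; simpl; field).
unfold Cexp; simpl; rewrite exp_0, cos_PI2, sin_PI2; apply Ceq; simpl; ring.
Qed.

Lemma Ci_nz : (Ci <> RtoC 0)%C.
Proof. intros E; apply (f_equal Im) in E; simpl in E; lra. Qed.

Lemma Ci_sq : (Ci * Ci)%C = (- (1))%C.
Proof. apply Ceq; simpl; ring. Qed.

Lemma Cinv_Ci : (/ Ci)%C = (- Ci)%C.
Proof. apply Ceq; simpl; field. Qed.

Lemma csinh_half_PI (z : C) : csinh (z + PI / 2 * Ci)%C = (Ci * ccosh z)%C.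
Proof.
unfold csinh, ccosh.
replace (- (z + PI / 2 * Ci))%C with (- z + - (PI / 2 * Ci))%C by ring.
rewrite !Cexp_plus, (Cexp_opp (PI / 2 * Ci)), Cexp_half_PI, Cinv_Ci.
field.
Qed.

Lemma csinh_PI (z : C) : csinh (z + PI * Ci)%C = (- csinh z)%C.
Proof.
replace (z + PI * Ci)%C with ((z + PI / 2 * Ci) + PI / 2 * Ci)%C by field.
rewrite csinh_half_PI; unfold csinh, ccosh.
replace (- (z + PI / 2 * Ci))%C with (- z + - (PI / 2 * Ci))%C by ring.
rewrite !Cexp_plus, (Cexp_opp (PI / 2 * Ci)), Cexp_half_PI, Cinv_Ci.
transitivity (Ci * Ci * ((Cexp z - Cexp (- z)) / 2))%C; [field|].
rewrite Ci_sq; ring.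
Qed.

(** [coth x - coth y] up to sign, divided by [x - y]. *)
Definition coth_diff (x y : C) : C :=
  (csinhc (x - y) / (csinh x * csinh y))%C.

Lemma ccosh_minus (x y : C) :
  ccosh (x - y)%C = (ccosh x * ccosh y - csinh x * csinh y)%C.
Proof.
unfold ccosh, csinh, Cminus at 1.
replace (- (x - y))%C with (- x + y)%C by ring.
rewrite !Cexp_plus; field.
Qed.

(** Doubling brings out the factor [cosh (x - y) = cosh x cosh y - sinh x sinh y]. Divided by
    [sinh x cosh x sinh y cosh y] it splits into two terms, the second being the first with both
    arguments shifted by [i pi / 2]. *)
Lemma coth_diff_double (x y : C) :
  (csinh (2 * x) <> 0)%C -> (csinh (2 * y) <> 0)%C ->
  coth_diff (2 * x)%C (2 * y)%C
  = ((coth_diff x y + coth_diff (x + PI / 2 * Ci) (y + PI / 2 * Ci)) / 4)%C.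
Proof.
unfold coth_diff; intros Hx Hy.
replace (x + PI / 2 * Ci - (y + PI / 2 * Ci))%C with (x - y)%C by ring.
replace (2 * x - 2 * y)%C with (2 * (x - y))%C by ring.
rewrite csinhc_double, ccosh_minus, !csinh_half_PI, !csinh_double in *.
assert (A : forall u, (2 * csinh u * ccosh u <> 0)%C ->
  (csinh u <> 0)%C /\ (ccosh u <> 0)%C).
{ intros u Hu; split; intros E; apply Hu; rewrite E; ring. }
destruct (A x Hx), (A y Hy).
replace (Ci * ccosh x * (Ci * ccosh y))%C with (- (ccosh x * ccosh y))%C
  by (transitivity ((Ci * Ci) * (ccosh x * ccosh y))%C; [rewrite Ci_sq|]; ring).
field; auto.
Qed.

Lemma coth_diff_PI (x y : C) :
  coth_diff (x + PI * Ci)%C (y + PI * Ci)%C = coth_diff x y.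
Proof.
unfold coth_diff; rewrite !csinh_PI.
replace (x + PI * Ci - (y + PI * Ci))%C with (x - y)%C by ring.
f_equal; ring.
Qed.

Lemma csinh_double_nz (u : C) : (csinh (2 * u) <> 0)%C ->
  (csinh u <> 0)%C /\ (csinh (u + PI / 2 * Ci) <> 0)%C.
Proof.
rewrite csinh_half_PI, csinh_double; intros H; split; intros E; apply H.
- rewrite E; ring.
- replace (ccosh u) with (- Ci * (Ci * ccosh u))%C
    by (transitivity (- (Ci * Ci) * ccosh u)%C; [|rewrite Ci_sq]; ring).
  rewrite E; ring.
Qed.

Lemma pow2_C_nz (r : nat) : (RtoC (2 ^ r) <> 0)%C.
Proof.
intros E; apply RtoC_inj in E; generalize (pow_lt 2 r); lra.
Qed.

Definition slice (x : C) (r : nat) (k : Z) : C := (PI * (x + Ci * IZR k) / RtoC (2 ^ r))%C.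

Lemma slice_split (x : C) (r k : nat) :
  slice x r (Z.of_nat k) = (2 * slice x (S r) (Z.of_nat k))%C /\
  slice x (S r) (Z.of_nat (2 ^ r + k))
   = (slice x (S r) (Z.of_nat k) + PI / 2 * Ci)%C.
Proof.
unfold slice; assert (H := pow2_C_nz r).
rewrite Nat2Z.inj_add, plus_IZR, <- !INR_IZR_INZ, pow_INR.
change (INR 2) with 2; simpl pow; rewrite !RtoC_mult, RtoC_plus; split; field; auto.
Qed.

(** Iterating the duplication formula cuts [coth_diff] into [2 ^ r] pieces whose
    rescaled limits are the polar terms. *)
Lemma coth_diff_slices (x y : C) (r : nat) :
  (csinh (PI * x) <> 0)%C -> (csinh (PI * y) <> 0)%C ->
  (forall k, (k < 2 ^ r)%nat -> (csinh (slice x r (Z.of_nat k)) <> 0)%C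
      /\ (csinh (slice y r (Z.of_nat k)) <> 0)%C) /\
  coth_diff (PI * x)%C (PI * y)%C = (/ RtoC (4 ^ r) * csum (fun k =>
    coth_diff (slice x r (Z.of_nat k)) (slice y r (Z.of_nat k))) (2 ^ r))%C.
Proof.
intros Hx Hy; induction r as [|r [IH1 IH2]].
- assert (E : forall u, slice u 0 (Z.of_nat 0) = (PI * u)%C)
    by (intros; unfold slice; simpl; field).
  split.
  + intros k Hk; simpl in Hk; replace k with O by lia; now rewrite !E.
  + simpl; rewrite !E; field.
- split.
  + intros k Hk; destruct (Nat.lt_ge_cases k (2 ^ r)) as [L|L].
    * destruct (IH1 k L) as [A B].
      rewrite (proj1 (slice_split x r k)) in A; rewrite (proj1 (slice_split y r k)) in B.
      split; now apply csinh_double_nz.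
    * destruct (IH1 (k - 2 ^ r)%nat) as [A B]; [simpl in Hk; lia|].
      rewrite (proj1 (slice_split x r _)) in A; rewrite (proj1 (slice_split y r _)) in B.
      replace k with (2 ^ r + (k - 2 ^ r))%nat by lia.
      rewrite (proj2 (slice_split x r _)), (proj2 (slice_split y r _)).
      split; now apply csinh_double_nz.
  + rewrite IH2.
    replace (2 ^ S r)%nat with (2 ^ r + 2 ^ r)%nat by (simpl; lia).
    rewrite csum_split, <- csum_plus.
    rewrite (csum_ext _ (fun k => / 4 * (coth_diff (slice x (S r) (Z.of_nat k)) (slice y (S r) (Z.of_nat k))
      + coth_diff (slice x (S r) (Z.of_nat (2 ^ r + k))) (slice y (S r) (Z.of_nat (2 ^ r + k)))))%C).
    * rewrite csum_scal; simpl pow; rewrite RtoC_mult.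
      assert (H4 : (RtoC (4 ^ r) <> 0)%C).
      { intros E; apply RtoC_inj in E; generalize (pow_lt 4 r); lra. }
      field; auto.
    * intros k Hk; destruct (IH1 k Hk) as [A B].
      rewrite (proj2 (slice_split x r _)), (proj2 (slice_split y r _)).
      rewrite (proj1 (slice_split x r k)) in *; rewrite (proj1 (slice_split y r k)) in *.
      rewrite coth_diff_double by auto; field.
Qed.

Lemma csum_rev (f : nat -> C) (n : nat) :
  csum f n = csum (fun i => f (n - 1 - i)%nat) n.
Proof.
induction n as [|n IH]; [reflexivity|].
rewrite (csum_S_l (fun i => f (S n - 1 - i)%nat)); simpl csum at 1; rewrite IH.
rewrite Cplus_comm; f_equal; [f_equal; lia|].
apply csum_ext; intros; f_equal; lia.
Qed.

(** The period [i pi] moves the upper half of the slices to negative indices. All slices then lie in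
    a strip around the real axis where [csinh] vanishes only at [0], as [csinh_lower] requires. *)
Lemma coth_diff_centered (x y : C) (r : nat) :
  (csinh (PI * x) <> 0)%C -> (csinh (PI * y) <> 0)%C ->
  coth_diff (PI * x)%C (PI * y)%C = csum (fun k => / RtoC (4 ^ S r) *
    (coth_diff (slice x (S r) (Z.of_nat k)) (slice y (S r) (Z.of_nat k))
     + coth_diff (slice x (S r) (- Z.of_nat (S k))) (slice y (S r) (- Z.of_nat (S k)))))%C (2 ^ r).
Proof.
intros Hx Hy; rewrite (proj2 (coth_diff_slices x y (S r) Hx Hy)).
rewrite csum_scal; f_equal.
replace (2 ^ S r)%nat with (2 ^ r + 2 ^ r)%nat by (simpl; lia).
rewrite csum_split, csum_plus; f_equal.
rewrite csum_rev; apply csum_ext; intros k Hk.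
assert (E : forall u, slice u (S r) (Z.of_nat (2 ^ r + (2 ^ r - 1 - k)))
   = (slice u (S r) (- Z.of_nat (S k)) + PI * Ci)%C).
{ intros u; unfold slice.
  replace (Z.of_nat (2 ^ r + (2 ^ r - 1 - k)))
    with (Z.of_nat (2 ^ S r) + (- Z.of_nat (S k)))%Z by (simpl Nat.pow; lia).
  rewrite plus_IZR, <- (INR_IZR_INZ (2 ^ S r)), pow_INR.
  change (INR 2) with 2; rewrite RtoC_plus.
  field; apply pow2_C_nz. }
rewrite !E; apply coth_diff_PI.
Qed.

(** The range [3 pi / 4] stays clear of the zero at [pi]. It is the height reached by the slices: at
    level [r + 1], an index of modulus at most [2^r] and [2 |Im x| <= 2^r] give at most
    [pi (3/2) 2^r / 2^(r+1)]. *)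
Lemma sin_lower (y : R) : Rabs y <= 3 * PI / 4 -> Rabs y / 6 <= Rabs (sin y).
Proof.
assert (HPI := PI_RGT_0).
assert (S1 : forall y, 0 <= y <= PI / 3 -> y / 2 <= sin y).
{ intros z Hz; destruct (Req_dec z 0) as [->|Hn]; [rewrite sin_0; lra|].
  destruct (MVT_cor2 sin cos 0 z ltac:(lra)) as [c [E Hc]].
  - intros; apply derivable_pt_lim_sin.
  - rewrite sin_0 in E.
    assert (1 / 2 <= cos c) by (rewrite <- cos_PI3; apply cos_decr_1; lra).
    nra. }
assert (S2 : forall y, 0 <= y <= PI / 2 -> y / 3 <= sin y).
{ intros z Hz; destruct (Rle_dec z (PI / 3)) as [L|L].
  - generalize (S1 z ltac:(lra)); lra.
  - apply Rle_trans with (sin (PI / 3)).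
    + generalize (S1 (PI / 3) ltac:(lra)); lra.
    + apply sin_incr_1; lra. }
assert (S3 : forall y, 0 <= y <= 3 * PI / 4 -> y / 6 <= sin y).
{ intros z Hz; destruct (Rle_dec z (PI / 2)) as [L|L].
  - generalize (S2 z ltac:(lra)); lra.
  - rewrite <- sin_PI_x.
    destruct (Rle_dec (PI - z) (PI / 3)) as [L'|L'].
    + generalize (S1 (PI - z) ltac:(lra)); lra.
    + apply Rle_trans with (sin (PI / 3)).
      * generalize (S1 (PI / 3) ltac:(lra)); lra.
      * apply sin_incr_1; lra. }
intros Hy; unfold Rabs at 1 in Hy; unfold Rabs at 1.
destruct (Rcase_abs y) as [L|L].
- rewrite <- Rabs_Ropp, <- sin_neg.
  apply Rle_trans with (2 := Rle_abs _); apply S3; lra.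
- apply Rle_trans with (2 := Rle_abs _); apply S3; lra.
Qed.

(** From [|sinh (x + i y)|^2 = sinh^2 x + sin^2 y], each square being bounded separately. *)
Lemma csinh_lower (u : C) : Rabs (Im u) <= 3 * PI / 4 -> Cmod u / 6 <= Cmod (csinh u).
Proof.
intros Hu; assert (Hs := sin_lower _ Hu).
destruct u as [x y]; simpl Im in *.
assert (E : csinh (x, y) = ((exp x - exp (- x)) / 2 * cos y,
   (exp x + exp (- x)) / 2 * sin y)).
{ unfold csinh, Cexp; simpl; rewrite cos_neg, sin_neg; apply Ceq; simpl; field. }
assert (A := exp_pos x); assert (B := exp_pos (- x)).
assert (AB : exp x * exp (- x) = 1) by (rewrite <- exp_plus, <- exp_0; f_equal; ring).
assert (T := sin2_cos2 y); unfold Rsqr in T.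
assert (Hsq : Cmod (csinh (x, y)) ^ 2 = ((exp x - exp (- x)) / 2) ^ 2 + sin y ^ 2).
{ rewrite Cmod2_alt, E; simpl Re; simpl Im.
  replace (cos y * cos y) with (1 - sin y * sin y) in T by lra.
  replace ((_ * cos y) ^ 2) with
    (((exp x - exp (- x)) / 2) ^ 2 * (1 - sin y * sin y))
    by (replace (1 - sin y * sin y) with (cos y * cos y)
          by (generalize (sin2_cos2 y); unfold Rsqr; lra); ring).
  replace (((exp x + exp (- x)) / 2 * sin y) ^ 2)
   with ((((exp x - exp (- x)) / 2) ^ 2 + exp x * exp (- x)) * sin y ^ 2) by field.
  rewrite AB; ring. }
assert (X : (x / 2) ^ 2 <= ((exp x - exp (- x)) / 2) ^ 2).
{ assert (P : forall t, 0 <= t -> t <= exp t - exp (- t)).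
  { intros t Ht; destruct Ht as [Ht|<-]; [|rewrite Ropp_0; lra].
    assert (1 + t < exp t) by (apply exp_ineq1; lra).
    assert (exp (- t) <= 1) by (rewrite <- exp_0; apply exp_mono; lra).
    lra. }
  destruct (Rle_dec 0 x) as [L|L].
  - specialize (P x L); nra.
  - specialize (P (- x) ltac:(lra)); rewrite Ropp_involutive in P; nra. }
assert (Y : (y / 6) ^ 2 <= sin y ^ 2).
{ assert (P := Rabs_pos y); rewrite <- (pow2_abs (sin y)), <- (Rabs_pos_eq 6) by lra.
  unfold Rdiv in Hs |- *.
  rewrite <- (pow2_abs (y * / Rabs 6)), Rabs_mult.
  rewrite (Rabs_pos_eq (/ Rabs 6)), (Rabs_pos_eq 6) by (rewrite ?Rabs_pos_eq; lra).
  apply pow_incr; lra. }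
assert (M : (Cmod (x, y) / 6) ^ 2 <= Cmod (csinh (x, y)) ^ 2).
{ rewrite Hsq; replace ((Cmod (x, y) / 6) ^ 2) with (Cmod (x, y) ^ 2 / 36) by field.
  rewrite Cmod2_alt; simpl Re; simpl Im; nra. }
assert (P1 := Cmod_ge_0 (x, y)); assert (P2 := Cmod_ge_0 (csinh (x, y))).
apply Rnot_lt_le; intros L; nra.
Qed.

Lemma csinh_sub_id (u : C) : Cmod (csinh u - u)%C <= exp (Cmod u) * Cmod u ^ 2.
Proof.
assert (A := Cexp_sub_1_id u); assert (B := Cexp_sub_1_id (- u)%C).
rewrite Cmod_opp in B.
replace (csinh u - u)%C with
  (/ 2 * ((Cexp u - 1 - u) - (Cexp (- u) - 1 - (- u))))%C by (unfold csinh; field).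
rewrite Cmod_mult, <- RtoC_inv, Cmod_R, Rabs_pos_eq by lra.
generalize (Cmod_minus_le (Cexp u - 1 - u) (Cexp (- u) - 1 - - u)); lra.
Qed.

Lemma csinhc_sub_1 (u : C) : Cmod (csinhc u - 1)%C <= exp (Cmod u) * Cmod u.
Proof.
destruct (Ceq_dec u 0) as [->|H].
- unfold csinhc; destruct (Ceq_dec (RtoC 0) 0) as [_|E]; [|tauto].
  replace (1 - 1)%C with (RtoC 0) by ring; rewrite Cmod_0; lra.
- assert (A := csinh_sub_id u); rewrite <- csinhc_mul in A.
  replace (u * csinhc u - u)%C with (u * (csinhc u - 1))%C in A by ring.
  rewrite Cmod_mult in A.
  assert (0 < Cmod u) by (now apply Cmod_gt_0).
  apply Rmult_le_reg_l with (Cmod u); auto; nra.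
Qed.

Lemma is_lim_seq_half_pow (c : R) : is_lim_seq (fun r => c / 2 ^ S r) 0.
Proof.
apply is_lim_seq_ext with (fun r => (c / 2) * (/ 2) ^ r).
- intros r; simpl; rewrite pow_inv; field; apply pow_nonzero; lra.
- replace (Finite 0) with (Finite ((c / 2) * 0)) by (f_equal; ring).
  apply is_lim_seq_mult'; [apply is_lim_seq_const|].
  apply is_lim_seq_geom; rewrite Rabs_pos_eq; lra.
Qed.

Lemma Clim_scaled_csinh (a : C) :
  Clim (fun r => RtoC (2 ^ S r) * csinh (a / RtoC (2 ^ S r)))%C a.
Proof.
apply Clim_squeeze with (fun r => (exp (Cmod a) * Cmod a ^ 2) / 2 ^ S r);
  [|apply is_lim_seq_half_pow].
intros r; assert (Hn := pow2_C_nz (S r)).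
assert (H2 : 1 <= 2 ^ S r) by (apply pow_R1_Rle; lra).
set (p := 2 ^ S r) in *.
replace (p * csinh (a / p) - a)%C with (p * (csinh (a / p) - a / p))%C
  by (field; auto).
rewrite Cmod_mult, Cmod_R, Rabs_pos_eq by lra.
assert (A := csinh_sub_id (a / p)%C).
assert (E : Cmod (a / p)%C = Cmod a / p)
  by (rewrite Cmod_div, Cmod_R, Rabs_pos_eq by (auto; lra); auto).
rewrite E in A; assert (B := Cmod_ge_0 a).
assert (C1 : exp (Cmod a / p) <= exp (Cmod a)).
{ apply exp_mono, Rmult_le_reg_r with p; [lra|]; field_simplify; nra. }
apply Rle_trans with (p * (exp (Cmod a) * (Cmod a / p) ^ 2)).
- apply Rmult_le_compat_l; [lra|]; eapply Rle_trans; [apply A|].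
  apply Rmult_le_compat_r; auto; apply pow2_ge_0.
- right; field; lra.
Qed.

Lemma Clim_scaled_csinhc (a : C) : Clim (fun r => csinhc (a / RtoC (2 ^ S r))%C) (RtoC 1).
Proof.
apply Clim_squeeze with (fun r => (exp (Cmod a) * Cmod a) / 2 ^ S r);
  [|apply is_lim_seq_half_pow].
intros r; assert (Hn := pow2_C_nz (S r)).
assert (H2 : 1 <= 2 ^ S r) by (apply pow_R1_Rle; lra).
set (p := 2 ^ S r) in *.
eapply Rle_trans; [apply csinhc_sub_1|].
assert (E : Cmod (a / p)%C = Cmod a / p)
  by (rewrite Cmod_div, Cmod_R, Rabs_pos_eq by (auto; lra); auto).
rewrite E; assert (B := Cmod_ge_0 a).
assert (C1 : exp (Cmod a / p) <= exp (Cmod a)).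
{ apply exp_mono, Rmult_le_reg_r with p; [lra|]; field_simplify; nra. }
unfold Rdiv; rewrite <- Rmult_assoc.
apply Rmult_le_compat_r; [left; apply Rinv_0_lt_compat; lra|].
now apply Rmult_le_compat_r.
Qed.

(** [x] stays away from the poles [i Z] of [coth (PI x)]. *)
Definition off_poles (x : C) : Prop :=
  exists c, 0 < c /\ forall k : Z, c * (1 + Rabs (IZR k)) <= Cmod (x + Ci * IZR k)%C.

Lemma off_poles_Re (x : C) : Re x <> 0 -> off_poles x.
Proof.
intros Hx; set (p := Rabs (Re x)).
assert (Hp : 0 < p) by (now apply Rabs_pos_lt).
set (D := (1 + Rabs (Im x)) / p + 1).
assert (HI := Rabs_pos (Im x)).
assert (HD : 0 < D).
{ unfold D; assert (0 <= (1 + Rabs (Im x)) / p) by (apply Rdiv_le_0_compat; lra); lra. }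
exists (/ D); split; [now apply Rinv_0_lt_compat|].
intros k; set (z := (x + Ci * IZR k)%C).
assert (A : p <= Cmod z).
{ unfold p; replace (Re x) with (Re z) by (unfold z, Re, Im; simpl; ring); apply re_le_Cmod. }
assert (B : Rabs (Im x + IZR k) <= Cmod z).
{ replace (Im x + IZR k) with (Im z) by (unfold z, Re, Im; simpl; ring); apply im_le_Cmod. }
assert (B' : Rabs (IZR k) <= Cmod z + Rabs (Im x)).
{ replace (IZR k) with ((Im x + IZR k) + - Im x) at 1 by ring.
  eapply Rle_trans; [apply Rabs_triang|]; rewrite Rabs_Ropp; lra. }
apply Rmult_le_reg_l with D; auto.
rewrite <- Rmult_assoc, Rinv_r, Rmult_1_l by lra.
unfold D; rewrite Rmult_plus_distr_r, Rmult_1_l.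
assert (1 + Rabs (Im x) <= (1 + Rabs (Im x)) / p * Cmod z).
{ apply Rmult_le_reg_r with p; auto.
  replace ((1 + Rabs (Im x)) / p * Cmod z * p) with ((1 + Rabs (Im x)) * Cmod z)
    by (field; lra).
  apply Rmult_le_compat_l; lra. }
lra.
Qed.

Lemma off_poles_nz (x : C) (k : Z) : off_poles x -> (x + Ci * IZR k <> 0)%C.
Proof.
intros [c [Hc H]]; apply Cmod_gt_0; apply Rlt_le_trans with (2 := H k).
apply Rmult_lt_0_compat; auto; generalize (Rabs_pos (IZR k)); lra.
Qed.

Lemma summable_inv_sq : summable (fun k => / INR (S k) ^ 2).
Proof.
assert (H0 : forall k, 0 < / INR (S k) ^ 2).
{ intros; apply Rinv_0_lt_compat, pow_lt, lt_0_INR; lia. }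
apply summable_bound with 2; [intros; left; auto|].
assert (H : forall n, rsum (fun k => / INR (S k) ^ 2) (S n) <= 2 - / INR (S n)).
{ induction n as [|n IH]; [simpl; lra|].
  change (rsum (fun k => / INR (S k) ^ 2) (S n) + / INR (S (S n)) ^ 2
     <= 2 - / INR (S (S n))).
  assert (P : 0 < INR (S n)) by (apply lt_0_INR; lia).
  rewrite (S_INR (S n)); set (t := INR (S n)) in *.
  assert (/ (t + 1) ^ 2 <= / t - / (t + 1)).
  { replace (/ t - / (t + 1)) with (/ (t * (t + 1))) by (field; lra).
    apply Rinv_le_contravar; nra. }
  lra. }
intros [|n]; [simpl; lra|]; apply Rle_trans with (1 := H n).
assert (0 < / INR (S n)) by (apply Rinv_0_lt_compat, lt_0_INR; lia); lra.
Qed.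

Definition pole_term (x y : C) (k : Z) : C :=
  (/ ((x + Ci * IZR k) * (y + Ci * IZR k)))%C.

Lemma pole_term_bound (x y : C) : off_poles x -> off_poles y ->
  exists M, 0 < M /\ forall k, Cmod (pole_term x y k) <= M / (1 + Rabs (IZR k)) ^ 2.
Proof.
intros Hx Hy; destruct (Hx) as [c [Hc Hcx]]; destruct (Hy) as [d [Hd Hdy]].
exists (/ (c * d)); split; [apply Rinv_0_lt_compat; nra|].
intros k; unfold pole_term.
rewrite Cmod_inv by (apply Cmult_neq_0; now apply off_poles_nz).
rewrite Cmod_mult; specialize (Hcx k); specialize (Hdy k).
assert (P := Rabs_pos (IZR k)).
unfold Rdiv; rewrite <- Rinv_mult.
apply Rinv_le_contravar.
- apply Rmult_lt_0_compat; [nra|]; apply pow_lt; lra.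
- replace (c * d * (1 + Rabs (IZR k)) ^ 2)
    with ((c * (1 + Rabs (IZR k))) * (d * (1 + Rabs (IZR k)))) by ring.
  apply Rmult_le_compat; auto; apply Rmult_le_pos; lra.
Qed.

Lemma off_poles_csinh_nz (x : C) : off_poles x -> (csinh (PI * x) <> 0)%C.
Proof.
intros Hx E.
assert (E1 : Cexp (2 * (PI * x))%C = RtoC 1).
{ unfold csinh in E.
  assert (E2 : Cexp (PI * x)%C = Cexp (- (PI * x))%C).
  { replace (Cexp (PI * x)) with
     ((Cexp (PI * x) - Cexp (- (PI * x))) / 2 * 2 + Cexp (- (PI * x)))%C by field.
    rewrite E; ring. }
  replace (2 * (PI * x))%C with (PI * x + PI * x)%C by ring.
  rewrite Cexp_plus; rewrite E2 at 1; rewrite <- Cexp_plus, <- Cexp_0.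
  f_equal; ring. }
destruct x as [a b].
assert (Ha : a = 0).
{ apply (f_equal Cmod) in E1; rewrite Cmod_Cexp, Cmod_1 in E1.
  simpl in E1; rewrite <- exp_0 in E1; apply exp_inv in E1.
  assert (P := PI_RGT_0); nra. }
subst a.
assert (Hs : sin (PI * b) = 0).
{ apply (f_equal Re) in E1; unfold Cexp in E1; simpl in E1.
  replace (2 * (PI * 0 - 0 * b) - 0 * (PI * b + 0 * 0)) with 0 in E1 by ring.
  replace (2 * (PI * b + 0 * 0) + 0 * (PI * 0 - 0 * b)) with (2 * (PI * b)) in E1 by ring.
  rewrite exp_0, cos_2a_sin in E1.
  assert (sin (PI * b) * sin (PI * b) = 0) by lra.
  destruct (Rmult_integral _ _ H); auto. }
apply sin_eq_0_0 in Hs; destruct Hs as [k Hk].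
assert (b = IZR k) by (assert (P := PI_RGT_0); nra).
apply (off_poles_nz (0, b) (- k) Hx).
rewrite opp_IZR; apply Ceq; simpl; lra.
Qed.

(** [tannery] applied to [coth_diff_centered]. Each rescaled slice tends to its polar term because
    [2^r sinh (a / 2^r)] tends to [a]; the lower bound of [csinh] dominates the slices by a multiple
    of the polar terms, uniformly in [r]. The pairing of [k] with [- (k + 1)] is inherited from the
    recentred slices. *)
Lemma pole_expansion (x y : C) : off_poles x -> off_poles y ->
  Csums (fun k => pole_term x y (Z.of_nat k) + pole_term x y (- Z.of_nat (S k)))%C
    (PI ^ 2 * coth_diff (PI * x) (PI * y))%C.
Proof.
intros Hx Hy.
assert (HPI : (RtoC PI <> 0)%C)
  by (intros E; apply RtoC_inj in E; generalize PI_RGT_0; lra).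
destruct (pole_term_bound x y Hx Hy) as [M [HM0 HM]].
set (v := fun k => (pole_term x y (Z.of_nat k) + pole_term x y (- Z.of_nat (S k)))%C).
assert (HMk : forall k, Cmod (v k) <= 2 * M * / INR (S k) ^ 2).
{ intros k; unfold v; eapply Rle_trans; [apply Cmod_triangle|].
  assert (A := HM (Z.of_nat k)); assert (B := HM (- Z.of_nat (S k))%Z).
  rewrite opp_IZR, Rabs_Ropp, <- INR_IZR_INZ, Rabs_pos_eq in B by apply pos_INR.
  rewrite <- INR_IZR_INZ, Rabs_pos_eq, Rplus_comm, <- S_INR in A by apply pos_INR.
  assert (P : 0 < INR (S k)) by (apply lt_0_INR; lia).
  assert (M / (1 + INR (S k)) ^ 2 <= M / INR (S k) ^ 2).
  { apply Rmult_le_compat_l; [lra|]; apply Rinv_le_contravar; [apply pow_lt; lra|].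
    apply pow_incr; lra. }
  unfold Rdiv in *; lra. }
assert (Hs2 : summable (fun k => 2 * M * / INR (S k) ^ 2)).
{ apply (summable_scal (2 * M) (fun k => / INR (S k) ^ 2)); [lra|apply summable_inv_sq]. }
destruct (Csums_dom v _ HMk (proj2 Hs2)) as [l [Hl _]].
(* [2 ^ r0] absorbs the imaginary parts, so that all slices stay in the strip
   of [csinh_lower]. *)
destruct (Pow_x_infinity 2 ltac:(rewrite Rabs_pos_eq; lra)
   (2 * (Rabs (Im x) + Rabs (Im y)))) as [r0 Hr0].
(* [36] is [6 * 6], from [csinh_lower] for each of the two denominators; the other factor bounds
   [csinhc] at every rescaling of [PI (x - y)]. *)
set (B := 36 * (1 + exp (Cmod (PI * (x - y))) * Cmod (PI * (x - y)))).
assert (HB : 0 <= B).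
{ unfold B; assert (X1 := exp_pos (Cmod (PI * (x - y)))).
  assert (X2 := Cmod_ge_0 (PI * (x - y))); nra. }
assert (Hbd : forall r k, (r0 <= r)%nat -> (Z.abs k <= 2 ^ Z.of_nat r)%Z ->
  Cmod (/ RtoC (4 ^ S r) * coth_diff (slice x (S r) k) (slice y (S r) k))%C
    <= B / PI ^ 2 * Cmod (pole_term x y k)).
{ intros r k Hr Hk.
  assert (Hp2 : 0 < 2 ^ S r) by (apply pow_lt; lra).
  assert (Hlow : forall u, off_poles u -> 2 * Rabs (Im u) <= 2 ^ r ->
    PI * Cmod (u + Ci * IZR k)%C / (6 * 2 ^ S r) <= Cmod (csinh (slice u (S r) k))).
  { intros u Hu Hur.
    replace (PI * Cmod (u + Ci * IZR k)%C / (6 * 2 ^ S r))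
      with (Cmod (slice u (S r) k) / 6).
    - apply csinh_lower; unfold slice.
      replace (Im _) with (PI * (Im u + IZR k) / 2 ^ S r).
      + unfold Rdiv; rewrite !Rabs_mult, (Rabs_pos_eq PI), (Rabs_pos_eq (/ _))
          by (left; try apply Rinv_0_lt_compat; auto; apply PI_RGT_0).
        apply Rmult_le_reg_r with (2 ^ S r); auto.
        rewrite Rmult_assoc, Rinv_l, Rmult_1_r by lra.
        assert (A := Rabs_triang (Im u) (IZR k)).
        assert (A2 : Rabs (IZR k) <= 2 ^ r).
        { rewrite <- abs_IZR; apply IZR_le in Hk; rewrite <- pow_IZR in Hk; exact Hk. }
        simpl pow; assert (P := PI_RGT_0); nra.
      + clear - Hp2; destruct u as [a b]; set (p := 2 ^ S r) in *.
        unfold Cdiv; rewrite <- RtoC_inv by lra; simpl; field; lra.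
    - unfold slice; rewrite Cmod_div, Cmod_mult, !Cmod_R by (apply pow2_C_nz).
      rewrite !Rabs_pos_eq by (left; auto; apply PI_RGT_0); field; lra. }
  assert (Hr' : 2 * (Rabs (Im x) + Rabs (Im y)) <= 2 ^ r).
  { generalize (Hr0 r ltac:(lia)); rewrite Rabs_pos_eq; [lra|].
    left; apply pow_lt; lra. }
  assert (Ix := Rabs_pos (Im x)); assert (Iy := Rabs_pos (Im y)).
  assert (Lx := Hlow x Hx ltac:(lra)); assert (Ly := Hlow y Hy ltac:(lra)).
  assert (Px : 0 < Cmod (x + Ci * IZR k)%C) by (apply Cmod_gt_0; now apply off_poles_nz).
  assert (Py : 0 < Cmod (y + Ci * IZR k)%C) by (apply Cmod_gt_0; now apply off_poles_nz).
  assert (PP := PI_RGT_0).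
  set (X := Cmod (x + Ci * IZR k)%C) in *; set (Y := Cmod (y + Ci * IZR k)%C) in *.
  assert (Qx : 0 < PI * X / (6 * 2 ^ S r)) by (apply Rdiv_lt_0_compat; nra).
  assert (Qy : 0 < PI * Y / (6 * 2 ^ S r)) by (apply Rdiv_lt_0_compat; nra).
  assert (Nx : (csinh (slice x (S r) k) <> 0)%C) by (apply Cmod_gt_0; lra).
  assert (Ny : (csinh (slice y (S r) k) <> 0)%C) by (apply Cmod_gt_0; lra).
  unfold pole_term; rewrite Cmod_inv, Cmod_mult by (apply Cmult_neq_0; now apply off_poles_nz).
  fold X Y.
  unfold coth_diff; rewrite Cmod_mult, Cmod_div, Cmod_mult by now apply Cmult_neq_0.
  assert (H4 : 0 < 4 ^ S r) by (apply pow_lt; lra).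
  rewrite <- RtoC_inv, Cmod_R, Rabs_pos_eq by (try (left; apply Rinv_0_lt_compat); lra).
  assert (S1 : Cmod (csinhc (slice x (S r) k - slice y (S r) k)) <= B / 36).
  { unfold B; replace (slice x (S r) k - slice y (S r) k)%C
      with (PI * (x - y) / RtoC (2 ^ S r))%C
      by (unfold slice; field; apply pow2_C_nz).
    set (u := (PI * (x - y) / RtoC (2 ^ S r))%C).
    assert (U : Cmod u <= Cmod (PI * (x - y))%C).
    { unfold u; rewrite Cmod_div, (Cmod_R (2 ^ S r)), Rabs_pos_eq by (try apply pow2_C_nz; lra).
      assert (1 <= 2 ^ S r) by (apply pow_R1_Rle; lra).
      apply Rmult_le_reg_r with (2 ^ S r); auto; field_simplify; [|lra].
      assert (T := Cmod_ge_0 (PI * (x - y))%C); nra. }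
    assert (V := csinhc_sub_1 u); assert (W := Cmod_triangle_sub (csinhc u) (RtoC 1)).
    rewrite Cmod_1 in W; assert (T := exp_mono _ _ U).
    assert (T1 := exp_pos (Cmod u)); assert (T2 := Cmod_ge_0 u).
    assert (exp (Cmod u) * Cmod u <= exp (Cmod (PI * (x - y))) * Cmod (PI * (x - y)))
      by (apply Rmult_le_compat; lra).
    lra. }
  apply Rle_trans with (/ 4 ^ S r * (B / 36 / ((PI * X / (6 * 2 ^ S r)) * (PI * Y / (6 * 2 ^ S r))))).
  - apply Rmult_le_compat_l; [left; now apply Rinv_0_lt_compat|].
    unfold Rdiv at 1 4; apply Rmult_le_compat; auto; [apply Cmod_ge_0| |].
    + left; apply Rinv_0_lt_compat; nra.
    + apply Rinv_le_contravar; [now apply Rmult_lt_0_compat|].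
      apply Rmult_le_compat; lra.
  - right; replace 4 with (2 * 2) by ring; rewrite Rpow_mult_distr.
    set (p := 2 ^ S r) in *; fold X Y; field; lra. }
set (K := fun r => (2 ^ (r + r0))%nat).
set (u := fun r k => (/ RtoC (4 ^ S (r + r0)) *
    (coth_diff (slice x (S (r + r0)) (Z.of_nat k)) (slice y (S (r + r0)) (Z.of_nat k))
     + coth_diff (slice x (S (r + r0)) (- Z.of_nat (S k)))
        (slice y (S (r + r0)) (- Z.of_nat (S k)))))%C).
assert (Hlim : Clim (fun r => csum (u r) (K r)) (/ PI ^ 2 * l)%C).
{ apply (tannery u (fun k => / PI ^ 2 * v k)%C (fun k => B / PI ^ 2 * (2 * M * / INR (S k) ^ 2)) K).
  - intros r k Hk; unfold u.
    assert (HK : (Z.of_nat (K r) = 2 ^ Z.of_nat (r + r0))%Z)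
      by (unfold K; now rewrite Nat2Z.inj_pow).
    rewrite Cmult_plus_distr_l; eapply Rle_trans; [apply Cmod_triangle|].
    assert (A1 := Hbd (r + r0)%nat (Z.of_nat k) ltac:(lia) ltac:(lia)).
    assert (A2 := Hbd (r + r0)%nat (- Z.of_nat (S k))%Z ltac:(lia) ltac:(lia)).
    assert (P2 : 0 <= B / PI ^ 2)
      by (apply Rdiv_le_0_compat; auto; apply pow_lt, PI_RGT_0).
    eapply Rle_trans; [apply Rplus_le_compat; eassumption|].
    rewrite <- Rmult_plus_distr_l; apply Rmult_le_compat_l; auto.
    assert (A := HM (Z.of_nat k)); assert (B' := HM (- Z.of_nat (S k))%Z).
    rewrite opp_IZR, Rabs_Ropp, <- INR_IZR_INZ, Rabs_pos_eq in B' by apply pos_INR.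
    rewrite <- INR_IZR_INZ, Rabs_pos_eq, Rplus_comm, <- S_INR in A by apply pos_INR.
    assert (P : 0 < INR (S k)) by (apply lt_0_INR; lia).
    assert (M / (1 + INR (S k)) ^ 2 <= M / INR (S k) ^ 2).
    { apply Rmult_le_compat_l; [lra|]; apply Rinv_le_contravar; [apply pow_lt; lra|].
      apply pow_incr; lra. }
    unfold Rdiv in *; lra.
  - apply (ex_series_scal (K := R_AbsRing) (V := R_NormedModule) (B / PI ^ 2)).
    apply Hs2.
  - intros k.
    assert (G : forall z, Clim (fun r => / RtoC (4 ^ S r) *
       coth_diff (slice x (S r) z) (slice y (S r) z))%C (/ PI ^ 2 * pole_term x y z)%C).
    { intros z; unfold coth_diff.
      apply Clim_ext with (fun r => csinhc ((PI * (x - y)) / RtoC (2 ^ S r)) *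
        / ((RtoC (2 ^ S r) * csinh ((PI * (x + Ci * IZR z)) / RtoC (2 ^ S r))) *
           (RtoC (2 ^ S r) * csinh ((PI * (y + Ci * IZR z)) / RtoC (2 ^ S r)))))%C.
      - intros r; unfold slice.
        replace (PI * (x + Ci * IZR z) / RtoC (2 ^ S r) - PI * (y + Ci * IZR z) / RtoC (2 ^ S r))%C
          with (PI * (x - y) / RtoC (2 ^ S r))%C by (field; apply pow2_C_nz).
        replace (4 ^ S r) with (2 ^ S r * 2 ^ S r)
          by (rewrite <- Rpow_mult_distr; f_equal; ring).
        rewrite RtoC_mult.
        assert (Hn := pow2_C_nz (S r)).
        set (p := RtoC (2 ^ S r)) in *.
        set (s1 := csinh (PI * (x + Ci * IZR z) / p)); set (s2 := csinh (PI * (y + Ci * IZR z) / p)).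
        (* Valid for zero factors as well, because the inverse of [0] is [0]; no slice has to be
           shown to avoid the zeros of [csinh] here. *)
        assert (CinvM : forall a b : C, (/ (a * b) = / a * / b)%C).
        { intros a b; destruct (Ceq_dec a 0) as [->|Ha].
          - rewrite Cmult_0_l; apply Ceq; simpl; unfold Rdiv; ring.
          - destruct (Ceq_dec b 0) as [->|Hb'].
            + rewrite Cmult_0_r; apply Ceq; simpl; unfold Rdiv; ring.
            + field; auto. }
        unfold Cdiv; rewrite !CinvM; ring.
      - replace (/ PI ^ 2 * pole_term x y z)%C with (RtoC 1 * / ((PI * (x + Ci * IZR z)) * (PI * (y + Ci * IZR z))))%C.
        + apply Clim_mult; [apply Clim_scaled_csinhc|].
          apply Clim_inv; [repeat apply Cmult_neq_0; auto; now apply off_poles_nz|].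
          apply Clim_mult; apply Clim_scaled_csinh.
        + unfold pole_term; field; repeat split; auto; now apply off_poles_nz. }
    unfold u, v; rewrite Cmult_plus_distr_l.
    apply Clim_ext with (fun r => / RtoC (4 ^ S (r + r0)) *
      coth_diff (slice x (S (r + r0)) (Z.of_nat k)) (slice y (S (r + r0)) (Z.of_nat k))
      + / RtoC (4 ^ S (r + r0)) * coth_diff (slice x (S (r + r0)) (- Z.of_nat (S k)))
        (slice y (S (r + r0)) (- Z.of_nat (S k))))%C; [intros; ring|].
    apply Clim_plus.
    + apply (Clim_subseq _ _ (fun r => (r + r0)%nat)) with (2 := G (Z.of_nat k)); intros; lia.
    + apply (Clim_subseq _ _ (fun r => (r + r0)%nat)) with (2 := G (- Z.of_nat (S k))%Z); intros; lia.
  - intros r; unfold K; assert (A := Nat.pow_gt_lin_r 2 (r + r0) ltac:(lia)); lia.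
  - now apply Csums_scal. }
assert (E : (/ PI ^ 2 * l)%C = coth_diff (PI * x) (PI * y)).
{ apply (Clim_unique (fun r => csum (u r) (K r))); auto.
  apply Clim_ext with (fun _ => coth_diff (PI * x) (PI * y)); [|apply Clim_const].
  intros r; apply coth_diff_centered; now apply off_poles_csinh_nz. }
rewrite <- E; replace (PI ^ 2 * (/ PI ^ 2 * l))%C with l; [exact Hl|].
field; auto.
Qed.

(** * Expansions of coth and of 1/sinh^2, and the sum of the inverse squares *)

Lemma is_lim_seq_inv_S : is_lim_seq (fun n => / INR (S n)) 0.
Proof.
apply Rlim_is_lim_seq; intros eps He.
destruct (archimed_cor1 eps He) as [N [HN HN0]]; exists N; intros n Hn.
assert (0 < INR N) by (apply lt_0_INR; lia).
assert (INR N <= INR (S n)) by (apply le_INR; lia).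
rewrite Rminus_0_r, Rabs_pos_eq by (left; apply Rinv_0_lt_compat; lra).
apply Rle_lt_trans with (2 := HN); apply Rinv_le_contravar; lra.
Qed.

(** Pairing [n] with [- n] instead of [- (n + 1)] changes the partial sums by the term at [0] and by
    one boundary term, which tends to [0]. *)
Lemma pole_expansion_sym (x y : C) : off_poles x -> off_poles y ->
  Csums (fun n => pole_term x y (Z.of_nat (S n)) + pole_term x y (- Z.of_nat (S n)))%C
    (PI ^ 2 * coth_diff (PI * x) (PI * y) - pole_term x y 0)%C.
Proof.
intros Hx Hy; assert (H := pole_expansion x y Hx Hy).
destruct (pole_term_bound x y Hx Hy) as [M [HM0 HM]].
assert (Ht : Clim (fun n => pole_term x y (Z.of_nat n)) (RtoC 0)).
{ apply Clim_squeeze with (fun n => M * / INR (S n)).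
  - intros n; replace (pole_term x y (Z.of_nat n) - 0)%C
      with (pole_term x y (Z.of_nat n)) by ring.
    eapply Rle_trans; [apply HM|].
    rewrite <- INR_IZR_INZ, Rabs_pos_eq, Rplus_comm, <- S_INR by apply pos_INR.
    assert (1 <= INR (S n)) by (rewrite S_INR; generalize (pos_INR n); lra).
    apply Rmult_le_compat_l; [lra|]; apply Rinv_le_contravar; nra.
  - replace (Finite 0) with (Finite (M * 0)) by (f_equal; ring).
    apply is_lim_seq_mult'; [apply is_lim_seq_const|apply is_lim_seq_inv_S]. }
apply Clim_ext with (fun n => csum (fun k => pole_term x y (Z.of_nat k)
   + pole_term x y (- Z.of_nat (S k)))%C n + pole_term x y (Z.of_nat n)
   - pole_term x y 0)%C.
- intros n; induction n as [|n IH]; [simpl; ring|].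
  cbn [csum]; rewrite <- IH; ring.
- apply Clim_minus; [|apply Clim_const].
  rewrite <- (Cplus_0_r (PI ^ 2 * _)%C); now apply Clim_plus.
Qed.

Lemma pole_term_0 (x y : C) : pole_term x y 0 = (/ (x * y))%C.
Proof. unfold pole_term; f_equal; ring. Qed.

Lemma csinhc_0 : csinhc (RtoC 0) = RtoC 1.
Proof. unfold csinhc; now destruct (Ceq_dec (RtoC 0) 0). Qed.

Lemma csch_sq_expansion (x : C) : 0 < Re x ->
  Csums (fun n => / (x + Ci * INR (S n)) ^ 2 + / (x - Ci * INR (S n)) ^ 2)%C
    (PI ^ 2 / csinh (PI * x) ^ 2 - / x ^ 2)%C.
Proof.
intros Hx; assert (Ho : off_poles x) by (apply off_poles_Re; lra).
assert (H := pole_expansion_sym x x Ho Ho).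
assert (Hn := off_poles_csinh_nz x Ho); assert (Hxn := Re_pos_nz x Hx).
rewrite pole_term_0 in H; unfold coth_diff in H.
replace (PI * x - PI * x)%C with (RtoC 0) in H by ring; rewrite csinhc_0 in H.
replace (PI ^ 2 / csinh (PI * x) ^ 2 - / x ^ 2)%C
  with (PI ^ 2 * (1 / (csinh (PI * x) * csinh (PI * x))) - / (x * x))%C
  by (field; auto).
refine (Csums_ext _ _ _ _ H); intros n; unfold pole_term.
rewrite opp_IZR, <- INR_IZR_INZ, RtoC_opp; f_equal; f_equal; ring.
Qed.

(** The case [y = - x] of the polar expansion, where both terms of a pair equal [- 1/(x^2 + n^2)];
    the case [y = x] gives [csch_sq_expansion]. *)
Lemma coth_expansion (x : C) : 0 < Re x ->
  Csums (fun n => / (x ^ 2 + INR (S n) ^ 2))%C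
    ((PI * (ccosh (PI * x) / csinh (PI * x)) / x - / x ^ 2) / 2)%C.
Proof.
intros Hx; assert (Ho : off_poles x) by (apply off_poles_Re; lra).
assert (Ho' : off_poles (- x)%C) by (apply off_poles_Re; rewrite re_opp; lra).
assert (H := pole_expansion_sym x (- x) Ho Ho').
assert (Hn := off_poles_csinh_nz x Ho); assert (Hxn := Re_pos_nz x Hx).
assert (HPI : (RtoC PI <> 0)%C)
  by (intros E; apply RtoC_inj in E; generalize PI_RGT_0; lra).
rewrite pole_term_0 in H; unfold coth_diff in H.
replace (PI * x - PI * - x)%C with (2 * (PI * x))%C in H by ring.
rewrite csinhc_double in H.
replace (csinh (PI * - x)) with (- csinh (PI * x))%C in H.
2:{ unfold csinh; replace (PI * - x)%C with (- (PI * x))%C by ring.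
    replace (- - (PI * x))%C with (PI * x)%C by ring; field. }
assert (E := csinhc_mul (PI * x)).
replace (csinhc (PI * x)) with (csinh (PI * x) / (PI * x))%C in H
  by (rewrite <- E; field; auto).
replace ((PI * (ccosh (PI * x) / csinh (PI * x)) / x - / x ^ 2) / 2)%C with
 (- / 2 * (PI ^ 2 * (csinh (PI * x) / (PI * x) * ccosh (PI * x)
    / (csinh (PI * x) * - csinh (PI * x))) - / (x * - x)))%C
 by (field; repeat split; auto).
assert (Hz : forall n : nat, (x ^ 2 + INR (S n) ^ 2 <> 0)%C).
{ intros n E0.
  assert (A := off_poles_nz x (Z.of_nat (S n)) Ho).
  assert (B := off_poles_nz x (- Z.of_nat (S n)) Ho).
  rewrite opp_IZR in B; rewrite <- INR_IZR_INZ in A, B.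
  apply (Cmult_neq_0 _ _ A B).
  rewrite RtoC_opp.
  transitivity (x ^ 2 - (Ci * Ci) * INR (S n) ^ 2)%C; [ring|].
  rewrite Ci_sq, <- E0; ring. }
apply Csums_scal with (c := (- / 2)%C) in H.
refine (Csums_ext _ _ _ _ H); intros n; unfold pole_term.
rewrite opp_IZR, <- INR_IZR_INZ, RtoC_opp.
specialize (Hz n).
replace ((x + Ci * INR (S n)) * (- x + Ci * INR (S n)))%C
  with (- (x ^ 2 + INR (S n) ^ 2))%C.
2:{ transitivity (- x ^ 2 + (Ci * Ci) * INR (S n) ^ 2)%C; [rewrite Ci_sq|]; ring. }
replace ((x + Ci * - INR (S n)) * (- x + Ci * - INR (S n)))%C
  with (- (x ^ 2 + INR (S n) ^ 2))%C.
2:{ transitivity (- x ^ 2 + (Ci * Ci) * INR (S n) ^ 2)%C; [rewrite Ci_sq|]; ring. }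
field; auto.
Qed.

(** The expansion at [x = i / 2] gives [sum 1 / (2 k + 1) ^ 2]. *)
Lemma basel : Csums (fun n => / INR (S n) ^ 2)%C (PI ^ 2 / 6)%C.
Proof.
set (x := (Ci / 2)%C).
assert (Ho : off_poles x).
{ exists (/ 6); split; [lra|]; intros k.
  replace (x + Ci * IZR k)%C with (Ci * RtoC (1 / 2 + IZR k))%C
    by (unfold x; rewrite RtoC_plus, RtoC_div by lra; field).
  rewrite Cmod_mult, Cmod_Ci, Cmod_R, Rmult_1_l.
  destruct (Z_le_gt_dec 0 k) as [L|L].
  - apply IZR_le in L; rewrite !Rabs_pos_eq by lra; lra.
  - assert (L' : IZR k <= -1) by (apply IZR_le; lia).
    rewrite !Rabs_left1 by lra; lra. }
assert (H := pole_expansion x x Ho Ho).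
assert (V : (PI ^ 2 * coth_diff (PI * x) (PI * x))%C = (- PI ^ 2)%C).
{ unfold coth_diff; replace (PI * x - PI * x)%C with (RtoC 0) by ring.
  rewrite csinhc_0.
  assert (E : csinh (PI * x) = Ci).
  { unfold csinh; rewrite Cexp_opp.
    replace (PI * x)%C with (PI / 2 * Ci)%C by (unfold x; field).
    rewrite Cexp_half_PI, Cinv_Ci; field. }
  rewrite E, Ci_sq; field. }
rewrite V in H.
apply Csums_scal with (c := (- / 8)%C) in H.
assert (Hodd : Csums (fun n => / INR (2 * n + 1) ^ 2)%C (PI ^ 2 / 8)%C).
{ replace (PI ^ 2 / 8)%C with (- / 8 * - PI ^ 2)%C by field.
  refine (Csums_ext _ _ _ _ H); intros n.
  unfold pole_term; rewrite opp_IZR, <- !INR_IZR_INZ.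
  assert (Hn : (RtoC (INR (2 * n + 1)) <> 0)%C).
  { intros E; apply RtoC_inj in E; revert E; apply not_0_INR; lia. }
  assert (A1 : (x + Ci * INR n)%C = (Ci * (INR (2 * n + 1) / 2))%C).
  { unfold x; rewrite plus_INR, mult_INR; change (INR 2) with 2; change (INR 1) with 1.
    rewrite RtoC_plus, RtoC_mult; field. }
  assert (A2 : (x + Ci * RtoC (- INR (S n)))%C = (- (Ci * (INR (2 * n + 1) / 2)))%C).
  { unfold x; rewrite plus_INR, mult_INR, S_INR; change (INR 2) with 2; change (INR 1) with 1.
    rewrite RtoC_opp, !RtoC_plus, RtoC_mult; field. }
  rewrite A1, A2.
  replace (Ci * (INR (2 * n + 1) / 2) * (Ci * (INR (2 * n + 1) / 2)))%C
    with (- (INR (2 * n + 1) / 2) ^ 2)%C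
    by (transitivity ((Ci * Ci) * (INR (2 * n + 1) / 2) ^ 2)%C; [rewrite Ci_sq|]; ring).
  replace (- (Ci * (INR (2 * n + 1) / 2)) * - (Ci * (INR (2 * n + 1) / 2)))%C
    with (- (INR (2 * n + 1) / 2) ^ 2)%C
    by (transitivity ((Ci * Ci) * (INR (2 * n + 1) / 2) ^ 2)%C; [rewrite Ci_sq|]; ring).
  field; auto. }
destruct (Csums_dom (fun n => / INR (S n) ^ 2)%C (fun n => / INR (S n) ^ 2)) as [l [Hl _]].
{ intros n; rewrite <- RtoC_pow, <- RtoC_inv, Cmod_R, Rabs_pos_eq; [lra| |].
  - left; apply Rinv_0_lt_compat, pow_lt, lt_0_INR; lia.
  - apply pow_nonzero, not_0_INR; lia. }
{ apply summable_inv_sq. }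
(* The first [2 n] terms split into odd and even integers; the even ones contribute a quarter of the
   whole sum. *)
assert (E : l = (PI ^ 2 / 8 + / 4 * l)%C).
{ apply (Clim_unique (fun n => csum (fun n => / INR (S n) ^ 2)%C (n + n))).
  - apply (Clim_subseq (csum _) l (fun n => (n + n)%nat)); [intros; lia|exact Hl].
  - apply Clim_ext with (fun n => csum (fun n => / INR (2 * n + 1) ^ 2)%C n
       + / 4 * csum (fun n => / INR (S n) ^ 2)%C n)%C.
    + intros n; induction n as [|n IH]; [simpl; ring|].
      replace (S n + S n)%nat with (S (S (n + n))) by lia.
      cbn [csum]; rewrite <- IH.
      replace (S (n + n)) with (2 * n + 1)%nat by lia.
      replace (S (2 * n + 1)) with (2 * S n)%nat by lia.
      rewrite (mult_INR 2 (S n)); change (INR 2) with 2; rewrite RtoC_mult.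
      assert (Hn : (RtoC (INR (S n)) <> 0)%C).
      { intros E; apply RtoC_inj in E; revert E; apply not_0_INR; lia. }
      assert (Hn' : (RtoC (INR (2 * n + 1)) <> 0)%C).
      { intros E; apply RtoC_inj in E; revert E; apply not_0_INR; lia. }
      field; auto.
    + apply Clim_plus; [exact Hodd|now apply Clim_scal]. }
replace (PI ^ 2 / 6)%C with l; [exact Hl|].
replace l with (4 / 3 * (l - / 4 * l))%C by field.
rewrite E at 1; field.
Qed.

(** [eisen_sum w E] means [E] is the (row by row) sum of [1 / (m w + i n) ^ 2]
    over [m >= 1] and all integers [n], by [csch_sq_expansion]. *)
Definition eisen_sum (w E : C) : Prop :=
  Csums (fun m => PI ^ 2 / csinh (PI * (INR (S m) * w)) ^ 2)%C E.

(** [Re w > 0] makes [w] and [i] independent over the reals: the real part controls [m], and then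
    [v] is controlled by [m] and the modulus. *)
Lemma cone_bound (w : C) : 0 < Re w -> exists c, 0 < c /\
  forall m v, 0 <= m -> c * (m + Rabs v) <= Cmod (m * w + Ci * v)%C.
Proof.
intros Hw; assert (HM := Cmod_ge_0 w).
set (D := (1 + Cmod w) / Re w + 1).
assert (HD : 0 < D).
{ unfold D; assert (0 <= (1 + Cmod w) / Re w) by (apply Rdiv_le_0_compat; lra); lra. }
exists (/ D); split; [now apply Rinv_0_lt_compat|]; intros m v Hm.
set (z := (m * w + Ci * v)%C).
assert (A : m * Re w <= Cmod z).
{ replace (m * Re w) with (Re z) by (unfold z, Re; simpl; ring); apply Re_le. }
assert (B : Rabs v <= Cmod z + m * Cmod w).
{ assert (Rabs v = Cmod (z - m * w)%C).
  { unfold z; replace (m * w + Ci * v - m * w)%C with (Ci * v)%C by ring.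
    rewrite Cmod_mult, Cmod_Ci, Cmod_R; ring. }
  rewrite H; eapply Rle_trans; [apply Cmod_minus_le|].
  rewrite Cmod_mult, Cmod_R, Rabs_pos_eq by auto; lra. }
assert (Hm' : m <= Cmod z / Re w).
{ apply Rmult_le_reg_r with (Re w); auto; field_simplify; lra. }
apply Rmult_le_reg_l with D; auto.
rewrite <- Rmult_assoc, Rinv_r, Rmult_1_l by lra.
unfold D; replace (((1 + Cmod w) / Re w + 1) * Cmod z)
  with ((1 + Cmod w) * (Cmod z / Re w) + Cmod z) by (field; lra).
assert (m * (1 + Cmod w) <= (1 + Cmod w) * (Cmod z / Re w)) by nra.
lra.
Qed.

Lemma Re_scal_pos (m : nat) (w : C) : 0 < Re w -> 0 < Re (INR (S m) * w)%C.
Proof.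
intros Hw; rewrite re_scal_l; apply Rmult_lt_0_compat; auto; apply lt_0_INR; lia.
Qed.

(** The subtracted term is [(1/(x - i/2) - 1/(x + i/2)) / i], which telescopes under [x -> x + i].
    The difference is [1/(4 x^2 (x + i/2) (x - i/2))], of order [x^-4], hence absolutely summable
    over a lattice. *)
Definition telescoped (x : C) : C := (/ x ^ 2 - / (x ^ 2 + / 4))%C.

Lemma telescoped_eq (x : C) : (x <> 0)%C -> (x + Ci / 2 <> 0)%C -> (x - Ci / 2 <> 0)%C ->
  telescoped x = (/ 4 * / (x ^ 2 * ((x + Ci / 2) * (x - Ci / 2))))%C /\
  (/ (x ^ 2 + / 4))%C = ((/ (x - Ci / 2) - / (x + Ci / 2)) / Ci)%C.
Proof.
intros H1 H2 H3.
assert (E : (x ^ 2 + / 4)%C = ((x + Ci / 2) * (x - Ci / 2))%C).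
{ transitivity (x ^ 2 - (Ci * Ci) / 4)%C; [rewrite Ci_sq; field|field]. }
assert (Hi := Ci_nz).
unfold telescoped; rewrite E; split.
2:{ set (u := (Ci / 2)%C) in *.
    assert (Hu : Ci = (2 * u)%C) by (unfold u; field).
    assert (Hu0 : (u <> 0)%C).
    { intros E0; apply Hi; rewrite Hu, E0; ring. }
    rewrite Hu; clearbody u; field; auto. }
assert (HP := Cmult_neq_0 _ _ H2 H3).
set (P := ((x + Ci / 2) * (x - Ci / 2))%C) in *; clearbody P.
replace (/ 4 * / (x ^ 2 * P))%C with ((P - x ^ 2) * / (x ^ 2 * P))%C
  by (rewrite <- E; f_equal; ring).
field; auto.
Qed.

(** * Exchange of summation in the Eisenstein series of weight 2 *)

Section EisensteinSwap.

Variable w : C.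
Hypothesis Hw : 0 < Re w.

Definition lattice (m : nat) (v : R) : C := (INR (S m) * w + Ci * v)%C.

Lemma lattice_nz (m : nat) (v : R) : (lattice m v <> 0)%C.
Proof.
apply Re_pos_nz; unfold lattice; rewrite re_plus.
generalize (Re_scal_pos m w Hw); simpl (Re (Ci * v)); rewrite Rmult_0_l, Rmult_0_r.
simpl; lra.
Qed.

(** Adding [- 1 / (x ^ 2 + 1 / 4)], which telescopes along the rows, makes the
    Eisenstein series absolutely convergent. *)
Definition swap_term (m n : nat) : C :=
  match n with
  | O => telescoped (lattice m 0)
  | S _ => (telescoped (lattice m (INR n)) + telescoped (lattice m (- INR n)))%C
  end.

Lemma lattice_shift (m : nat) (v : R) :
  (lattice m v + Ci / 2)%C = lattice m (v + / 2) /\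
  (lattice m v - Ci / 2)%C = lattice m (v - / 2).
Proof.
unfold lattice; split; rewrite ?RtoC_plus, ?RtoC_minus, RtoC_inv by lra; field.
Qed.

Lemma telescoped_lattice (m : nat) (v : R) :
  telescoped (lattice m v)
   = (/ 4 * / (lattice m v ^ 2 * (lattice m (v + / 2) * lattice m (v - / 2))))%C /\
  telescoped (lattice m v)
   = (/ lattice m v ^ 2 - (/ lattice m (v - / 2) - / lattice m (v + / 2)) / Ci)%C.
Proof.
assert (S1 := lattice_shift m v); destruct S1 as [S1 S2].
destruct (telescoped_eq (lattice m v)) as [A B].
- apply lattice_nz.
- rewrite S1; apply lattice_nz.
- rewrite S2; apply lattice_nz.
- rewrite S1, S2 in A, B; split; auto.
  unfold telescoped; now rewrite B.
Qed.

(** By [cone_bound] the four factors of the denominator are at least multiples of [a + b], with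
    [a = m + 1] and [b = n]; [a >= 1] absorbs the shifts by [1/2]. Then [(a + b)^2 >= a (b + 1)]
    turns the fourth power into the product majorant asked for by [fubini]. *)
Lemma swap_term_bound : exists M, 0 <= M /\ forall m n,
  Cmod (swap_term m n) <= (M * / INR (S m) ^ 2) * / INR (S n) ^ 2.
Proof.
destruct (cone_bound w Hw) as [c [Hc HB]].
set (M0 := / c ^ 4).
assert (HM0 : 0 <= M0) by (left; apply Rinv_0_lt_compat, pow_lt; auto).
assert (T : forall m n v, Rabs v = INR n ->
  Cmod (telescoped (lattice m v)) <= (M0 * / INR (S m) ^ 2) * / INR (S n) ^ 2).
{ intros m n v Hv; rewrite (proj1 (telescoped_lattice m v)).
  assert (Hm : 1 <= INR (S m)) by (rewrite S_INR; generalize (pos_INR m); lra).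
  assert (Hn := pos_INR n).
  assert (N : forall u, (lattice m u <> 0)%C) by (intros; apply lattice_nz).
  rewrite Cmod_mult, <- RtoC_inv, Cmod_R, Rabs_pos_eq by lra.
  rewrite Cmod_inv, Cmod_mult, Cmod_pow, Cmod_mult
    by (apply Cmult_neq_0; [apply Cpow_nz|apply Cmult_neq_0]; auto).
  assert (B0 := HB (INR (S m)) v ltac:(lra)); rewrite Hv in B0.
  assert (B1 := HB (INR (S m)) (v + / 2) ltac:(lra)).
  assert (B2 := HB (INR (S m)) (v - / 2) ltac:(lra)).
  fold (lattice m v) in B0; fold (lattice m (v + / 2)) in B1.
  fold (lattice m (v - / 2)) in B2.
  assert (V1 : INR n - / 2 <= Rabs (v + / 2)).
  { rewrite <- Hv; generalize (Rabs_triang (v + / 2) (- / 2)).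
    rewrite Rabs_Ropp, (Rabs_pos_eq (/ 2)) by lra.
    replace (v + / 2 + - / 2) with v by ring; lra. }
  assert (V2 : INR n - / 2 <= Rabs (v - / 2)).
  { rewrite <- Hv; generalize (Rabs_triang (v - / 2) (/ 2)).
    rewrite (Rabs_pos_eq (/ 2)) by lra.
    replace (v - / 2 + / 2) with v by ring; lra. }
  assert (V1' := Rabs_pos (v + / 2)); assert (V2' := Rabs_pos (v - / 2)).
  set (L0 := Cmod (lattice m v)) in *; set (L1 := Cmod (lattice m (v + / 2))) in *.
  set (L2 := Cmod (lattice m (v - / 2))) in *.
  set (a := INR (S m)) in *.
  rewrite (S_INR n); set (b := INR n) in *.
  assert (C0 : c * (a + b) <= L0) by lra.
  assert (C1 : c * ((a + b) / 2) <= L1).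
  { apply Rle_trans with (2 := B1); apply Rmult_le_compat_l; lra. }
  assert (C2 : c * ((a + b) / 2) <= L2).
  { apply Rle_trans with (2 := B2); apply Rmult_le_compat_l; lra. }
  assert (Hp : c ^ 4 / 4 * (a ^ 2 * (b + 1) ^ 2) <= L0 ^ 2 * (L1 * L2)).
  { assert (Q1 : a * (b + 1) <= (a + b) ^ 2) by nra.
    assert (Q2 : a ^ 2 * (b + 1) ^ 2 <= (a + b) ^ 4).
    { replace (a ^ 2 * (b + 1) ^ 2) with ((a * (b + 1)) ^ 2) by ring.
      replace ((a + b) ^ 4) with (((a + b) ^ 2) ^ 2) by ring.
      apply pow_incr; split; auto; nra. }
    assert (P0 : 0 <= c * (a + b)) by (apply Rmult_le_pos; lra).
    apply Rle_trans with ((c * (a + b)) ^ 2 * ((c * ((a + b) / 2)) * (c * ((a + b) / 2)))).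
    - apply Rle_trans with (c ^ 4 / 4 * (a + b) ^ 4); [|right; field].
      apply Rmult_le_compat_l; auto.
      apply Rmult_le_pos; [left; now apply pow_lt|lra].
    - apply Rmult_le_compat.
      + apply pow2_ge_0.
      + apply Rmult_le_pos; nra.
      + apply pow_incr; lra.
      + apply Rmult_le_compat; nra. }
  unfold M0; rewrite <- !Rinv_mult.
  replace (/ 4 * / (L0 ^ 2 * (L1 * L2))) with (/ (4 * (L0 ^ 2 * (L1 * L2))))
    by (rewrite Rinv_mult; auto).
  assert (0 < c ^ 4) by now apply pow_lt.
  apply Rinv_le_contravar; [|nra].
  repeat apply Rmult_lt_0_compat; nra. }
exists (2 * M0); split; [lra|].
assert (Hpos : forall m n, 0 <= (M0 * / INR (S m) ^ 2) * / INR (S n) ^ 2).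
{ intros m n; repeat apply Rmult_le_pos; auto; left; apply Rinv_0_lt_compat, pow_lt, lt_0_INR; lia. }
intros m [|n].
- generalize (T m O 0 Rabs_R0) (Hpos m O); simpl swap_term; lra.
- simpl swap_term; eapply Rle_trans; [apply Cmod_triangle|].
  generalize (T m (S n) (INR (S n)) (Rabs_pos_eq _ (pos_INR _)))
   (T m (S n) (- INR (S n)) ltac:(rewrite Rabs_Ropp; apply Rabs_pos_eq, pos_INR)).
  change (match n with O => 1 | S _ => INR n + 1 end) with (INR (S n)); lra.
Qed.

Lemma swap_row_partial (m N : nat) :
  csum (swap_term m) (S N) = (/ (INR (S m) * w) ^ 2
    + csum (fun n => / (INR (S m) * w + Ci * INR (S n)) ^ 2
        + / (INR (S m) * w - Ci * INR (S n)) ^ 2) N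
    - (/ lattice m (- (INR N + / 2)) - / lattice m (INR N + / 2)) / Ci)%C.
Proof.
assert (L : forall v, lattice m (- v) = (INR (S m) * w - Ci * v)%C)
  by (intros; unfold lattice; rewrite RtoC_opp; ring).
induction N as [|N IH].
- cbn [csum]; simpl swap_term; rewrite (proj2 (telescoped_lattice m 0)).
  replace (INR 0 + / 2) with (0 + / 2) by (simpl; ring).
  replace (0 - / 2) with (- (0 + / 2)) by ring.
  replace (lattice m 0) with (INR (S m) * w)%C by (unfold lattice; ring); ring.
- change (csum (swap_term m) (S (S N))) with (csum (swap_term m) (S N) + swap_term m (S N))%C.
  rewrite IH; cbn [csum swap_term].
  rewrite (proj2 (telescoped_lattice m (INR (S N)))), (proj2 (telescoped_lattice m (- INR (S N)))).
  rewrite (L (INR (S N))); fold (lattice m (INR (S N))).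
  replace (- INR (S N) + / 2) with (- (INR N + / 2)) by (rewrite S_INR; field).
  replace (- INR (S N) - / 2) with (- (INR (S N) + / 2)) by field.
  replace (INR (S N) - / 2) with (INR N + / 2) by (rewrite S_INR; field).
  unfold Cdiv; ring.
Qed.

Lemma half_shift_lim (m : nat) :
  Clim (fun N => (/ lattice m (- (INR N + / 2)) - / lattice m (INR N + / 2)) / Ci)%C (RtoC 0).
Proof.
destruct (cone_bound w Hw) as [c [Hc HB]].
apply Clim_squeeze with (fun N => 2 * / c * / INR (S N)).
2:{ replace (Finite 0) with (Finite (2 * / c * 0)) by (f_equal; ring).
    apply is_lim_seq_mult'; [apply is_lim_seq_const|apply is_lim_seq_inv_S]. }
intros N.
assert (G : forall v, Rabs v = INR N + / 2 -> Cmod (/ lattice m v)%C <= / c * / INR (S N)).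
{ intros v Hv; rewrite Cmod_inv by apply lattice_nz.
  rewrite <- Rinv_mult; apply Rinv_le_contravar.
  - apply Rmult_lt_0_compat; auto; apply lt_0_INR; lia.
  - eapply Rle_trans; [|apply (HB (INR (S m)) v), pos_INR].
    apply Rmult_le_compat_l; [lra|]; rewrite Hv, !S_INR.
    generalize (pos_INR m); lra. }
assert (P := pos_INR N).
replace (_ / Ci - 0)%C with ((/ lattice m (- (INR N + / 2)) - / lattice m (INR N + / 2)) * / Ci)%C
  by (unfold Cdiv; ring).
rewrite Cmod_mult, Cmod_inv, Cmod_Ci by apply Ci_nz.
assert (A := G (INR N + / 2) (Rabs_pos_eq (INR N + / 2) ltac:(lra))).
assert (B := G (- (INR N + / 2)) ltac:(rewrite Rabs_Ropp; apply Rabs_pos_eq; lra)).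
generalize (Cmod_minus_le (/ lattice m (- (INR N + / 2))) (/ lattice m (INR N + / 2))); lra.
Qed.

Lemma swap_row (m : nat) :
  Csums (swap_term m) (PI ^ 2 / csinh (PI * (INR (S m) * w)) ^ 2)%C.
Proof.
apply Clim_shift.
apply Clim_ext with (fun N => / (INR (S m) * w) ^ 2
    + csum (fun n => / (INR (S m) * w + Ci * INR (S n)) ^ 2
        + / (INR (S m) * w - Ci * INR (S n)) ^ 2) N
    - (/ lattice m (- (INR N + / 2)) - / lattice m (INR N + / 2)) / Ci)%C.
- intros N; now rewrite swap_row_partial.
- replace (PI ^ 2 / csinh (PI * (INR (S m) * w)) ^ 2)%C with
   (/ (INR (S m) * w) ^ 2 + (PI ^ 2 / csinh (PI * (INR (S m) * w)) ^ 2
     - / (INR (S m) * w) ^ 2) - 0)%C by ring.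
  apply Clim_minus; [|apply half_shift_lim].
  apply Clim_plus; [apply Clim_const|].
  apply csch_sq_expansion, Re_scal_pos, Hw.
Qed.

(** The sum over all rows of the ends [+-(N + 1/2)] left by telescoping, evaluated by
    [coth_expansion]. In each single row these ends tend to [0] with [N], but their total tends to
    [PI / w]: this is the defect of modularity in weight [2]. *)
Definition half_coth (N : nat) : C :=
  let B := ((INR N + / 2) / w)%C in
  (/ w * (PI * (ccosh (PI * B) / csinh (PI * B)) - / B))%C.

Lemma half_coth_lim : Clim half_coth (PI / w)%C.
Proof.
set (y := (/ w)%C); assert (Hy : 0 < Re y) by now apply Re_inv_pos.
assert (Hy0 := Re_pos_nz y Hy).
set (B := fun N : nat => ((INR N + / 2) / w)%C).
assert (HB : forall N, B N = (RtoC (INR N + / 2) * y)%C)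
  by (intros; unfold B, y; rewrite RtoC_plus, RtoC_inv by lra; reflexivity).
assert (HBr : forall N, 0 < Re (B N)).
{ intros N; rewrite HB, re_scal_l; apply Rmult_lt_0_compat; auto.
  generalize (pos_INR N); lra. }
assert (HBn : forall N, (B N <> 0)%C) by (intros; now apply Re_pos_nz).
assert (Hinv : Clim (fun N => / B N)%C (RtoC 0)).
{ apply Clim_squeeze with (fun N => 2 * / Cmod y * / INR (S N)).
  - intros N; replace (/ B N - 0)%C with (/ B N)%C by ring.
    rewrite HB, Cmod_inv, Cmod_mult, Cmod_R, Rabs_pos_eq
      by (try (rewrite <- HB; apply HBn); generalize (pos_INR N); lra).
    assert (0 < Cmod y) by now apply Cmod_gt_0.
    assert (P := pos_INR N); rewrite S_INR.
    replace (2 * / Cmod y * / (INR N + 1)) with (/ ((INR N + 1) / 2 * Cmod y))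
      by (field; lra).
    apply Rinv_le_contravar; nra.
  - replace (Finite 0) with (Finite (2 * / Cmod y * 0)) by (f_equal; ring).
    apply is_lim_seq_mult'; [apply is_lim_seq_const|apply is_lim_seq_inv_S]. }
assert (Hexp : Clim (fun N => Cexp (- (2 * PI * B N))%C) (RtoC 0)).
{ apply Clim_squeeze with (fun N => / (2 * PI * Re y * (/ 2)) * / INR (S N)).
  - intros N; replace (Cexp (- (2 * PI * B N)) - 0)%C with (Cexp (- (2 * PI * B N))%C) by ring.
    rewrite Cmod_Cexp, HB.
    replace (Re _) with (- (2 * PI * Re y * (INR N + / 2)))
      by (destruct y; simpl; ring).
    assert (P := PI_RGT_0); assert (P1 := pos_INR N).
    assert (Q : 0 < 2 * PI * Re y) by (apply Rmult_lt_0_compat; lra).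
    set (u := 2 * PI * Re y) in *.
    rewrite exp_Ropp, <- Rinv_mult; apply Rinv_le_contravar.
    + apply Rmult_lt_0_compat; [lra|]; apply lt_0_INR; lia.
    + assert (T : 1 + u * (INR N + / 2) < exp (u * (INR N + / 2)))
        by (apply exp_ineq1; apply Rgt_not_eq, Rmult_lt_0_compat; lra).
      rewrite S_INR; nra.
  - replace (Finite 0) with (Finite (/ (2 * PI * Re y * (/ 2)) * 0)) by (f_equal; ring).
    apply is_lim_seq_mult'; [apply is_lim_seq_const|apply is_lim_seq_inv_S]. }
assert (H1 : (RtoC 1 <> RtoC 0)%C) by (intros E; apply RtoC_inj in E; lra).
apply Clim_ext with (fun N => / w * (PI * ((1 + Cexp (- (2 * PI * B N)))
   * / (1 - Cexp (- (2 * PI * B N)))) - / B N))%C.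
- intros N; unfold half_coth; fold (B N).
  f_equal; f_equal; f_equal.
  assert (Hs : (csinh (PI * B N) <> 0)%C).
  { apply off_poles_csinh_nz, off_poles_Re; apply Rgt_not_eq, HBr. }
  assert (E : Cexp (- (2 * PI * B N))%C = (Cexp (- (PI * B N)) * Cexp (- (PI * B N)))%C).
  { rewrite <- Cexp_plus; f_equal; ring. }
  rewrite E; unfold ccosh, csinh in *; rewrite Cexp_opp in *.
  assert (Hz := Cexp_nz (PI * B N)); set (z := Cexp (PI * B N)) in *.
  assert (Hz2 : (z * z - 1 <> 0)%C).
  { intros E0; apply Hs; replace ((z - / z) / 2)%C with ((z * z - 1) / (2 * z))%C by (field; auto).
    rewrite E0; unfold Cdiv; ring. }
  field; repeat split; auto.
  all: try (intros E0; apply Hz2; rewrite <- E0; ring).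
- replace (PI / w)%C with (/ w * (PI * ((1 + 0) * / (1 - 0)) - 0))%C.
  + apply Clim_scal, Clim_minus; [|exact Hinv].
    apply Clim_scal, Clim_mult; [apply Clim_plus; [apply Clim_const|exact Hexp]|].
    apply Clim_inv; [replace (1 - 0)%C with (RtoC 1) by ring; auto|].
    apply Clim_minus; [apply Clim_const|exact Hexp].
  + field; now apply Re_pos_nz.
Qed.

(** Column [n] of the lattice is, up to the factor [- 1/w^2], a row of the lattice of [1/w]. Column
    [0] is a multiple of the sum of inverse squares; the terms [1/n^2] make up for the point
    [m = 0], which the sum over [m >= 1] leaves out. *)
Lemma swap_columns (N : nat) :
  Csums (fun m => csum (swap_term m) (S N))
    ((PI ^ 2 / 6) / w ^ 2 + csum (fun n => / INR (S n) ^ 2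
      - / w ^ 2 * (PI ^ 2 / csinh (PI * (INR (S n) * / w)) ^ 2)) N - half_coth N)%C.
Proof.
assert (Hw0 := Re_pos_nz w Hw).
assert (HS : forall n, (RtoC (INR (S n)) <> 0)%C).
{ intros n E; apply RtoC_inj in E; revert E; apply not_0_INR; lia. }
eapply Csums_ext; [intros m; symmetry; apply swap_row_partial|].
apply Csums_minus; [apply Csums_plus|].
- apply Csums_ext with (fun m => / w ^ 2 * / INR (S m) ^ 2)%C.
  + intros m; field; split; auto.
  + replace (PI ^ 2 / 6 / w ^ 2)%C with (/ w ^ 2 * (PI ^ 2 / 6))%C by (unfold Cdiv; ring).
    apply Csums_scal, basel.
- apply (Csums_csum (fun n m => / (INR (S m) * w + Ci * INR (S n)) ^ 2
        + / (INR (S m) * w - Ci * INR (S n)) ^ 2)%C).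
  intros n _; set (y := (INR (S n) * / w)%C).
  assert (Hy : 0 < Re y) by (apply Re_scal_pos; now apply Re_inv_pos).
  assert (Hoy : off_poles y) by (apply off_poles_Re; lra).
  replace (/ INR (S n) ^ 2 - / w ^ 2 * (PI ^ 2 / csinh (PI * y) ^ 2))%C
   with (- / w ^ 2 * (PI ^ 2 / csinh (PI * y) ^ 2 - / y ^ 2))%C.
  2:{ unfold y; field; repeat split; auto.
      now apply off_poles_csinh_nz. }
  assert (G := csch_sq_expansion y Hy).
  apply Csums_scal with (c := (- / w ^ 2)%C) in G.
  refine (Csums_ext _ _ _ _ G); intros m.
  assert (A := off_poles_nz y (Z.of_nat (S m)) Hoy).
  assert (B := off_poles_nz y (- Z.of_nat (S m)) Hoy).
  rewrite opp_IZR in B; rewrite <- INR_IZR_INZ in A, B; rewrite RtoC_opp in B.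
  replace (y + Ci * - INR (S m))%C with (y - Ci * INR (S m))%C in B by ring.
  (* [m w + i n = i w (n / w - i m)] *)
  replace (INR (S m) * w + Ci * INR (S n))%C with (Ci * w * (y - Ci * INR (S m)))%C.
  2:{ unfold y; transitivity (Ci * INR (S n) - (Ci * Ci) * w * INR (S m))%C;
      [field; auto|rewrite Ci_sq; ring]. }
  replace (INR (S m) * w - Ci * INR (S n))%C with (- (Ci * w * (y + Ci * INR (S m))))%C.
  2:{ unfold y; transitivity (- Ci * INR (S n) - (Ci * Ci) * w * INR (S m))%C;
      [field; auto|rewrite Ci_sq; ring]. }
  replace ((Ci * w * (y - Ci * INR (S m))) ^ 2)%C with (- (w ^ 2 * (y - Ci * INR (S m)) ^ 2))%C
    by (transitivity ((Ci * Ci) * w ^ 2 * (y - Ci * INR (S m)) ^ 2)%C; [rewrite Ci_sq|]; ring).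
  replace ((- (Ci * w * (y + Ci * INR (S m)))) ^ 2)%C with (- (w ^ 2 * (y + Ci * INR (S m)) ^ 2))%C
    by (transitivity ((Ci * Ci) * w ^ 2 * (y + Ci * INR (S m)) ^ 2)%C; [rewrite Ci_sq|]; ring).
  field; auto.
- assert (HA : (RtoC (INR N + / 2) <> 0)%C).
  { intros E; apply RtoC_inj in E; generalize (pos_INR N); lra. }
  set (B := (RtoC (INR N + / 2) * / w)%C).
  assert (HB : 0 < Re B).
  { unfold B; rewrite re_scal_l; apply Rmult_lt_0_compat; [generalize (pos_INR N); lra|].
    now apply Re_inv_pos. }
  assert (HB0 := Re_pos_nz B HB).
  assert (HoB : off_poles B) by (apply off_poles_Re; lra).
  assert (HsB := off_poles_csinh_nz B HoB).
  assert (G := coth_expansion B HB).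
  apply Csums_scal with (c := (2 * RtoC (INR N + / 2) / w ^ 2)%C) in G.
  replace (half_coth N) with (2 * RtoC (INR N + / 2) / w ^ 2 *
     ((PI * (ccosh (PI * B) / csinh (PI * B)) / B - / B ^ 2) / 2))%C.
  2:{ unfold half_coth.
      replace ((INR N + / 2) / w)%C with B
        by (unfold B; rewrite RtoC_plus, RtoC_inv by lra; reflexivity).
      replace (RtoC (INR N + / 2)) with (B * w)%C at 1 by (unfold B; field; auto).
      field; auto. }
  refine (Csums_ext _ _ _ _ G); intros m.
  assert (X1 := lattice_nz m (INR N + / 2)); assert (X2 := lattice_nz m (- (INR N + / 2))).
  unfold lattice in *; rewrite RtoC_opp in *.
  set (A := RtoC (INR N + / 2)) in *; set (M := RtoC (INR (S m))) in *.
  replace (M * w + Ci * - A)%C with (M * w - Ci * A)%C in * by ring.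
  assert (X3 : (A ^ 2 + M ^ 2 * w ^ 2 <> 0)%C).
  { intros E0; apply (Cmult_neq_0 _ _ X1 X2).
    transitivity (M ^ 2 * w ^ 2 - (Ci * Ci) * A ^ 2)%C; [ring|rewrite Ci_sq, <- E0; ring]. }
  replace (B ^ 2 + M ^ 2)%C with ((A ^ 2 + M ^ 2 * w ^ 2) / w ^ 2)%C
    by (unfold B; field; auto).
  assert (Hi := Ci_nz).
  transitivity ((2 * A) / ((M * w - Ci * A) * (M * w + Ci * A)))%C; [|field; auto].
  replace ((M * w - Ci * A) * (M * w + Ci * A))%C with (A ^ 2 + M ^ 2 * w ^ 2)%C
    by (transitivity (M ^ 2 * w ^ 2 - (Ci * Ci) * A ^ 2)%C; [rewrite Ci_sq|]; ring).
  field; split; auto; replace ((M * w) ^ 2)%C with (M ^ 2 * w ^ 2)%C by ring; auto.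
Qed.

(** Quasi-modularity of the Eisenstein series of weight [2]. Summing [swap_term] by rows gives [E]
    with no trace of the telescoping terms; summing it by columns gives the side of [1/w] together
    with the limit of [- half_coth N]. *)
Lemma eisen_swap (E E' : C) : eisen_sum w E -> eisen_sum (/ w)%C E' ->
  E = ((PI ^ 2 / 6) / w ^ 2 + (PI ^ 2 / 6 - / w ^ 2 * E') - PI / w)%C.
Proof.
intros HE HE'.
destruct swap_term_bound as [M [HM Hb]].
destruct (fubini swap_term (fun m => M * / INR (S m) ^ 2) (fun n => / INR (S n) ^ 2)
  (fun m => PI ^ 2 / csinh (PI * (INR (S m) * w)) ^ 2)%C E Hb) as [col [Hc1 Hc2]].
- now apply summable_scal, summable_inv_sq.
- apply summable_inv_sq.
- intros m; apply swap_row.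
- exact HE.
- apply (Clim_unique (fun N => csum col (S N))); [now apply Clim_shift|].
  apply Clim_ext with (fun N => (PI ^ 2 / 6) / w ^ 2 + csum (fun n => / INR (S n) ^ 2
      - / w ^ 2 * (PI ^ 2 / csinh (PI * (INR (S n) * / w)) ^ 2)) N - half_coth N)%C.
  + intros N; apply (Csums_unique (fun m => csum (swap_term m) (S N))).
    * apply swap_columns.
    * apply (Csums_csum (fun n m => swap_term m n)); auto.
  + apply Clim_minus; [|apply half_coth_lim].
    apply Clim_plus; [apply Clim_const|].
    apply Csums_minus; [apply basel|]; now apply Csums_scal.
Qed.

End EisensteinSwap.

(** * The Euler product and its inversion formula *)

Fixpoint prN (N : nat) (q : C) : C :=
  match N with O => RtoC 1 | S N' => (prN N' q * (1 - q ^ N))%C end.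

Definition pr (q : C) : C := Clim_val (fun N => prN N q).

Lemma rsum_geom_le (r : R) (N : nat) : 0 <= r < 1 ->
  rsum (fun i => r ^ S i) N <= r / (1 - r).
Proof.
intros Hr.
assert (E : rsum (fun i => r ^ S i) N = r * (1 - r ^ N) / (1 - r)).
{ induction N as [|N IH]; [simpl; field; lra|].
  cbn [rsum]; rewrite IH; simpl; field; lra. }
rewrite E; apply Rmult_le_compat_r; [left; apply Rinv_0_lt_compat; lra|].
assert (0 <= r ^ N) by (apply pow_le; lra); nra.
Qed.

Lemma summable_geom (r : R) : 0 <= r < 1 -> summable (fun i => r ^ S i).
Proof.
intros Hr; apply summable_bound with (r / (1 - r)).
- intros; apply pow_le; lra.
- intros; now apply rsum_geom_le.
Qed.

Lemma rtail_geom (r : R) (N : nat) : 0 <= r < 1 ->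
  rtail (fun i => r ^ S i) N = r ^ S N / (1 - r).
Proof.
intros Hr; unfold rtail.
rewrite (Series_ext _ (fun i => r ^ S N * r ^ i))
  by (intros; rewrite <- pow_add; f_equal; lia).
rewrite Series_scal_l, Series_geom by (rewrite Rabs_pos_eq; lra); reflexivity.
Qed.

(** These bounds come from [1 + x <= exp x] and from [exp (- x / (1 - r)) <= 1 - x] for
    [0 <= x <= r], multiplied over [x = r^n]. They hold for all partial products at once on the disc
    of radius [r], so the infinite product does not vanish there. *)
Definition pr_ub (r : R) : R := exp (r / (1 - r)).
Definition pr_lb (r : R) : R := exp (- (r / (1 - r) ^ 2)).

Lemma prN_bounds (r : R) (N : nat) (q : C) : 0 <= r < 1 -> Cmod q <= r ->
  pr_lb r <= Cmod (prN N q) <= pr_ub r.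
Proof.
intros Hr Hq.
assert (Hs := rsum_geom_le r N Hr).
assert (H : exp (- (rsum (fun i => r ^ S i) N / (1 - r))) <= Cmod (prN N q)
   <= exp (rsum (fun i => r ^ S i) N)).
{ clear Hs; induction N as [|N IH].
  - simpl; unfold Rdiv; rewrite Rmult_0_l, Ropp_0, exp_0, Cmod_1; lra.
  - cbn [rsum prN]; rewrite Cmod_mult.
    assert (Hx : Cmod (q ^ S N) <= r ^ S N).
    { rewrite Cmod_pow; apply pow_incr; split; auto; apply Cmod_ge_0. }
    assert (Hx1 : 0 <= r ^ S N <= r).
    { split; [apply pow_le; lra|]; simpl.
      assert (r ^ N <= 1) by (rewrite <- (pow1 N); apply pow_incr; lra).
      nra. }
    set (x := r ^ S N) in *.
    assert (U : Cmod (1 - q ^ S N)%C <= exp x).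
    { eapply Rle_trans; [apply Cmod_minus_le|]; rewrite Cmod_1.
      destruct (Req_dec x 0) as [->|Hn]; [rewrite exp_0; lra|].
      generalize (exp_ineq1 x Hn); lra. }
    assert (L : exp (- (x / (1 - r))) <= Cmod (1 - q ^ S N)%C).
    { assert (A := Cmod_triangle_sub (RtoC 1) (q ^ S N)); rewrite Cmod_1 in A.
      apply Rle_trans with (1 - x); [|lra].
      rewrite exp_Ropp; apply Rmult_le_reg_l with (exp (x / (1 - r))); [apply exp_pos|].
      rewrite Rinv_r by (apply Rgt_not_eq, exp_pos).
      assert (B : 1 + x / (1 - r) <= exp (x / (1 - r))).
      { destruct (Req_dec (x / (1 - r)) 0) as [->|Hn]; [rewrite exp_0; lra|].
        generalize (exp_ineq1 _ Hn); lra. }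
      apply Rle_trans with ((1 + x / (1 - r)) * (1 - x)).
      - replace ((1 + x / (1 - r)) * (1 - x)) with (1 + x * (r - x) / (1 - r)) by (field; lra).
        assert (0 <= x * (r - x) / (1 - r)) by (apply Rdiv_le_0_compat; [apply Rmult_le_pos|]; lra).
        lra.
      - apply Rmult_le_compat_r; lra. }
    split.
    + replace (- ((rsum (fun i => r ^ S i) N + x) / (1 - r)))
        with (- (rsum (fun i => r ^ S i) N / (1 - r)) + - (x / (1 - r))) by (field; lra).
      rewrite exp_plus; apply Rmult_le_compat; try (left; apply exp_pos); auto; apply IH.
    + rewrite exp_plus; apply Rmult_le_compat; try apply Cmod_ge_0; auto; apply IH. }
unfold pr_lb, pr_ub; split.
- eapply Rle_trans; [|apply H]; apply exp_mono, Ropp_le_contravar.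
  apply Rle_trans with ((r / (1 - r)) / (1 - r)); [|right; field; lra].
  apply Rmult_le_compat_r; auto; left; apply Rinv_0_lt_compat; lra.
- eapply Rle_trans; [apply H|]; now apply exp_mono.
Qed.

Lemma pr_ub_pos (r : R) : 0 < pr_ub r.
Proof. apply exp_pos. Qed.

Lemma pr_lb_pos (r : R) : 0 < pr_lb r.
Proof. apply exp_pos. Qed.

Lemma prN_lim_aux (r : R) (q : C) : 0 <= r < 1 -> Cmod q <= r ->
  exists l, Clim (fun N => prN N q) l /\
    forall N, Cmod (l - prN N q)%C <= pr_ub r * (r ^ S N / (1 - r)).
Proof.
intros Hr Hq.
set (f := fun n => (prN (S n) q - prN n q)%C).
assert (Hf : forall n, Cmod (f n) <= pr_ub r * r ^ S n).
{ intros n; unfold f; cbn [prN].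
  replace (prN n q * (1 - q ^ S n) - prN n q)%C with (- (prN n q * q ^ S n))%C by ring.
  rewrite Cmod_opp, Cmod_mult; apply Rmult_le_compat; try apply Cmod_ge_0.
  - now apply prN_bounds.
  - rewrite Cmod_pow; apply pow_incr; split; auto; apply Cmod_ge_0. }
assert (E : forall N, csum f N = (prN N q - 1)%C).
{ induction N as [|N IH]; [simpl; ring|].
  cbn [csum]; rewrite IH; unfold f; ring. }
assert (Hs := summable_geom r Hr).
destruct (Csums_dom f _ Hf) as [l [Hl Ht]].
{ apply (ex_series_scal (K := R_AbsRing) (V := R_NormedModule) (pr_ub r)), Hs. }
exists (l + 1)%C; split.
- apply Clim_ext with (fun N => csum f N + 1)%C; [intros; rewrite E; ring|].
  apply Clim_plus; [exact Hl|apply Clim_const].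
- intros N; specialize (Ht N).
  replace (l + 1 - prN N q)%C with (l - csum f N)%C by (rewrite E; ring).
  rewrite <- rtail_geom by auto; unfold rtail in *; now rewrite Series_scal_l in Ht.
Qed.

Lemma pr_spec (r : R) (q : C) : 0 <= r < 1 -> Cmod q <= r ->
  Clim (fun N => prN N q) (pr q) /\
  (forall N, Cmod (pr q - prN N q)%C <= pr_ub r * (r ^ S N / (1 - r))) /\
  pr_lb r <= Cmod (pr q) <= pr_ub r.
Proof.
intros Hr Hq; destruct (prN_lim_aux r q Hr Hq) as [l [H1 H2]].
unfold pr; rewrite (Clim_val_eq _ _ H1); repeat split; auto.
- destruct (Rle_lt_dec (pr_lb r) (Cmod l)) as [L|L]; auto; exfalso.
  destruct (H1 (pr_lb r - Cmod l) ltac:(lra)) as [N HN].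
  specialize (HN N (le_n _)); rewrite Cmod_sub_comm in HN.
  generalize (Cmod_triangle_sub (prN N q) l) (prN_bounds r N q Hr Hq).
  rewrite (Cmod_sub_comm (prN N q) l); lra.
- apply (Clim_bounded_le _ _ _ 0 H1); intros; now apply prN_bounds.
Qed.

(** * Lambert series and the logarithmic derivative of the Euler product *)

Definition nome (w : C) : C := Cexp (- (2 * PI * w))%C.

Lemma Cmod_nome (w : C) : Cmod (nome w) = exp (- (2 * PI * Re w)).
Proof. unfold nome; rewrite Cmod_Cexp; f_equal; destruct w; simpl; ring. Qed.

Lemma Cmod_nome_lt (w : C) : 0 < Re w -> 0 <= Cmod (nome w) < 1.
Proof.
intros Hw; split; [apply Cmod_ge_0|].
rewrite Cmod_nome, <- exp_0; apply exp_increasing.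
generalize PI_RGT_0; nra.
Qed.

(** Minus the image of [log (1 - q^(n+1))] under [q d/dq]. *)
Definition lambert_term (q : C) (n : nat) : C := (INR (S n) * q ^ S n / (1 - q ^ S n))%C.

Definition lambert_bound (r : R) (n : nat) : R := / (1 - r) * (INR (S n) * r ^ S n).

(** With [p = sqrt r], the quantity [n p^n] is at most [p + ... + p^n <= p/(1 - p)], so [n r^n] is
    dominated by a multiple of [p^n]. *)
Lemma summable_lambert_bound (r : R) : 0 <= r < 1 -> summable (lambert_bound r).
Proof.
intros Hr; apply summable_scal; [left; apply Rinv_0_lt_compat; lra|].
set (p := sqrt r).
assert (Hp : 0 <= p < 1).
{ split; [apply sqrt_pos|]; rewrite <- sqrt_1; apply sqrt_lt_1; lra. }
assert (Hpp : r = p * p) by (unfold p; now rewrite sqrt_sqrt by lra).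
apply summable_le with (fun n => / (1 - p) * p ^ S n).
- intros n; split.
  + apply Rmult_le_pos; [apply pos_INR|apply pow_le; lra].
  + rewrite Hpp, Rpow_mult_distr, <- Rmult_assoc.
    apply Rmult_le_compat_r; [apply pow_le; lra|].
    assert (A : INR (S n) * p ^ S n <= rsum (fun i => p ^ S i) (S n)).
    { clear - Hp; assert (G : forall m, INR m * p ^ S n <= rsum (fun _ => p ^ S n) m).
      { induction m as [|m IH]; [simpl; lra|].
        cbn [rsum]; rewrite S_INR; lra. }
      eapply Rle_trans; [apply G|]; apply rsum_le; intros i Hi.
      replace (S n) with (S i + (n - i))%nat by lia; rewrite pow_add.
      assert (p ^ (n - i) <= 1) by (rewrite <- (pow1 (n - i)); apply pow_incr; lra).
      assert (0 <= p ^ S i) by (apply pow_le; lra); nra. }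
    eapply Rle_trans; [apply A|]; eapply Rle_trans; [apply (rsum_geom_le p _ Hp)|].
    assert (0 < / (1 - p)) by (apply Rinv_0_lt_compat; lra).
    unfold Rdiv; nra.
- apply summable_scal; [left; apply Rinv_0_lt_compat; lra|now apply summable_geom].
Qed.

Lemma pow_S_le (r : R) (n : nat) : 0 <= r < 1 -> 0 <= r ^ S n <= r.
Proof.
intros Hr; split; [apply pow_le; lra|]; simpl.
assert (r ^ n <= 1) by (rewrite <- (pow1 n); apply pow_incr; lra).
nra.
Qed.

Lemma one_minus_pow_bound (r : R) (q : C) (n : nat) : 0 <= r < 1 -> Cmod q <= r ->
  1 - r <= Cmod (1 - q ^ S n)%C.
Proof.
intros Hr Hq.
assert (A := Cmod_triangle_sub (RtoC 1) (q ^ S n)); rewrite Cmod_1 in A.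
assert (B : Cmod (q ^ S n) <= r ^ S n).
{ rewrite Cmod_pow; apply pow_incr; split; auto; apply Cmod_ge_0. }
generalize (pow_S_le r n Hr); lra.
Qed.

Lemma lambert_term_bound (r : R) (q : C) (n : nat) : 0 <= r < 1 -> Cmod q <= r ->
  Cmod (lambert_term q n) <= lambert_bound r n.
Proof.
intros Hr Hq; unfold lambert_term, lambert_bound.
assert (L := one_minus_pow_bound r q n Hr Hq).
rewrite Cmod_div, Cmod_mult, Cmod_R, Rabs_pos_eq, Cmod_pow
  by (try apply pos_INR; apply Cmod_gt_0; lra).
unfold Rdiv; rewrite Rmult_comm; apply Rmult_le_compat.
- left; apply Rinv_0_lt_compat; lra.
- apply Rmult_le_pos; [apply pos_INR|apply pow_le, Cmod_ge_0].
- apply Rinv_le_contravar; lra.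
- apply Rmult_le_compat_l; [apply pos_INR|].
  apply pow_incr; split; auto; apply Cmod_ge_0.
Qed.

Lemma Csums_geom (z : C) : Cmod z < 1 -> Csums (fun m => z ^ m)%C (/ (1 - z))%C.
Proof.
intros Hz.
assert (H1 : (1 - z <> 0)%C).
{ apply Cmod_gt_0; assert (A := Cmod_triangle_sub (RtoC 1) z); rewrite Cmod_1 in A; lra. }
apply Clim_ext with (fun n => (1 - z ^ n) * / (1 - z))%C.
- intros n; induction n as [|n IH]; [simpl; ring|].
  cbn [csum]; rewrite <- IH, Cpow_S; field; auto.
- rewrite <- (Cmult_1_l (/ (1 - z))%C) at 1.
  apply Clim_mult; [|apply Clim_const].
  apply Clim_squeeze with (fun n => Cmod z ^ n).
  + intros n; replace (1 - z ^ n - 1)%C with (- z ^ n)%C by ring.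
    rewrite Cmod_opp, Cmod_pow; lra.
  + apply is_lim_seq_geom; rewrite Rabs_pos_eq; auto; apply Cmod_ge_0.
Qed.

Lemma Csums_geom_deriv (z : C) : Cmod z < 1 ->
  Csums (fun n => INR (S n) * z ^ S n)%C (z / (1 - z) ^ 2)%C.
Proof.
intros Hz.
assert (H1 : (1 - z <> 0)%C).
{ apply Cmod_gt_0; assert (A := Cmod_triangle_sub (RtoC 1) z); rewrite Cmod_1 in A; lra. }
set (r := Cmod z).
assert (Hr : 0 <= r < 1) by (split; [apply Cmod_ge_0|auto]).
destruct (Csums_dom (fun n => INR (S n) * z ^ S n)%C (lambert_bound r)) as [l [Hl _]].
{ intros n; unfold lambert_bound; rewrite Cmod_mult, Cmod_R, Rabs_pos_eq, Cmod_pow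
    by apply pos_INR; fold r.
  assert (P : 0 <= INR (S n) * r ^ S n)
    by (apply Rmult_le_pos; [apply pos_INR|apply pow_le; lra]).
  assert (1 <= / (1 - r)) by (rewrite <- Rinv_1; apply Rinv_le_contravar; lra).
  nra. }
{ now apply summable_lambert_bound. }
(* [l = z l + (z + z^2 + ...)] *)
assert (G := Csums_geom z Hz).
assert (E : l = (z * l + z * / (1 - z))%C).
{ apply (Csums_unique (fun n => INR (S n) * z ^ S n)%C); auto.
  apply Clim_shift.
  apply Clim_ext with (fun n => z * csum (fun n => INR (S n) * z ^ S n) n
     + z * csum (fun m => z ^ m) (S n))%C.
  - intros n; induction n as [|n IH]; [simpl; ring|].
    change (csum (fun n => INR (S n) * z ^ S n)%C (S (S n))) with
     (csum (fun n => INR (S n) * z ^ S n)%C (S n) + INR (S (S n)) * z ^ S (S n))%C.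
    transitivity (z * csum (fun n => INR (S n) * z ^ S n) n
      + z * csum (fun m => z ^ m) (S n) + INR (S (S n)) * z ^ S (S n))%C.
    + cbn [csum]; rewrite (S_INR (S n)), RtoC_plus, !Cpow_S; ring.
    + now rewrite IH.
  - apply Clim_plus; [now apply Clim_scal|].
    apply Clim_scal, Clim_shift with (u := csum _); exact G. }
replace (z / (1 - z) ^ 2)%C with l; [exact Hl|].
replace l with ((l - z * l) / (1 - z))%C by (field; auto).
rewrite E at 1; field; auto.
Qed.

(** Each Lambert term is expanded as a geometric series and the double sum [n q^(n m)] is summed
    over [n] instead. With [z = q^m] this gives [z/(1 - z)^2 = 1/(4 sinh^2 (pi m w))]. *)
Lemma lambert_eisen (w : C) : 0 < Re w ->
  exists L, Csums (lambert_term (nome w)) L /\ eisen_sum w (4 * PI ^ 2 * L)%C.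
Proof.
intros Hw; set (q := nome w); assert (Hr := Cmod_nome_lt w Hw); fold q in Hr.
set (r := Cmod q) in *.
destruct (Csums_dom (lambert_term q) (lambert_bound r)) as [L [HL _]].
{ intros n; now apply lambert_term_bound, Rle_refl. }
{ now apply summable_lambert_bound. }
exists L; split; auto.
set (a := fun n m => (INR (S n) * q ^ (S n * S m))%C).
destruct (fubini a (lambert_bound r) (fun m => r ^ m) (lambert_term q) L) as [col [Hc1 Hc2]].
- intros n m; unfold a, lambert_bound.
  rewrite Cmod_mult, Cmod_R, Rabs_pos_eq, Cmod_pow by apply pos_INR; fold r.
  replace (S n * S m)%nat with (S n + m + n * m)%nat by lia.
  rewrite !pow_add.
  assert (P1 : 0 <= r ^ S n) by (apply pow_le; lra).
  assert (P2 : 0 <= r ^ m) by (apply pow_le; lra).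
  assert (P3 : 0 <= r ^ (n * m) <= 1).
  { split; [apply pow_le; lra|]; rewrite <- (pow1 (n * m)); apply pow_incr; lra. }
  assert (P4 : 1 <= / (1 - r)) by (rewrite <- Rinv_1; apply Rinv_le_contravar; lra).
  assert (P5 := pos_INR (S n)).
  assert (P6 : 0 <= INR (S n) * (r ^ S n * r ^ m)) by (apply Rmult_le_pos; [|apply Rmult_le_pos]; auto).
  replace (/ (1 - r) * (INR (S n) * r ^ S n) * r ^ m)
    with (/ (1 - r) * (INR (S n) * (r ^ S n * r ^ m))) by ring.
  apply Rle_trans with (1 * (INR (S n) * (r ^ S n * r ^ m))); [nra|].
  apply Rmult_le_compat_r; auto.
- now apply summable_lambert_bound.
- apply summable_bound with (/ (1 - r)).
  + intros; apply pow_le; lra.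
  + intros n; destruct n as [|n]; [simpl; left; apply Rinv_0_lt_compat; lra|].
    replace (S n) with (1 + n)%nat by lia; rewrite rsum_split.
    generalize (rsum_geom_le r n Hr); simpl.
    replace (/ (1 - r)) with (1 + r / (1 - r)) by (field; lra); lra.
- intros n; unfold a, lambert_term.
  apply Csums_ext with (fun m => (INR (S n) * q ^ S n) * (q ^ S n) ^ m)%C.
  + intros m; rewrite <- Cpow_mult_r, <- Cmult_assoc, <- Cpow_add_r.
    do 2 f_equal; lia.
  + apply Csums_scal, Csums_geom; rewrite Cmod_pow; fold r.
    generalize (pow_S_le r n Hr); lra.
- exact HL.
- unfold eisen_sum; apply Csums_ext with (fun m => 4 * PI ^ 2 * col m)%C;
    [|now apply Csums_scal].
  intros m; set (z := (q ^ S m)%C).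
  assert (Hz : Cmod z < 1).
  { unfold z; rewrite Cmod_pow; fold r; generalize (pow_S_le r m Hr); lra. }
  assert (H1 : (1 - z <> 0)%C).
  { apply Cmod_gt_0; assert (A := Cmod_triangle_sub (RtoC 1) z); rewrite Cmod_1 in A; lra. }
  assert (Ec : col m = (z / (1 - z) ^ 2)%C).
  { apply (Csums_unique (fun n => a n m)); auto.
    apply Csums_ext with (2 := Csums_geom_deriv z Hz).
    intros n; unfold a, z; rewrite <- Cpow_mult_r; do 2 f_equal; lia. }
  rewrite Ec; unfold csinh.
  assert (Ez : z = (Cexp (- (PI * (INR (S m) * w))) * Cexp (- (PI * (INR (S m) * w))))%C).
  { unfold z, q, nome; rewrite Cexp_pow, <- Cexp_plus; f_equal; ring. }
  rewrite Cexp_opp in *; assert (Hx := Cexp_nz (PI * (INR (S m) * w))).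
  set (x := Cexp (PI * (INR (S m) * w))) in *.
  rewrite Ez in *; clearbody x; field; repeat split; auto.
  + intros E0; apply H1; transitivity ((x * x - 1) / (x * x))%C; [field; auto|].
    rewrite E0; unfold Cdiv; ring.
Qed.

Lemma cderiv_prN (g : R -> C) (t : R) (g' : C) (N : nat) :
  (forall n, (1 - Cexp (g t) ^ S n <> 0)%C) -> cderiv g t g' ->
  cderiv (fun s => prN N (Cexp (g s))) t
    (prN N (Cexp (g t)) * (- g' * csum (lambert_term (Cexp (g t))) N))%C.
Proof.
intros Hnz Hg; induction N as [|N IH].
- simpl; eapply cderiv_eq; [apply cderiv_const|ring].
- cbn [prN]; eapply cderiv_eq.
  + apply cderiv_mult; [exact IH|].
    apply cderiv_minus; [apply cderiv_const|apply cderiv_pow, cderiv_Cexp, Hg].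
  + cbn [csum]; set (S0 := csum _ N); unfold lambert_term; specialize (Hnz N).
    rewrite !Cpow_S in *; field; auto.
Qed.

(** A lower bound independent of [s]: the path from [Cexp (- z)] to [Cexp z] stays away from the
    imaginary axis, and the nomes along it lie in one disc of radius less than [1]. *)
Lemma Re_Cexp_path (z : C) (s : R) : Rabs (Im z) < PI / 2 -> Rabs s <= 1 ->
  0 < exp (- Rabs (Re z)) * cos (Im z) <= Re (Cexp (s * z)%C).
Proof.
intros Hz Hs; destruct z as [a b]; simpl in *.
replace (s * a - 0 * b) with (s * a) by ring; replace (s * b + 0 * a) with (s * b) by ring.
assert (Hc : 0 < cos b).
{ apply Rabs_def2 in Hz; apply cos_gt_0; lra. }
assert (Hsb : Rabs (s * b) <= Rabs b).
{ rewrite Rabs_mult; generalize (Rabs_pos b) (Rabs_pos s); nra. }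
assert (Hcos : cos b <= cos (s * b)).
{ assert (E : forall u, cos u = cos (Rabs u)).
  { intros u; unfold Rabs; destruct (Rcase_abs u); auto; now rewrite cos_neg. }
  rewrite (E b), (E (s * b)); apply cos_decr_1; generalize (Rabs_pos b) (Rabs_pos (s * b)); lra. }
assert (Hsa : - Rabs a <= s * a).
{ generalize (Rabs_mult s a) (Rle_abs (- (s * a))) (Rabs_pos a); rewrite Rabs_Ropp.
  assert (Rabs s * Rabs a <= Rabs a) by (generalize (Rabs_pos a); nra). lra. }
split; [apply Rmult_lt_0_compat; auto; apply exp_pos|].
apply Rmult_le_compat; auto; [left; apply exp_pos|lra|now apply exp_mono].
Qed.

Lemma nome_pow_nz (w : C) (n : nat) : 0 < Re w -> (1 - nome w ^ S n <> 0)%C.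
Proof.
intros Hw; assert (Hr := Cmod_nome_lt w Hw).
apply Cmod_gt_0; assert (A := one_minus_pow_bound _ (nome w) n Hr (Rle_refl _)); lra.
Qed.

(** The quotient of the two sides, with [z] replaced by [t z], has zero
    logarithmic derivative by [lambert_eisen] and [eisen_swap], and is [1] at
    [t = 0]. *)
Theorem pr_inversion (z : C) : Rabs (Im z) < PI / 2 ->
  pr (nome (Cexp z)) = (Cexp (- (z / 2) + PI / 12 * Cexp z - PI / 12 * Cexp (- z))
    * pr (nome (Cexp (- z))))%C.
Proof.
intros Hz.
(* [W] runs from [1] to [Cexp z], and [V] is its inverse. Using [z] instead of [Cexp z] as the
   variable makes the square root in the formula simply [Cexp (z / 2)]. *)
set (W := fun t : R => Cexp (t * z)%C).
set (V := fun t : R => Cexp (RtoC (- t) * z)%C).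
assert (HWV : forall t, (W t * V t)%C = RtoC 1).
{ intros t; unfold W, V; rewrite <- Cexp_plus, <- Cexp_0; f_equal.
  rewrite RtoC_opp; ring. }
set (mu := exp (- Rabs (Re z)) * cos (Im z)).
assert (HW : forall t, 0 <= t <= 1 -> 0 < mu <= Re (W t)).
{ intros t Ht; apply Re_Cexp_path; auto; rewrite Rabs_pos_eq; lra. }
assert (HV : forall t, 0 <= t <= 1 -> 0 < mu <= Re (V t)).
{ intros t Ht; apply Re_Cexp_path; auto; rewrite Rabs_Ropp, Rabs_pos_eq; lra. }
assert (Hmu : 0 < mu) by (destruct (HW 0 ltac:(lra)); lra).
set (r := exp (- (2 * PI * mu))).
assert (Hr : 0 <= r < 1).
{ unfold r; split; [left; apply exp_pos|]; rewrite <- exp_0; apply exp_increasing.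
  generalize PI_RGT_0; nra. }
assert (Hnome : forall w, mu <= Re w -> Cmod (nome w) <= r).
{ intros w Hw; rewrite Cmod_nome; apply exp_mono; generalize PI_RGT_0; nra. }
set (EX := fun t : R => Cexp (t * (z / 2) - PI / 12 * W t + PI / 12 * V t)%C).
set (Psi := fun (N : nat) (t : R) =>
  (EX t * (prN N (nome (W t)) * / prN N (nome (V t))))%C).
(* [z * kap N] is the logarithmic derivative of [Psi N]. With the full Lambert series in place of
   their partial sums it would be [0] by [eisen_swap], so it is bounded by their tails. *)
set (kap := fun (N : nat) (t : R) => (1 / 2 - PI / 12 * (W t + V t)
   + 2 * PI * W t * csum (lambert_term (nome (W t))) N
   + 2 * PI * V t * csum (lambert_term (nome (V t))) N)%C).
assert (dW : forall t, cderiv W t (z * W t)%C).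
{ intros t; unfold W; eapply cderiv_eq; [apply cderiv_Cexp, cderiv_mult;
    [apply cderiv_id|apply cderiv_const]|cbv beta; ring]. }
assert (dV : forall t, cderiv V t (- z * V t)%C).
{ intros t; unfold V; eapply cderiv_eq; [apply cderiv_Cexp, cderiv_mult;
    [apply (cderiv_RtoC (fun s => - s) t (-1)); auto_derive; auto; ring
    |apply cderiv_const]|].
  cbv beta; ring. }
assert (HPnz : forall N w, mu <= Re w -> (prN N (nome w) <> 0)%C).
{ intros N w Hw; apply Cmod_gt_0; apply Rlt_le_trans with (1 := pr_lb_pos r).
  apply prN_bounds; auto. }
assert (dPsi : forall N t, 0 <= t <= 1 -> cderiv (Psi N) t (Psi N t * (z * kap N t))%C).
{ intros N t Ht; destruct (HW t Ht) as [_ HWt]; destruct (HV t Ht) as [_ HVt].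
  assert (dn : forall (F : R -> C) F', cderiv F t F' -> mu <= Re (F t) ->
    cderiv (fun s => prN N (nome (F s))) t
     (prN N (nome (F t)) * (2 * PI * F' * csum (lambert_term (nome (F t))) N))%C).
  { intros F F' HF HFt; eapply cderiv_eq.
    - apply (cderiv_prN (fun s => - (2 * PI * F s))%C).
      + intros n; apply nome_pow_nz; lra.
      + apply (cderiv_ext (fun s => - (2 * PI) * F s)%C); [intros; ring|].
        apply cderiv_scal; exact HF.
    - unfold nome; ring. }
  eapply cderiv_eq.
  - apply cderiv_mult; [|apply cderiv_mult; [apply dn; [apply dW|auto]|
      apply cderiv_inv; [now apply HPnz|apply dn; [apply dV|auto]]]].
    unfold EX; apply cderiv_Cexp, cderiv_plus; [apply cderiv_minus|].
    + apply cderiv_mult; [apply cderiv_id|apply cderiv_const].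
    + apply cderiv_scal, dW.
    + apply cderiv_scal, dV.
  - unfold Psi, kap; cbv beta; fold (EX t).
    assert (A := HPnz N (V t) HVt); field; auto. }
assert (Hkap : forall N t, 0 <= t <= 1 ->
  Cmod (kap N t) <= 4 * PI * exp (Cmod z) * rtail (lambert_bound r) N).
{ intros N t Ht; destruct (HW t Ht) as [_ HWt]; destruct (HV t Ht) as [_ HVt].
  destruct (lambert_eisen (W t) ltac:(lra)) as [L [L1 L2]].
  destruct (lambert_eisen (V t) ltac:(lra)) as [L' [L1' L2']].
  assert (HW0 : (W t <> 0)%C) by apply Cexp_nz.
  assert (HVi : V t = (/ W t)%C).
  { replace (V t) with (/ W t * (W t * V t))%C by (field; auto); rewrite HWV; ring. }
  assert (HPI : (RtoC PI <> 0)%C)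
    by (intros E; apply RtoC_inj in E; generalize PI_RGT_0; lra).
  rewrite HVi in L2'.
  assert (S := eisen_swap (W t) ltac:(lra) _ _ L2 L2').
  assert (Z0 : (1 / 2 - PI / 12 * (W t + V t) + 2 * PI * W t * L + 2 * PI * V t * L')%C = RtoC 0).
  { rewrite HVi.
    replace (2 * PI * W t * L)%C with (W t / (2 * PI) * (4 * PI ^ 2 * L))%C by (field; auto).
    rewrite S; field; auto. }
  replace (kap N t) with (- (2 * PI * W t * (L - csum (lambert_term (nome (W t))) N)
     + 2 * PI * V t * (L' - csum (lambert_term (nome (V t))) N)))%C.
  2:{ unfold kap.
      transitivity ((1 / 2 - PI / 12 * (W t + V t) + 2 * PI * W t * L + 2 * PI * V t * L')
       - (2 * PI * W t * (L - csum (lambert_term (nome (W t))) N)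
       + 2 * PI * V t * (L' - csum (lambert_term (nome (V t))) N)))%C;
       [rewrite Z0|]; ring. }
  rewrite Cmod_opp; eapply Rle_trans; [apply Cmod_triangle|].
  assert (B : forall F Lx, mu <= Re F -> Cmod F <= exp (Cmod z) -> Csums (lambert_term (nome F)) Lx ->
    Cmod (2 * PI * F * (Lx - csum (lambert_term (nome F)) N))%C
     <= 2 * PI * exp (Cmod z) * rtail (lambert_bound r) N).
  { intros F Lx HF HF2 HLx.
    assert (P := PI_RGT_0).
    rewrite !Cmod_mult, !Cmod_R, !Rabs_pos_eq by lra.
    apply Rmult_le_compat; try apply Cmod_ge_0.
    - apply Rmult_le_pos; [lra|apply Cmod_ge_0].
    - apply Rmult_le_compat_l; lra.
    - apply (Csums_dom_le (lambert_term (nome F))); auto.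
      + intros n; apply lambert_term_bound; auto.
      + now apply summable_lambert_bound. }
  assert (Bm : forall s, Rabs s <= 1 -> Cmod (Cexp (s * z)%C) <= exp (Cmod z)).
  { intros s Hs; rewrite Cmod_Cexp; apply exp_mono; rewrite re_scal_l.
    generalize (Rle_abs (s * Re z)) (re_le_Cmod z) (Rabs_pos (Re z)); rewrite Rabs_mult.
    intros; assert (Rabs s * Rabs (Re z) <= Rabs (Re z)) by nra; lra. }
  assert (B1 := B (W t) L HWt (Bm t ltac:(rewrite Rabs_pos_eq; lra)) L1).
  assert (B2 := B (V t) L' HVt (Bm (- t) ltac:(rewrite Rabs_Ropp, Rabs_pos_eq; lra)) L1').
  lra. }
set (MP := exp (2 * Cmod z + PI * exp (Cmod z)) * (pr_ub r * / pr_lb r)).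
assert (HPsi : forall N t, 0 <= t <= 1 -> Cmod (Psi N t) <= MP).
{ intros N t Ht; destruct (HW t Ht) as [_ HWt]; destruct (HV t Ht) as [_ HVt].
  unfold Psi, MP; rewrite !Cmod_mult, Cmod_inv by now apply HPnz.
  assert (A1 := prN_bounds r N (nome (W t)) Hr (Hnome _ HWt)).
  assert (A2 := prN_bounds r N (nome (V t)) Hr (Hnome _ HVt)).
  assert (A3 := pr_lb_pos r).
  apply Rmult_le_compat; try apply Cmod_ge_0.
  - apply Rmult_le_pos; [apply Cmod_ge_0|]; left; apply Rinv_0_lt_compat; lra.
  - unfold EX; rewrite Cmod_Cexp; apply exp_mono.
    eapply Rle_trans; [apply Re_le|].
    eapply Rle_trans; [apply Cmod_triangle|].
    assert (B := Cmod_minus_le (t * (z / 2)) (PI / 12 * W t)).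
    assert (C1 : Cmod (t * (z / 2))%C <= Cmod z).
    { rewrite Cmod_mult, Cmod_R, Cmod_div, Cmod_R, !Rabs_pos_eq
        by (try (intros E; apply RtoC_inj in E); lra).
      generalize (Cmod_ge_0 z); nra. }
    assert (Bm : forall s, Rabs s <= 1 -> Cmod (PI / 12 * Cexp (s * z))%C <= PI / 12 * exp (Cmod z)).
    { intros s Hs; rewrite Cmod_mult; rewrite <- RtoC_div, Cmod_R, Rabs_pos_eq
        by (generalize PI_RGT_0; lra).
      apply Rmult_le_compat_l; [generalize PI_RGT_0; lra|].
      rewrite Cmod_Cexp; apply exp_mono; rewrite re_scal_l.
      generalize (Rle_abs (s * Re z)) (re_le_Cmod z) (Rabs_pos (Re z)); rewrite Rabs_mult.
      intros; assert (Rabs s * Rabs (Re z) <= Rabs (Re z)) by nra; lra. }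
    assert (D1 := Bm t ltac:(rewrite Rabs_pos_eq; lra)); fold (W t) in D1.
    assert (D2 := Bm (- t) ltac:(rewrite Rabs_Ropp, Rabs_pos_eq; lra)); fold (V t) in D2.
    assert (0 <= PI * exp (Cmod z)).
    { apply Rmult_le_pos; [generalize PI_RGT_0; lra|left; apply exp_pos]. }
    generalize (Cmod_ge_0 z); lra.
  - apply Rmult_le_compat; try apply Cmod_ge_0; [|lra|].
    + left; apply Rinv_0_lt_compat; lra.
    + apply Rinv_le_contravar; lra. }
assert (HW1 : W 1 = Cexp z) by (unfold W; f_equal; ring).
assert (HV1 : V 1 = Cexp (- z)%C) by (unfold V; f_equal; rewrite RtoC_opp; ring).
assert (HPsi0 : forall N, Psi N 0 = RtoC 1).
{ intros N; unfold Psi, EX.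
  assert (E1 : W 0 = RtoC 1) by (unfold W; rewrite Cmult_0_l; apply Cexp_0).
  assert (E2 : V 0 = RtoC 1) by (unfold V; rewrite Ropp_0, Cmult_0_l; apply Cexp_0).
  rewrite E1, E2.
  replace (0 * (z / 2) - PI / 12 * 1 + PI / 12 * 1)%C with (RtoC 0) by ring.
  rewrite Cexp_0; field; apply HPnz; rewrite <- E1; apply (HW 0); lra. }
assert (HL1 : Clim (fun N => Psi N 1) (RtoC 1)).
{ apply Clim_squeeze with (fun N => (MP * (Cmod z * (4 * PI * exp (Cmod z)))) * rtail (lambert_bound r) N).
  2:{ replace (Finite 0) with (Finite ((MP * (Cmod z * (4 * PI * exp (Cmod z)))) * 0)) by (f_equal; ring).
      apply is_lim_seq_mult'; [apply is_lim_seq_const|].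
      apply rtail_lim; now apply summable_lambert_bound. }
  intros N; rewrite <- (HPsi0 N).
  eapply Rle_trans; [apply (cderiv_bounded (Psi N) (fun t => Psi N t * (z * kap N t))%C
    (MP * (Cmod z * (4 * PI * exp (Cmod z) * rtail (lambert_bound r) N)))); [lra|auto|]|].
  - intros t Ht; rewrite !Cmod_mult.
    apply Rmult_le_compat; try apply Cmod_ge_0; auto.
    + apply Rmult_le_pos; apply Cmod_ge_0.
    + apply Rmult_le_compat_l; [apply Cmod_ge_0|auto].
  - right; ring. }
destruct (HW 1 ltac:(lra)) as [_ HWr]; destruct (HV 1 ltac:(lra)) as [_ HVr].
destruct (pr_spec r (nome (W 1)) Hr (Hnome _ HWr)) as [P1 [_ P1']].
destruct (pr_spec r (nome (V 1)) Hr (Hnome _ HVr)) as [P2 [_ P2']].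
assert (P3 : (pr (nome (V 1)) <> 0)%C) by (apply Cmod_gt_0; generalize (pr_lb_pos r); lra).
assert (E : (EX 1 * (pr (nome (W 1)) * / pr (nome (V 1))))%C = RtoC 1).
{ apply (Clim_unique (fun N => Psi N 1)); auto.
  unfold Psi; apply Clim_scal, Clim_mult; auto.
  now apply Clim_inv. }
unfold EX in E; rewrite HW1, HV1 in *.
replace (1 * (z / 2) - PI / 12 * Cexp z + PI / 12 * Cexp (- z))%C
  with (- (- (z / 2) + PI / 12 * Cexp z - PI / 12 * Cexp (- z)))%C in E by ring.
rewrite Cexp_opp in E.
assert (Hx := Cexp_nz (- (z / 2) + PI / 12 * Cexp z - PI / 12 * Cexp (- z))).
set (x := Cexp (- (z / 2) + PI / 12 * Cexp z - PI / 12 * Cexp (- z))) in *.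
set (p2 := pr (nome (Cexp (- z)))) in *.
rewrite <- (Cmult_1_r (x * p2)%C), <- E.
field; auto.
Qed.

(** A logarithm on the right half plane only. *)
Definition Clog (w : C) : C := (ln (Cmod w), atan (Im w / Re w)).

Lemma Clog_spec (w : C) : 0 < Re w ->
  Cexp (Clog w) = w /\ Rabs (Im (Clog w)) < PI / 2.
Proof.
intros Hw; split.
- destruct w as [x y]; simpl in Hw; unfold Cexp, Clog; simpl Re; simpl Im.
  assert (H0 : 0 < Cmod (x, y)) by (apply Cmod_gt_0, Re_pos_nz; exact Hw).
  rewrite exp_ln, cos_atan, sin_atan by auto.
  assert (E : Cmod (x, y) = x * sqrt (1 + Rsqr (y / x))).
  { unfold Cmod; simpl fst; simpl snd.
    replace (x ^ 2 + y ^ 2) with (x ^ 2 * (1 + Rsqr (y / x)))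
      by (unfold Rsqr; field; lra).
    rewrite sqrt_mult, sqrt_pow2 by
      (try apply pow2_ge_0; try lra; generalize (Rle_0_sqr (y / x)); lra); auto. }
  assert (Hs : 0 < sqrt (1 + Rsqr (y / x)))
    by (apply sqrt_lt_R0; generalize (Rle_0_sqr (y / x)); lra).
  rewrite E; apply Ceq; simpl; field; lra.
- simpl; apply Rabs_def1; generalize (atan_bound (Im w / Re w)); lra.
Qed.

Lemma Re_Cexp_pos (z : C) : Rabs (Im z) < PI / 2 -> 0 < Re (Cexp z).
Proof.
intros H; simpl; apply Rmult_lt_0_compat; [apply exp_pos|].
apply Rabs_def2 in H; apply cos_gt_0; lra.
Qed.

Lemma Im_eq_atan (z : C) : Rabs (Im z) < PI / 2 ->
  Im z = atan (Im (Cexp z) / Re (Cexp z)).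
Proof.
intros H; assert (H' := Rabs_def2 _ _ H).
assert (Hc : 0 < cos (Im z)) by (apply cos_gt_0; lra).
simpl; replace (exp (Re z) * sin (Im z) / (exp (Re z) * cos (Im z)))
  with (tan (Im z)).
- symmetry; apply atan_tan; lra.
- unfold tan; field; split; [lra|apply Rgt_not_eq, exp_pos].
Qed.

(** * The Euler product near an arbitrary rational point *)

Lemma nome_periodic (w : C) (k : Z) : nome (w - Ci * IZR k)%C = nome w.
Proof.
unfold nome.
replace (- (2 * PI * (w - Ci * IZR k)))%C
  with (- (2 * PI * w) + 2 * PI * Ci * IZR k)%C by ring.
rewrite Cexp_plus, Cexp_2PI_Z; ring.
Qed.

Lemma RtoC_INR_nz (n : nat) : (0 < n)%nat -> (RtoC (INR n) <> 0)%C.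
Proof.
intros Hn E; apply RtoC_inj in E; revert E; apply not_0_INR; lia.
Qed.

Lemma Zgcd_of_nat (a b : nat) : Z.gcd (Z.of_nat a) (Z.of_nat b) = Z.of_nat (Nat.gcd a b).
Proof.
assert (H : forall q c, (q | Z.of_nat c)%Z -> Nat.divide (Z.abs_nat q) c).
{ intros q c [d Hd]; exists (Z.abs_nat d).
  rewrite <- Zabs2Nat.inj_mul, <- Hd; now rewrite Zabs2Nat.id. }
apply Z.gcd_unique.
- lia.
- destruct (Nat.gcd_divide_l a b) as [c Hc]; exists (Z.of_nat c).
  rewrite Hc at 1; apply Nat2Z.inj_mul.
- destruct (Nat.gcd_divide_r a b) as [c Hc]; exists (Z.of_nat c).
  rewrite Hc at 1; apply Nat2Z.inj_mul.
- intros q Ha Hb.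
  destruct (Nat.gcd_greatest a b (Z.abs_nat q) (H _ _ Ha) (H _ _ Hb)) as [c Hc].
  apply Z.divide_abs_l; exists (Z.of_nat c).
  rewrite Hc, Nat2Z.inj_mul, Zabs2Nat.id_abs; reflexivity.
Qed.

(** Euclid's algorithm on [(h, j)]: each step is one inversion, and the
    reciprocity law of Dedekind sums accounts for the phase it produces. *)
Lemma pr_transform (j : nat) : (0 < j)%nat -> forall h : Z, Z.gcd h (Z.of_nat j) = 1%Z ->
  exists xi : R, forall z : C, Rabs (Im z) < PI / 2 ->
  pr (nome (Cexp z - Ci * RtoC (IZR h / INR j))) =
  (Cexp (PI / 12 * Cexp z - PI * Ci * dsZ h j - (z + ln (INR j)) / 2
     - PI / 12 * (/ (INR j ^ 2 * Cexp z)))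
   * pr (nome (/ (INR j ^ 2 * Cexp z) - Ci * xi)))%C.
Proof.
induction j as [j IH] using (well_founded_induction lt_wf); intros Hj h Hg.
assert (Hj' : 0 < INR j) by (apply lt_0_INR; lia).
assert (HjC := RtoC_INR_nz j Hj).
set (h0 := Z.to_nat (h mod Z.of_nat j)).
assert (Hh0 : Z.of_nat h0 = (h mod Z.of_nat j)%Z).
{ unfold h0; apply Z2Nat.id; apply Z.mod_pos_bound; lia. }
assert (Hh0j : (h0 < j)%nat).
{ apply Nat2Z.inj_lt; rewrite Hh0; apply Z.mod_pos_bound; lia. }
assert (Hper : forall z, nome (Cexp z - Ci * RtoC (IZR h / INR j))%C
   = nome (Cexp z - Ci * RtoC (INR h0 / INR j))%C).
{ intros z.
  rewrite <- (nome_periodic (Cexp z - Ci * RtoC (INR h0 / INR j))%C (h / Z.of_nat j)).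
  f_equal.
  replace (IZR h) with (INR j * IZR (h / Z.of_nat j) + INR h0).
  - rewrite !RtoC_div, RtoC_plus, RtoC_mult by lra; field; auto.
  - rewrite !INR_IZR_INZ, Hh0, <- mult_IZR, <- plus_IZR; f_equal.
    symmetry; apply Z.div_mod; lia. }
assert (Hds : dsZ h j = dsZ (Z.of_nat h0) j).
{ apply dsZ_mod; auto; rewrite Hh0, Z.mod_mod; lia. }
assert (Hg0 : Z.gcd (Z.of_nat h0) (Z.of_nat j) = 1%Z).
{ rewrite Hh0, Z.gcd_mod, Z.gcd_comm by lia; exact Hg. }
destruct (Nat.eq_dec h0 0) as [E0|E0].
- assert (Ej : j = 1%nat).
  { rewrite E0 in Hg0; simpl Z.of_nat in Hg0; rewrite Z.gcd_0_l in Hg0; lia. }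
  exists 0; intros z Hz; rewrite Hper, Hds, E0; subst j.
  replace (Cexp z - Ci * RtoC (INR 0 / INR 1))%C with (Cexp z)
    by (simpl; unfold Rdiv; rewrite Rmult_0_l; ring).
  rewrite pr_inversion by auto.
  simpl (INR 1); rewrite ln_1.
  replace (dsZ (Z.of_nat 0) 1) with 0 by reflexivity.
  assert (Hx := Cexp_nz z); rewrite (Cexp_opp z).
  replace (/ (1 ^ 2 * Cexp z))%C with (/ Cexp z)%C by (f_equal; ring).
  f_equal; [apply Cexp_eq; field; auto|].
  f_equal; f_equal; ring.
- assert (Hh0' : 0 < INR h0) by (apply lt_0_INR; lia).
  assert (HhC := RtoC_INR_nz h0 ltac:(lia)).
  assert (Hgn : Nat.gcd h0 j = 1%nat) by (apply Nat2Z.inj; rewrite <- Zgcd_of_nat; exact Hg0).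
  destruct (IH h0 Hh0j ltac:(lia) (- Z.of_nat j)%Z) as [xi Hxi].
  { rewrite Z.gcd_opp_l, Z.gcd_comm; exact Hg0. }
  (* No closed form of the shift is kept: being real, it leaves the modulus of the transformed nome
     unchanged, and only this modulus is estimated later. *)
  exists (xi - 1 / (INR j * INR h0)); intros z Hz; rewrite Hper, Hds.
  set (Z1 := Cexp z); assert (HZ1 : 0 < Re Z1) by now apply Re_Cexp_pos.
  assert (HZ1C := Re_pos_nz Z1 HZ1).
  set (c := INR h0 / INR j); assert (Hc : 0 < c) by (now apply Rdiv_lt_0_compat).
  set (w := (Z1 - Ci * c)%C).
  assert (HwR : Re w = Re Z1) by (unfold w, Re; simpl; ring).
  assert (HwI : Im w = Im Z1 - c) by (unfold w, Im; simpl; ring).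
  assert (HwP : 0 < Re w) by lra.
  assert (HwC := Re_pos_nz w HwP).
  destruct (Clog_spec w HwP) as [Hw1 Hw2]; set (z1 := Clog w) in *.
  (* A logarithm of [- i j Z1 / (h0 w)]. Shifted by the rational [- j / h0] it gives [1 / w], the
     argument left by the inversion, so the induction hypothesis for [h0] applies at [z2]. *)
  set (z2 := (z - z1 + ln (INR j / INR h0) - PI / 2 * Ci)%C).
  assert (Him : Rabs (Im z2) < PI / 2).
  { assert (I2 : Im z2 = Im z - Im z1 - PI / 2).
    { unfold z2, Cminus; rewrite !im_plus, !im_opp, im_RtoC, im_mult.
      rewrite <- RtoC_div, re_RtoC, im_RtoC by lra; simpl; ring. }
    assert (A1 := Im_eq_atan z Hz); fold Z1 in A1.
    assert (A2 : Im z1 = atan (Im w / Re w)) by reflexivity.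
    (* Moving down by [i c] lowers the argument. With both arguments within [pi/2] of [0], this
       places [Im z - Im z1] strictly between [0] and [pi], hence [z2] in the admissible strip. *)
    assert (L : Im z1 < Im z).
    { rewrite A1, A2; apply atan_increasing; rewrite HwR, HwI.
      apply Rmult_lt_compat_r; [apply Rinv_0_lt_compat|]; lra. }
    apply Rabs_def2 in Hz; apply Rabs_def2 in Hw2; apply Rabs_def1; lra. }
  assert (E2 : Cexp z2 = (- Ci * INR j * Z1 / (INR h0 * w))%C).
  { unfold z2, Cminus; rewrite !Cexp_plus, !Cexp_opp, Cexp_half_PI, Cexp_RtoC.
    rewrite Hw1, Cinv_Ci; fold Z1.
    rewrite exp_ln, RtoC_div by (try apply Rdiv_lt_0_compat; lra).
    field; auto. }
  rewrite <- Hw1, pr_inversion, Hw1 by auto.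
  assert (EI : Cexp (- z1) = (Cexp z2 - Ci * RtoC (IZR (- Z.of_nat j) / INR h0))%C).
  { rewrite Cexp_opp, Hw1, E2, opp_IZR, <- INR_IZR_INZ.
    rewrite RtoC_div, RtoC_opp by lra.
    transitivity ((Ci * INR j * w - Ci * INR j * Z1) / (INR h0 * w))%C; [|field; auto].
    unfold w at 2; unfold c; rewrite RtoC_div by lra.
    transitivity ((- (Ci * Ci) * INR h0) / (INR h0 * w))%C; [rewrite Ci_sq|]; field; auto. }
  rewrite EI at 2; rewrite (Hxi z2 Him).
  assert (EJ : (/ (INR h0 ^ 2 * Cexp z2))%C
     = (/ (INR j ^ 2 * Z1) + Ci / (INR j * INR h0))%C).
  { rewrite E2; assert (Hi := Ci_nz).
    transitivity (w * / - Ci / (INR h0 * INR j * Z1))%C; [field; auto|].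
    replace (/ - Ci)%C with Ci.
    2:{ transitivity (- (/ Ci))%C; [rewrite Cinv_Ci; ring|field; auto]. }
    unfold w, c; rewrite RtoC_div by lra.
    transitivity ((Ci * Z1 - (Ci * Ci) * INR h0 / INR j) / (INR h0 * INR j * Z1))%C;
      [field; auto|rewrite Ci_sq; field; auto]. }
  rewrite EJ.
  replace (/ (INR j ^ 2 * Z1) + Ci / (INR j * INR h0) - Ci * xi)%C
    with (/ (INR j ^ 2 * Z1) - Ci * RtoC (xi - 1 / (INR j * INR h0)))%C.
  2:{ rewrite RtoC_minus, RtoC_div, RtoC_mult by (apply Rgt_not_eq, Rmult_lt_0_compat; lra).
      field; auto. }
  rewrite Cmult_assoc, <- Cexp_plus; f_equal; apply Cexp_eq.
  rewrite dsZ_opp by (auto; try lia; rewrite Z.gcd_comm; exact Hg0).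
  assert (R := dsZ_reciprocity h0 j ltac:(lia) Hj Hgn).
  assert (R' : dsZ (Z.of_nat j) h0 = - 1 / 4 + (INR h0 / INR j + INR j / INR h0
     + 1 / (INR h0 * INR j)) / 12 - dsZ (Z.of_nat h0) j) by lra.
  assert (EI2 : Cexp z2 = (Cexp (- z1) + Ci * RtoC (IZR (- Z.of_nat j) / INR h0))%C)
    by (rewrite EI; ring).
  rewrite EI2, R', opp_IZR, <- INR_IZR_INZ.
  assert (Hln : RtoC (ln (INR j / INR h0)) = (ln (INR j) - ln (INR h0))%C).
  { rewrite ln_div, RtoC_minus by lra; reflexivity. }
  unfold z2; rewrite Hln; unfold w at 1, c.
  assert (H12 : INR h0 * INR j <> 0) by (apply Rgt_not_eq, Rmult_lt_0_compat; lra).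
  unfold Rdiv; rewrite !RtoC_opp, !RtoC_minus, !RtoC_plus, !RtoC_mult, !RtoC_plus,
    !RtoC_mult, !RtoC_inv, !RtoC_opp, !RtoC_mult by lra.
  unfold Cdiv.
  field; repeat split; auto.
Qed.

(** * The generating function near a rational point *)

Lemma nome_pow (w : C) (m : nat) : (nome w ^ m)%C = nome (INR m * w)%C.
Proof. unfold nome; rewrite Cexp_pow; f_equal; ring. Qed.

Lemma gcd_1_l (j : nat) : Nat.gcd 1 j = 1%nat.
Proof. apply Nat.divide_1_r, Nat.gcd_divide_l. Qed.

Lemma coprime_mul (a b c : nat) : Nat.gcd a c = 1%nat -> Nat.gcd b c = 1%nat ->
  Nat.gcd (a * b) c = 1%nat.
Proof.
intros Ha Hb; set (d := Nat.gcd (a * b) c).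
assert (D1 : Nat.divide d (a * b)) by apply Nat.gcd_divide_l.
assert (D2 : Nat.divide d c) by apply Nat.gcd_divide_r.
assert (G : Nat.gcd d a = 1%nat).
{ apply Nat.divide_1_r; rewrite <- Ha; apply Nat.gcd_greatest.
  - apply Nat.gcd_divide_r.
  - apply Nat.divide_trans with (2 := D2), Nat.gcd_divide_l. }
apply Nat.gauss in D1; [|exact G].
apply Nat.divide_1_r; rewrite <- Hb; now apply Nat.gcd_greatest.
Qed.

(** [m h / j] has lowest terms [(m h / g) / (j / g)], and [(j / g)^2 m = j^2 / c]. The factor [m] is
    absorbed by adding [ln m] to the logarithm [z], which does not change its imaginary part. *)
Lemma pr_transform_mul (m j h : nat) : (0 < m)%nat -> (0 < j)%nat ->
  Nat.gcd h j = 1%nat ->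
  let g := Nat.gcd m j in let c := INR g ^ 2 / INR m in
  exists xi : R, forall z : C, Rabs (Im z) < PI / 2 ->
  pr (nome (INR m * (Cexp z - Ci * RtoC (INR h / INR j)))) =
  (Cexp (PI / 12 * (INR m * Cexp z) - PI * Ci * dedekind_sum (m * h / g) (j / g)
     - (z + RtoC (ln (INR m) + ln (INR j) - ln (INR g))) / 2
     - PI / 12 * (c * / (INR j ^ 2 * Cexp z)))
   * pr (nome (c * / (INR j ^ 2 * Cexp z) - Ci * xi)))%C.
Proof.
intros Hm Hj Hg g c.
assert (Dm : Nat.divide g m) by apply Nat.gcd_divide_l.
assert (Dj : Nat.divide g j) by apply Nat.gcd_divide_r.
assert (Hg0 : (g <> 0)%nat).
{ intros E; destruct Dm as [x Hx]; rewrite E in Hx; lia. }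
destruct Dm as [m' Em]; destruct Dj as [j' Ej].
assert (Ejg : (j / g = j')%nat) by (rewrite Ej; now apply Nat.div_mul).
assert (Emg : (m * h / g = m' * h)%nat).
{ rewrite Em; replace (m' * g * h)%nat with (m' * h * g)%nat by ring; now apply Nat.div_mul. }
assert (Hj' : (0 < j')%nat) by (destruct j'; simpl in Ej; lia).
assert (Hco : Nat.gcd (m' * h) j' = 1%nat).
{ apply coprime_mul.
  - assert (X := Nat.gcd_div_gcd m j g Hg0 eq_refl).
    rewrite Ejg in X; rewrite Em in X at 1; now rewrite Nat.div_mul in X.
  - apply Nat.divide_1_r; rewrite <- Hg; apply Nat.gcd_greatest.
    + apply Nat.gcd_divide_l.
    + apply Nat.divide_trans with j'; [apply Nat.gcd_divide_r|exists g; rewrite Ej; ring]. }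
destruct (pr_transform j' Hj' (Z.of_nat (m' * h))) as [xi Hxi].
{ rewrite Zgcd_of_nat, Hco; reflexivity. }
exists xi; intros z Hz.
rewrite Emg, Ejg, dedekind_sum_dsZ.
assert (Pm : 0 < INR m) by (apply lt_0_INR; lia).
assert (Pj : 0 < INR j') by (apply lt_0_INR; lia).
assert (Pg : 0 < INR g) by (apply lt_0_INR; lia).
assert (Rm : INR m = INR m' * INR g) by (rewrite Em at 1; apply mult_INR).
assert (Rj : INR j = INR j' * INR g) by (rewrite Ej at 1; apply mult_INR).
specialize (Hxi (z + ln (INR m))%C).
assert (Cm := RtoC_INR_nz m Hm); assert (Cj := RtoC_INR_nz j' Hj').
assert (Cg := RtoC_INR_nz g ltac:(lia)).
assert (Ez : Cexp (z + ln (INR m)) = (INR m * Cexp z)%C).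
{ rewrite Cexp_plus, Cexp_RtoC, exp_ln by auto; ring. }
rewrite Ez in Hxi.
assert (Hx := Cexp_nz z).
replace (INR m * (Cexp z - Ci * RtoC (INR h / INR j)))%C with
  (INR m * Cexp z - Ci * RtoC (IZR (Z.of_nat (m' * h)) / INR j'))%C.
2:{ rewrite <- INR_IZR_INZ, mult_INR, Rj, !RtoC_div, !RtoC_mult by nra.
    rewrite Rm, RtoC_mult; field; auto. }
rewrite Hxi by (rewrite im_plus, im_RtoC, Rplus_0_r; exact Hz).
assert (Ec : (/ (INR j' ^ 2 * (INR m * Cexp z)))%C = (c * / (INR j ^ 2 * Cexp z))%C).
{ unfold c; rewrite Rj, RtoC_div, RtoC_pow, RtoC_mult by lra; field; auto. }
rewrite Ec; f_equal; apply Cexp_eq.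
rewrite Rj, (ln_mult (INR j')) by auto.
replace (ln (INR m) + (ln (INR j') + ln (INR g)) - ln (INR g))
  with (ln (INR m) + ln (INR j')) by ring.
rewrite RtoC_plus; unfold Cdiv; ring.
Qed.

Definition eta_quotient (P : C -> C) (k : nat) (q : C) : C :=
  (P (q ^ 2) * P (q ^ (2 * k + 1)) / (P q ^ 3 * P (q ^ (4 * k + 2))))%C.

(** The transformed nome of the factor [m_r] has modulus [exp (- 2 pi cusp_width t)] with
    [t = Re (1/(j^2 z))]. Up to normalisation this is the order of the eta function of argument
    multiplied by [m_r] at a cusp of denominator [j]. *)
Definition cusp_width (k j r : nat) : R :=
  INR (Nat.gcd (m_ k r) j) ^ 2 / INR (m_ k r).

(** Everything depends only on [j] modulo [6] or [10], so it is a finite check. The bound [1/10] is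
    attained for [m_r = 10] and trivial gcd. The decisive inequality is
    [alpha_ k j <= 24 * cusp_width k j r]; it is an equality for [k = 2], [r = 4] and [j] prime to
    [10]. *)
Lemma cusp_facts (k j : nat) : (k = 1 \/ k = 2)%nat -> (0 < j)%nat ->
  alpha_ k j = 3 * cusp_width k j 1 - cusp_width k j 2 - cusp_width k j 3
    + cusp_width k j 4 /\
  0 <= alpha_ k j <= 6 /\
  (forall r, (1 <= r <= 4)%nat ->
     1 / 10 <= cusp_width k j r /\ alpha_ k j <= 24 * cusp_width k j r) /\
  (Nat.gcd (m_ k 4) j = Nat.gcd (m_ k 2) j * Nat.gcd (m_ k 3) j)%nat.
Proof.
intros Hk Hj.
assert (Hr : forall N, (0 < N)%nat -> exists q r, (j = r + q * N /\ r < N)%nat).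
{ intros N HN; exists (j / N)%nat, (j mod N)%nat; split.
  - rewrite (Nat.div_mod_eq j N) at 1; ring.
  - apply Nat.mod_upper_bound; lia. }
assert (Hall : forall g2 gM : nat,
  Nat.gcd 2 j = g2 -> Nat.gcd (2 * k + 1) j = gM -> Nat.gcd (4 * k + 2) j = (g2 * gM)%nat ->
  (g2 = 2 /\ Nat.even j = true \/ g2 = 1 /\ Nat.even j = false)%nat ->
  (gM = 1 \/ gM = 2 * k + 1)%nat ->
  alpha_ k j = 3 * cusp_width k j 1 - cusp_width k j 2 - cusp_width k j 3
    + cusp_width k j 4 /\
  0 <= alpha_ k j <= 6 /\
  (forall r, (1 <= r <= 4)%nat ->
     1 / 10 <= cusp_width k j r /\ alpha_ k j <= 24 * cusp_width k j r) /\
  (Nat.gcd (m_ k 4) j = Nat.gcd (m_ k 2) j * Nat.gcd (m_ k 3) j)%nat).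
{ intros g2 gM E2 EM E4 H2 HM.
  assert (W : forall r, (1 <= r <= 4)%nat ->
    cusp_width k j r = match r with 1%nat => 1 | 2%nat => INR g2 ^ 2 / 2
      | 3%nat => INR gM ^ 2 / (2 * INR k + 1)
      | _ => INR (g2 * gM) ^ 2 / (4 * INR k + 2) end).
  { intros r Hr'; unfold cusp_width.
    destruct r as [|[|[|[|[|r]]]]]; try lia; simpl m_.
    - replace (Nat.gcd 1 j) with 1%nat by (symmetry; apply gcd_1_l); simpl; field.
    - rewrite E2; reflexivity.
    - replace (k + (k + 0) + 1)%nat with (2 * k + 1)%nat by lia.
      rewrite EM, plus_INR, mult_INR; reflexivity.
    - replace (k + (k + (k + (k + 0))) + 2)%nat with (4 * k + 2)%nat by lia.
      rewrite E4, (plus_INR (4 * k)), (mult_INR 4 k); replace (INR 4) with 4 by (simpl; ring).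
      replace (INR 2) with 2 by (simpl; ring); reflexivity. }
  split; [|split; [|split]].
  - rewrite !W by lia; unfold alpha_; rewrite EM.
    destruct H2 as [[-> ->]|[-> ->]]; rewrite mult_INR;
      destruct Hk as [-> | ->]; destruct HM as [-> | ->]; simpl; field.
  - unfold alpha_; rewrite EM.
    destruct H2 as [[-> ->]|[-> ->]];
      destruct Hk as [-> | ->]; destruct HM as [-> | ->]; simpl; lra.
  - intros r Hr'; rewrite W by auto; unfold alpha_; rewrite EM.
    destruct r as [|[|[|[|[|r]]]]]; try lia;
    destruct H2 as [[-> ->]|[-> ->]]; rewrite ?mult_INR;
      destruct Hk as [-> | ->]; destruct HM as [-> | ->]; simpl; lra.
  - simpl m_; replace (k + (k + (k + (k + 0))) + 2)%nat with (4 * k + 2)%nat by lia.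
    replace (k + (k + 0) + 1)%nat with (2 * k + 1)%nat by lia.
    rewrite E2, EM; exact E4. }
assert (Ev : forall r q N, Nat.even N = true -> Nat.even (r + q * N) = Nat.even r).
{ intros r q N HN; rewrite Nat.even_add, Nat.even_mul, HN, Bool.orb_true_r.
  now destruct (Nat.even r). }
assert (Gd : forall a r q N c, (N = c * a)%nat -> Nat.gcd a (r + q * N) = Nat.gcd a r).
{ intros a r q N c ->; replace (q * (c * a))%nat with ((q * c) * a)%nat by ring.
  apply Nat.gcd_add_mult_diag_r. }
destruct Hk as [-> | ->].
- destruct (Hr 6%nat ltac:(lia)) as [q [r [E L]]].
  apply (Hall (Nat.gcd 2 r) (Nat.gcd 3 r)); rewrite ?E.
  + now apply (Gd 2 r q 6 3)%nat.
  + now apply (Gd 3 r q 6 2)%nat.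
  + rewrite (Gd _ r q 6 1)%nat by reflexivity.
    destruct r as [|[|[|[|[|[|r]]]]]]; try lia; reflexivity.
  + rewrite Ev by reflexivity.
    destruct r as [|[|[|[|[|[|r]]]]]]; try lia; simpl; auto.
  + destruct r as [|[|[|[|[|[|r]]]]]]; try lia; simpl; auto.
- destruct (Hr 10%nat ltac:(lia)) as [q [r [E L]]].
  apply (Hall (Nat.gcd 2 r) (Nat.gcd 5 r)); rewrite ?E.
  + now apply (Gd 2 r q 10 5)%nat.
  + now apply (Gd 5 r q 10 2)%nat.
  + rewrite (Gd _ r q 10 1)%nat by reflexivity.
    destruct r as [|[|[|[|[|[|[|[|[|[|r]]]]]]]]]]; try lia; reflexivity.
  + rewrite Ev by reflexivity.
    destruct r as [|[|[|[|[|[|[|[|[|[|r]]]]]]]]]]; try lia; simpl; auto.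
  + destruct r as [|[|[|[|[|[|[|[|[|[|r]]]]]]]]]]; try lia; simpl; auto.
Qed.

Lemma pr_near_1 (r : R) (q : C) : 0 <= r < 1 -> Cmod q <= r ->
  Cmod (pr q - 1)%C <= pr_ub r / (1 - r) * Cmod q.
Proof.
intros Hr Hq; assert (H0 := Cmod_ge_0 q).
destruct (pr_spec (Cmod q) q ltac:(lra) (Rle_refl _)) as [_ [H _]].
specialize (H O); simpl prN in H; rewrite pow_1 in H.
eapply Rle_trans; [apply H|].
replace (pr_ub r / (1 - r) * Cmod q) with (pr_ub r * (Cmod q / (1 - r))) by (field; lra).
apply Rmult_le_compat; try (left; apply pr_ub_pos).
- apply Rdiv_le_0_compat; lra.
- apply exp_mono; unfold Rdiv; apply Rmult_le_compat; try lra.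
  + left; apply Rinv_0_lt_compat; lra.
  + apply Rinv_le_contravar; lra.
- unfold Rdiv; apply Rmult_le_compat_l; auto; apply Rinv_le_contravar; lra.
Qed.

(** The difference from [1] is written as a sum of products with one factor [pr q - 1] each;
    [pr_near_1] bounds that factor, and the others are bounded on the disc of radius [r]. *)
Lemma eta_ratio_bound (r : R) : 0 <= r < 1 -> exists K, 0 < K /\
  forall y q1 q2 q3 q4, (forall q, q = q1 \/ q = q2 \/ q = q3 \/ q = q4 ->
    Cmod q <= r /\ Cmod q <= y) ->
  Cmod (pr q2 * pr q3 / (pr q1 ^ 3 * pr q4) - 1)%C <= K * y.
Proof.
intros Hr; set (B := pr_ub r); set (b := pr_lb r); set (K := B / (1 - r)).
assert (HB : 0 < B) by apply pr_ub_pos; assert (Hb : 0 < b) by apply pr_lb_pos.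
assert (HK : 0 < K) by (apply Rdiv_lt_0_compat; lra).
exists (/ b ^ 4 * (K * (B + 1) + K * (B ^ 3 + B ^ 2 + B + 1))).
assert (Hb4 : 0 < / b ^ 4) by (apply Rinv_0_lt_compat, pow_lt; auto).
assert (HB2 := pow_lt B 2 HB); assert (HB3 := pow_lt B 3 HB).
split; [apply Rmult_lt_0_compat; auto; nra|].
intros y q1 q2 q3 q4 Hq.
assert (S : forall q, q = q1 \/ q = q2 \/ q = q3 \/ q = q4 ->
  b <= Cmod (pr q) <= B /\ Cmod (pr q - 1)%C <= K * y).
{ intros q H; destruct (Hq q H) as [A1 A2]; split; [now apply (pr_spec r)|].
  eapply Rle_trans; [apply (pr_near_1 r); auto|]; fold B; fold K.
  apply Rmult_le_compat_l; lra. }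
destruct (S q1 ltac:(auto)) as [U1 V1]; destruct (S q2 ltac:(auto)) as [U2 V2].
destruct (S q3 ltac:(auto)) as [U3 V3]; destruct (S q4 ltac:(auto)) as [U4 V4].
clear S Hq.
set (p1 := pr q1) in *; set (p2 := pr q2) in *; set (p3 := pr q3) in *; set (p4 := pr q4) in *.
assert (N1 : (p1 <> 0)%C) by (apply Cmod_gt_0; lra).
assert (N4 : (p4 <> 0)%C) by (apply Cmod_gt_0; lra).
replace (p2 * p3 / (p1 ^ 3 * p4) - 1)%C
  with (/ (p1 ^ 3 * p4) * ((p2 * (p3 - 1) + (p2 - 1)) - (p1 ^ 3 * (p4 - 1)
     + (p1 ^ 2 * (p1 - 1) + (p1 * (p1 - 1) + (p1 - 1))))))%C
  by (field; auto).
rewrite Cmod_mult, Cmod_inv, Cmod_mult, Cmod_pow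
  by (apply Cmult_neq_0; [apply Cpow_nz|]; auto).
rewrite Rmult_assoc; apply Rmult_le_compat.
- left; apply Rinv_0_lt_compat, Rmult_lt_0_compat; [apply pow_lt|]; lra.
- apply Cmod_ge_0.
- apply Rinv_le_contravar; [now apply pow_lt|].
  replace (b ^ 4) with (b ^ 3 * b) by ring; apply Rmult_le_compat; try lra.
  + apply pow_le; lra.
  + apply pow_incr; lra.
- assert (Hy : 0 <= K * y) by (generalize (Cmod_ge_0 (p1 - 1)%C); lra).
  assert (M : forall x u D, 0 <= D -> Cmod x <= D -> Cmod u <= K * y ->
    Cmod (x * u)%C <= D * (K * y)).
  { intros x u D HD Hx Hu; rewrite Cmod_mult; apply Rmult_le_compat; auto; apply Cmod_ge_0. }
  assert (T1 := M p2 (p3 - 1)%C B ltac:(lra) ltac:(lra) V3).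
  assert (T2 := M (p1 ^ 3)%C (p4 - 1)%C (B ^ 3) ltac:(lra)
    ltac:(rewrite Cmod_pow; apply pow_incr; lra) V4).
  assert (T3 := M (p1 ^ 2)%C (p1 - 1)%C (B ^ 2) ltac:(lra)
    ltac:(rewrite Cmod_pow; apply pow_incr; lra) V1).
  assert (T4 := M p1 (p1 - 1)%C B ltac:(lra) ltac:(lra) V1).
  eapply Rle_trans; [apply Cmod_minus_le|].
  assert (X1 := Cmod_triangle (p2 * (p3 - 1)) (p2 - 1)).
  assert (X2 := Cmod_triangle (p1 ^ 3 * (p4 - 1)) (p1 ^ 2 * (p1 - 1) + (p1 * (p1 - 1) + (p1 - 1)))).
  assert (X3 := Cmod_triangle (p1 ^ 2 * (p1 - 1)) (p1 * (p1 - 1) + (p1 - 1))).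
  assert (X4 := Cmod_triangle (p1 * (p1 - 1)) (p1 - 1)).
  replace ((K * (B + 1) + K * (B ^ 3 + B ^ 2 + B + 1)) * y)
   with ((B * (K * y) + K * y) + (B ^ 3 * (K * y) + (B ^ 2 * (K * y) + (B * (K * y) + K * y)))) by ring.
  lra.
Qed.

(** The leading term of the generating function at [nome (z - i h / j)]. *)
Definition polar_part (k h j : nat) (z : C) : C :=
  (INR j * z * Cexp (- (PI * Ci * A_phase k h j)
     + PI * alpha_ k j / (12 * INR j ^ 2) * / z
     - PI * (INR k + 1) / 6 * z))%C.

Lemma A_phase_sum (k h j : nat) :
  let s r := dedekind_sum (m_ k r * h / Nat.gcd (m_ k r) j) (j / Nat.gcd (m_ k r) j) in
  A_phase k h j = - 3 * s 1%nat + s 2%nat + s 3%nat - s 4%nat.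
Proof.
intros s; unfold A_phase.
rewrite !(sum_n_Sm _ 1 (S _)) by lia; rewrite sum_n_n.
fold (s 1%nat) (s 2%nat) (s 3%nat) (s 4%nat).
unfold plus; simpl; ring.
Qed.

(** The four transformations give [polar_part] times a quotient [R0] of values of [pr]. With
    [t = Re (1/(j^2 z))], the leading exponential grows like [exp (pi alpha t / 12)], and [R0 - 1]
    is of the size of the largest nome, at most [exp (- pi alpha t / 12)] by [cusp_facts]. The two
    cancel and [j |z|] is left. *)
Lemma eta_quotient_near_rational (k : nat) : (k = 1 \/ k = 2)%nat ->
  exists K, 0 < K /\ forall h j z, (0 < j)%nat -> Nat.gcd h j = 1%nat ->
  0 < Re z -> 1 / 2 <= Re (/ (INR j ^ 2 * z))%C ->
  Cmod (eta_quotient pr k (nome (z - Ci * RtoC (INR h / INR j))) - polar_part k h j z)%C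
    <= K * INR j * Cmod z.
Proof.
(* [pi/10] is [2 pi] times the least value [1/10] allowed for [cusp_width] times the lower bound
   [1/2] of [Re (1/(j^2 z))]. *)
intros Hk; set (r := exp (- (PI / 10))).
assert (HPI := PI_RGT_0).
assert (Hr : 0 <= r < 1).
{ unfold r; split; [left; apply exp_pos|]; rewrite <- exp_0; apply exp_increasing; lra. }
destruct (eta_ratio_bound r Hr) as [K [HK HR]]; exists K; split; auto.
intros h j z Hj Hg Hz Ht.
assert (Pj : 0 < INR j) by (apply lt_0_INR; lia).
assert (Cj := RtoC_INR_nz j Hj).
destruct (cusp_facts k j Hk Hj) as [Ea [_ [Hw Hg4]]].
destruct (Clog_spec z Hz) as [Ez Hzi]; set (l := Clog z) in *.
assert (Hm : forall r, (1 <= r <= 4)%nat -> (0 < m_ k r)%nat).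
{ intros i Hi; destruct i as [|[|[|[|[|i]]]]]; simpl; lia. }
assert (T : forall r, (1 <= r <= 4)%nat -> exists xi : R,
  pr (nome (INR (m_ k r) * (z - Ci * RtoC (INR h / INR j)))) =
  (Cexp (PI / 12 * (INR (m_ k r) * z) - PI * Ci * dedekind_sum (m_ k r * h / Nat.gcd (m_ k r) j) (j / Nat.gcd (m_ k r) j)
     - (l + RtoC (ln (INR (m_ k r)) + ln (INR j) - ln (INR (Nat.gcd (m_ k r) j)))) / 2
     - PI / 12 * (cusp_width k j r * / (INR j ^ 2 * z)))
   * pr (nome (cusp_width k j r * / (INR j ^ 2 * z) - Ci * xi)))%C).
{ intros i Hi; destruct (pr_transform_mul (m_ k i) j h (Hm i Hi) Hj Hg) as [xi Hxi].
  exists xi; specialize (Hxi l Hzi); rewrite Ez in Hxi; exact Hxi. }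
assert (Q : forall i xi, (1 <= i <= 4)%nat ->
  Cmod (nome (cusp_width k j i * / (INR j ^ 2 * z) - Ci * RtoC xi)) <= r /\
  Cmod (nome (cusp_width k j i * / (INR j ^ 2 * z) - Ci * RtoC xi))
    <= exp (- (PI * alpha_ k j / 12 * Re (/ (INR j ^ 2 * z))%C))).
{ intros i xi Hi; rewrite Cmod_nome.
  replace (Re (cusp_width k j i * / (INR j ^ 2 * z) - Ci * RtoC xi)%C)
    with (cusp_width k j i * Re (/ (INR j ^ 2 * z))%C)
    by (rewrite re_minus, re_scal_l; simpl; ring).
  destruct (Hw i Hi) as [W1 W2]; set (t := Re (/ (INR j ^ 2 * z))%C) in *.
  split; apply exp_mono, Ropp_le_contravar.
  - assert (1 / 10 * (1 / 2) <= cusp_width k j i * t) by (apply Rmult_le_compat; lra); nra.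
  - assert (alpha_ k j * t <= 24 * cusp_width k j i * t) by (apply Rmult_le_compat_r; lra); nra. }
destruct (T 1%nat ltac:(lia)) as [x1 T1]; destruct (T 2%nat ltac:(lia)) as [x2 T2].
destruct (T 3%nat ltac:(lia)) as [x3 T3]; destruct (T 4%nat ltac:(lia)) as [x4 T4].
assert (B := HR (exp (- (PI * alpha_ k j / 12 * Re (/ (INR j ^ 2 * z))%C)))
   (nome (cusp_width k j 1 * / (INR j ^ 2 * z) - Ci * RtoC x1))
   (nome (cusp_width k j 2 * / (INR j ^ 2 * z) - Ci * RtoC x2))
   (nome (cusp_width k j 3 * / (INR j ^ 2 * z) - Ci * RtoC x3))
   (nome (cusp_width k j 4 * / (INR j ^ 2 * z) - Ci * RtoC x4))).
match type of B with _ -> Cmod (Cminus ?rr _) <= _ => set (R0 := rr) in * end.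
assert (B' : Cmod (R0 - 1)%C <= K * exp (- (PI * alpha_ k j / 12 * Re (/ (INR j ^ 2 * z))%C))).
{ apply B; intros q [-> | [-> | [-> | ->]]]; apply Q; lia. }
clear B Q T.
assert (Hn : forall i, (1 <= i <= 4)%nat -> forall xi,
  (pr (nome (cusp_width k j i * / (INR j ^ 2 * z) - Ci * RtoC xi)) <> 0)%C).
{ intros i Hi xi; set (w := (cusp_width k j i * / (INR j ^ 2 * z) - Ci * RtoC xi)%C).
  assert (Hw' : 0 < Re w).
  { unfold w; rewrite re_minus, re_scal_l.
    replace (Re (Ci * RtoC xi)) with 0 by (simpl; ring).
    destruct (Hw i Hi); rewrite Rminus_0_r; apply Rmult_lt_0_compat; lra. }
  destruct (pr_spec _ _ (Cmod_nome_lt w Hw') (Rle_refl _)) as [_ [_ P]].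
  apply Cmod_gt_0; generalize (pr_lb_pos (Cmod (nome w))); lra. }
assert (E : eta_quotient pr k (nome (z - Ci * RtoC (INR h / INR j))) = (polar_part k h j z * R0)%C).
{ unfold eta_quotient; rewrite !nome_pow.
  change (2 * k + 1)%nat with (m_ k 3); change (4 * k + 2)%nat with (m_ k 4).
  change 2%nat with (m_ k 2) at 1.
  replace (pr (nome (z - Ci * RtoC (INR h / INR j)))) with
    (pr (nome (INR (m_ k 1) * (z - Ci * RtoC (INR h / INR j)))))
    by (f_equal; f_equal; simpl; ring).
  rewrite T1, T2, T3, T4; unfold R0.
  assert (N1 := Hn 1%nat ltac:(lia) x1); assert (N4 := Hn 4%nat ltac:(lia) x4).
  set (p1 := pr _) in *; set (p2 := pr (nome (cusp_width k j 2 * _ - _))) in *;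
  set (p3 := pr (nome (cusp_width k j 3 * _ - _))) in *; set (p4 := pr (nome (cusp_width k j 4 * _ - _))) in *.
  match goal with |- ((Cexp ?e2 * _) * (Cexp ?e3 * _) / ((Cexp ?e1 * _) ^ 3 * (Cexp ?e4 * _)) = _)%C =>
    set (a1 := e1) in *; set (a2 := e2) in *; set (a3 := e3) in *; set (a4 := e4) in * end.
  (* Each exponent contains [- (l + ln m + ln j - ln g) / 2], and the multiplicities add up to
     [1 + 1 - 3 - 1 = -2], whence the factor [j z]. The terms [ln m] and [ln g] cancel because
     [m_4 = m_2 m_3], and likewise for the gcds. *)
  assert (M : (Cexp a2 * Cexp a3 / (Cexp a1 ^ 3 * Cexp a4))%C = polar_part k h j z).
  { transitivity (Cexp (a2 + a3 + - (INR 3 * a1) + - a4)).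
    - rewrite !Cexp_plus, !Cexp_opp, <- (Cexp_pow a1 3).
      assert (Y1 := Cexp_nz a1); assert (Y4 := Cexp_nz a4); field; auto.
    - unfold polar_part; rewrite <- Ez at 1.
      replace (RtoC (INR j)) with (Cexp (ln (INR j))) at 1 by (rewrite Cexp_RtoC, exp_ln; auto).
      rewrite <- !Cexp_plus; apply Cexp_eq.
      unfold a1, a2, a3, a4; rewrite (A_phase_sum k h j), Ea, Hg4, mult_INR.
      assert (Zn := Re_pos_nz z Hz).
      set (s1 := dedekind_sum (m_ k 1 * h / _) _); set (s2 := dedekind_sum (m_ k 2 * h / _) _);
      set (s3 := dedekind_sum (m_ k 3 * h / _) _); set (s4 := dedekind_sum (m_ k 4 * h / _) _).
      replace (Nat.gcd (m_ k 1) j) with 1%nat by (symmetry; apply gcd_1_l).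
      assert (G2 : 0 < INR (Nat.gcd (m_ k 2) j)).
      { apply lt_0_INR; assert (Nat.gcd (m_ k 2) j <> 0%nat); [|lia].
        intros E0; apply Nat.gcd_eq_0 in E0; simpl in E0; lia. }
      assert (G3 : 0 < INR (Nat.gcd (m_ k 3) j)).
      { apply lt_0_INR; assert (Nat.gcd (m_ k 3) j <> 0%nat); [|lia].
        intros E0; apply Nat.gcd_eq_0 in E0; simpl in E0; lia. }
      assert (M4 : INR (m_ k 4) = INR (m_ k 2) * INR (m_ k 3)).
      { rewrite <- mult_INR; f_equal; simpl; lia. }
      rewrite M4, (ln_mult (INR (m_ k 2))), (ln_mult (INR (Nat.gcd (m_ k 2) j)))
        by (auto; apply lt_0_INR; simpl; lia).
      replace (INR (m_ k 3)) with (2 * INR k + 1)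
        by (simpl m_; rewrite !plus_INR; simpl; ring).
      replace (INR (m_ k 2)) with 2 by (simpl; ring).
      replace (INR (m_ k 1)) with 1 by (simpl; ring).
      replace (INR 3) with 3 by (simpl; ring). replace (INR 1) with 1 by (simpl; ring).
      rewrite ln_1.
      rewrite !RtoC_plus, !RtoC_minus, !RtoC_plus, !RtoC_mult, !RtoC_plus, !RtoC_mult.
      field; auto. }
  rewrite <- M.
  assert (Y1 := Cexp_nz a1); assert (Y4 := Cexp_nz a4); field; auto. }
rewrite E; replace (polar_part k h j z * R0 - polar_part k h j z)%C
  with (polar_part k h j z * (R0 - 1))%C by ring.
rewrite Cmod_mult; unfold polar_part.
rewrite !Cmod_mult, Cmod_R, Rabs_pos_eq, Cmod_Cexp by lra.
set (t := Re (/ (INR j ^ 2 * z))%C) in *.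
match goal with |- context [exp (Re ?e)] => assert (X : Re e = PI * alpha_ k j / 12 * t - PI * (INR k + 1) / 6 * Re z) end.
{ unfold t.
  replace (PI * alpha_ k j / (12 * INR j ^ 2) * / z)%C with
    (RtoC (PI * alpha_ k j / 12) * / (INR j ^ 2 * z))%C.
  2:{ assert (Zn := Re_pos_nz z Hz); rewrite RtoC_div, RtoC_mult by lra; field; auto. }
  replace (PI * (INR k + 1) / 6)%C with (RtoC (PI * (INR k + 1) / 6))
    by (rewrite RtoC_div, RtoC_mult, RtoC_plus by lra; reflexivity).
  replace (PI * Ci * A_phase k h j)%C with (Ci * RtoC (PI * A_phase k h j))%C
    by (rewrite RtoC_mult; ring).
  rewrite re_minus, re_plus, !re_scal_l, re_opp; simpl (Re (Ci * _)); ring. }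
rewrite X.
apply Rle_trans with (INR j * Cmod z * exp (PI * alpha_ k j / 12 * t)
   * (K * exp (- (PI * alpha_ k j / 12 * t)))).
- apply Rmult_le_compat; auto; try apply Cmod_ge_0.
  + repeat apply Rmult_le_pos; try apply Cmod_ge_0; try lra; left; apply exp_pos.
  + apply Rmult_le_compat_l.
    * apply Rmult_le_pos; [lra|apply Cmod_ge_0].
    * apply exp_mono.
      assert (0 <= PI * (INR k + 1) / 6 * Re z); [|lra].
      apply Rmult_le_pos; [|lra]; generalize (pos_INR k); intros; apply Rdiv_le_0_compat; nra.
- rewrite exp_Ropp; right; field; apply Rgt_not_eq, exp_pos.
Qed.

(** * Coefficients as integrals *)

Lemma Clim_parts (u : nat -> C) (x y : R) :
  is_lim_seq (fun n => Re (u n)) x -> is_lim_seq (fun n => Im (u n)) y -> Clim u (x, y).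
Proof.
intros Hx Hy eps He; apply Rlim_is_lim_seq in Hx; apply Rlim_is_lim_seq in Hy.
destruct (Hx (eps / 2) ltac:(lra)) as [N HN]; destruct (Hy (eps / 2) ltac:(lra)) as [M HM].
exists (N + M)%nat; intros n Hn; eapply Rle_lt_trans; [apply Cmod_le_abs|].
rewrite re_minus, im_minus; change (Re (x, y)) with x; change (Im (x, y)) with y.
specialize (HN n ltac:(lia)); specialize (HM n ltac:(lia)); lra.
Qed.

Lemma Re_csum (f : nat -> C) (n : nat) : Re (csum f n) = rsum (fun i => Re (f i)) n.
Proof. induction n as [|n IH]; [reflexivity|]; cbn [csum rsum]; now rewrite re_plus, IH. Qed.

Lemma Im_csum (f : nat -> C) (n : nat) : Im (csum f n) = rsum (fun i => Im (f i)) n.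
Proof. induction n as [|n IH]; [reflexivity|]; cbn [csum rsum]; now rewrite im_plus, IH. Qed.

Lemma is_series_rsum (f : nat -> R) (l : R) : is_series f l <-> is_lim_seq (rsum f) l.
Proof.
split; intros H.
- apply is_lim_seq_incr_1; apply is_lim_seq_ext with (sum_n f); auto.
  intros; now rewrite rsum_sum_n.
- apply is_lim_seq_incr_1 in H.
  exact (is_lim_seq_ext (fun n => rsum f (S n)) (sum_n f) l (rsum_sum_n f) H).
Qed.

Lemma Csums_series (f : nat -> C) (l : C) : Csums f l <->
  is_series (fun n => Re (f n)) (Re l) /\ is_series (fun n => Im (f n)) (Im l).
Proof.
rewrite !is_series_rsum; split.
- intros H; split; [apply is_lim_seq_ext with (2 := Clim_Re _ _ H)|
    apply is_lim_seq_ext with (2 := Clim_Im _ _ H)]; intros; [apply Re_csum|apply Im_csum].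
- intros [H1 H2]; destruct l as [x y]; apply Clim_parts.
  + apply is_lim_seq_ext with (2 := H1); intros; symmetry; apply Re_csum.
  + apply is_lim_seq_ext with (2 := H2); intros; symmetry; apply Im_csum.
Qed.

Lemma ex_series_Rabs_le (a b : nat -> R) :
  (forall n, Rabs (a n) <= b n) -> ex_series b -> ex_series a.
Proof. apply (ex_series_le (K := R_AbsRing) (V := R_CompleteNormedModule)). Qed.

Lemma Csums_cauchy_product (f g : nat -> C) (a b : C) :
  ex_series (fun n => Cmod (f n)) -> ex_series (fun n => Cmod (g n)) ->
  Csums f a -> Csums g b ->
  Csums (fun n => csum (fun k => f k * g (n - k)%nat) (S n))%C (a * b)%C.
Proof.
intros Hf Hg Ha Hb; apply Csums_series in Ha; apply Csums_series in Hb.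
destruct Ha as [A1 A2], Hb as [B1 B2].
assert (E : forall (h : nat -> C), ex_series (fun n => Cmod (h n)) ->
  ex_series (fun n => Rabs (Re (h n))) /\ ex_series (fun n => Rabs (Im (h n)))).
{ intros h Hh; split; apply ex_series_Rabs_le with (2 := Hh); intros n;
    rewrite Rabs_Rabsolu; [apply re_le_Cmod|apply im_le_Cmod]. }
destruct (E f Hf) as [F1 F2]; destruct (E g Hg) as [G1 G2].
assert (S : forall (u v : nat -> R) n, sum_f_R0 (fun k => u k * v (n - k)%nat) n
  = rsum (fun k => u k * v (n - k)%nat) (S n)).
{ intros u v n; now rewrite rsum_sum_n, sum_n_Reals. }
assert (M11 := is_series_mult _ _ _ _ A1 B1 F1 G1).
assert (M12 := is_series_mult _ _ _ _ A1 B2 F1 G2).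
assert (M21 := is_series_mult _ _ _ _ A2 B1 F2 G1).
assert (M22 := is_series_mult _ _ _ _ A2 B2 F2 G2).
apply Csums_series; split.
- rewrite re_mult.
  refine (is_series_ext _ _ _ _ (is_series_minus _ _ _ _ M11 M22)).
  intros n; rewrite Re_csum.
  match goal with |- @eq _ ?x ?y => change (@eq R x y) end.
  transitivity (sum_f_R0 (fun k => Re (f k) * Re (g (n - k)%nat)) n
    - sum_f_R0 (fun k => Im (f k) * Im (g (n - k)%nat)) n); [reflexivity|].
  rewrite (S (fun k => Re (f k)) (fun k => Re (g k))), (S (fun k => Im (f k)) (fun k => Im (g k))).
  rewrite (rsum_ext (fun i => Re _) (fun i => Re (f i) * Re (g (n - i)%nat) +
    (-1) * (Im (f i) * Im (g (n - i)%nat)))) by (intros; rewrite re_mult; ring).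
  rewrite rsum_plus, rsum_scal; ring.
- rewrite im_mult.
  refine (is_series_ext _ _ _ _ (is_series_plus _ _ _ _ M12 M21)).
  intros n; rewrite Im_csum.
  match goal with |- @eq _ ?x ?y => change (@eq R x y) end.
  transitivity (sum_f_R0 (fun k => Re (f k) * Im (g (n - k)%nat)) n
    + sum_f_R0 (fun k => Im (f k) * Re (g (n - k)%nat)) n); [reflexivity|].
  rewrite (S (fun k => Re (f k)) (fun k => Im (g k))), (S (fun k => Im (f k)) (fun k => Re (g k))).
  rewrite (rsum_ext (fun i => Im _) (fun i => Re (f i) * Im (g (n - i)%nat) +
    Im (f i) * Re (g (n - i)%nat))) by (intros; now rewrite im_mult).
  now rewrite rsum_plus.
Qed.

(** Absolute convergence is included to make the notion stable under Cauchy products. *)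
Definition has_sum_at (a : nat -> R) (q s : C) : Prop :=
  ex_series (fun i => Rabs (a i) * Cmod q ^ i) /\ Csums (fun i => RtoC (a i) * q ^ i)%C s.

Lemma has_sum_mult (a b : nat -> R) (q s t : C) :
  has_sum_at a q s -> has_sum_at b q t -> has_sum_at (PS_mult a b) q (s * t)%C.
Proof.
intros [A1 A2] [B1 B2].
assert (Em : forall (c : nat -> R) n, Cmod (RtoC (c n) * q ^ n)%C = Rabs (c n) * Cmod q ^ n).
{ intros; now rewrite Cmod_mult, Cmod_R, Cmod_pow. }
assert (EF : forall (c : nat -> R), ex_series (fun i => Rabs (c i) * Cmod q ^ i) ->
  ex_series (fun n => Cmod (RtoC (c n) * q ^ n)%C)).
{ intros c; apply ex_series_ext; intros; symmetry; apply Em. }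
assert (P := Csums_cauchy_product _ _ _ _ (EF _ A1) (EF _ B1) A2 B2).
assert (S : forall n, PS_mult a b n = rsum (fun k => a k * b (n - k)%nat) (S n)).
{ intros n; unfold PS_mult; now rewrite rsum_sum_n, sum_n_Reals. }
split.
- destruct A1 as [la A1], B1 as [lb B1].
  assert (Abs : forall c : nat -> R, (forall n, 0 <= c n) -> forall l, is_series c l ->
    ex_series (fun n => Rabs (c n))).
  { intros c Hc l Hl; exists l; refine (is_series_ext _ _ _ _ Hl).
    intros; symmetry; now apply Rabs_pos_eq. }
  assert (Pos : forall (c : nat -> R) n, 0 <= Rabs (c n) * Cmod q ^ n).
  { intros; apply Rmult_le_pos; [apply Rabs_pos|apply pow_le, Cmod_ge_0]. }
  assert (M := is_series_mult _ _ _ _ A1 B1 (Abs _ (Pos a) _ A1) (Abs _ (Pos b) _ B1)).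
  apply ex_series_Rabs_le with (2 := ex_intro _ _ M).
  intros n; rewrite Rabs_pos_eq by (apply Rmult_le_pos; [apply Rabs_pos|apply pow_le, Cmod_ge_0]).
  rewrite S, <- sum_n_Reals, <- rsum_sum_n.
  assert (T : forall (u : nat -> R) m, Rabs (rsum u m) <= rsum (fun i => Rabs (u i)) m).
  { intros u m; induction m as [|m IH]; [simpl; rewrite Rabs_R0; lra|].
    cbn [rsum]; eapply Rle_trans; [apply Rabs_triang|lra]. }
  rewrite Rmult_comm; eapply Rle_trans.
  + apply Rmult_le_compat_l; [apply pow_le, Cmod_ge_0|apply T].
  + rewrite <- rsum_scal; apply rsum_le; intros i Hi.
    replace n with (i + (n - i))%nat at 1 by lia.
    rewrite pow_add, Rabs_mult; right; ring.
- refine (Csums_ext _ _ _ _ P); intros n.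
  rewrite S, <- csum_RtoC, Cmult_comm, <- csum_scal.
  apply csum_ext; intros i Hi.
  replace n with (i + (n - i))%nat at 3 by lia.
  rewrite Cpow_add_r, RtoC_mult; ring.
Qed.

Lemma ex_series_geom_dom (a : nat -> R) (r : R) : 0 <= r < 1 ->
  (forall i, Rabs (a i) <= 1) -> ex_series (fun i => Rabs (a i) * r ^ i).
Proof.
intros Hr Ha; apply ex_series_Rabs_le with (fun i => r ^ i).
- intros n; rewrite Rabs_mult, Rabs_Rabsolu, (Rabs_pos_eq (r ^ n)) by (apply pow_le; lra).
  specialize (Ha n); assert (0 <= r ^ n) by (apply pow_le; lra); nra.
- apply ex_series_geom; rewrite Rabs_pos_eq; lra.
Qed.

Lemma has_sum_one_minus_pow (m : nat) (q : C) : (0 < m)%nat -> Cmod q < 1 ->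
  has_sum_at (PS_one_minus_pow m) q (1 - q ^ m)%C.
Proof.
intros Hm Hq; split.
- apply ex_series_geom_dom; [split; auto; apply Cmod_ge_0|].
  intros i; unfold PS_one_minus_pow; destruct (Nat.eqb i 0), (Nat.eqb i m);
    apply Rabs_le; lra.
- assert (E : forall n, csum (fun i => RtoC (PS_one_minus_pow m i) * q ^ i)%C n
    = ((if Nat.ltb 0 n then 1 else 0) - (if Nat.ltb m n then q ^ m else 0))%C).
  { induction n as [|n IH]; [simpl; ring|].
    cbn [csum]; rewrite IH; unfold PS_one_minus_pow.
    destruct (Nat.eqb_spec n 0) as [->|H0].
    - destruct (Nat.ltb_spec m 0), (Nat.ltb_spec m 1); try lia; simpl; ring.
    - destruct (Nat.eqb_spec n m) as [H1|H1];
      destruct (Nat.ltb_spec 0 n), (Nat.ltb_spec 0 (S n)), (Nat.ltb_spec m n),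
        (Nat.ltb_spec m (S n)); try lia; try rewrite H1; ring. }
  apply Clim_eventually with (fun _ => (1 - q ^ m)%C) (S m); [|apply Clim_const].
  intros n Hn; rewrite E; destruct (Nat.ltb_spec 0 n), (Nat.ltb_spec m n); try lia; ring.
Qed.

Lemma has_sum_geom (m : nat) (q : C) : (0 < m)%nat -> Cmod q < 1 ->
  has_sum_at (PS_geom m) q (/ (1 - q ^ m))%C.
Proof.
intros Hm Hq.
assert (Hr : 0 <= Cmod q < 1) by (split; auto; apply Cmod_ge_0).
assert (Ha : forall i, Rabs (PS_geom m i) <= 1).
{ intros i; unfold PS_geom; destruct (Nat.eqb (i mod m) 0);
    rewrite ?Rabs_R1, ?Rabs_R0; lra. }
assert (Hs := ex_series_geom_dom (PS_geom m) _ Hr Ha).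
split; auto.
destruct (Csums_dom (fun i => RtoC (PS_geom m i) * q ^ i)%C
  (fun i => Rabs (PS_geom m i) * Cmod q ^ i)) as [l [Hl _]]; auto.
{ intros i; rewrite Cmod_mult, Cmod_R, Cmod_pow; lra. }
replace (/ (1 - q ^ m))%C with l; [exact Hl|].
apply (Clim_unique (fun N => csum (fun i => RtoC (PS_geom m i) * q ^ i)%C (m * N))).
- apply (Clim_subseq _ _ (fun N => (m * N)%nat)) with (2 := Hl); intros; nia.
- apply Clim_ext with (csum (fun l => (q ^ m) ^ l)%C).
  + intros N; induction N as [|N IH]; [now rewrite Nat.mul_0_r|].
    replace (m * S N)%nat with (m * N + m)%nat by ring.
    rewrite csum_split, <- IH; cbn [csum]; f_equal.
    destruct m as [|m']; [lia|]; rewrite csum_S_l.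
    rewrite (csum_ext _ (fun _ => RtoC 0)), csum_zero.
    * unfold PS_geom; rewrite Nat.add_0_r, Nat.mul_comm, Nat.Div0.mod_mul; simpl (Nat.eqb 0 0).
      rewrite <- Cpow_mult_r; rewrite (Nat.mul_comm N); ring.
    * intros i Hi; unfold PS_geom.
      replace (S m' * N + S i)%nat with (S i + N * S m')%nat by ring.
      rewrite Nat.Div0.mod_add, Nat.mod_small by lia; simpl; ring.
  + apply Csums_geom; rewrite Cmod_pow; destruct m as [|m']; [lia|].
    generalize (pow_S_le _ m' Hr); lra.
Qed.

Lemma Cmod_pow_lt (q : C) (m : nat) : (0 < m)%nat -> Cmod q < 1 -> Cmod (q ^ m)%C < 1.
Proof.
intros Hm Hq; rewrite Cmod_pow; destruct m as [|m']; [lia|].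
generalize (pow_S_le (Cmod q) m' (conj (Cmod_ge_0 q) Hq)); lra.
Qed.

Lemma one_minus_nz (z : C) : Cmod z < 1 -> (1 - z <> 0)%C.
Proof.
intros Hz; apply Cmod_gt_0.
generalize (Cmod_triangle_sub (RtoC 1) z); rewrite Cmod_1; lra.
Qed.

Lemma prN_nz (N : nat) (q : C) : Cmod q < 1 -> (prN N q <> 0)%C.
Proof.
intros Hq; apply Cmod_gt_0; apply Rlt_le_trans with (1 := pr_lb_pos (Cmod q)).
apply prN_bounds; [split; auto; apply Cmod_ge_0|lra].
Qed.

(** Formal and analytic products are matched at finite length, factor by factor, so no infinite
    product of power series has to be expanded. *)
Lemma has_sum_diamond (k N : nat) (q : C) : Cmod q < 1 ->
  has_sum_at (PS_prod (diamond_factor k) N) q (eta_quotient (prN N) k q).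
Proof.
intros Hq; induction N as [|N IH].
- split.
  + apply ex_series_geom_dom; [split; auto; apply Cmod_ge_0|].
    intros i; simpl; unfold PS_one; destruct (Nat.eqb i 0); rewrite ?Rabs_R1, ?Rabs_R0; lra.
  + replace (eta_quotient (prN 0) k q) with (RtoC 1) by (unfold eta_quotient; simpl; field).
    apply Clim_eventually with (fun _ => RtoC 1) 1%nat; [|apply Clim_const].
    intros [|n] Hn; [lia|]; clear Hn; rewrite csum_S_l.
    rewrite (csum_ext _ (fun _ => RtoC 0)), csum_zero.
    * unfold PS_prod, PS_one; simpl; ring.
    * intros i _; unfold PS_prod, PS_one; simpl; ring.
- replace (eta_quotient (prN (S N)) k q) with (eta_quotient (prN N) k q *
    (((1 - q ^ (2 * S N)) * (1 - q ^ ((2 * k + 1) * S N))) *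
     ((/ (1 - q ^ S N) * (/ (1 - q ^ S N) * / (1 - q ^ S N))) * / (1 - q ^ ((4 * k + 2) * S N)))))%C.
  + cbn [PS_prod]; unfold diamond_factor.
    apply has_sum_mult; [exact IH|].
    repeat apply has_sum_mult; first [apply has_sum_one_minus_pow|apply has_sum_geom]; auto; lia.
  + unfold eta_quotient; cbn [prN]; rewrite <- !Cpow_mult_r.
    assert (A1 := prN_nz N q Hq).
    assert (A2 := prN_nz N (q ^ (4 * k + 2)) (Cmod_pow_lt q (4 * k + 2) ltac:(lia) Hq)).
    assert (B1 := one_minus_nz _ (Cmod_pow_lt q (S N) ltac:(lia) Hq)).
    assert (B2 := one_minus_nz _ (Cmod_pow_lt q ((4 * k + 2) * S N) ltac:(lia) Hq)).
    set (x1 := (q ^ S N)%C) in *; set (x2 := (q ^ ((4 * k + 2) * S N))%C) in *.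
    set (x3 := (q ^ (2 * S N))%C) in *; set (x4 := (q ^ ((2 * k + 1) * S N))%C) in *.
    field; repeat split; auto.
Qed.

Lemma cdiff_mult (f g : R -> C) (t : R) :
  cdiff f t -> cdiff g t -> cdiff (fun s => f s * g s)%C t.
Proof.
intros [a Ha] [b Hb]; exists (a * g t + f t * b)%C; now apply cderiv_mult.
Qed.

Lemma cdiff_pow (f : R -> C) (t : R) (n : nat) : cdiff f t -> cdiff (fun s => f s ^ n)%C t.
Proof.
intros [a Ha]; destruct n as [|n].
- exists (RtoC 0); apply (cderiv_const (RtoC 1)).
- exists (INR (S n) * f t ^ n * a)%C; now apply cderiv_pow.
Qed.

Lemma cdiff_inv (f : R -> C) (t : R) : (f t <> 0)%C -> cdiff f t -> cdiff (fun s => / f s)%C t.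
Proof.
intros Hf [a Ha]; exists (- a / (f t * f t))%C; now apply cderiv_inv.
Qed.

Lemma cdiff_Cexp (f : R -> C) (t : R) : cdiff f t -> cdiff (fun s => Cexp (f s)) t.
Proof. intros [a Ha]; exists (a * Cexp (f t))%C; now apply cderiv_Cexp. Qed.

Lemma cderiv_affine (a b : C) (t : R) : cderiv (fun s => a + b * s)%C t b.
Proof.
eapply cderiv_eq; [apply cderiv_plus; [apply cderiv_const|apply cderiv_scal, cderiv_id]|].
ring.
Qed.

Lemma cdiff_affine (a b : C) (t : R) : cdiff (fun s => a + b * s)%C t.
Proof. exists b; apply cderiv_affine. Qed.

Lemma cdiff_ext (f g : R -> C) (t : R) : (forall s, f s = g s) -> cdiff f t -> cdiff g t.
Proof. intros E [l H]; exists l; now apply (cderiv_ext f). Qed.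

Lemma cdiff_prN (N : nat) (f : R -> C) (t : R) : cdiff f t -> cdiff (fun s => prN N (f s)) t.
Proof.
intros Hf; induction N as [|N IH]; [exists (RtoC 0); apply (cderiv_const (RtoC 1))|].
cbn [prN]; apply cdiff_mult; auto.
destruct Hf as [l Hl]; exists (RtoC 0 - INR (S N) * f t ^ N * l)%C.
apply (cderiv_minus (fun _ => RtoC 1)); [apply cderiv_const|now apply (cderiv_pow f)].
Qed.

(** * Coefficient extraction on a circle *)

Definition circle_point (rho phi : R) : C := (rho - Ci * phi)%C.

Lemma Re_circle_point (rho phi : R) : Re (circle_point rho phi) = rho.
Proof. unfold circle_point; simpl; ring. Qed.

Lemma Cmod_nome_circle (rho phi : R) : Cmod (nome (circle_point rho phi)) = exp (- (2 * PI * rho)).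
Proof. now rewrite Cmod_nome, Re_circle_point. Qed.

Lemma nome_circle_lt (rho phi : R) : 0 < rho -> Cmod (nome (circle_point rho phi)) < 1.
Proof. intros H; apply Cmod_nome_lt; now rewrite Re_circle_point. Qed.

Lemma cdiff_nome_circle (rho phi : R) : cdiff (fun s => nome (circle_point rho s)) phi.
Proof.
unfold nome, circle_point; apply cdiff_Cexp.
apply cdiff_ext with (fun s => (- (2 * PI * rho)) + (2 * PI * Ci) * s)%C;
  [intros; ring|apply cdiff_affine].
Qed.

Lemma cdiff_eta_quotient (k N : nat) (rho phi : R) : 0 < rho ->
  cdiff (fun s => eta_quotient (prN N) k (nome (circle_point rho s))) phi.
Proof.
intros Hr; unfold eta_quotient, Cdiv.
assert (Hq := nome_circle_lt rho phi Hr); assert (D := cdiff_nome_circle rho phi).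
set (q := fun s => nome (circle_point rho s)) in *.
assert (P : forall m, cdiff (fun s => prN N (q s ^ m)%C) phi).
{ intros m; apply (cdiff_prN N (fun s => (q s ^ m)%C)), (cdiff_pow q), D. }
assert (P3 : cdiff (fun s => prN N (q s) ^ 3)%C phi).
{ apply (cdiff_pow (fun s => prN N (q s)) phi 3), (cdiff_prN N q), D. }
apply (cdiff_mult (fun s => prN N (q s ^ 2) * prN N (q s ^ (2 * k + 1)))%C
  (fun s => / (prN N (q s) ^ 3 * prN N (q s ^ (4 * k + 2))))%C).
- apply (cdiff_mult (fun s => prN N (q s ^ 2)%C)); apply P.
- apply (cdiff_inv (fun s => prN N (q s) ^ 3 * prN N (q s ^ (4 * k + 2)))%C).
  + apply Cmult_neq_0; [apply Cpow_nz|]; apply prN_nz; auto; apply Cmod_pow_lt; auto; lia.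
  + apply (cdiff_mult (fun s => prN N (q s) ^ 3)%C); auto.
Qed.

Lemma CInt_character (m : Z) :
  CInt (fun phi => Cexp (2 * PI * Ci * IZR m * phi)%C) 0 1
  = if Z.eqb m 0 then RtoC 1 else RtoC 0.
Proof.
assert (D : forall t (c : C), cderiv (fun s => c * Cexp (2 * PI * Ci * IZR m * s))%C t
  (c * (2 * PI * Ci * IZR m * Cexp (2 * PI * Ci * IZR m * t)))%C).
{ intros t c; apply cderiv_scal, cderiv_Cexp.
  eapply cderiv_eq; [apply cderiv_scal, cderiv_id|ring]. }
destruct (Z.eqb_spec m 0) as [->|Hm].
- rewrite (CInt_ext _ (fun _ => RtoC 1)).
  + rewrite (CInt_derive (fun s => RtoC s) (fun _ => RtoC 1)); [ring| |].
    * intros; apply cderiv_id.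
    * intros; exists (RtoC 0); apply cderiv_const.
  + intros t _; replace (2 * PI * Ci * 0 * t)%C with (RtoC 0) by ring; apply Cexp_0.
- assert (Hc : (2 * PI * Ci * IZR m <> 0)%C).
  { repeat apply Cmult_neq_0; try (intros E; apply RtoC_inj in E; revert E).
    - lra.
    - generalize PI_RGT_0; lra.
    - apply Ci_nz.
    - now apply not_0_IZR. }
  rewrite (CInt_derive (fun s => / (2 * PI * Ci * IZR m) * Cexp (2 * PI * Ci * IZR m * s))%C).
  + replace (2 * PI * Ci * IZR m * 1)%C with (2 * PI * Ci * IZR m)%C by ring.
    rewrite Cexp_2PI_Z; replace (2 * PI * Ci * IZR m * 0)%C with (RtoC 0) by ring.
    rewrite Cexp_0; ring.
  + intros t _; eapply cderiv_eq; [apply D|].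
    rewrite Cmult_assoc, Cinv_l by auto; ring.
  + intros t _; apply cdiff_ext with (fun s => 1 * Cexp (2 * PI * Ci * IZR m * s))%C;
      [intros; ring|].
    exists (1 * (2 * PI * Ci * IZR m * Cexp (2 * PI * Ci * IZR m * t)))%C; apply D.
Qed.

Definition char_weight (n : nat) (w : C) : C := Cexp (2 * PI * INR n * w)%C.

Lemma cdiff_char_weight (n : nat) (rho phi : R) :
  cdiff (fun s => char_weight n (circle_point rho s)) phi.
Proof.
unfold char_weight, circle_point; apply cdiff_Cexp.
apply cdiff_ext with (fun s => (2 * PI * INR n * rho) + (- (2 * PI * INR n * Ci)) * s)%C;
  [intros; ring|apply cdiff_affine].
Qed.

Lemma coefficient_integral (a : nat -> R) (g : R -> C) (rho : R) (n : nat) : 0 < rho ->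
  (forall phi, has_sum_at a (nome (circle_point rho phi)) (g phi)) ->
  (forall phi, cdiff g phi) ->
  CInt (fun phi => g phi * char_weight n (circle_point rho phi))%C 0 1 = RtoC (a n).
Proof.
intros Hrho Hg Hd.
set (q := fun phi => nome (circle_point rho phi)).
set (r := exp (- (2 * PI * rho))).
set (b := fun i => Rabs (a i) * r ^ i).
assert (Hb : ex_series b).
{ destruct (Hg 0) as [H _]; refine (ex_series_ext _ _ _ H).
  intros i; unfold b; now rewrite Cmod_nome_circle. }
assert (Hbp : forall i, 0 <= b i).
{ intros; apply Rmult_le_pos; [apply Rabs_pos|]; apply pow_le; left; apply exp_pos. }
set (S := fun I phi => (csum (fun i => RtoC (a i) * q phi ^ i) I * char_weight n (circle_point rho phi))%C).
assert (Et : forall i phi, (q phi ^ i * char_weight n (circle_point rho phi))%C =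
  (RtoC (exp (2 * PI * rho * (INR n - INR i))) * Cexp (2 * PI * Ci * IZR (Z.of_nat i - Z.of_nat n) * phi))%C).
{ intros i phi; unfold q, char_weight, nome; rewrite Cexp_pow, <- Cexp_RtoC, <- !Cexp_plus.
  apply Cexp_eq; unfold circle_point.
  rewrite minus_IZR, <- !INR_IZR_INZ, !RtoC_mult, !RtoC_minus; ring. }
assert (Hex : forall i, ex_CInt (fun phi => q phi ^ i * char_weight n (circle_point rho phi))%C 0 1).
{ intros i; apply ex_CInt_diff; intros t _; apply cdiff_mult; [|apply cdiff_char_weight].
  apply (cdiff_pow q), cdiff_nome_circle. }
assert (Hi : forall i, CInt (fun phi => q phi ^ i * char_weight n (circle_point rho phi))%C 0 1
  = if Nat.eqb i n then RtoC 1 else RtoC 0).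
{ intros i; rewrite (CInt_ext _ _ _ _ (fun t _ => Et i t)).
  rewrite CInt_scal.
  - rewrite CInt_character.
    destruct (Nat.eqb_spec i n) as [->|H].
    + rewrite !Rminus_diag, Rmult_0_r, exp_0, Z.sub_diag; simpl; ring.
    + destruct (Z.eqb_spec (Z.of_nat i - Z.of_nat n) 0); [lia|ring].
  - apply ex_CInt_diff; intros t _; apply cdiff_Cexp.
    apply cdiff_ext with (fun s => 0 + (2 * PI * Ci * IZR (Z.of_nat i - Z.of_nat n)) * s)%C;
      [intros; ring|apply cdiff_affine]. }
assert (HexS : forall I, ex_CInt (S I) 0 1 /\ CInt (S I) 0 1 =
  csum (fun i => if Nat.eqb i n then RtoC (a i) else RtoC 0) I).
{ induction I as [|I [IH1 IH2]].
  - assert (E : forall t, S O t = RtoC 0) by (intros; unfold S; simpl; ring).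
    split.
    + apply ex_CInt_diff; intros t _; apply cdiff_ext with (fun _ => RtoC 0); [now intros; rewrite E|].
      exists (RtoC 0); apply cderiv_const.
    + rewrite (CInt_ext _ (fun _ => RtoC 0)) by (intros; apply E).
      rewrite (CInt_derive (fun _ => RtoC 0) (fun _ => RtoC 0)); [simpl; ring| |]; intros.
      * apply cderiv_const.
      * exists (RtoC 0); apply cderiv_const.
  - assert (E : forall t, S (Datatypes.S I) t = (S I t + RtoC (a I) * (q t ^ I * char_weight n (circle_point rho t)))%C)
      by (intros; unfold S; cbn [csum]; ring).
    assert (X := ex_CInt_scal (RtoC (a I)) _ _ _ (Hex I)).
    assert (Y := ex_CInt_plus _ _ _ _ IH1 X).
    split.
    + destruct Y as [Y1 Y2]; split; [refine (ex_RInt_ext _ _ _ _ _ Y1)|refine (ex_RInt_ext _ _ _ _ _ Y2)];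
        intros t _; cbv beta; now rewrite E.
    + rewrite (CInt_ext _ _ _ _ (fun t _ => E t)), CInt_plus, CInt_scal, Hi, IH2 by auto.
      cbn [csum]; destruct (Nat.eqb I n); ring. }
assert (Hexg : ex_CInt (fun phi => g phi * char_weight n (circle_point rho phi))%C 0 1).
{ apply ex_CInt_diff; intros t _; apply cdiff_mult; [apply Hd|apply cdiff_char_weight]. }
apply (Clim_unique (fun I => CInt (S I) 0 1)).
- apply Clim_squeeze with (fun I => 2 * exp (2 * PI * INR n * rho) * rtail b I).
  + intros I; rewrite <- CInt_minus by (auto; apply HexS).
    replace (2 * exp (2 * PI * INR n * rho) * rtail b I)
      with (2 * (rtail b I * exp (2 * PI * INR n * rho)) * (1 - 0)) by ring.
    apply CInt_bound; [lra| |].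
    * apply ex_CInt_minus; auto; apply HexS.
    * intros t _; unfold S; cbv beta.
      replace (csum (fun i => RtoC (a i) * q t ^ i) I * char_weight n (circle_point rho t)
        - g t * char_weight n (circle_point rho t))%C
       with (- (g t - csum (fun i => RtoC (a i) * q t ^ i) I) * char_weight n (circle_point rho t))%C by ring.
      rewrite Cmod_mult, Cmod_opp; apply Rmult_le_compat; try apply Cmod_ge_0.
      -- apply (Csums_dom_le (fun i => RtoC (a i) * q t ^ i)%C); auto.
         ++ intros i; unfold b, r; rewrite Cmod_mult, Cmod_R, Cmod_pow.
            unfold q; rewrite Cmod_nome_circle; lra.
         ++ apply Hg.
      -- unfold char_weight; rewrite Cmod_Cexp; apply exp_mono; right.
         unfold circle_point; simpl; ring.
  + replace (Finite 0) with (Finite (2 * exp (2 * PI * INR n * rho) * 0)) by (f_equal; ring).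
    apply is_lim_seq_mult'; [apply is_lim_seq_const|]; apply rtail_lim; split; auto.
- apply Clim_eventually with (fun _ => RtoC (a n)) (Datatypes.S n); [|apply Clim_const].
  intros I HI; rewrite (proj2 (HexS I)); clear - HI; induction HI as [|I HI IH].
  + cbn [csum]; rewrite Nat.eqb_refl, (csum_ext _ (fun _ => RtoC 0)), csum_zero; [ring|].
    intros i Hi; destruct (Nat.eqb_spec i n); [lia|auto].
  + cbn [csum]; rewrite <- IH; destruct (Nat.eqb_spec I n); [lia|ring].
Qed.

Lemma diamond_integral (k n N : nat) (rho : R) : 0 < rho -> (n <= N)%nat ->
  CInt (fun phi => eta_quotient (prN N) k (nome (circle_point rho phi))
    * char_weight n (circle_point rho phi))%C 0 1 = RtoC (DiamondDelta k n).
Proof.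
intros Hr Hn; rewrite <- (DiamondDelta_stable k n N Hn).
apply coefficient_integral; auto.
- intros phi; apply has_sum_diamond, nome_circle_lt, Hr.
- intros phi; now apply cdiff_eta_quotient.
Qed.

(** Size and distance are bundled because closeness passes to products only between bounded factors.
    The constants do not depend on [e], so closeness of order [e] is inherited by the whole
    quotient. *)
Definition near (B K e : R) (x y : C) : Prop :=
  Cmod x <= B /\ Cmod y <= B /\ Cmod (x - y)%C <= K * e.

Lemma near_mult (B1 K1 B2 K2 e : R) (x1 y1 x2 y2 : C) : 0 <= e ->
  near B1 K1 e x1 y1 -> near B2 K2 e x2 y2 ->
  near (B1 * B2) (B1 * K2 + K1 * B2) e (x1 * x2)%C (y1 * y2)%C.
Proof.
intros He [A1 [A2 A3]] [C1 [C2 C3]].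
assert (P1 := Cmod_ge_0 x1); assert (P2 := Cmod_ge_0 x2).
assert (P3 := Cmod_ge_0 y1); assert (P4 := Cmod_ge_0 y2).
assert (P5 := Cmod_ge_0 (x1 - y1)%C); assert (P6 := Cmod_ge_0 (x2 - y2)%C).
repeat split; try (rewrite Cmod_mult; apply Rmult_le_compat; auto).
replace (x1 * x2 - y1 * y2)%C with (x1 * (x2 - y2) + (x1 - y1) * y2)%C by ring.
eapply Rle_trans; [apply Cmod_triangle|]; rewrite !Cmod_mult.
replace ((B1 * K2 + K1 * B2) * e) with (B1 * (K2 * e) + (K1 * e) * B2) by ring.
apply Rplus_le_compat; apply Rmult_le_compat; auto.
Qed.

Lemma near_inv (b K e : R) (x y : C) : 0 < b -> b <= Cmod x -> b <= Cmod y ->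
  Cmod (x - y)%C <= K * e -> near (/ b) (/ b ^ 2 * K) e (/ x)%C (/ y)%C.
Proof.
intros Hb Hx Hy H.
assert (Nx : (x <> 0)%C) by (apply Cmod_gt_0; lra).
assert (Ny : (y <> 0)%C) by (apply Cmod_gt_0; lra).
repeat split; try (rewrite Cmod_inv by auto; apply Rinv_le_contravar; auto).
replace (/ x - / y)%C with (/ (x * y) * - (x - y))%C by (field; auto).
rewrite Cmod_mult, Cmod_opp, Cmod_inv, Cmod_mult by (now apply Cmult_neq_0).
rewrite Rmult_assoc; apply Rmult_le_compat; try apply Cmod_ge_0; auto.
- left; apply Rinv_0_lt_compat; nra.
- apply Rinv_le_contravar; nra.
Qed.

Lemma eta_quotient_uniform (k : nat) (r eps : R) : 0 <= r < 1 -> 0 < eps ->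
  exists N0, forall N, (N0 <= N)%nat -> forall q, Cmod q <= r ->
  Cmod (eta_quotient (prN N) k q - eta_quotient pr k q)%C <= eps.
Proof.
intros Hr Heps; set (B := pr_ub r); set (b := pr_lb r).
assert (HB : 0 < B) by apply pr_ub_pos; assert (Hb : 0 < b) by apply pr_lb_pos.
set (e := fun N => r ^ S N / (1 - r)).
assert (He0 : forall N, 0 <= e N) by (intros; apply Rdiv_le_0_compat; [apply pow_le|]; lra).
assert (He : is_lim_seq e 0).
{ apply is_lim_seq_ext with (fun N => (r / (1 - r)) * r ^ N).
  - intros N; unfold e; simpl; field; lra.
  - replace (Finite 0) with (Finite (r / (1 - r) * 0)) by (f_equal; ring).
    apply is_lim_seq_mult'; [apply is_lim_seq_const|].
    apply is_lim_seq_geom; rewrite Rabs_pos_eq; lra. }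
assert (Hpow : forall q m, (0 < m)%nat -> Cmod q <= r -> Cmod (q ^ m)%C <= r).
{ intros q m Hm Hq; rewrite Cmod_pow; destruct m as [|m']; [lia|].
  apply Rle_trans with (r ^ S m'); [apply pow_incr; split; auto; apply Cmod_ge_0|].
  apply pow_S_le; auto. }
assert (Hn : exists K, 0 <= K /\ forall N q, Cmod q <= r ->
  Cmod (eta_quotient (prN N) k q - eta_quotient pr k q)%C <= K * e N).
{ assert (G1 : forall N q, Cmod q <= r -> near B B (e N) (prN N q) (pr q)).
  { intros N q Hq; destruct (pr_spec r q Hr Hq) as [_ [D E]].
    repeat split; [apply prN_bounds; auto|apply E|].
    rewrite Cmod_sub_comm; apply D. }
  assert (G2 : forall N q, Cmod q <= r -> near (/ b) (/ b ^ 2 * B) (e N) (/ prN N q)%C (/ pr q)%C).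
  { intros N q Hq; destruct (pr_spec r q Hr Hq) as [_ [D E]].
    apply near_inv; auto; [apply prN_bounds; auto|apply E|].
    rewrite Cmod_sub_comm; apply D. }
    assert (Z1 : forall q (P : C -> C), (P q <> 0)%C -> (P (q ^ (4 * k + 2)) <> 0)%C ->
      eta_quotient P k q = (P (q ^ 2) * P (q ^ (2 * k + 1)) * (/ P q * (/ P q * (/ P q * / P (q ^ (4 * k + 2))))))%C).
    { intros q P; unfold eta_quotient.
      generalize (P q) (P (q ^ 2)%C) (P (q ^ (2 * k + 1))%C) (P (q ^ (4 * k + 2))%C).
      intros p1 p2 p3 p4 H1 H2; field; auto. }
  assert (G3 : exists B' K', forall N q, Cmod q <= r ->
    near B' K' (e N) (eta_quotient (prN N) k q) (eta_quotient pr k q)).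
  { do 2 eexists; intros N q Hq.
    assert (Pnz : forall q', Cmod q' <= r -> (pr q' <> 0)%C).
    { intros q' Hq'; destruct (pr_spec r q' Hr Hq') as [_ [_ E]]; apply Cmod_gt_0; fold b in E; lra. }
    rewrite (Z1 q (prN N)), (Z1 q pr); try (apply Pnz; auto; apply Hpow; auto; lia);
      try (apply prN_nz; try apply Cmod_pow_lt; try lia; lra).
    apply near_mult; auto.
    - apply near_mult; auto; apply G1; apply Hpow; auto; lia.
    - apply near_mult; auto; apply near_mult; auto; apply near_mult; auto; apply G2; auto.
      apply Hpow; auto; lia. }
  destruct G3 as [B' [K' G3]]; exists (Rmax K' 0); split; [apply Rmax_r|].
  intros N q Hq; destruct (G3 N q Hq) as [_ [_ H]].
  eapply Rle_trans; [apply H|]; apply Rmult_le_compat_r; auto; apply Rmax_l. }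
destruct Hn as [K [HK Hn]].
assert (Hlim : is_lim_seq (fun N => K * e N) 0).
{ replace (Finite 0) with (Finite (K * 0)) by (f_equal; ring).
  apply is_lim_seq_mult'; [apply is_lim_seq_const|exact He]. }
destruct (proj1 (Rlim_is_lim_seq _ _) Hlim eps Heps) as [N0 HN0].
exists N0; intros N HN q Hq; specialize (HN0 N HN); rewrite Rminus_0_r in HN0.
eapply Rle_trans; [now apply Hn|]; generalize (Rle_abs (K * e N)); lra.
Qed.

(** * Bessel functions as residues *)

(** [exp (- t) * gamma_poly n t] is the upper incomplete Gamma function [Gamma(n + 1, t)], here with
    the recursion given by integration by parts. *)
Fixpoint gamma_poly (n : nat) (t : R) : R :=
  match n with O => 1 | S m => t ^ n + INR n * gamma_poly m t end.

Lemma is_derive_gamma_poly (n : nat) (t : R) :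
  is_derive (gamma_poly n) t (gamma_poly n t - t ^ n).
Proof.
induction n as [|n IH].
- simpl; replace (1 - 1) with 0 by ring; apply @is_derive_const.
- apply (is_derive_ext (fun t => t ^ S n + INR (S n) * gamma_poly n t)); [reflexivity|].
  eapply is_derive_eq.
  + apply is_derive_Rplus.
    * apply is_derive_Reals, (derivable_pt_lim_pow t (S n)).
    * apply is_derive_scal, IH.
  + cbn [gamma_poly]; simpl Init.Nat.pred; ring.
Qed.

Definition gamma_prim (n : nat) (t : R) : R := - (exp (- t) * gamma_poly n t).

Lemma is_derive_gamma_prim (n : nat) (t : R) :
  is_derive (gamma_prim n) t (t ^ n * exp (- t)).
Proof.
eapply is_derive_eq.
- unfold gamma_prim; apply @is_derive_opp, is_derive_Rmult; [|apply is_derive_gamma_poly].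
  auto_derive; [auto|reflexivity].
- unfold opp; simpl; ring.
Qed.

Lemma gamma_poly_0 (n : nat) : gamma_poly n 0 = INR (fact n).
Proof.
induction n as [|n IH]; [simpl; ring|].
cbn [gamma_poly]; rewrite IH, fact_simpl, mult_INR; simpl pow; ring.
Qed.

Lemma gamma_poly_bound (n : nat) : exists K, 0 <= K /\
  forall t, 1 <= t -> 0 <= gamma_poly n t <= K * t ^ n.
Proof.
induction n as [|n [K [HK IH]]].
- exists 1; split; [lra|]; intros; simpl; lra.
- exists (1 + INR (S n) * K); split.
  + assert (P := pos_INR (S n)); nra.
  + intros t Ht; specialize (IH t Ht); cbn [gamma_poly].
    assert (P := pos_INR (S n)); assert (Q : 0 <= t ^ S n) by (apply pow_le; lra).
    assert (Q' : 0 <= t ^ n) by (apply pow_le; lra).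
    assert (t ^ n <= t ^ S n) by (simpl; nra).
    split; [apply Rplus_le_le_0_compat; [lra|apply Rmult_le_pos; lra]|].
    rewrite Rmult_plus_distr_r, Rmult_1_l; apply Rplus_le_compat_l.
    rewrite Rmult_assoc; apply Rmult_le_compat_l; auto; nra.
Qed.

Lemma gamma_prim_infty (n : nat) : filterlim (gamma_prim n) (Rbar_locally p_infty) (locally 0).
Proof.
destruct (gamma_poly_bound n) as [K [HK HB]].
intros P [eps HP].
set (F := INR (fact (S n))).
assert (HF : 0 < F) by apply INR_fact_lt_0.
exists (Rmax 1 (K * F / eps)); intros t Ht.
assert (Ht1 : 1 < t) by (eapply Rle_lt_trans; [apply Rmax_l|exact Ht]).
assert (Ht2 : K * F / eps < t) by (eapply Rle_lt_trans; [apply Rmax_r|exact Ht]).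
apply HP; unfold ball; simpl; unfold AbsRing_ball, abs, minus, plus, opp; simpl.
unfold gamma_prim; rewrite Ropp_0, Rplus_0_r, Rabs_Ropp.
destruct (HB t ltac:(lra)) as [B1 B2].
assert (He := exp_pos (- t)).
rewrite Rabs_pos_eq by (apply Rmult_le_pos; lra).
assert (Htn : 0 < t ^ n) by (apply pow_lt; lra).
assert (E : t ^ S n / F <= exp t).
{ apply Rle_trans with (2 := exp_ge_taylor t (S n) ltac:(lra)).
  rewrite tech5; fold F.
  assert (0 <= sum_f_R0 (fun k => t ^ k / INR (fact k)) n); [|lra].
  apply cond_pos_sum; intros k; apply Rdiv_le_0_compat; [apply pow_le; lra|apply INR_fact_lt_0]. }
assert (E2 : exp (- t) * t ^ n <= F / t).
{ rewrite exp_Ropp; apply Rmult_le_reg_l with (exp t); [apply exp_pos|].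
  rewrite <- Rmult_assoc, Rinv_r, Rmult_1_l by (apply Rgt_not_eq, exp_pos).
  apply Rle_trans with (t ^ S n / F * (F / t)).
  - right; simpl; field; lra.
  - apply Rmult_le_compat_r; auto; apply Rdiv_le_0_compat; lra. }
apply Rle_lt_trans with (K * (F / t)).
- apply Rle_trans with (K * (exp (- t) * t ^ n)); [nra|now apply Rmult_le_compat_l].
- destruct eps as [e He']; simpl in *.
  apply Rmult_lt_reg_r with (t / e); [apply Rdiv_lt_0_compat; lra|].
  replace (K * (F / t) * (t / e)) with (K * F / e) by (field; lra).
  replace (e * (t / e)) with t by (field; lra); auto.
Qed.

Lemma Gamma_nat (n : nat) : Gamma (INR n + 1) = INR (fact n).
Proof.
unfold Gamma; apply (is_RInt_gen_unique (V := R_CompleteNormedModule)).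
(* [Rpower] is identified with the ordinary power only on positive reals, so the integration
   interval must eventually lie in them. *)
assert (Hpos : filter_prod (at_right 0) (Rbar_locally p_infty)
  (fun ab => forall x, Rmin (fst ab) (snd ab) <= x <= Rmax (fst ab) (snd ab) -> 0 < x)).
{ apply (Filter_prod _ _ _ (fun a => 0 < a) (fun b => 0 < b)).
  - exists (mkposreal 1 Rlt_0_1); intros y _ Hy; exact Hy.
  - now exists 0.
  - intros a b Ha Hb x [Hx _]; apply Rlt_le_trans with (2 := Hx).
    now apply Rmin_glb_lt. }
assert (HD : forall t, Derive (gamma_prim n) t = t ^ n * exp (- t))
  by (intros; apply is_derive_unique, is_derive_gamma_prim).
assert (G : is_RInt_gen (Derive (gamma_prim n)) (at_right 0) (Rbar_locally p_infty)
  (0 - gamma_prim n 0)).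
{ apply is_RInt_gen_Derive; try typeclasses eauto.
  - apply filter_forall; intros ab x _; eexists; apply is_derive_gamma_prim.
  - apply filter_forall; intros ab x _.
    apply (continuous_ext (fun t => t ^ n * exp (- t))); [intros; now rewrite HD|].
    apply (ex_derive_continuous (fun t => t ^ n * exp (- t))).
    auto_derive; auto.
  - eapply filterlim_filter_le_1; [apply filter_le_within|].
    apply (ex_derive_continuous (gamma_prim n)); eexists; apply is_derive_gamma_prim.
  - apply gamma_prim_infty. }
replace (0 - gamma_prim n 0) with (INR (fact n)) in G
  by (unfold gamma_prim; rewrite gamma_poly_0, Ropp_0, exp_0; ring).
revert G; apply is_RInt_gen_ext.
revert Hpos; apply filter_imp; intros [a b] H x Hx; simpl in *.
rewrite HD; replace (INR n + 1 - 1) with (INR n) by ring.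
rewrite Rpower_pow; auto; apply H; lra.
Qed.

(** The coefficient of [1/z] in [z exp (a z) exp (b / z)] is the sum of these terms: order [l] in
    the first exponential meets order [l + 2] in the second. *)
Definition residue_term (a b : R) (l : nat) : R :=
  a ^ l * b ^ (l + 2) / (INR (fact l) * INR (fact (l + 2))).

Lemma BesselI_2_series (a b L : R) : 0 < a -> 0 <= b ->
  is_lim_seq (rsum (residue_term a b)) L ->
  L = b / a * BesselI 2 (2 * sqrt (a * b)).
Proof.
intros Ha Hb HL; apply is_series_rsum in HL.
apply is_series_unique in HL; rewrite <- HL; unfold BesselI.
rewrite <- Series_scal_l; apply Series_ext; intros l; unfold residue_term.
replace (INR (l + 2 + 1)) with (INR (l + 2) + 1) by (rewrite (plus_INR (l + 2)); reflexivity).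
rewrite Gamma_nat.
replace (2 * sqrt (a * b) / 2) with (sqrt (a * b)) by field.
replace (2 * l + 2)%nat with (2 * (l + 1))%nat by ring.
rewrite pow_mult, pow2_sqrt by (apply Rmult_le_pos; lra).
rewrite Rpow_mult_distr; replace (l + 2)%nat with (S (S l)) by lia.
replace (l + 1)%nat with (S l) by lia; simpl pow.
field; repeat split; try lra; apply INR_fact_neq_0.
Qed.

(** The integral of [f] along the lower half of the rectangle with vertices
    [+-rho +- i theta], run clockwise, with respect to [i dz]. *)
Definition half_contour (rho theta : R) (f : C -> C) : C :=
  (CInt (fun t => f (rho - Ci * t)) 0 theta
   - Ci * CInt (fun x => f (x - Ci * theta)) (- rho) rho
   - CInt (fun t => f (- rho - Ci * t)) 0 theta)%C.

(** Differentiability along every differentiable path avoiding [0]. It ensures that [f] is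
    integrable on the sides of the contour, and is all that is used of holomorphy there. *)
Definition smooth_off_0 (f : C -> C) : Prop :=
  forall (p : R -> C) t, (p t <> 0)%C -> cdiff p t -> cdiff (fun s => f (p s)) t.

Section HalfContour.

Variables rho theta : R.
Hypothesis Hrho : 0 < rho.
Hypothesis Htheta : 0 < theta.

Lemma contour_nz : (forall t : R, (rho - Ci * t <> 0)%C) /\
  (forall t : R, (- rho - Ci * t <> 0)%C) /\ (forall x : R, (x - Ci * theta <> 0)%C).
Proof.
repeat split; intros u E.
- apply (f_equal Re) in E; simpl in E; lra.
- apply (f_equal Re) in E; simpl in E; lra.
- apply (f_equal Im) in E; simpl in E; lra.
Qed.

Lemma half_contour_int (f : C -> C) : smooth_off_0 f ->
  ex_CInt (fun t => f (rho - Ci * t)%C) 0 theta /\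
  ex_CInt (fun x => f (x - Ci * theta)%C) (- rho) rho /\
  ex_CInt (fun t => f (- rho - Ci * t)%C) 0 theta.
Proof.
intros Hf; destruct contour_nz as [H1 [H2 H3]].
split; [|split]; apply ex_CInt_diff; intros t _.
- apply (Hf (fun t => rho - Ci * t)%C); auto.
  apply cdiff_ext with (fun s => rho + (- Ci) * s)%C; [intros; ring|apply cdiff_affine].
- apply (Hf (fun x => x - Ci * theta)%C); auto.
  apply cdiff_ext with (fun s => - (Ci * theta) + 1 * s)%C; [intros; ring|apply cdiff_affine].
- apply (Hf (fun t => - rho - Ci * t)%C); auto.
  apply cdiff_ext with (fun s => - rho + (- Ci) * s)%C; [intros; ring|apply cdiff_affine].
Qed.

Lemma half_contour_plus (f g : C -> C) : smooth_off_0 f -> smooth_off_0 g ->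
  half_contour rho theta (fun z => f z + g z)%C
  = (half_contour rho theta f + half_contour rho theta g)%C.
Proof.
intros Hf Hg; destruct (half_contour_int f Hf) as [F1 [F2 F3]].
destruct (half_contour_int g Hg) as [G1 [G2 G3]].
unfold half_contour; rewrite !CInt_plus by auto; ring.
Qed.

Lemma half_contour_minus (f g : C -> C) : smooth_off_0 f -> smooth_off_0 g ->
  half_contour rho theta (fun z => f z - g z)%C
  = (half_contour rho theta f - half_contour rho theta g)%C.
Proof.
intros Hf Hg; destruct (half_contour_int f Hf) as [F1 [F2 F3]].
destruct (half_contour_int g Hg) as [G1 [G2 G3]].
unfold half_contour; rewrite !CInt_minus by auto; ring.
Qed.

Lemma half_contour_scal (c : C) (f : C -> C) : smooth_off_0 f ->
  half_contour rho theta (fun z => c * f z)%C = (c * half_contour rho theta f)%C.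
Proof.
intros Hf; destruct (half_contour_int f Hf) as [F1 [F2 F3]].
unfold half_contour; rewrite !CInt_scal by auto; ring.
Qed.

Lemma half_contour_ext (f g : C -> C) : (forall z : C, (z <> 0)%C -> f z = g z) ->
  half_contour rho theta f = half_contour rho theta g.
Proof.
intros E; destruct contour_nz as [H1 [H2 H3]]; unfold half_contour.
rewrite (CInt_ext (fun t => f (rho - Ci * t)%C) (fun t => g (rho - Ci * t)%C)) by (intros; apply E; auto).
rewrite (CInt_ext (fun x => f (x - Ci * theta)%C) (fun x => g (x - Ci * theta)%C)) by (intros; apply E; auto).
rewrite (CInt_ext (fun t => f (- rho - Ci * t)%C) (fun t => g (- rho - Ci * t)%C)) by (intros; apply E; auto).
reflexivity.
Qed.

Lemma smooth_csum (f : nat -> C -> C) (n : nat) : (forall i, smooth_off_0 (f i)) ->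
  smooth_off_0 (fun z => csum (fun i => f i z) n).
Proof.
intros Hf p t Hp Hd; induction n as [|n IH]; cbn [csum].
- exists (RtoC 0); apply cderiv_const.
- destruct IH as [l1 H1]; destruct (Hf n p t Hp Hd) as [l2 H2].
  exists (l1 + l2)%C; now apply (cderiv_plus (fun s => csum (fun i => f i (p s)) n)).
Qed.

Lemma half_contour_csum (f : nat -> C -> C) (n : nat) : (forall i, smooth_off_0 (f i)) ->
  half_contour rho theta (fun z => csum (fun i => f i z) n)
  = csum (fun i => half_contour rho theta (f i)) n.
Proof.
intros Hf; induction n as [|n IH]; cbn [csum].
- transitivity (RtoC 0 * half_contour rho theta (fun z => z))%C; [|ring].
  rewrite <- half_contour_scal; [|intros p t _ Hd; exact Hd].
  apply half_contour_ext; intros; ring.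
- rewrite <- IH; apply (half_contour_plus (fun z => csum (fun i => f i z) n)); auto.
  now apply smooth_csum.
Qed.

Lemma half_contour_bound (f : C -> C) (M : R) : smooth_off_0 f ->
  (forall z, Rmin rho theta <= Cmod z <= rho + theta -> Cmod (f z) <= M) ->
  Cmod (half_contour rho theta f) <= 4 * M * (rho + theta).
Proof.
intros Hf HM; destruct (half_contour_int f Hf) as [F1 [F2 F3]].
assert (Hs : forall x y : R, (x = rho \/ x = - rho) /\ 0 <= y <= theta \/
   - rho <= x <= rho /\ y = theta -> Rmin rho theta <= Cmod (x - Ci * y)%C <= rho + theta).
{ intros x y Hxy; set (z := (x - Ci * y)%C).
  assert (Ex : Re z = x) by (unfold z; simpl; ring).
  assert (Ey : Im z = - y) by (unfold z; simpl; ring).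
  assert (A1 := re_le_Cmod z); assert (A2 := im_le_Cmod z); assert (A3 := Cmod_le_abs z).
  rewrite Ex, Ey, Rabs_Ropp in *.
  assert (Rm1 := Rmin_l rho theta); assert (Rm2 := Rmin_r rho theta).
  destruct Hxy as [[[-> | ->] Hy]|[Hx ->]].
  - rewrite (Rabs_pos_eq rho), (Rabs_pos_eq y) in * by lra; lra.
  - rewrite Rabs_Ropp, (Rabs_pos_eq rho), (Rabs_pos_eq y) in * by lra; lra.
  - rewrite (Rabs_pos_eq theta) in * by lra.
    assert (Rabs x <= rho) by (apply Rabs_le; lra); lra. }
assert (B1 := CInt_bound _ 0 theta M ltac:(lra) F1).
assert (B2 := CInt_bound _ (- rho) rho M ltac:(lra) F2).
assert (B3 := CInt_bound _ 0 theta M ltac:(lra) F3).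
unfold half_contour; eapply Rle_trans; [apply Cmod_minus_le|].
set (i1 := CInt (fun t => f (rho - Ci * t)%C) 0 theta) in *.
set (i2 := CInt (fun x => f (x - Ci * theta)%C) (- rho) rho) in *.
set (i3 := CInt (fun t => f (- rho - Ci * t)%C) 0 theta) in *.
assert (X1 := Cmod_minus_le i1 (Ci * i2)); rewrite Cmod_mult, Cmod_Ci, Rmult_1_l in X1.
assert (Y1 : Cmod i1 <= 2 * M * (theta - 0)).
{ apply B1; intros t Ht; apply HM, Hs; left; auto. }
assert (Y2 : Cmod i2 <= 2 * M * (rho - - rho)).
{ apply B2; intros t Ht; apply HM, Hs; right; auto. }
assert (Y3 : Cmod i3 <= 2 * M * (theta - 0)).
{ apply B3; intros t Ht; apply HM; rewrite <- RtoC_opp; apply Hs; left; auto. }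
lra.
Qed.

(** The chain rule along paths takes the place of a complex derivative of [F]. The values at the
    corners cancel; only the ends on the real axis remain, so [theta] drops out. *)
Lemma half_contour_primitive (f F : C -> C) : smooth_off_0 f ->
  (forall (p : R -> C) t p', (p t <> 0)%C -> cderiv p t p' ->
     cderiv (fun s => F (p s)) t (f (p t) * p')%C) ->
  half_contour rho theta f = (Ci * (F (- rho)%C - F (RtoC rho)))%C.
Proof.
intros Hf HF; destruct contour_nz as [H1 [H2 H3]].
assert (D1 : forall (c : C) t, cderiv (fun s => c - Ci * s)%C t (- Ci)%C).
{ intros c t; apply cderiv_ext with (fun s => c + (- Ci) * s)%C; [intros; ring|apply cderiv_affine]. }
assert (D2 : forall (c : C) t, cderiv (fun s => s - c)%C t (RtoC 1)).
{ intros c t; apply cderiv_ext with (fun s => - c + 1 * s)%C; [intros; ring|apply cderiv_affine]. }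
assert (I1 : forall c : C, (forall t : R, (c - Ci * t <> 0)%C) ->
  CInt (fun t => f (c - Ci * t)%C) 0 theta = (Ci * F (c - Ci * theta) - Ci * F c)%C).
{ intros c Hc; rewrite (CInt_derive (fun t => Ci * F (c - Ci * t))%C).
  - do 4 f_equal; ring.
  - intros t _; eapply cderiv_eq; [apply cderiv_scal, HF; [apply Hc|apply D1]|].
    transitivity (- (Ci * Ci) * f (c - Ci * t))%C; [|rewrite Ci_sq]; ring.
  - intros t _; apply (Hf (fun t => c - Ci * t)%C); [apply Hc|]; eexists; apply D1. }
unfold half_contour; rewrite (I1 rho), (I1 (- rho)%C) by auto.
rewrite (CInt_derive (fun x => F (x - Ci * theta)%C)).
- rewrite RtoC_opp; ring.
- intros t _; eapply cderiv_eq; [apply HF; [apply H3|apply D2]|cbv beta; ring].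
- intros t _; apply (Hf (fun t => t - Ci * theta)%C); [apply H3|]; eexists; apply D2.
Qed.

(** Each side is integrated with real primitives. The logarithms cancel at the corners and the
    arctangents add up to half a turn. *)
Lemma half_contour_inv : half_contour rho theta Cinv = RtoC PI.
Proof.
assert (Q : forall u v : R, 0 < u ^ 2 + v ^ 2 -> (/ (u - Ci * v))%C
  = (u / (u ^ 2 + v ^ 2), v / (u ^ 2 + v ^ 2))).
{ intros u v H; apply Ceq; simpl; field; nra. }
assert (Da : forall c t : R, c <> 0 -> is_derive (fun t => atan (t / c)) t (c / (c ^ 2 + t ^ 2))).
{ intros c t Hc; auto_derive; auto; unfold Rsqr; field; split; auto; nra. }
assert (Dl : forall c t : R, c <> 0 -> is_derive (fun t => / 2 * ln (c ^ 2 + t ^ 2)) t (t / (c ^ 2 + t ^ 2))).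
{ intros c t Hc; auto_derive; [nra|]; field; nra. }
assert (Dl' : forall c t : R, c <> 0 -> is_derive (fun t => / 2 * ln (t ^ 2 + c ^ 2)) t (t / (t ^ 2 + c ^ 2))).
{ intros c t Hc; auto_derive; [nra|]; field; nra. }
assert (Smooth : smooth_off_0 Cinv).
{ intros p t Hp [l Hl]; eexists; apply cderiv_inv; eauto. }
destruct contour_nz as [H1 [H2 H3]].
assert (Df : forall (c : C) t, cdiff (fun s => c - Ci * s)%C t).
{ intros c t; apply cdiff_ext with (fun s => c + (- Ci) * s)%C; [intros; ring|apply cdiff_affine]. }
assert (Dg : forall (c : C) t, cdiff (fun s => s - c)%C t).
{ intros c t; apply cdiff_ext with (fun s => - c + 1 * s)%C; [intros; ring|apply cdiff_affine]. }
unfold half_contour.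
rewrite (CInt_derive (fun t => (atan (t / rho), / 2 * ln (rho ^ 2 + t ^ 2)) : C)).
2:{ intros t _; rewrite Q by nra; split; simpl Re; simpl Im; [apply Da|apply Dl]; lra. }
2:{ intros t _; apply (Smooth (fun t => rho - Ci * t)%C); auto. }
rewrite (CInt_derive (fun x => (/ 2 * ln (x ^ 2 + theta ^ 2), atan (x / theta)) : C)).
2:{ intros t _; rewrite Q by nra; split; simpl Re; simpl Im; [apply Dl'; lra|].
    rewrite (Rplus_comm (t ^ 2)); apply Da; lra. }
2:{ intros t _; apply (Smooth (fun t => t - Ci * theta)%C); auto. }
rewrite (CInt_derive (fun t => (atan (t / - rho), / 2 * ln ((- rho) ^ 2 + t ^ 2)) : C)).
2:{ intros t _; rewrite <- RtoC_opp, Q by nra; split; simpl Re; simpl Im; [apply Da|apply Dl]; lra. }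
2:{ intros t _; apply (Smooth (fun t => - rho - Ci * t)%C); auto. }
assert (A1 : atan (theta / rho) = PI / 2 - atan (rho / theta)).
{ replace (theta / rho) with (/ (rho / theta)) by (field; lra).
  apply atan_inv, Rdiv_lt_0_compat; lra. }
assert (A2 : atan (- rho / theta) = - atan (rho / theta)).
{ rewrite <- atan_opp; f_equal; field; lra. }
assert (A3 : atan (theta / - rho) = - atan (theta / rho)).
{ rewrite <- atan_opp; f_equal; field; lra. }
assert (A4 : atan (0 / rho) = 0) by (unfold Rdiv; rewrite Rmult_0_l; apply atan_0).
assert (A5 : atan (0 / - rho) = 0) by (unfold Rdiv; rewrite Rmult_0_l; apply atan_0).
replace ((- rho) ^ 2) with (rho ^ 2) by ring.
apply Ceq; simpl; rewrite ?A1, ?A2, ?A3, ?A4, ?A5, ?A1.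
- field.
- replace (- rho * (- rho * 1)) with (rho * (rho * 1)) by ring; ring.
Qed.

End HalfContour.

(** * Laurent monomials, truncated exponentials and the residue *)

Definition laurent (l m : nat) (z : C) : C := (z ^ S l * (/ z) ^ m)%C.

Lemma smooth_laurent (l m : nat) : smooth_off_0 (laurent l m).
Proof.
intros p t Hp Hd; unfold laurent.
apply (cdiff_mult (fun s => p s ^ S l)%C (fun s => (/ p s) ^ m)%C).
- now apply (cdiff_pow p).
- apply (cdiff_pow (fun s => / p s)%C); now apply cdiff_inv.
Qed.

(** The exponent is [l + 1 - m], equal to [-1] exactly for [m = l + 2]. Otherwise there is a
    primitive with real values at [+-rho], so the integral, [i] times their difference, is purely
    imaginary: taking real parts isolates the residue although the contour is only half closed. *)
Lemma half_contour_laurent (rho theta : R) (l m : nat) : 0 < rho -> 0 < theta ->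
  half_contour rho theta (laurent l m) = half_contour rho 1 (laurent l m) /\
  Re (half_contour rho theta (laurent l m)) = if Nat.eqb m (l + 2) then PI else 0.
Proof.
intros Hr Ht.
assert (Prim : forall (f F : C -> C), (forall z : C, (z <> 0)%C -> laurent l m z = f z) ->
  smooth_off_0 f ->
  (forall (p : R -> C) t p', (p t <> 0)%C -> cderiv p t p' ->
     cderiv (fun s => F (p s)) t (f (p t) * p')%C) ->
  (exists x : R, (F (- rho)%C - F (RtoC rho))%C = RtoC x) ->
  half_contour rho theta (laurent l m) = half_contour rho 1 (laurent l m) /\
  Re (half_contour rho theta (laurent l m)) = 0).
{ intros f F E S D [x Hx].
  assert (G : forall th, 0 < th -> half_contour rho th (laurent l m) = (Ci * RtoC x)%C).
  { intros th Hth; rewrite (half_contour_ext rho th Hr Hth _ _ E), <- Hx.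
    now apply half_contour_primitive. }
  rewrite !G by lra; split; auto; simpl; ring. }
assert (HnC : forall n, (RtoC (INR (S n)) <> 0)%C) by (intros; apply RtoC_INR_nz; lia).
destruct (lt_eq_lt_dec m (l + 2)) as [[L|E]|L].
- destruct (Nat.eqb_spec m (l + 2)) as [E|_]; [lia|].
  set (n := (S l - m)%nat).
  apply (Prim (fun z => z ^ n)%C (fun z => / INR (S n) * z ^ S n)%C).
  + intros z Hz; unfold laurent; replace (S l) with (n + m)%nat by (unfold n; lia).
    rewrite Cpow_add_r, Cpow_inv by auto; field; now apply Cpow_nz.
  + intros p t _ Hd; now apply (cdiff_pow p).
  + intros p t p' _ Hd; eapply cderiv_eq; [apply cderiv_scal, cderiv_pow; exact Hd|].
    rewrite !Cmult_assoc, Cinv_l by auto; ring.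
  + exists (/ INR (S n) * (- rho) ^ S n - / INR (S n) * rho ^ S n).
    rewrite RtoC_minus, !RtoC_mult, RtoC_inv, !RtoC_pow, RtoC_opp
      by (apply not_0_INR; lia); reflexivity.
- rewrite E, Nat.eqb_refl.
  assert (G : forall th, 0 < th -> half_contour rho th (laurent l (l + 2)) = RtoC PI).
  { intros th Hth; rewrite <- (half_contour_inv rho th Hr Hth).
    apply half_contour_ext; auto; intros z Hz; unfold laurent.
    replace (l + 2)%nat with (S (S l)) by lia; rewrite Cpow_inv, (Cpow_S z (S l)) by auto.
    field; split; auto; now apply Cpow_nz. }
  rewrite !G by lra; split; auto.
- destruct (Nat.eqb_spec m (l + 2)) as [E|_]; [lia|].
  set (n := (m - l - 3)%nat).
  apply (Prim (fun z => / z ^ S (S n))%C (fun z => - / INR (S n) * / z ^ S n)%C).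
  + intros z Hz; unfold laurent; replace m with (S l + S (S n))%nat by (unfold n; lia).
    rewrite Cpow_inv, Cpow_add_r by auto; field; split; now apply Cpow_nz.
  + intros p t Hp Hd; apply (cdiff_inv (fun s => p s ^ S (S n))%C); [now apply Cpow_nz|].
    now apply (cdiff_pow p).
  + intros p t p' Hp Hd; eapply cderiv_eq.
    * apply cderiv_scal, cderiv_inv; [apply (Cpow_nz (p t) (S n) Hp)|apply cderiv_pow; exact Hd].
    * rewrite !Cpow_S; assert (Hq := Cpow_nz (p t) n Hp); specialize (HnC n); field; auto.
  + exists (- / INR (S n) * / (- rho) ^ S n - - / INR (S n) * / rho ^ S n).
    rewrite RtoC_minus, !RtoC_mult, RtoC_opp, !RtoC_inv, !RtoC_pow, RtoC_opp
      by (try apply pow_nonzero; try apply not_0_INR; try lia; lra); reflexivity.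
Qed.

Definition polar_kernel (a b : R) (z : C) : C := (z * Cexp (b * / z + a * z))%C.

Lemma smooth_polar_kernel (a b : R) : smooth_off_0 (polar_kernel a b).
Proof.
intros p t Hp Hd; unfold polar_kernel.
apply (cdiff_mult p); auto.
apply (cdiff_Cexp (fun s => b * / p s + a * p s)%C).
destruct (cdiff_inv p t Hp Hd) as [l1 H1]; destruct Hd as [l2 H2].
exists (b * l1 + a * l2)%C; apply (cderiv_plus (fun s => b * / p s)%C);
  now apply cderiv_scal.
Qed.

Definition laurent_partial (a b : R) (M : nat) (z : C) : C :=
  csum (fun l => csum (fun m => RtoC (a ^ l / INR (fact l) * (b ^ m / INR (fact m)))
    * laurent l m z) M)%C M.

Lemma laurent_partial_eq (a b : R) (M : nat) (z : C) : (z <> 0)%C ->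
  laurent_partial a b M z = (z * (ctaylor M (a * z) * ctaylor M (b * / z)))%C.
Proof.
intros Hz; unfold laurent_partial, ctaylor.
set (f := fun l => ((a * z) ^ l / INR (fact l))%C).
set (g := fun m => ((b * / z) ^ m / INR (fact m))%C).
transitivity (csum (fun l => csum (fun m => z * f l * g m) M) M)%C.
- apply csum_ext; intros l _; apply csum_ext; intros m _; unfold laurent, f, g.
  assert (A := INR_fact_C_nz l); assert (B := INR_fact_C_nz m).
  rewrite RtoC_mult, !RtoC_div, !RtoC_pow, !Cpow_mult_l, Cpow_S by apply INR_fact_neq_0.
  unfold Cdiv; ring.
- rewrite (csum_ext _ (fun l => (z * csum g M) * f l)%C).
  + rewrite csum_scal; ring.
  + intros l _; rewrite csum_scal; ring.
Qed.

Lemma smooth_laurent_partial (a b : R) (M : nat) : smooth_off_0 (laurent_partial a b M).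
Proof.
apply (smooth_csum (fun l z => csum (fun m => RtoC (a ^ l / INR (fact l) * (b ^ m / INR (fact m)))
    * laurent l m z) M)%C); intros l.
apply (smooth_csum (fun m z => RtoC (a ^ l / INR (fact l) * (b ^ m / INR (fact m)))
    * laurent l m z)%C); intros m p t Hp Hd.
destruct (smooth_laurent l m p t Hp Hd) as [x Hx]; eexists; apply cderiv_scal; exact Hx.
Qed.

Lemma half_contour_partial (a b rho theta : R) (M : nat) : 0 < rho -> 0 < theta ->
  half_contour rho theta (laurent_partial a b M) =
  csum (fun l => csum (fun m => RtoC (a ^ l / INR (fact l) * (b ^ m / INR (fact m)))
    * half_contour rho 1 (laurent l m)) M)%C M.
Proof.
intros Hr Ht; unfold laurent_partial.
assert (S : forall l m, smooth_off_0 (fun z => RtoC (a ^ l / INR (fact l) * (b ^ m / INR (fact m)))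
    * laurent l m z)%C).
{ intros l m p t Hp Hd; destruct (smooth_laurent l m p t Hp Hd) as [x Hx].
  eexists; apply cderiv_scal; exact Hx. }
rewrite (half_contour_csum rho theta Hr Ht (fun l z => csum (fun m => RtoC (a ^ l / INR (fact l) * (b ^ m / INR (fact m)))
    * laurent l m z) M)%C) by (intros l; apply (smooth_csum _ M (S l))).
apply csum_ext; intros l _.
rewrite (half_contour_csum rho theta Hr Ht (fun m z => RtoC (a ^ l / INR (fact l) * (b ^ m / INR (fact m)))
    * laurent l m z)%C) by apply S.
apply csum_ext; intros m _.
rewrite half_contour_scal by (auto; apply smooth_laurent).
f_equal; now apply half_contour_laurent.
Qed.

Lemma rsum_single (f : nat -> R) (c : R) (k M : nat) :
  rsum (fun m => f m * (if Nat.eqb m k then c else 0)) M = if Nat.ltb k M then f k * c else 0.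
Proof.
induction M as [|M IH]; [reflexivity|].
cbn [rsum]; rewrite IH.
destruct (Nat.eqb_spec M k) as [H|H], (Nat.ltb_spec k M), (Nat.ltb_spec k (S M));
  try lia; try rewrite H; ring.
Qed.

(** Truncation at [M + 2] because the pair [(l, l + 2)] lies in the square of that size exactly when
    [l < M]. *)
Lemma Re_half_contour_partial (a b rho : R) (M : nat) : 0 < rho ->
  Re (half_contour rho 1 (laurent_partial a b (M + 2))) = PI * rsum (residue_term a b) M.
Proof.
intros Hr; rewrite half_contour_partial by lra.
rewrite Re_csum.
rewrite (rsum_ext _ (fun l => if Nat.ltb (l + 2) (M + 2) then
  a ^ l / INR (fact l) * (b ^ (l + 2) / INR (fact (l + 2))) * PI else 0)).
- rewrite rsum_split, (rsum_ext _ (fun l => PI * residue_term a b l)).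
  + rewrite rsum_scal, (rsum_ext (fun i => if Nat.ltb (M + i + 2) _ then _ else _) (fun _ => 0)), rsum_const; [ring|].
    intros i _; destruct (Nat.ltb_spec (M + i + 2) (M + 2)); [lia|auto].
  + intros i Hi; destruct (Nat.ltb_spec (i + 2) (M + 2)); [|lia].
    unfold residue_term; field; split; apply INR_fact_neq_0.
- intros l _; rewrite <- (rsum_single (fun m => a ^ l / INR (fact l) * (b ^ m / INR (fact m)))).
  rewrite Re_csum; apply rsum_ext; intros m _; rewrite re_scal_l; f_equal.
  now apply half_contour_laurent; lra.
Qed.

(** On the contour [|z|] lies between [Rmin rho theta] and [rho + theta], so [|a z|] and [|b / z|]
    have a common bound [A] and both Taylor remainders are uniformly small. *)
Lemma laurent_approx (a b rho theta : R) : 0 < rho -> 0 < theta ->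
  Clim (fun M => half_contour rho theta (laurent_partial a b M))
    (half_contour rho theta (polar_kernel a b)).
Proof.
intros Hr Ht.
set (D := rho + theta); set (d := Rmin rho theta).
assert (Hd : 0 < d) by now apply Rmin_glb_lt.
set (A := Rabs a * D + Rabs b * / d).
assert (HA : 0 <= A).
{ unfold A, D; assert (X := Rabs_pos a); assert (Y := Rabs_pos b).
  assert (0 < / d) by now apply Rinv_0_lt_compat.
  apply Rplus_le_le_0_compat; apply Rmult_le_pos; lra. }
set (e := fun M => exp A * (A ^ M / INR (fact M))).
assert (He : is_lim_seq e 0).
{ replace (Finite 0) with (Finite (exp A * 0)) by (f_equal; ring).
  apply is_lim_seq_mult'; [apply is_lim_seq_const|].
  apply is_lim_seq_Reals, cv_speed_pow_fact. }
apply Clim_squeeze with (fun M => 4 * (D * (2 * exp A + e M) * e M) * (rho + theta)).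
2:{ replace (Finite 0) with (Finite (4 * (D * (2 * exp A + 0) * 0) * (rho + theta))) by (f_equal; ring).
    apply is_lim_seq_mult'; [|apply is_lim_seq_const].
    apply is_lim_seq_mult'; [apply is_lim_seq_const|].
    apply is_lim_seq_mult'; auto.
    apply is_lim_seq_mult'; [apply is_lim_seq_const|].
    apply is_lim_seq_plus'; auto; apply is_lim_seq_const. }
intros M.
rewrite <- (half_contour_minus rho theta Hr Ht (laurent_partial a b M) (polar_kernel a b)
  (smooth_laurent_partial a b M) (smooth_polar_kernel a b)).
apply (half_contour_bound rho theta Hr Ht
  (fun z => laurent_partial a b M z - polar_kernel a b z)%C).
{ intros p t Hp Hdp; destruct (smooth_laurent_partial a b M p t Hp Hdp) as [x Hx].
  destruct (smooth_polar_kernel a b p t Hp Hdp) as [y Hy].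
  exists (x - y)%C; now apply (cderiv_minus (fun s => laurent_partial a b M (p s))). }
intros z [Hz1 Hz2]; fold d D in Hz1, Hz2.
assert (Hz : (z <> 0)%C) by (apply Cmod_gt_0; lra).
assert (T : forall u, Cmod u <= A -> Cmod (Cexp u) <= exp A /\ Cmod (Cexp u - ctaylor M u)%C <= e M).
{ intros u Hu; split.
  - rewrite Cmod_Cexp; apply exp_mono; generalize (Re_le u); lra.
  - eapply Rle_trans; [apply Cexp_taylor|]; unfold e, Rdiv; rewrite Rmult_assoc.
    assert (P := Cmod_ge_0 u).
    apply Rmult_le_compat; [left; apply exp_pos| |now apply exp_mono|].
    + apply Rmult_le_pos; [now apply pow_le|left; apply Rinv_0_lt_compat, INR_fact_lt_0].
    + apply Rmult_le_compat_r; [left; apply Rinv_0_lt_compat, INR_fact_lt_0|].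
      now apply pow_incr. }
assert (X := Rabs_pos a); assert (Y := Rabs_pos b); assert (Z := Cmod_ge_0 z).
assert (Zi : Cmod (/ z)%C <= / d) by (rewrite Cmod_inv by auto; now apply Rinv_le_contravar).
assert (0 < / d) by now apply Rinv_0_lt_compat.
destruct (T (a * z)%C) as [T1 T2].
{ rewrite Cmod_mult, Cmod_R; unfold A.
  assert (Rabs a * Cmod z <= Rabs a * D) by (apply Rmult_le_compat_l; auto).
  assert (0 <= Rabs b * / d) by (apply Rmult_le_pos; lra); lra. }
destruct (T (b * / z)%C) as [T3 T4].
{ rewrite Cmod_mult, Cmod_R; unfold A.
  assert (Rabs b * Cmod (/ z)%C <= Rabs b * / d) by (apply Rmult_le_compat_l; auto).
  assert (0 <= Rabs a * D) by (apply Rmult_le_pos; unfold D; lra); lra. }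
rewrite laurent_partial_eq by auto; unfold polar_kernel; rewrite Cexp_plus.
set (E1 := Cexp (a * z)) in *; set (E2 := Cexp (b * / z)) in *.
set (S1 := ctaylor M (a * z)) in *; set (S2 := ctaylor M (b * / z)) in *.
replace (z * (S1 * S2) - z * (E2 * E1))%C
  with (- (z * (E2 * (E1 - S1) + S1 * (E2 - S2))))%C by ring.
assert (HS1 : Cmod S1 <= exp A + e M).
{ generalize (Cmod_triangle_sub S1 E1); rewrite Cmod_sub_comm; lra. }
assert (Hm := exp_pos A); assert (HeM : 0 <= e M) by (generalize (Cmod_ge_0 (E1 - S1)%C); lra).
rewrite Cmod_opp, Cmod_mult, Rmult_assoc; apply Rmult_le_compat; auto; try apply Cmod_ge_0.
eapply Rle_trans; [apply Cmod_triangle|]; rewrite !Cmod_mult.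
assert (Cmod E2 * Cmod (E1 - S1)%C <= exp A * e M) by (apply Rmult_le_compat; auto; apply Cmod_ge_0).
assert (Cmod S1 * Cmod (E2 - S2)%C <= (exp A + e M) * e M) by (apply Rmult_le_compat; auto; apply Cmod_ge_0).
lra.
Qed.

(** True for every Laurent truncation, hence in the limit. Thus arcs of different lengths around
    fractions of the same denominator share one main term, taken at height [1]. *)
Theorem half_contour_polar_kernel (a b rho theta : R) : 0 < rho -> 0 < theta ->
  half_contour rho theta (polar_kernel a b) = half_contour rho 1 (polar_kernel a b).
Proof.
intros Hr Ht.
apply (Clim_unique (fun M => half_contour rho theta (laurent_partial a b M))).
- now apply laurent_approx.
- apply Clim_ext with (fun M => half_contour rho 1 (laurent_partial a b M)).
  + intros M; now rewrite !half_contour_partial by lra.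
  + apply laurent_approx; lra.
Qed.

Theorem Re_half_contour_polar_kernel (a b rho : R) : 0 < rho -> 0 < a -> 0 <= b ->
  Re (half_contour rho 1 (polar_kernel a b)) = PI * (b / a * BesselI 2 (2 * sqrt (a * b))).
Proof.
intros Hr Ha Hb.
assert (L := Clim_Re _ _ (laurent_approx a b rho 1 Hr ltac:(lra))).
set (X := Re (half_contour rho 1 (polar_kernel a b))) in *.
assert (L2 : is_lim_seq (rsum (residue_term a b)) (/ PI * X)).
{ apply is_lim_seq_ext with (fun M => / PI * Re (half_contour rho 1 (laurent_partial a b (M + 2)))).
  - intros M; rewrite Re_half_contour_partial by auto; field; generalize PI_RGT_0; lra.
  - apply is_lim_seq_mult'; [apply is_lim_seq_const|].
    now apply (is_lim_seq_incr_n (fun M => Re (half_contour rho 1 (laurent_partial a b M))) 2). }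
apply BesselI_2_series in L2; auto.
rewrite <- L2; field; generalize PI_RGT_0; lra.
Qed.

(** * The circle method *)

Definition phase (k n h j : nat) : C :=
  Cexp (- (2 * PI * Ci * INR h * INR n / INR j) - PI * Ci * A_phase k h j)%C.

(** Equal to [PI (24 n - (2 k + 2)) / 12], so that [2 sqrt (kernel_a * kernel_b)] is
    [sqrt alpha * x_ / j], the argument of the Bessel function. *)
Definition kernel_a (k n : nat) : R := 2 * PI * INR n - PI * (INR k + 1) / 6.
Definition kernel_b (k j : nat) : R := PI * alpha_ k j / (12 * INR j ^ 2).

Lemma Cmod_phase (k n h j : nat) : (0 < j)%nat -> Cmod (phase k n h j) = 1.
Proof.
intros Hj; unfold phase; rewrite Cmod_Cexp, <- exp_0; f_equal.
replace (- (2 * PI * Ci * INR h * INR n / INR j) - PI * Ci * A_phase k h j)%C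
 with (Ci * RtoC (- (2 * PI * INR h * INR n / INR j) - PI * A_phase k h j))%C.
- simpl; ring.
- rewrite RtoC_minus, RtoC_opp, RtoC_div, !RtoC_mult by (apply not_0_INR; lia).
  unfold Cdiv; ring.
Qed.

Lemma kernel_facts (k n j : nat) : (k = 1 \/ k = 2)%nat -> (1 <= n)%nat -> (0 < j)%nat ->
  0 < kernel_a k n <= 2 * PI * INR n /\ 0 <= kernel_b k j /\ INR j ^ 2 * kernel_b k j <= PI / 2.
Proof.
intros Hk Hn Hj; assert (P := PI_RGT_0).
assert (Hn' : 1 <= INR n) by (apply (le_INR 1); lia).
assert (Hj' : 0 < INR j) by (apply lt_0_INR; lia).
destruct (cusp_facts k j Hk Hj) as [_ [[Ha1 Ha2] _]].
unfold kernel_a, kernel_b; repeat split.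
- destruct Hk as [-> | ->]; simpl INR; nra.
- assert (0 <= PI * (INR k + 1) / 6); [|lra].
  generalize (pos_INR k); intros; apply Rdiv_le_0_compat; nra.
- apply Rdiv_le_0_compat; [nra|]; generalize (pow_lt _ 2 Hj'); lra.
- replace (INR j ^ 2 * (PI * alpha_ k j / (12 * INR j ^ 2))) with (PI * alpha_ k j / 12)
    by (field; lra); nra.
Qed.

Lemma polar_part_kernel (k n h j : nat) (z : C) : (0 < j)%nat ->
  (polar_part k h j z * char_weight n (z - Ci * RtoC (INR h / INR j)))%C
  = (phase k n h j * INR j * polar_kernel (kernel_a k n) (kernel_b k j) z)%C.
Proof.
intros Hj; assert (Cj := RtoC_INR_nz j Hj).
assert (Rj : INR j <> 0) by (apply not_0_INR; lia).
unfold polar_part, phase, polar_kernel, char_weight.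
match goal with |- (RtoC (INR j) * z * Cexp ?x * Cexp ?y = Cexp ?u * RtoC (INR j) * (z * Cexp ?v))%C =>
  transitivity (INR j * z * Cexp (x + y))%C; [rewrite Cexp_plus; ring|];
  transitivity (INR j * z * Cexp (u + v))%C; [|rewrite Cexp_plus; ring] end.
f_equal; apply Cexp_eq; unfold kernel_a, kernel_b.
assert (H12 : 12 * INR j ^ 2 <> 0).
{ apply Rmult_integral_contrapositive; split; [lra|now apply pow_nonzero]. }
rewrite RtoC_minus, !RtoC_div, !RtoC_mult, RtoC_plus, RtoC_pow by first [assumption|lra].
unfold Cdiv; ring.
Qed.

Lemma CInt_conj (f : R -> C) (a b : R) : ex_CInt f a b ->
  ex_CInt (fun t => Cconj (f t)) a b /\
  CInt (fun t => Cconj (f t)) a b = Cconj (CInt f a b).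
Proof.
intros [F1 F2]; split; [split; simpl; auto; now apply (ex_RInt_opp (V := R_NormedModule))|].
apply Ceq; simpl; [reflexivity|].
now apply (RInt_opp (V := R_CompleteNormedModule) (fun t => Im (f t))).
Qed.

Lemma Cexp_conj (z : C) : Cexp (Cconj z) = Cconj (Cexp z).
Proof.
destruct z as [x y]; unfold Cexp, Cconj; simpl; rewrite cos_neg, sin_neg.
apply Ceq; simpl; ring.
Qed.

Lemma Cinv_conj (z : C) : (/ Cconj z)%C = Cconj (/ z)%C.
Proof.
destruct z as [x y]; apply Ceq; simpl.
- replace (- y * (- y * 1)) with (y * (y * 1)) by ring; reflexivity.
- replace (- y * (- y * 1)) with (y * (y * 1)) by ring; unfold Rdiv; ring.
Qed.

Lemma polar_kernel_conj (a b : R) (z : C) :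
  polar_kernel a b (Cconj z) = Cconj (polar_kernel a b z).
Proof.
unfold polar_kernel; rewrite Cinv_conj.
replace (b * Cconj (/ z) + a * Cconj z)%C with (Cconj (b * / z + a * z)%C)
  by (apply Ceq; unfold Re, Im; simpl; ring).
rewrite Cexp_conj; apply Ceq; unfold Re, Im; simpl; ring.
Qed.

Lemma Re_inv_shift (x y : R) : 0 < x ^ 2 + y ^ 2 ->
  Re (/ (x - Ci * y))%C = x / (x ^ 2 + y ^ 2).
Proof. intros H; simpl; field; nra. Qed.

Section FareyArcs.

Variables k n N : nat.
Hypothesis Hk : (k = 1 \/ k = 2)%nat.
Hypothesis Hn : (1 <= n)%nat.
Hypothesis HN : (1 <= N)%nat.

Definition rho_N : R := / INR N ^ 2.

Lemma rho_facts : 0 < rho_N <= 1 /\ 1 <= INR N.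
Proof.
assert (H : 1 <= INR N) by (apply (le_INR 1); lia).
unfold rho_N; repeat split; auto.
- apply Rinv_0_lt_compat, pow_lt; lra.
- rewrite <- Rinv_1; apply Rinv_le_contravar; [lra|nra].
Qed.

Definition half_value (j : nat) : C :=
  half_contour rho_N 1 (polar_kernel (kernel_a k n) (kernel_b k j)).

(** Bounds the exponential on the discarded sides: [2 PI n] for [Re (a z)], as [Re z <= 1], and
    [2 PI] for [Re (b / z) <= 4 j^2 b]. *)
Definition side_const : R := exp (2 * PI * INR n + 2 * PI).

(** Only the right side of the half contour matters: elsewhere
    [Re (b / z)] is bounded since [theta ^ 2 >= rho / (4 j ^ 2)]. *)
Lemma right_side_value (j : nat) (theta : R) : (0 < j <= N)%nat ->
  / (2 * INR j * INR N) <= theta <= / (INR j * INR N) ->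
  Cmod (CInt (fun t => polar_kernel (kernel_a k n) (kernel_b k j) (rho_N - Ci * t)%C) 0 theta
    - half_value j)%C <= 20 * side_const * theta / (INR j * INR N).
Proof.
intros Hj Ht; destruct rho_facts as [[R0 R1] HN1].
assert (Hj1 : 1 <= INR j) by (apply (le_INR 1); lia).
assert (HjN : INR j <= INR N) by (apply le_INR; lia).
assert (HPI := PI_RGT_0).
destruct (kernel_facts k n j Hk Hn ltac:(lia)) as [[A1 A2] [B1 B2]].
set (a := kernel_a k n) in *; set (b := kernel_b k j) in *.
set (x := INR j) in *; set (y := INR N) in *.
assert (Hxy : 0 < x * y) by nra.
assert (Ht0 : 0 < theta).
{ apply Rlt_le_trans with (2 := proj1 Ht); apply Rinv_0_lt_compat; nra. }
assert (Hrt : rho_N <= 2 * theta).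
{ unfold rho_N; fold y; apply Rle_trans with (2 * / (2 * x * y)); [|lra].
  replace (2 * / (2 * x * y)) with (/ (x * y)) by (field; lra).
  apply Rinv_le_contravar; nra. }
assert (Hr2 : rho_N <= 4 * x ^ 2 * theta ^ 2).
{ assert (S1 : (/ (2 * x * y)) ^ 2 <= theta ^ 2).
  { apply pow_incr; split; [left; apply Rinv_0_lt_compat; nra|lra]. }
  replace rho_N with (4 * x ^ 2 * (/ (2 * x * y)) ^ 2) by (unfold rho_N; fold y; field; lra).
  apply Rmult_le_compat_l; auto; nra. }
assert (Hr3 : rho_N <= / (x * y)).
{ unfold rho_N; fold y; apply Rinv_le_contravar; nra. }
set (f := polar_kernel a b).
assert (Sf : smooth_off_0 f) by apply smooth_polar_kernel.
destruct (half_contour_int rho_N theta R0 Ht0 f Sf) as [I1 [I2 I3]].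
unfold half_value; fold a b.
rewrite <- (half_contour_polar_kernel a b rho_N theta R0 Ht0); fold f.
unfold half_contour.
match goal with |- Cmod (?i1 - (?i1' - Ci * ?i2 - ?i3))%C <= _ =>
  replace (i1 - (i1' - Ci * i2 - i3))%C with (Ci * i2 + i3)%C by ring;
  set (J2 := i2); set (J3 := i3) end.
set (M := 2 / (x * y) * side_const).
assert (Hbd : forall z, Cmod z <= 2 / (x * y) -> Re (b * / z)%C <= 2 * PI -> Re z <= 1 ->
  Cmod (f z) <= M).
{ intros z Z1 Z2 Z3; unfold f, polar_kernel, M; rewrite Cmod_mult, Cmod_Cexp.
  apply Rmult_le_compat; auto; [apply Cmod_ge_0|left; apply exp_pos|].
  apply exp_mono; rewrite re_plus, (re_scal_l a); nra. }
assert (Hb4 : 4 * x ^ 2 * b <= 2 * PI) by lra.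
assert (B2' : Cmod J2 <= 2 * M * (rho_N - - rho_N)).
{ apply CInt_bound; [lra|auto|]; intros u Hu; apply Hbd.
  - eapply Rle_trans; [apply Cmod_le_abs|].
    replace (Re (u - Ci * theta)%C) with u by (simpl; ring).
    replace (Im (u - Ci * theta)%C) with (- theta) by (simpl; ring).
    rewrite Rabs_Ropp, (Rabs_pos_eq theta) by lra.
    assert (Rabs u <= rho_N) by (apply Rabs_le; lra).
    replace (2 / (x * y)) with (/ (x * y) + / (x * y)) by (field; lra); lra.
  - rewrite re_scal_l, Re_inv_shift by nra.
    assert (D : 0 < u ^ 2 + theta ^ 2) by nra.
    apply Rle_trans with (2 := Hb4).
    apply Rmult_le_reg_r with (u ^ 2 + theta ^ 2); auto.
    replace (b * (u / (u ^ 2 + theta ^ 2)) * (u ^ 2 + theta ^ 2)) with (b * u) by (field; lra).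
    rewrite (Rmult_comm (4 * x ^ 2)), Rmult_assoc; apply Rmult_le_compat_l; auto.
    assert (0 <= x ^ 2 * u ^ 2) by (apply Rmult_le_pos; apply pow2_ge_0).
    lra.
  - simpl; lra. }
assert (B3' : Cmod J3 <= 2 * M * (theta - 0)).
{ apply CInt_bound; [lra|auto|]; intros t Ht'; apply Hbd; rewrite <- RtoC_opp.
  - eapply Rle_trans; [apply Cmod_le_abs|].
    replace (Re (RtoC (- rho_N) - Ci * t)%C) with (- rho_N) by (simpl; ring).
    replace (Im (RtoC (- rho_N) - Ci * t)%C) with (- t) by (simpl; ring).
    rewrite !Rabs_Ropp, !Rabs_pos_eq by lra.
    replace (2 / (x * y)) with (/ (x * y) + / (x * y)) by (field; lra); lra.
  - rewrite re_scal_l, Re_inv_shift by nra.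
    assert (D : 0 < (- rho_N) ^ 2 + t ^ 2) by nra.
    assert (0 <= b * (rho_N / ((- rho_N) ^ 2 + t ^ 2))).
    { apply Rmult_le_pos; auto; apply Rdiv_le_0_compat; lra. }
    unfold Rdiv in *; lra.
  - simpl; lra. }
eapply Rle_trans; [apply Cmod_triangle|]; rewrite Cmod_mult, Cmod_Ci, Rmult_1_l.
(* The constant [20] is [2 * 2 * 5]: from [CInt_bound], from [|z| <= 2/(j N)], and from
   [2 rho + theta <= 5 theta]. *)
apply Rle_trans with (2 * M * (2 * rho_N + theta)); [lra|].
apply Rle_trans with (2 * M * (5 * theta)).
- apply Rmult_le_compat_l; [|lra].
  assert (0 < M); [|lra]; apply Rmult_lt_0_compat; [apply Rdiv_lt_0_compat; lra|apply exp_pos].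
- right; unfold M; field; lra.
Qed.

Variable K : R.
Hypothesis HK : 0 < K.
Hypothesis Hrat : forall h j z, (0 < j)%nat -> Nat.gcd h j = 1%nat ->
  0 < Re z -> 1 / 2 <= Re (/ (INR j ^ 2 * z))%C ->
  Cmod (eta_quotient pr k (nome (z - Ci * RtoC (INR h / INR j))) - polar_part k h j z)%C
    <= K * INR j * Cmod z.

(** Length of the finite product that replaces the infinite one on the circle of order [N], at a
    cost of [1/N]; it is chosen after [N]. *)
Variable N' : nat.
Hypothesis Happ : forall q, Cmod q <= exp (- (2 * PI * rho_N)) ->
  Cmod (eta_quotient (prN N') k q - eta_quotient pr k q)%C <= / INR N.

Definition integrand (phi : R) : C :=
  (eta_quotient (prN N') k (nome (circle_point rho_N phi))
    * char_weight n (circle_point rho_N phi))%C.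

Lemma cdiff_integrand (phi : R) : cdiff integrand phi.
Proof.
apply (cdiff_mult (fun s => eta_quotient (prN N') k (nome (circle_point rho_N s)))).
- apply cdiff_eta_quotient, rho_facts.
- apply cdiff_char_weight.
Qed.

Lemma ex_CInt_integrand (u v : R) : ex_CInt integrand u v.
Proof. apply ex_CInt_diff; intros t _; apply cdiff_integrand. Qed.

(** The exponential bounds [char_weight], since [rho_N <= 1]; [2 K] comes from [K j |z| <= 2 K / N]
    and [1] from the passage to finite products. *)
Definition arc_const : R := exp (2 * PI * INR n) * (2 * K + 1).

Lemma integrand_near (h j : nat) (t : R) : (0 < j <= N)%nat -> Nat.gcd h j = 1%nat ->
  Rabs t <= / (INR j * INR N) ->
  Cmod (integrand (INR h / INR j + t) - phase k n h j * INR j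
    * polar_kernel (kernel_a k n) (kernel_b k j) (rho_N - Ci * t))%C <= arc_const / INR N.
Proof.
intros Hj Hg Ht; destruct rho_facts as [[R0 R1] HN1].
assert (Hj1 : 1 <= INR j) by (apply (le_INR 1); lia).
assert (HjN : INR j <= INR N) by (apply le_INR; lia).
set (z := (rho_N - Ci * t)%C).
assert (Ez : circle_point rho_N (INR h / INR j + t) = (z - Ci * RtoC (INR h / INR j))%C).
{ unfold circle_point, z; rewrite RtoC_plus; ring. }
assert (Rz : Re z = rho_N) by (unfold z; simpl; ring).
rewrite <- polar_part_kernel by lia.
unfold integrand; rewrite Ez.
set (w := (z - Ci * RtoC (INR h / INR j))%C).
assert (Rw : Re w = rho_N) by (unfold w; rewrite re_minus, Rz; simpl; ring).
replace (eta_quotient (prN N') k (nome w) * char_weight n w - polar_part k h j z * char_weight n w)%C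
  with (char_weight n w * ((eta_quotient (prN N') k (nome w) - eta_quotient pr k (nome w))
    + (eta_quotient pr k (nome w) - polar_part k h j z)))%C by ring.
rewrite Cmod_mult.
replace (arc_const / INR N) with (exp (2 * PI * INR n) * (/ INR N + 2 * K / INR N))
  by (unfold arc_const; field; lra).
set (x := INR j) in *; set (y := INR N) in *.
assert (Hxy : 0 < x * y) by nra.
assert (Hr3 : rho_N <= / (x * y)).
{ unfold rho_N; fold y; apply Rinv_le_contravar; nra. }
apply Rmult_le_compat; try apply Cmod_ge_0.
- unfold char_weight; rewrite Cmod_Cexp; apply exp_mono.
  replace (2 * PI * INR n * w)%C with (RtoC (2 * PI * INR n) * w)%C by (rewrite !RtoC_mult; ring).
  rewrite re_scal_l, Rw.
  assert (0 <= 2 * PI * INR n) by (generalize PI_RGT_0 (pos_INR n); nra); nra.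
- eapply Rle_trans; [apply Cmod_triangle|]; apply Rplus_le_compat.
  + apply Happ; rewrite Cmod_nome, Rw; lra.
  + eapply Rle_trans; [apply Hrat; auto; try lia; try lra|].
    * fold x; replace (/ (x ^ 2 * z))%C with (RtoC (/ x ^ 2) * / z)%C.
      2:{ assert (Zn : (z <> 0)%C) by (apply Re_pos_nz; lra).
          rewrite RtoC_inv, RtoC_pow by (apply pow_nonzero; lra); field; split; auto.
          apply RtoC_INR_nz; lia. }
      rewrite re_scal_l; unfold z; rewrite Re_inv_shift by nra.
      assert (T2 : t ^ 2 <= / (x * y) ^ 2).
      { rewrite <- pow2_abs, <- pow_inv; apply pow_incr; split; auto; apply Rabs_pos. }
      (* Both [j^2 t^2] and [j^2 rho^2] are at most [rho = 1/N^2], by [|t| <= 1/(j N)] and [j <= N];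
         this gives [Re (1/(j^2 z)) >= 1/2]. *)
      assert (X2 : x ^ 2 * (rho_N ^ 2 + t ^ 2) <= 2 * rho_N).
      { assert (x ^ 2 * t ^ 2 <= rho_N).
        { apply Rle_trans with (x ^ 2 * / (x * y) ^ 2).
          - apply Rmult_le_compat_l; auto; nra.
          - right; unfold rho_N; fold y; field; lra. }
        assert (x ^ 2 * rho_N <= 1).
        { apply Rle_trans with (y ^ 2 * rho_N); [apply Rmult_le_compat_r; [lra|]; apply pow_incr; lra|].
          right; unfold rho_N; fold y; field; lra. }
        nra. }
      assert (D : 0 < x ^ 2 * (rho_N ^ 2 + t ^ 2)) by (apply Rmult_lt_0_compat; nra).
      replace (/ x ^ 2 * (rho_N / (rho_N ^ 2 + t ^ 2))) with (rho_N / (x ^ 2 * (rho_N ^ 2 + t ^ 2)))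
        by (field; split; nra).
      apply Rmult_le_reg_r with (x ^ 2 * (rho_N ^ 2 + t ^ 2)); auto.
      replace (rho_N / (x ^ 2 * (rho_N ^ 2 + t ^ 2)) * (x ^ 2 * (rho_N ^ 2 + t ^ 2))) with rho_N
        by (field; split; nra).
      lra.
    * assert (Hz : Cmod z <= 2 / (x * y)).
      { eapply Rle_trans; [apply Cmod_le_abs|]; rewrite Rz.
        replace (Im z) with (- t) by (unfold z; simpl; ring).
        rewrite Rabs_Ropp, (Rabs_pos_eq rho_N) by lra.
        replace (2 / (x * y)) with (/ (x * y) + / (x * y)) by (field; lra); lra. }
      apply Rle_trans with (K * x * (2 / (x * y))).
      -- apply Rmult_le_compat_l; auto; nra.
      -- right; field; lra.
Qed.

Definition total_const : R := 2 * arc_const + 20 * side_const.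

Lemma ex_CInt_kernel_right (a b theta : R) :
  ex_CInt (fun t => polar_kernel a b (rho_N - Ci * t)%C) 0 theta.
Proof.
apply ex_CInt_diff; intros t _.
apply (smooth_polar_kernel a b (fun t => rho_N - Ci * t)%C).
- apply Re_pos_nz; destruct rho_facts as [[R0 _] _]; simpl; lra.
- apply cdiff_ext with (fun s => rho_N + (- Ci) * s)%C; [intros; ring|apply cdiff_affine].
Qed.

Lemma right_arc (h j : nat) (theta : R) : (0 < j <= N)%nat -> Nat.gcd h j = 1%nat ->
  / (2 * INR j * INR N) <= theta <= / (INR j * INR N) ->
  Cmod (CInt integrand (INR h / INR j) (INR h / INR j + theta)
    - phase k n h j * INR j * half_value j)%C <= total_const / INR N * theta.
Proof.
intros Hj Hg Ht; destruct rho_facts as [_ HN1].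
assert (Hj1 : 1 <= INR j) by (apply (le_INR 1); lia).
assert (Ht0 : 0 < theta).
{ apply Rlt_le_trans with (2 := proj1 Ht); apply Rinv_0_lt_compat.
  apply Rmult_lt_0_compat; lra. }
set (x := INR h / INR j); set (P := (phase k n h j * INR j)%C).
set (f := fun t : R => polar_kernel (kernel_a k n) (kernel_b k j) (rho_N - Ci * t)%C).
assert (If : ex_CInt f 0 theta) by apply ex_CInt_kernel_right.
assert (E1 : CInt integrand x (x + theta) = CInt (fun t => integrand (t + x)) 0 theta).
{ rewrite CInt_comp_shift by apply ex_CInt_integrand.
  rewrite Rplus_0_l, (Rplus_comm theta); reflexivity. }
assert (Ig : ex_CInt (fun t => integrand (t + x)) 0 theta).
{ apply ex_CInt_diff; intros t _; destruct (cdiff_integrand (t + x)) as [l [L1 L2]].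
  exists l; split.
  - eapply is_derive_eq; [apply (is_derive_comp (fun t => Re (integrand t)) (fun t => t + x)); eauto|].
    + apply (is_derive_Rplus (fun t => t) (fun _ => x)); [apply @is_derive_id|apply @is_derive_const].
    + unfold scal, one, zero; simpl; unfold mult; simpl; ring.
  - eapply is_derive_eq; [apply (is_derive_comp (fun t => Im (integrand t)) (fun t => t + x)); eauto|].
    + apply (is_derive_Rplus (fun t => t) (fun _ => x)); [apply @is_derive_id|apply @is_derive_const].
    + unfold scal, one, zero; simpl; unfold mult; simpl; ring. }
rewrite E1.
replace (CInt (fun t => integrand (t + x)) 0 theta - P * half_value j)%C with
  ((CInt (fun t => integrand (t + x)) 0 theta - P * CInt f 0 theta)
    + P * (CInt f 0 theta - half_value j))%C by ring.
eapply Rle_trans; [apply Cmod_triangle|].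
assert (B1 : Cmod (CInt (fun t => integrand (t + x)) 0 theta - P * CInt f 0 theta)%C
  <= 2 * (arc_const / INR N) * (theta - 0)).
{ rewrite <- CInt_scal, <- CInt_minus by (auto; now apply ex_CInt_scal).
  apply CInt_bound; [lra|apply ex_CInt_minus; auto; now apply ex_CInt_scal|].
  intros t Ht'; rewrite (Rplus_comm t); apply integrand_near; auto.
  rewrite Rabs_pos_eq; lra. }
assert (B2 := right_side_value j theta Hj Ht); fold f in B2.
rewrite Cmod_mult; unfold P at 2; rewrite Cmod_mult, Cmod_phase, Cmod_R, Rabs_pos_eq by (try lia; lra).
assert (B3 : 1 * INR j * Cmod (CInt f 0 theta - half_value j)%C <= 20 * side_const * theta / INR N).
{ apply Rle_trans with (1 * INR j * (20 * side_const * theta / (INR j * INR N))).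
  - apply Rmult_le_compat_l; lra.
  - right; field; lra. }
replace (total_const / INR N * theta) with (2 * (arc_const / INR N) * (theta - 0)
  + 20 * side_const * theta / INR N) by (unfold total_const; field; lra).
lra.
Qed.

(** Reflecting [t] conjugates the argument of the kernel, and the kernel has real parameters; hence
    the conjugate of [half_value j], while the phase is the same as on the right. *)
Lemma left_arc (h j : nat) (theta : R) : (0 < j <= N)%nat -> Nat.gcd h j = 1%nat ->
  / (2 * INR j * INR N) <= theta <= / (INR j * INR N) ->
  Cmod (CInt integrand (INR h / INR j - theta) (INR h / INR j)
    - phase k n h j * INR j * Cconj (half_value j))%C <= total_const / INR N * theta.
Proof.
intros Hj Hg Ht; destruct rho_facts as [_ HN1].
assert (Hj1 : 1 <= INR j) by (apply (le_INR 1); lia).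
assert (Ht0 : 0 < theta).
{ apply Rlt_le_trans with (2 := proj1 Ht); apply Rinv_0_lt_compat.
  apply Rmult_lt_0_compat; lra. }
set (x := INR h / INR j); set (P := (phase k n h j * INR j)%C).
set (f := fun t : R => polar_kernel (kernel_a k n) (kernel_b k j) (rho_N - Ci * t)%C).
assert (If : ex_CInt f 0 theta) by apply ex_CInt_kernel_right.
destruct (CInt_conj f 0 theta If) as [If' Ec].
assert (E1 : CInt integrand (x - theta) x = CInt (fun t => integrand (x - t)) 0 theta).
{ rewrite CInt_comp_reflect by apply ex_CInt_integrand.
  rewrite Rminus_0_r; reflexivity. }
assert (Ig : ex_CInt (fun t => integrand (x - t)) 0 theta).
{ apply ex_CInt_diff; intros t _; destruct (cdiff_integrand (x - t)) as [l [L1 L2]].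
  exists (- l)%C; split.
  - eapply is_derive_eq; [apply (is_derive_comp (fun t => Re (integrand t)) (fun t => x - t)); eauto|].
    + apply (is_derive_Rminus (fun _ => x) (fun t => t)); [apply @is_derive_const|apply @is_derive_id].
    + rewrite re_opp; unfold scal, one, zero; simpl; unfold mult; simpl; ring.
  - eapply is_derive_eq; [apply (is_derive_comp (fun t => Im (integrand t)) (fun t => x - t)); eauto|].
    + apply (is_derive_Rminus (fun _ => x) (fun t => t)); [apply @is_derive_const|apply @is_derive_id].
    + rewrite im_opp; unfold scal, one, zero; simpl; unfold mult; simpl; ring. }
rewrite E1.
replace (CInt (fun t => integrand (x - t)) 0 theta - P * Cconj (half_value j))%C with
  ((CInt (fun t => integrand (x - t)) 0 theta - P * CInt (fun t => Cconj (f t)) 0 theta)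
    + P * (Cconj (CInt f 0 theta - half_value j)))%C
  by (rewrite Ec; unfold Cminus; rewrite Cplus_conj, Copp_conj; ring).
eapply Rle_trans; [apply Cmod_triangle|].
assert (B1 : Cmod (CInt (fun t => integrand (x - t)) 0 theta - P * CInt (fun t => Cconj (f t)) 0 theta)%C
  <= 2 * (arc_const / INR N) * (theta - 0)).
{ rewrite <- CInt_scal, <- CInt_minus by (auto; now apply ex_CInt_scal).
  apply CInt_bound; [lra|apply ex_CInt_minus; auto; now apply ex_CInt_scal|].
  intros t Ht'; unfold f; rewrite <- polar_kernel_conj.
  replace (Cconj (rho_N - Ci * t)) with (rho_N - Ci * RtoC (- t))%C
    by (apply Ceq; simpl; ring).
  replace (x - t) with (x + - t) by ring; apply integrand_near; auto.
  rewrite Rabs_Ropp, Rabs_pos_eq; lra. }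
assert (B2 := right_side_value j theta Hj Ht); fold f in B2.
rewrite Cmod_mult, Cmod_conj; unfold P at 2.
rewrite Cmod_mult, Cmod_phase, Cmod_R, Rabs_pos_eq by (try lia; lra).
assert (B3 : 1 * INR j * Cmod (CInt f 0 theta - half_value j)%C <= 20 * side_const * theta / INR N).
{ apply Rle_trans with (1 * INR j * (20 * side_const * theta / (INR j * INR N))).
  - apply Rmult_le_compat_l; lra.
  - right; field; lra. }
replace (total_const / INR N * theta) with (2 * (arc_const / INR N) * (theta - 0)
  + 20 * side_const * theta / INR N) by (unfold total_const; field; lra).
lra.
Qed.

(** * Farey fractions and mediants *)

Definition full_value (h j : nat) : C :=
  (phase k n h j * INR j * (half_value j + Cconj (half_value j)))%C.

Definition between (a b c d h j : nat) : bool :=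
  ((Nat.gcd h j =? 1) && ((a * j <? h * b) && (h * d <? c * j)))%nat%bool.

(** The endpoints are excluded, each having only one half of its arc inside the interval.
    Denominators are [S i <= N], and numerators up to [N] cover the unit interval. *)
Definition farey_sum (a b c d : nat) : C :=
  csum (fun i => csum (fun h => if between a b c d h (S i) then full_value h (S i)
    else RtoC 0) (S N)) N.

Lemma adjacent_coprime (a b c d : nat) : (c * b = a * d + 1)%nat ->
  Nat.gcd a b = 1%nat /\ Nat.gcd c d = 1%nat.
Proof.
intros H; split; apply Nat.divide_1_r.
- destruct (Nat.gcd_divide_l a b) as [u Hu]; destruct (Nat.gcd_divide_r a b) as [v Hv].
  set (g := Nat.gcd a b) in *; exists (c * v - u * d)%nat; nia.
- destruct (Nat.gcd_divide_l c d) as [u Hu]; destruct (Nat.gcd_divide_r c d) as [v Hv].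
  set (g := Nat.gcd c d) in *; exists (u * b - a * v)%nat; nia.
Qed.

(** From [j = b (c j - h d) + d (h b - a j)], where both brackets are positive integers. *)
Lemma between_denominator (a b c d h j : nat) : (c * b = a * d + 1)%nat ->
  between a b c d h j = true -> (b + d <= j)%nat.
Proof.
intros H E; unfold between in E.
apply andb_prop in E; destruct E as [_ E]; apply andb_prop in E; destruct E as [E1 E2].
apply Nat.ltb_lt in E1; apply Nat.ltb_lt in E2.
assert (X : (j * (c * b) = j * (a * d) + j)%nat) by (rewrite H; ring).
assert (d * (a * j + 1) <= d * (h * b))%nat by (apply Nat.mul_le_mono_l; lia).
assert (b * (h * d + 1) <= b * (c * j))%nat by (apply Nat.mul_le_mono_l; lia).
nia.
Qed.

Lemma farey_sum_zero (a b c d : nat) : (c * b = a * d + 1)%nat -> (N < b + d)%nat ->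
  farey_sum a b c d = RtoC 0.
Proof.
intros H HL; unfold farey_sum.
rewrite (csum_ext _ (fun _ => RtoC 0)), csum_zero; auto.
intros i Hi; rewrite (csum_ext _ (fun _ => RtoC 0)), csum_zero; auto.
intros h Hh; destruct (between a b c d h (S i)) eqn:E; auto.
apply between_denominator in E; auto; lia.
Qed.

Lemma coprime_fraction_eq (h j p q : nat) : Nat.gcd h j = 1%nat -> Nat.gcd p q = 1%nat ->
  (0 < j)%nat -> (h * q = p * j)%nat -> h = p /\ j = q.
Proof.
intros H1 H2 Hj E.
assert (D1 : Nat.divide j q).
{ apply (Nat.gauss j h); [exists p; lia|now rewrite Nat.gcd_comm]. }
assert (D2 : Nat.divide q j).
{ apply (Nat.gauss q p); [exists h; lia|now rewrite Nat.gcd_comm]. }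
assert (Ej : j = q) by now apply Nat.divide_antisym.
split; auto; subst q; nia.
Qed.

Lemma csum_single (f : nat -> C) (p n0 : nat) : (p < n0)%nat ->
  csum (fun i => if Nat.eqb i p then f i else RtoC 0) n0 = f p.
Proof.
induction 1 as [|m Hm IH]; cbn [csum].
- rewrite Nat.eqb_refl, (csum_ext _ (fun _ => RtoC 0)), csum_zero; [ring|].
  intros i Hi; destruct (Nat.eqb_spec i p); [lia|auto].
- rewrite IH; destruct (Nat.eqb_spec m p); [lia|ring].
Qed.

(** Every reduced fraction lies left of, at, or right of the mediant. Writing the mediant's
    contribution as a double sum with a single nonzero entry, at [S i = b + d], allows an entrywise
    comparison. *)
Lemma farey_sum_split (a b c d : nat) : (c * b = a * d + 1)%nat ->
  (a <= b)%nat -> (c <= d)%nat -> (0 < b)%nat -> (0 < d)%nat -> (b + d <= N)%nat ->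
  farey_sum a b c d = (farey_sum a b (a + c) (b + d) + full_value (a + c) (b + d)
    + farey_sum (a + c) (b + d) c d)%C.
Proof.
intros H Hab Hcd Hb Hd HL.
assert (Hm : ((a + c) * b = a * (b + d) + 1)%nat) by nia.
assert (Hm' : (c * (b + d) = (a + c) * d + 1)%nat) by nia.
destruct (adjacent_coprime _ _ _ _ Hm) as [_ Hg].
assert (Es : full_value (a + c) (b + d) = csum (fun i => csum (fun h =>
   if Nat.eqb h (a + c) then (if Nat.eqb i (b + d - 1) then full_value h (S i) else RtoC 0)
   else RtoC 0) (S N)) N).
{ rewrite (csum_ext _ (fun i => if Nat.eqb i (b + d - 1) then full_value (a + c) (S i) else RtoC 0)).
  - rewrite csum_single by lia; f_equal; lia.
  - intros i _; now rewrite csum_single by lia. }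
rewrite Es; unfold farey_sum; rewrite <- !csum_plus.
apply csum_ext; intros i Hi; rewrite <- !csum_plus; apply csum_ext; intros h Hh.
unfold between.
destruct (Nat.eqb_spec (Nat.gcd h (S i)) 1) as [G|G]; simpl andb.
- destruct (Nat.lt_trichotomy (h * (b + d)) ((a + c) * S i)) as [L|[L|L]].
  + replace (((a + c) * S i <? h * (b + d))%nat) with false by (symmetry; apply Nat.ltb_ge; lia).
    replace ((h * (b + d) <? (a + c) * S i)%nat) with true by (symmetry; apply Nat.ltb_lt; lia).
    assert (X : (a * S i <? h * b)%nat = true -> (h * d <? c * S i)%nat = true).
    { intros X; apply Nat.ltb_lt in X; apply Nat.ltb_lt; nia. }
    destruct (Nat.eqb_spec h (a + c)) as [E1|E1], (Nat.eqb_spec i (b + d - 1)) as [E2|E2];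
      try (exfalso; replace (S i) with (b + d)%nat in L by lia; rewrite E1 in L; nia);
      destruct (a * S i <? h * b)%nat eqn:EX; try rewrite (X eq_refl); simpl; ring.
  + destruct (coprime_fraction_eq h (S i) (a + c) (b + d) G Hg ltac:(lia) ltac:(lia)) as [E1 E2].
    replace (Nat.eqb h (a + c)) with true by (symmetry; apply Nat.eqb_eq; auto).
    replace (Nat.eqb i (b + d - 1)) with true by (symmetry; apply Nat.eqb_eq; lia).
    rewrite L, Nat.ltb_irrefl.
    replace (a * S i <? h * b)%nat with true by (symmetry; apply Nat.ltb_lt; rewrite E1, E2; nia).
    replace (h * d <? c * S i)%nat with true by (symmetry; apply Nat.ltb_lt; rewrite E1, E2; nia).
    simpl; ring.
  + replace (((a + c) * S i <? h * (b + d))%nat) with true by (symmetry; apply Nat.ltb_lt; lia).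
    replace ((h * (b + d) <? (a + c) * S i)%nat) with false by (symmetry; apply Nat.ltb_ge; lia).
    assert (X : (h * d <? c * S i)%nat = true -> (a * S i <? h * b)%nat = true).
    { intros X; apply Nat.ltb_lt in X; apply Nat.ltb_lt; nia. }
    destruct (Nat.eqb_spec h (a + c)) as [E1|E1], (Nat.eqb_spec i (b + d - 1)) as [E2|E2];
      try (exfalso; replace (S i) with (b + d)%nat in L by lia; rewrite E1 in L; nia);
      destruct (h * d <? c * S i)%nat eqn:EX; try rewrite (X eq_refl);
      rewrite ?Bool.andb_false_r; simpl; ring.
- destruct (Nat.eqb_spec h (a + c)) as [E1|E1], (Nat.eqb_spec i (b + d - 1)) as [E2|E2];
    try ring.
  exfalso; apply G; rewrite E1; replace (S i) with (b + d)%nat by lia; exact Hg.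
Qed.

(** Descent in the Stern-Brocot tree from the pair [a/b < c/d] of neighbours. *)
Lemma farey_integral (fuel : nat) : forall a b c d : nat, (c * b = a * d + 1)%nat ->
  (a <= b)%nat -> (c <= d)%nat -> (0 < b <= N)%nat -> (0 < d <= N)%nat ->
  (2 * N < fuel + b + d)%nat ->
  Cmod (CInt integrand (INR a / INR b) (INR c / INR d)
    - (phase k n a b * INR b * half_value b + phase k n c d * INR d * Cconj (half_value d)
       + farey_sum a b c d))%C <= total_const / INR N * (INR c / INR d - INR a / INR b).
Proof.
(* [b + d] increases at each descent and cannot exceed [2 N], which makes [2 N] an upper bound for
   the depth. *)
induction fuel as [|fuel IH]; intros a b c d H Hab Hcd Hb Hd Hf; [lia|].
destruct (adjacent_coprime _ _ _ _ H) as [G1 G2].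
assert (Pb : 0 < INR b) by (apply lt_0_INR; lia).
assert (Pd : 0 < INR d) by (apply lt_0_INR; lia).
assert (HR : INR c * INR b = INR a * INR d + 1).
{ rewrite <- !mult_INR, H, plus_INR; reflexivity. }
destruct (le_lt_dec (b + d) N) as [L|L].
- assert (I1 := IH a b (a + c)%nat (b + d)%nat ltac:(nia) ltac:(lia) ltac:(lia) ltac:(lia) ltac:(lia) ltac:(lia)).
  assert (I2 := IH (a + c)%nat (b + d)%nat c d ltac:(nia) ltac:(lia) ltac:(lia) ltac:(lia) ltac:(lia) ltac:(lia)).
  set (m := INR (a + c) / INR (b + d)) in *.
  rewrite <- (CInt_Chasles integrand (INR a / INR b) m (INR c / INR d)) by apply ex_CInt_integrand.
  rewrite (farey_sum_split a b c d) by (auto; lia).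
  unfold full_value.
  match type of I1 with Cmod (?i1 - ?v1)%C <= _ => match type of I2 with Cmod (?i2 - ?v2)%C <= _ =>
    match goal with |- Cmod ?X <= _ => replace X with ((i1 - v1) + (i2 - v2))%C by ring end end end.
  eapply Rle_trans; [apply Cmod_triangle|].
  replace (total_const / INR N * (INR c / INR d - INR a / INR b)) with
    (total_const / INR N * (m - INR a / INR b) + total_const / INR N * (INR c / INR d - m)) by ring.
  lra.
- rewrite farey_sum_zero by auto.
  (* The distances from the two neighbours to their mediant, where the arcs meet. [N < b + d <= 2 N]
     puts them in the range demanded by [right_arc] and [left_arc]. *)
  set (t1 := / (INR b * INR (b + d))); set (t2 := / (INR d * INR (b + d))).
  assert (Pbd : INR N <= INR (b + d) <= 2 * INR N).
  { split; [apply le_INR; lia|].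
    replace (2 * INR N) with (INR (2 * N)) by (rewrite mult_INR; reflexivity); apply le_INR; lia. }
  assert (PN : 1 <= INR N) by apply rho_facts.
  assert (Hth : forall x, 0 < x -> / (2 * x * INR N) <= / (x * INR (b + d)) <= / (x * INR N)).
  { intros x Hx; split; apply Rinv_le_contravar; nra. }
  assert (E : INR a / INR b + t1 = INR c / INR d - t2).
  { unfold t1, t2; rewrite plus_INR.
    replace (INR c) with ((INR a * INR d + 1) / INR b) by (rewrite <- HR; field; lra).
    field; lra. }
  assert (A1 := right_arc a b t1 Hb G1 (Hth _ Pb)).
  assert (A2 := left_arc c d t2 Hd G2 (Hth _ Pd)).
  rewrite E in A1.
  rewrite <- (CInt_Chasles integrand (INR a / INR b) (INR c / INR d - t2) (INR c / INR d))
    by apply ex_CInt_integrand.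
  match type of A1 with Cmod (?i1 - ?v1)%C <= _ => match type of A2 with Cmod (?i2 - ?v2)%C <= _ =>
    match goal with |- Cmod ?X <= _ => replace X with ((i1 - v1) + (i2 - v2))%C by ring end end end.
  eapply Rle_trans; [apply Cmod_triangle|].
  replace (INR c / INR d - INR a / INR b) with (t1 + t2) by lra.
  rewrite Rmult_plus_distr_l; lra.
Qed.

Definition farey_total : C :=
  csum (fun i => csum (fun h => if Nat.eqb (Nat.gcd h (S i)) 1 then full_value h (S i)
    else RtoC 0) (S i)) N.

Lemma A_phase_1 (h : nat) : A_phase k h 1 = 0.
Proof.
rewrite A_phase_sum.
assert (E : forall m h', dedekind_sum h' (1 / Nat.gcd m 1) = 0).
{ intros m h'; rewrite Nat.gcd_comm, gcd_1_l, Nat.div_1_r, dedekind_sum_dsZ; reflexivity. }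
rewrite !E; ring.
Qed.

(** The endpoints [0/1] and [1/1] have equal phases, so their two half arcs combine into the full
    contribution of [h = 0], [j = 1]. *)
Lemma farey_total_bound :
  Cmod (CInt integrand 0 1 - farey_total)%C <= total_const / INR N.
Proof.
assert (B := farey_integral (2 * N) 0 1 1 1 ltac:(lia) ltac:(lia) ltac:(lia)
  ltac:(lia) ltac:(lia) ltac:(lia)).
replace (INR 0 / INR 1) with 0 in B by (simpl; field).
replace (INR 1 / INR 1) with 1 in B by (simpl; field).
rewrite Rminus_0_r, Rmult_1_r in B.
replace farey_total with (phase k n 0 1 * INR 1 * half_value 1
  + phase k n 1 1 * INR 1 * Cconj (half_value 1) + farey_sum 0 1 1 1)%C; [exact B|].
assert (P : phase k n 1 1 = phase k n 0 1).
{ unfold phase; rewrite !A_phase_1.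
  replace (- (2 * PI * Ci * INR 1 * INR n / INR 1) - PI * Ci * 0)%C
    with (- (2 * PI * Ci * INR n))%C by (simpl INR; field).
  replace (- (2 * PI * Ci * INR 0 * INR n / INR 1) - PI * Ci * 0)%C
    with (RtoC 0) by (simpl INR; field).
  rewrite Cexp_opp, Cexp_2PI_nat, Cexp_0; field. }
rewrite P; unfold farey_total, farey_sum.
destruct N as [|M]; [lia|].
rewrite (csum_S_l _ M), (csum_S_l (fun i => csum (fun h => if Nat.eqb _ 1 then _ else _) _) M).
rewrite (csum_ext _ (fun _ => RtoC 0) (S (S M))), csum_zero.
- simpl csum at 2.
  rewrite <- (csum_ext (fun i => csum (fun h => if between 0 1 1 1 h (S (S i)) then full_value h (S (S i)) else RtoC 0) (S (S M)))
    (fun i => csum (fun h => if Nat.eqb (Nat.gcd h (S (S i))) 1 then full_value h (S (S i)) else RtoC 0) (S (S i)))).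
  + cbn [csum]; replace (Nat.eqb (Nat.gcd 0 1) 1) with true by reflexivity.
    unfold full_value; ring.
  + intros i Hi; replace (S (S M)) with (S (S i) + (M - i))%nat by lia.
    assert (T : csum (fun l => if between 0 1 1 1 (S (S i) + l) (S (S i))
        then full_value (S (S i) + l) (S (S i)) else RtoC 0) (M - i) = RtoC 0).
    { rewrite (csum_ext _ (fun _ => RtoC 0)); [apply csum_zero|].
      intros l Hl; unfold between.
      destruct (Nat.ltb_spec ((S (S i) + l) * 1) (1 * S (S i))); [lia|].
      now rewrite !Bool.andb_false_r. }
    rewrite csum_split, T, Cplus_0_r; apply csum_ext; intros h Hh; unfold between.
    destruct (Nat.eqb_spec (Nat.gcd h (S (S i))) 1) as [G|G]; [|reflexivity].
    destruct h as [|h]; [rewrite Nat.gcd_0_l in G; lia|].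
    destruct (Nat.ltb_spec (0 * S (S i)) (S h * 1)), (Nat.ltb_spec (S h * 1) (1 * S (S i)));
      try lia; auto.
- intros h Hh; unfold between.
  destruct (Nat.ltb_spec (0 * 1) (h * 1)), (Nat.ltb_spec (h * 1) (1 * 1)); try lia;
    now rewrite ?Bool.andb_false_r.
Qed.

End FareyArcs.

(** * From the sum over Farey fractions to the series *)

Lemma sum_n_m_csum (f : nat -> C) (m : nat) :
  sum_n_m (G := C_AbelianMonoid) f 0 m = csum f (S m).
Proof.
induction m as [|m IH].
- rewrite sum_n_n; simpl; ring.
- rewrite sum_n_Sm by lia; rewrite IH; reflexivity.
Qed.

Definition rademacher_term (k n j : nat) : C :=
  (alpha_ k j * / INR j * A_hat k j n
     * BesselI 2 (sqrt (alpha_ k j) * x_ k n / INR j))%C.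

(** The half integral plus its conjugate is twice its real part, a Bessel value depending only on
    [j]; it factors out, and the phases summed over [h] form [A_hat]. *)
Lemma farey_total_eq (k n N : nat) : (k = 1 \/ k = 2)%nat -> (1 <= n)%nat -> (1 <= N)%nat ->
  farey_total k n N = (PI ^ 3 / (18 * x_ k n ^ 2) * csum (fun i => rademacher_term k n (S i)) N)%C.
Proof.
intros Hk Hn HN; unfold farey_total; rewrite <- csum_scal.
apply csum_ext; intros i Hi; set (j := S i).
assert (Hj : (0 < j)%nat) by (unfold j; lia).
assert (Pj : 0 < INR j) by (apply lt_0_INR; lia).
assert (Cj := RtoC_INR_nz j Hj); assert (HPI := PI_RGT_0).
destruct (kernel_facts k n j Hk Hn Hj) as [[A1 A2] [B1 B2]].
destruct (rho_facts k n N Hk Hn HN) as [[R0 _] _].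
destruct (cusp_facts k j Hk Hj) as [_ [[Ha1 Ha2] _]].
assert (V : (half_value k n N j + Cconj (half_value k n N j))%C =
  RtoC (2 * (PI * (kernel_b k j / kernel_a k n * BesselI 2 (2 * sqrt (kernel_a k n * kernel_b k j)))))).
{ rewrite <- (Re_half_contour_polar_kernel _ _ (rho_N N)) by auto.
  fold (half_value k n N j); apply Ceq; unfold Re, Im; simpl; ring. }
rewrite (csum_ext _ (fun h => (INR j * (half_value k n N j + Cconj (half_value k n N j))) *
  (if Nat.eqb (Nat.gcd h j) 1 then phase k n h j else RtoC 0))%C).
2:{ intros h _; destruct (Nat.eqb _ 1); unfold full_value; ring. }
rewrite csum_scal, V.
assert (EA : csum (fun h => if Nat.eqb (Nat.gcd h j) 1 then phase k n h j else RtoC 0) j = A_hat k j n).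
{ unfold A_hat; rewrite sum_n_m_csum; replace (S (j - 1)) with j by (unfold j; lia); reflexivity. }
rewrite EA; unfold rademacher_term.
set (nu := 24 * INR n - (2 * INR k + 2)).
assert (Hnu : 0 < nu).
{ unfold nu; assert (1 <= INR n) by (apply (le_INR 1); lia).
  destruct Hk as [-> | ->]; simpl INR; lra. }
assert (Ex : x_ k n = PI * sqrt nu / 6) by reflexivity.
assert (Ex2 : x_ k n ^ 2 = PI ^ 2 * nu / 36).
{ rewrite Ex; replace ((PI * sqrt nu / 6) ^ 2) with (PI ^ 2 * (sqrt nu * sqrt nu) / 36) by field.
  rewrite sqrt_sqrt by lra; reflexivity. }
assert (Ea : kernel_a k n = PI * nu / 12) by (unfold kernel_a, nu; field).
assert (Es : 2 * sqrt (kernel_a k n * kernel_b k j) = sqrt (alpha_ k j) * x_ k n / INR j).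
{ rewrite Ea; unfold kernel_b.
  replace (PI * nu / 12 * (PI * alpha_ k j / (12 * INR j ^ 2)))
    with ((PI / (12 * INR j)) ^ 2 * (nu * alpha_ k j)) by (field; lra).
  rewrite sqrt_mult, sqrt_pow2, sqrt_mult by
    (try apply pow2_ge_0; try (apply Rmult_le_pos; lra); try lra; apply Rdiv_le_0_compat; lra).
  rewrite Ex; field; lra. }
rewrite Es; set (Bs := BesselI 2 _); set (A := A_hat k j n).
rewrite Ea; unfold kernel_b.
assert (Cx : RtoC (x_ k n ^ 2) = (PI ^ 2 * nu / 36)%C).
{ rewrite Ex2, RtoC_div, RtoC_mult, RtoC_pow by lra; reflexivity. }
rewrite <- (RtoC_pow (x_ k n)), Cx.
assert (CP : (RtoC PI <> 0)%C) by (intros E; apply RtoC_inj in E; lra).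
assert (Cn : (RtoC nu <> 0)%C) by (intros E; apply RtoC_inj in E; lra).
replace (2 * (PI * (PI * alpha_ k j / (12 * INR j ^ 2) / (PI * nu / 12) * Bs)))
  with (2 * PI * alpha_ k j * Bs * / (INR j ^ 2 * nu)) by (field; lra).
rewrite !RtoC_mult, RtoC_inv, RtoC_mult, RtoC_pow
  by (apply Rmult_integral_contrapositive; split; [apply pow_nonzero|]; lra).
field; auto.
Qed.

(** [M] is independent of [N] because [K] and [n] are fixed first. The product length [N'] comes
    last: it must reach [n], for the coefficient to be exact, and approximate the infinite product
    within [1/N] on the circle belonging to [N]. *)
Lemma rademacher_bound (k n : nat) : (k = 1 \/ k = 2)%nat -> (1 <= n)%nat ->
  exists M, forall N, (1 <= N)%nat ->
  Cmod (RtoC (DiamondDelta k n) - PI ^ 3 / (18 * x_ k n ^ 2)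
     * csum (fun i => rademacher_term k n (S i)) N)%C <= M / INR N.
Proof.
intros Hk Hn; destruct (eta_quotient_near_rational k Hk) as [K [HK Hrat]].
exists (total_const n K); intros N HN.
destruct (rho_facts k n N Hk Hn HN) as [[R0 _] HN1].
assert (Hr : 0 <= exp (- (2 * PI * rho_N N)) < 1).
{ split; [left; apply exp_pos|]; rewrite <- exp_0; apply exp_increasing.
  generalize PI_RGT_0; nra. }
destruct (eta_quotient_uniform k _ (/ INR N) Hr) as [N0 HN0];
  [apply Rinv_0_lt_compat; lra|].
set (N' := (N0 + n)%nat).
rewrite <- (diamond_integral k n N' (rho_N N)) by (auto; unfold N'; lia).
rewrite <- farey_total_eq by auto.
apply (farey_total_bound k n N Hk Hn HN K HK Hrat N').
intros q Hq; apply HN0; auto; unfold N'; lia.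
Qed.

(* The sum over j >= 1 is indexed by i = j - 1. *)
Theorem theorem2p2 : forall k : nat, (k = 1%nat \/ k = 2%nat) ->
  forall n : nat, (1 <= n)%nat ->
  exists T : C,
    is_series (K := R_AbsRing) (V := C_R_NormedModule)
      (fun i : nat =>
        let j := S i in
        (alpha_ k j * / INR j * A_hat k j n
           * BesselI 2 (sqrt (alpha_ k j) * x_ k n / INR j))%C) T
    /\ RtoC (DiamondDelta k n) = (PI ^ 3 / (18 * x_ k n ^ 2) * T)%C.
Proof.
intros k Hk n Hn; destruct (rademacher_bound k n Hk Hn) as [M HM].
set (c := (PI ^ 3 / (18 * x_ k n ^ 2))%C) in *.
assert (Hc : (c <> 0)%C).
{ unfold c; assert (P := PI_RGT_0).
  assert (Hx : 0 < x_ k n).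
  { unfold x_; assert (1 <= INR n) by (apply (le_INR 1); lia).
    assert (0 < sqrt (24 * INR n - (2 * INR k + 2)))
      by (apply sqrt_lt_R0; destruct Hk as [-> | ->]; simpl INR; lra).
    nra. }
  assert (P3 := pow_lt _ 3 P); assert (X2 := pow_lt _ 2 Hx).
  rewrite <- !RtoC_pow, <- RtoC_mult, <- RtoC_div by lra.
  intros E; apply RtoC_inj in E; revert E; apply Rgt_not_eq, Rdiv_lt_0_compat; lra. }
set (D := RtoC (DiamondDelta k n)) in *.
(* The sum is prescribed by the identity itself; the bound [M / N] then shows that the partial sums
   converge to it, without any estimate of individual terms. *)
exists (/ c * D)%C; split; [|field; auto].
assert (HL : Clim (fun N => csum (fun i => rademacher_term k n (S i)) (S N)) (/ c * D)%C).
{ apply Clim_squeeze with (fun N => Cmod (/ c)%C * M * / INR (S N)).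
  - intros N; specialize (HM (S N) ltac:(lia)).
    set (s := csum _ (S N)) in *.
    replace (s - / c * D)%C with (- (/ c * (D - c * s)))%C by (field; auto).
    rewrite Cmod_opp, Cmod_mult, Rmult_assoc.
    apply Rmult_le_compat_l; [apply Cmod_ge_0|exact HM].
  - replace (Finite 0) with (Finite (Cmod (/ c)%C * M * 0)) by (f_equal; ring).
    apply is_lim_seq_mult'; [apply is_lim_seq_const|apply is_lim_seq_inv_S]. }
intros Q [eps HQ].
destruct (HL eps (cond_pos eps)) as [N HN]; exists N; intros m Hm; apply HQ.
assert (E : sum_n (G := C_R_NormedModule) (fun i => rademacher_term k n (S i)) m
  = csum (fun i => rademacher_term k n (S i)) (S m)).
{ clear; induction m as [|m IH]; [rewrite sum_O; simpl; ring|].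
  rewrite sum_Sn, IH; reflexivity. }
change (ball (M := C_R_NormedModule) (/ c * D)%C eps (sum_n (G := C_R_NormedModule) (fun i => rademacher_term k n (S i)) m)).
rewrite E; specialize (HN m Hm).
set (u := csum _ (S m)) in *; set (v := (/ c * D)%C) in *.
(* The ball of [C_R_NormedModule] is the product ball, so the two components are bounded
   separately. *)
assert (A1 := re_le_Cmod (u - v)%C); assert (A2 := im_le_Cmod (u - v)%C).
split; unfold ball; simpl; unfold AbsRing_ball, abs, minus, plus, opp; simpl;
  [change (Rabs (Re (u - v)%C) < eps)|change (Rabs (Im (u - v)%C) < eps)]; lra.
Qed.
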